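(* Let $\mathcal S\subset\mathbb H^1$ be an oriented $C^2$ $H$-minimal surface. For every $\mathcal X=aX_1+bX_2+kT$ with $a,b,k\in C^2_0(\mathcal S\setminus\Sigma_{\mathcal S})$, $$\mathcal V^H_{II}(\mathcal S;\mathcal X)=\int_{\mathcal S}\Big\{|\nabla^{H,\mathcal S}F|^2+(2\mathcal A-\bar\omega^2)F^2\Big\}\,d\sigma_H,\qquad F=\bar p\,a+\bar q\,b+\bar\omega\,k .$$ As a consequence, if $\Sigma_{\mathcal S}=\varnothing$, then $\mathcal S$ is stable if and only if $$\int_{\mathcal S}(\bar\omega^2-2\mathcal A)F^2\,d\sigma_H\le\int_{\mathcal S}|\nabla^{H,\mathcal S}F|^2\,d\sigma_H$$ for every $F=\bar p a+\bar q b+\bar\omega k$ with $a,b,k\in C^2_0(\mathcal S)$.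
   Context: $\mathbb H^1=\mathbb R^3$ with group law $(x,y,t)(x',y',t')=(x+x',y+y',t+t'+\frac12(xy'-x'y))$ and left-invariant fields $X_1=\partial_x-\frac y2\partial_t$, $X_2=\partial_y+\frac x2\partial_t$, $T=\partial_t$; $\langle\cdot,\cdot\rangle$ is the Riemannian metric making $\{X_1,X_2,T\}$ orthonormal, $\nabla$ its Levi-Civita connection. For an oriented $C^2$ surface $\mathcal S$, $\boldsymbol N$ is a non-unit Riemannian normal, $p=\langle\boldsymbol N,X_1\rangle$, $q=\langle\boldsymbol N,X_2\rangle$, $\omega=\langle\boldsymbol N,T\rangle$, $W=\sqrt{p^2+q^2}$, $\Sigma_{\mathcal S}=\{W=0\}$ (characteristic set); on $\mathcal S\setminus\Sigma_{\mathcal S}$: $\bar p=p/W$, $\bar q=q/W$, $\bar\omega=\omega/W$, $\nu^H=\bar pX_1+\bar qX_2$, and $Z=\bar qX_1-\bar pX_2$ (tangent to $\mathcal S$). $\mathcal A=-Z\bar\omega$. $d\sigma_H=\frac{W}{|\boldsymbol N|}d\sigma$, $\sigma$ the Riemannian surface measure. $\nabla^{H,\mathcal S}F=(ZF)\,Z$, so $|\nabla^{H,\mathcal S}F|^2=(ZF)^2$. The $H$-mean curvature is $\mathcal H=-\langle\nabla_ZZ,\nu^H\rangle$ on $\mathcal S\setminus\Sigma_{\mathcal S}$; $\mathcal S$ is $H$-minimal if $\mathcal H\equiv0$ on $\mathcal S$ (at characteristic points $\mathcal H$ is defined as a limit). Deformation: $\mathcal S^\lambda=\{g+\lambda\mathcal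 X(g):g\in\mathcal S\}$ for small $\lambda\in\mathbb R$, where $\mathcal X(g)$ is regarded as the vector $(a,b,k+\frac{bx-ay}{2})\in\mathbb R^3$ at $g=(x,y,t)$, and $+$ is addition in $\mathbb R^3$. $P_H(\mathcal S^\lambda)=\sigma_H(\mathcal S^\lambda)$ (if this is infinite, only the image of a relatively compact open subset of $\mathcal S$ containing the support of $\mathcal X$ is counted), and $\mathcal V^H_{II}(\mathcal S;\mathcal X)=\frac{d^2}{d\lambda^2}P_H(\mathcal S^\lambda)\big|_{\lambda=0}$. A surface $\mathcal S$ with $\Sigma_{\mathcal S}=\varnothing$ is stable if it is $H$-minimal (equivalently, stationary for the $H$-perimeter) and $\mathcal V^H_{II}(\mathcal S;\mathcal X)\ge0$ for every $\mathcal X=aX_1+bX_2+kT$ with $a,b,k\in C^2_0(\mathcal S)$. *)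

(* Defs.v *)
From HB Require Import structures.
From mathcomp Require Import all_boot all_order all_algebra.
From mathcomp Require Import all_classical all_reals all_analysis.
From mathcomp Require Import ring.

Set Implicit Arguments.
Unset Strict Implicit.
Unset Printing Implicit Defensive.

Import Order.TTheory GRing.Theory Num.Theory.
Import numFieldNormedType.Exports.

Local Open Scope classical_set_scope.
Local Open Scope ring_scope.

(* A point (or a coordinate vector) (x, y, t) of the Heisenberg group. *)
Notation heis R := (R * R * R)%type (only parsing).

Section Ck.
Context {R : realType} {V W : normedModType R}.

(* C^k on U, meant for U open; directional derivatives in every direction. *)
Fixpoint Ck (k : nat) (U : set V) (f : V -> W) : Prop :=
  match k with
  | 0 => forall u, U u -> {for u, continuous f}
  | j.+1 => (forall u, U u -> differentiable f u) /\
            (forall v, Ck j U (fun u => 'D_v f u))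
  end.

End Ck.

Section metric.
Context {R : realType}.
Implicit Types g v w : heis R.

Definition X1 g : heis R := (1, 0, - (g.1.2 / 2)).
Definition X2 g : heis R := (0, 1, g.1.1 / 2).
Definition Tfield g : heis R := (0, 0, 1).

(* The contact form: v = v.1.1 *: X1 g + v.1.2 *: X2 g + theta g v *: Tfield g. *)
Definition theta g v : R := v.2 - (g.1.1 * v.1.2 - g.1.2 * v.1.1) / 2.

Definition metric g v w : R :=
  v.1.1 * w.1.1 + v.1.2 * w.1.2 + theta g v * theta g w.

Lemma frame_decomposition g v :
  v = v.1.1 *: X1 g + v.1.2 *: X2 g + theta g v *: Tfield g.
Proof.
case: v g => [[v1 v2] v3] [[x y] t].
have scale3 (c r1 r2 r3 : R) :
  c *: ((r1, r2, r3) : heis R) = (c * r1, c * r2, c * r3) by [].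
have add3 (r1 r2 r3 s1 s2 s3 : R) :
  ((r1, r2, r3) : heis R) + (s1, s2, s3) = (r1 + s1, r2 + s2, r3 + s3) by [].
rewrite /X1 /X2 /Tfield /theta /= !scale3 !add3.
by congr (_, _, _) => /=; field.
Qed.

Lemma frame_orthonormal g :
  [/\ metric g (X1 g) (X1 g) = 1, metric g (X2 g) (X2 g) = 1,
      metric g (Tfield g) (Tfield g) = 1, metric g (X1 g) (X2 g) = 0 &
      metric g (X1 g) (Tfield g) = 0 /\ metric g (X2 g) (Tfield g) = 0].
Proof. by split; [| | | |split]; rewrite /metric /theta /=; field. Qed.

Definition normsq g v : R := metric g v v.

End metric.

Section surface.
Context {R : realType}.
Implicit Types (S M D : set (heis R)) (g v n : heis R) (u w : R * R).

(* Local parametrization of S: a C^2 immersion of the open set U which is a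
   homeomorphism onto a relatively open subset of S. *)
Definition chart S (U : set (R * R)) (phi : R * R -> heis R) : Prop :=
  [/\ open U, Ck 2 U phi,
      (forall u w, U u -> 'D_w phi u = 0 -> w = 0),
      (exists2 O : set (heis R), open O & phi @` U = S `&` O) &
      (exists2 psi : heis R -> R * R, {within phi @` U, continuous psi} &
        forall u, U u -> psi (phi u) = u)].

Definition C2_surface S : Prop :=
  forall g, S g -> exists U phi, chart S U phi /\ (phi @` U) g.

Definition tangent S g v : Prop :=
  exists U phi u w,
    [/\ chart S U phi, U u, phi u = g & 'D_w phi u = v].

Definition normal_to S g n : Prop := forall v, tangent S g v -> metric g n v = 0.

(* The orientation is given by the (not necessarily unit) normal field N; all
   the quantities below are invariant under N |-> f N with f > 0. *)
Definition oriented_C2_surface S (N : heis R -> heis R) : Prop :=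
  [/\ C2_surface S, {within S, continuous N} &
      forall g, S g -> N g != 0 /\ normal_to S g (N g)].

(* Derivative at g, in the tangent direction v, of a function F on S (only the
   values of F on S matter; for F of class C^1 on S it does not depend on the
   local parametrization). *)
Definition tder {V : normedModType R} S (F : heis R -> V) g v : V :=
  xget 0 [set d | exists U phi u w,
    [/\ chart S U phi, U u, phi u = g, 'D_w phi u = v &
        is_derive u w (F \o phi) d]].

Definition C2_on S (f : heis R -> R) : Prop :=
  forall U phi, chart S U phi -> Ck 2 U (f \o phi).

(* C^2_0(S), a function being identified with its extension by 0. *)
Definition C2c S (f : heis R -> R) : Prop :=
  C2_on S f /\
  exists K : set (heis R),
    [/\ compact K, K `<=` S & forall g, ~ K g -> f g = 0].

End surface.

Section surface_measure.
Context {R : realType}.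
Implicit Types S A : set (heis R).
Local Open Scope ereal_scope.

(* Riemannian area element of a parametrization: square root of the Gram
   determinant of the two coordinate tangent vectors. *)
Definition area_element (phi : R * R -> heis R) (u : R * R) : R :=
  let v1 := 'D_(1%R, 0%R) phi u in
  let v2 := 'D_(0%R, 1%R) phi u in
  Num.sqrt (metric (phi u) v1 v1 * metric (phi u) v2 v2
            - metric (phi u) v1 v2 ^+ 2)%R.

(* Area of S `&` A when it is contained in the image of one parametrization
   (all such parametrizations give the same value), +oo otherwise. *)
Definition patch_area S A : \bar R :=
  ereal_inf [set a | exists U phi,
    [/\ chart S U phi, S `&` A `<=` phi @` U &
        a = \int[lebesgue_measure \x lebesgue_measure]_(u in U `&` phi @^-1` A)
              (area_element phi u)%:E]].

Lemma patch_area_ge0 S A : 0 <= patch_area S A.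
Proof.
apply: le_ereal_inf_tmp => _ [U [phi [_ _ ->]]].
by apply: integral_ge0 => u _; rewrite lee_fin sqrtr_ge0.
Qed.

Lemma chart_set0 S : chart S set0 (fun=> 0%R).
Proof.
split; first exact: open0.
- by split=> [u []|v]; split=> [u []|w u []].
- by move=> u w [].
- by exists set0; [exact: open0|rewrite image_set0 setI0].
- exists (fun=> 0%R); last by [].
  by rewrite image_set0; exact: continuous_subspace0.
Qed.

Lemma patch_area0 S : patch_area S set0 = 0.
Proof.
apply/eqP; rewrite eq_le patch_area_ge0 andbT.
apply: ereal_inf_lbound; exists set0, (fun=> 0%R); split.
- exact: chart_set0.
- by rewrite setI0.
- by rewrite set0I integral_set0.
Qed.

(* The Riemannian surface measure of S, as the (Caratheodory) measure induced
   by the areas of patches. *)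
Definition surface_area S : set (heis R) -> \bar R := mu_ext (patch_area S).

Lemma surface_area0 S : surface_area S set0 = 0.
Proof. exact: mu_ext0 (patch_area0 S) (patch_area_ge0 S). Qed.

Lemma surface_area_ge0 S A : 0 <= surface_area S A.
Proof. exact: mu_ext_ge0 (patch_area_ge0 S) A. Qed.

Lemma le_surface_area S : {homo surface_area S : A B / A `<=` B >-> A <= B}.
Proof. exact: le_mu_ext. Qed.

Lemma surface_area_sigma_subadditive S : sigma_subadditive (surface_area S).
Proof. exact: mu_ext_sigma_subadditive (patch_area_ge0 S). Qed.

HB.instance Definition _ S := isOuterMeasure.Build R (heis R) (surface_area S)
  (surface_area0 S) (surface_area_ge0 S) (@le_surface_area S)
  (@surface_area_sigma_subadditive S).

Definition surface_outer_measure S : {outer_measure set (heis R) -> \bar R} :=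
  surface_area S.

Definition surface_measure S :
    {measure set (caratheodory_type (surface_outer_measure S)) -> \bar R} :=
  (OuterMeasure.sort (surface_outer_measure S) :
     set (caratheodory_type (surface_outer_measure S)) -> \bar R).

End surface_measure.

Section horizontal_geometry.
Context {R : realType}.
Implicit Types (S M D : set (heis R)) (g v : heis R).

Section normal_field.
Variable N : heis R -> heis R.

Definition pN g : R := metric g (N g) (X1 g).
Definition qN g : R := metric g (N g) (X2 g).
Definition omegaN g : R := metric g (N g) (Tfield g).
Definition Wnorm g : R := Num.sqrt (pN g ^+ 2 + qN g ^+ 2).

Definition pbar g : R := pN g / Wnorm g.
Definition qbar g : R := qN g / Wnorm g.
Definition omegabar g : R := omegaN g / Wnorm g.

Definition nuH g : heis R := pbar g *: X1 g + qbar g *: X2 g.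
Definition Zfield g : heis R := qbar g *: X1 g - pbar g *: X2 g.

Definition charset S : set (heis R) := [set g | S g /\ Wnorm g = 0].

Definition calA S g : R := - tder S omegabar g (Zfield g).

Definition gradHS S (F : heis R -> R) g : heis R := tder S F g (Zfield g) *: Zfield g.

(* Integral over S with respect to d sigma_H = W / |N| d sigma. *)
Definition integral_sigmaH S (f : heis R -> R) : \bar R :=
  (\int[surface_measure S]_(g in S)
     (f g * (Wnorm g / Num.sqrt (normsq g (N g))))%:E)%E.

End normal_field.

(* <nabla_v Y, w>_g for the Levi-Civita connection and a field Y along S, with
   v tangent to S: derivative of the coordinates of Y, plus the Christoffel
   symbols of the first kind
   (v<y,w> + y<v,w> - w<v,y>) / 2 for constant coordinate fields v, y, w. *)
Definition LC_inner S (Y : heis R -> heis R) g v w : R :=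
  metric g (tder S Y g v) w +
  ('D_v (fun h => metric h (Y g) w) g
   + 'D_(Y g) (fun h => metric h v w) g
   - 'D_w (fun h => metric h v (Y g)) g) / 2.

Definition nabla S (Y : heis R -> heis R) g v : heis R :=
  LC_inner S Y g v (X1 g) *: X1 g + LC_inner S Y g v (X2 g) *: X2 g
  + LC_inner S Y g v (Tfield g) *: Tfield g.

Definition H_curvature S N g : R :=
  - metric g (nabla S (Zfield N) g (Zfield N g)) (nuH N g).

Definition H_minimal S N : Prop :=
  (forall g, (S `\` charset N S) g -> H_curvature S N g = 0) /\
  (forall g, charset N S g ->
     H_curvature S N h @[h --> within (S `\` charset N S) (nbhs g)] --> (0 : R)).

(* W / |N| does not depend on the choice of the normal N, so that the
   H-perimeter is defined without reference to an orientation. *)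
Definition some_normal M g : heis R :=
  xget 0 [set n | n != 0 /\ normal_to M g n].

Definition H_perimeter M : \bar R :=
  integral_sigmaH (some_normal M) M (fun=> 1).

Section variation.
Variables a b k : heis R -> R.

Definition variation_field g : heis R := a g *: X1 g + b g *: X2 g + k g *: Tfield g.

Definition deform (l : R) D : set (heis R) :=
  [set g + l *: variation_field g | g in D].

Definition field_support S : set (heis R) :=
  closure [set g | S g /\ variation_field g != 0].

(* The part of S whose deformed perimeter is counted: S itself if the perimeter
   of its deformations is finite, otherwise a relatively compact open subset of
   S which contains the support of the field. *)
Definition counted_region S D : Prop :=
  let finite := \forall l \near (0 : R), (H_perimeter (deform l S) < +oo)%E in
  (finite /\ D = S) \/
  (~ finite /\
   [/\ exists2 O : set (heis R), open O & D = S `&` O,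
       exists K : set (heis R), [/\ compact K, K `<=` S & D `<=` K] &
       field_support S `<=` D]).

Definition deformed_perimeter D (l : R) : R := fine (H_perimeter (deform l D)).

Definition twice_differentiable_perimeter D : Prop :=
  [/\ \forall l \near (0 : R), H_perimeter (deform l D) \is a fin_num,
      \forall l \near (0 : R), derivable (deformed_perimeter D) l 1 &
      derivable (derive1 (deformed_perimeter D)) 0 1].

Definition second_variation D : R := derive1n 2 (deformed_perimeter D) 0.

Definition normal_component N g : R :=
  pbar N g * a g + qbar N g * b g + omegabar N g * k g.

End variation.

(* Meant for surfaces with empty characteristic set. *)
Definition stable S N : Prop :=
  H_minimal S N /\
  forall a b k, C2c S a -> C2c S b -> C2c S k ->
  forall D, counted_region a b k S D -> 0 <= second_variation a b k D.

End horizontal_geometry.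

(* Main.v *)
(** The frame [Z], [E = omegabar nu^H - T] spans the tangent planes of [S] away from the
    characteristic set, and the [H]-perimeter of the deformed surface is the integral against
    [d sigma_H] of the length of the horizontal part of the cross product of the images of [Z]
    and [E] under the differential of [g |-> g + lambda X(g)]. The components of this cross
    product are cubic polynomials in [lambda], so the perimeter can be differentiated twice under
    the integral sign. If [S] is [H]-minimal then [Z pbar = Z qbar = 0] and the symmetry of mixed
    second derivatives gives [pbar E(qbar) - qbar E(pbar) = Z omegabar + omegabar^2]. With these
    relations the second derivative of the integrand is
    [(ZF)^2 + (2 A - omegabar^2) F^2] plus a sum of Jacobians [Zf Eg - Ef Zg] where [f] has
    compact support; such a Jacobian times [d sigma_H] is the exact form [df /\ dg], whose
    integral over [S] vanishes. *)

From HB Require Import structures.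
Require Import Defs.
From mathcomp Require Import all_boot all_order all_algebra.
From mathcomp Require Import all_classical all_reals all_analysis.
From mathcomp Require Import measurable_realfun lebesgue_integral_under.
From mathcomp Require Import ring lra.
Import Order.TTheory GRing.Theory Num.Theory.
Import numFieldNormedType.Exports.
Local Open Scope classical_set_scope.
Local Open Scope ring_scope.

(** * Borel sets and change of variables *)

(** The surface is only of class C^2, and this shapes the argument. [pbar], [qbar] and [omegabar]
    are of class C^1 only, so mixed second derivatives are taken of the coordinates of a chart
    alone, and the integral of df /\ dg has to vanish for functions of class C^1, for which the form
    f dg has no classical differential. The measure d sigma comes from an infimum over all
    parametrizations of a patch, so these must first be shown to give the same area. Transition maps
    are a priori only continuous: strict differentiability takes the place of an inverse function
    theorem, and areas are compared by slicing, up to factors arbitrarily close to 1. For small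
    lambda the map g |-> g + lambda X(g) is bi-Lipschitz on S, hence carries charts of S to charts
    of the deformed surface. The square root causes no trouble near lambda = 0, where the deformed
    density is 1 relative to d sigma_H. Characteristic points remain in S; the frame does not exist
    there, but the field vanishes near them and the density changes only on its compact support. *)

Lemma compact_ind (T : topologicalType) (K : set T) (P : set T -> Prop) :
  compact K -> P set0 -> (forall A B, P A -> P B -> P (A `|` B)) ->
  (forall A B, A `<=` B -> P B -> P A) ->
  (forall x, K x -> exists2 O, nbhs x O & P O) -> P K.
Proof.
move=> cK P0 PU Ple Ploc; apply: contrapT => nPK.
(* The sets whose complement in [K] satisfies [P] form a filter. It is proper because [P K] fails,
   so it clusters at a point of [K], against the local hypothesis. *)
pose F : set_system T := [set A | P (K `\` A)].
have FF : Filter F.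
  split.
  - by rewrite /F /= setDT.
  - by move=> A B; rewrite /F /= setDIr; exact: PU.
  - by move=> A B AB; apply: Ple; exact: setDS.
have prF : ProperFilter F.
  apply: Build_ProperFilter_ex => A FA; apply: contrapT => nA.
  apply: nPK; move: FA; rewrite /F /= => FA; apply: Ple FA => x Kx; split=> // Ax.
  by apply: nA; exists x.
have KF : F K by rewrite /F /= setDv.
have [x [Kx xF]] := cK F prF KF.
have [V xV PV] := Ploc x Kx.
have FCO : F (~` V) by rewrite /F /=; apply: Ple PV => y [_ /contrapT].
by have [y [/= + +]] := xF _ _ FCO xV.
Qed.

Section basis.

(** Membership of the basis in [M] is part of the notion: every open set is then a countable union
    of members of [M]. This is how open sets of a product become measurable for the product
    sigma-algebra. *)
Definition countable_basis_in {T : topologicalType} (M : set (set T)) :=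
  exists B : nat -> set T, [/\ forall n, M (B n), forall n, open (B n) &
      forall x O, nbhs x O -> exists n, B n x /\ B n `<=` O].

Lemma real_basis (R : realType) : countable_basis_in (@measurable _ R).
Proof.
pose f n : set R := if @unpickle (rat * rat)%type n is Some ab then
  `]ratr ab.1, ratr ab.2[%classic else set0.
exists f; split.
- by move=> n; rewrite /f; case: unpickle.
- by move=> n; rewrite /f; case: unpickle => [ab|]; [exact: interval_open|exact: open0].
- move=> x O /nbhs_ballP[e /= e0 xO].
  have /rat_in_itvoo[a] : x - e < x by rewrite ltrBlDr ltrDl.
  have /rat_in_itvoo[b] : x < x + e by rewrite ltrDl.
  rewrite !in_itv /= => /andP[xb be] /andP[ea ax].
  exists (pickle (a, b)); rewrite /f pickleK /=; split; first by rewrite /= in_itv /= ax xb.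
  move=> y; rewrite /= in_itv /= => /andP[ay yb]; apply: xO.
  by rewrite /ball /= ltr_distlC; apply/andP; split; [exact: lt_trans ay|exact: lt_trans be].
Qed.

Lemma open_setX (T1 T2 : topologicalType) (A : set T1) (B : set T2) :
  open A -> open B -> open (A `*` B).
Proof.
move=> oA oB; rewrite openE => -[x y] [/= Ax By]; exists (A, B) => //=.
by split; exact: open_nbhs_nbhs.
Qed.

Lemma prod_basis (T1 T2 : topologicalType) (M1 : set (set T1)) (M2 : set (set T2))
    (M : set (set (T1 * T2))) :
  (forall A B, M1 A -> M2 B -> M (A `*` B)) ->
  countable_basis_in M1 -> countable_basis_in M2 -> countable_basis_in M.
Proof.
move=> MX [B1 [m1 o1 n1]] [B2 [m2 o2 n2]].
pose f n := if @unpickle (nat * nat)%type n is Some ab then B1 ab.1 `*` B2 ab.2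
  else B1 0%N `*` B2 0%N.
exists f; split.
- by move=> n; rewrite /f; case: unpickle => [ab|]; exact: MX.
- by move=> n; rewrite /f; case: unpickle => [ab|]; exact: open_setX.
- move=> [x y] O [[/= O1 O2] [/= /n1[i [ix iO]] /n2[j [jx jO]]] sO].
  exists (pickle (i, j)); rewrite /f pickleK; split => //.
  by move=> [a b] [/= /iO ? /jO ?]; exact: sO.
Qed.

Lemma real2_basis (R : realType) : countable_basis_in (@measurable _ (R * R)%type).
Proof.
by apply: prod_basis (real_basis R) (real_basis R) => A B; exact: measurableX.
Qed.

Lemma heis_basis (R : realType) : countable_basis_in (@measurable _ (R * R * R)%type).
Proof.
by apply: prod_basis (real2_basis R) (real_basis R) => A B; exact: measurableX.
Qed.

Lemma basis_open (d : measure_display) (M : measurableType d) (T : topologicalType)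
    (e : M -> T) (O : set T) :
  countable_basis_in [set A | measurable (e @^-1` A)] -> open O -> measurable (e @^-1` O).
Proof.
move=> [B [mB oB nB]] oO.
have -> : O = \bigcup_(n in [set n | B n `<=` O]) B n.
  rewrite eqEsubset; split=> [x Ox|x [n nO /nO]//].
  by have [n [nx nO]] := nB x O (open_nbhs_nbhs (conj oO Ox)); exists n.
by rewrite preimage_bigcup; apply: bigcup_measurable => n _; exact: mB.
Qed.

Lemma open_measurable2 (R : realType) (O : set (R * R)) : open O -> measurable O.
Proof. exact: (@basis_open _ (R * R)%type (R * R)%type id O (@real2_basis R)). Qed.

Lemma open_measurable3 (R : realType) (O : set (heis R)) : open O -> measurable O.
Proof. exact: (@basis_open _ (R * R * R)%type (R * R * R)%type id O (@heis_basis R)). Qed.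

Lemma closed_measurable2 (R : realType) (A : set (R * R)) : closed A -> measurable A.
Proof. by move=> /closed_openC /open_measurable2 /measurableC; rewrite setCK. Qed.

Lemma closed_measurable3 (R : realType) (A : set (heis R)) : closed A -> measurable A.
Proof. by move=> /closed_openC /open_measurable3 /measurableC; rewrite setCK. Qed.

End basis.

Lemma measurable_fun_open_preimage (d : measure_display) (T : measurableType d)
    (R : realType) (D : set T) (f : T -> R) :
  (forall O : set R, open O -> measurable (D `&` f @^-1` O)) -> measurable_fun D f.
Proof.
move=> mO; apply: (measurability _ (RGenOpens.measurableE R)).
by move=> /= _ [_ [a [b ->]] <-]; apply: mO; exact: interval_open.
Qed.

(** The converse of the measurability of open sets: a property that is stable under the operations
    of a sigma-algebra need only be checked on open sets. *)
Definition open_generated {T : topologicalType} (M : set (set T)) :=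
  forall G : set (set T), sigma_algebra setT G -> open `<=` G -> M `<=` G.

Lemma real_open_generated (R : realType) : open_generated (@measurable _ R).
Proof.
move=> G sG oG.
have mE : @measurable _ R = <<s @RGenOpens.G R >> by exact: RGenOpens.measurableE.
rewrite mE; apply: smallest_sub => //.
by move=> _ [a [b ->]]; apply: oG; exact: interval_open.
Qed.

(** A rectangle is the intersection of two cylinders, and the bases whose cylinder lies in [G] form
    a sigma-algebra that contains the open sets. *)
Lemma prod_open_generated (T1 T2 : topologicalType) (M1 : set (set T1)) (M2 : set (set T2)) :
  open_generated M1 -> open_generated M2 ->
  open_generated <<s [set A `*` B | A in M1 & B in M2] >>.
Proof.
move=> g1 g2 G sG oG; have [G0 GC GU] := sG.
have GI A B : G A -> G B -> G (A `&` B).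
  move=> GA GB; have -> : A `&` B = ~` (~` A `|` ~` B) by rewrite setCU !setCK.
  rewrite -setTD; apply: (GC _); rewrite -bigcup2E; apply: GU => n.
  by rewrite /bigcup2; case: ifP => _; [|case: ifP => _ //]; rewrite -setTD; exact: GC.
have G1 : M1 `<=` [set A | G (A `*` setT)].
  apply: g1; last by move=> A oA; apply: oG; apply: open_setX => //; exact: openT.
  split => [|A /= GA|F0 GF] /=.
  - by rewrite set0X.
  - have -> : (setT `\` A) `*` [set: T2] = setT `\` A `*` [set: T2].
      rewrite eqEsubset; split=> -[x y] /=; first by move=> [[_ nA] _]; split=> // -[].
      by move=> [_ nA]; do 2 split=> //; move=> Ax; apply: nA.
    exact: GC.
  - by rewrite setX_bigcupl; exact: GU.
have G2 : M2 `<=` [set A | G (setT `*` A)].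
  apply: g2; last by move=> A oA; apply: oG; apply: open_setX => //; exact: openT.
  split => [|A /= GA|F0 GF] /=.
  - by rewrite setX0.
  - have -> : [set: T1] `*` (setT `\` A) = setT `\` [set: T1] `*` A.
      rewrite eqEsubset; split=> -[x y] /=; first by move=> [_ [_ nA]]; split=> // -[].
      by move=> [_ nA]; do 2 split=> //; move=> Ax; apply: nA.
    exact: GC.
  - by rewrite setX_bigcupr; exact: GU.
apply: smallest_sub => //.
move=> _ [A mA [B mB <-]].
have -> : A `*` B = (A `*` setT) `&` (setT `*` B) by rewrite -setXI setIT setTI.
by apply: GI; [exact: G1|exact: G2].
Qed.

Lemma open_generates2 (R : realType) : open_generated (@measurable _ (R * R)%type).
Proof.
rewrite measurable_prod_measurableType.
by apply: prod_open_generated; exact: real_open_generated.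
Qed.

Lemma open_generates3 (R : realType) : open_generated (@measurable _ (heis R)).
Proof.
rewrite measurable_prod_measurableType.
by apply: prod_open_generated; [exact: open_generates2|exact: real_open_generated].
Qed.

(** Closed subsets of [C] have compact, hence closed images, and injectivity makes the image commute
    with complements relative to [C]. So the sets whose trace on [C] has a measurable image form a
    sigma-algebra containing the open sets. *)
Lemma injective_image_measurable (R : realType) (d : measure_display) (M : measurableType d)
    (W : topologicalType) (e : M -> W) (C : set (R * R)) (phi : R * R -> M) :
  (forall A : set W, closed A -> measurable (e @^-1` A)) -> hausdorff_space W -> injective e ->
  compact C -> {within C, continuous (e \o phi)} -> {in C &, injective phi} ->
  forall B, measurable B -> B `<=` C -> measurable (phi @` B).
Proof.
move=> mcl hW einj cC cphi iphi.
have cl (A : set (R * R)) : closed A -> measurable (phi @` (C `&` A)).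
  move=> clA; have cCA : compact (C `&` A) by exact: compact_closedI.
  have -> : phi @` (C `&` A) = e @^-1` ((e \o phi) @` (C `&` A)).
    rewrite eqEsubset; split=> [_ [x Cx <-]|y [x Cx /= /einj <-]]; first by exists x.
    by exists x.
  apply: mcl; apply: (compact_closed hW); apply: continuous_compact => //.
  by apply: continuous_subspaceW cphi; exact: subIsetl.
pose G : set (set (R * R)) := [set B | measurable (phi @` (C `&` B))].
have GC A : G A -> G (~` A).
  rewrite /G /= => GA.
  have -> : phi @` (C `&` ~` A) = phi @` (C `&` setT) `\` phi @` (C `&` A).
    rewrite eqEsubset; split.
      move=> _ [x [Cx Ax] <-]; split; first by exists x.
      by move=> [y [Cy Ay]] /iphi; rewrite !inE => /(_ Cy Cx) yx; apply: Ax; rewrite -yx.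
    move=> _ [[x [Cx _] <-] nA]; exists x => //; split=> // Ax; apply: nA.
    by exists x.
  by apply: measurableD => //; apply: cl; exact: closedT.
have mG : sigma_algebra setT G.
  split.
  - by rewrite /G /= setI0 image_set0.
  - by move=> A GA; rewrite setTD; exact: GC.
  - move=> F GF; rewrite /G /= setI_bigcupr image_bigcup; exact: bigcupT_measurable.
have sub : @measurable _ (R * R)%type `<=` G.
  apply: open_generates2 => // A oA; rewrite -(setCK A); apply: GC; apply: cl.
  exact: open_closedC.
by move=> B /sub; rewrite /G /= => + BC; rewrite (setIidr BC).
Qed.

Section transfer.
Local Open Scope ereal_scope.
Context d1 d2 (X : measurableType d1) (Y : measurableType d2) (R : realType).
Variables (mu : {measure set X -> \bar R}) (nu : {measure set Y -> \bar R}).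
Variables (D : set X) (h : X -> R) (phi : X -> Y) (A : set Y).
Hypotheses (mD : measurable D) (mh : measurable_fun D h).
Hypothesis h0 : forall x, D x -> (0 <= h x)%R.
Hypotheses (mphi : measurable_fun D phi) (mA : measurable A).
Hypothesis nuE : forall B, measurable B -> B `<=` A ->
  nu B = \int[mu]_(x in D `&` phi @^-1` B) (h x)%:E.

Import HBNNSimple.

Let DA := D `&` phi @^-1` A.
Let mDA : measurable DA. Proof. exact: mphi. Qed.
Let mhDA : measurable_fun DA h.
Proof. by apply: measurable_funS mh => //; exact: subIsetl. Qed.
Let mphiDA : measurable_fun DA phi.
Proof. by apply: measurable_funS mphi => //; exact: subIsetl. Qed.

Let transfer_nnsfun (f : {nnsfun Y >-> R}) :
  \int[nu]_(y in A) (f y)%:E = \int[mu]_(x in DA) ((f (phi x))%:E * (h x)%:E).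
Proof.
have mfphi r : measurable_fun DA (fun x => \1_(f @^-1` [set r]) (phi x) : R).
  exact: measurableT_comp.
transitivity (\sum_(k \in range f)
    \int[mu]_(x in DA) ((k * \1_(f @^-1` [set k]) (phi x))%:E * (h x)%:E)); last first.
  rewrite -ge0_integral_fsum//.
  - apply: eq_integral => x /[!inE] -[Dx Ax].
    rewrite -ge0_mule_fsuml; last by move=> r; rewrite nnfun_muleindic_ge0.
    by rewrite fsumEFin// -fimfunE.
  - move=> r; apply: emeasurable_funM; apply/measurable_EFinP => //.
    exact: measurable_funM.
  - by move=> r x [Dx _]; rewrite mule_ge0 ?nnfun_muleindic_ge0 ?lee_fin ?h0.
under eq_integral do rewrite fimfunE -fsumEFin//.
rewrite ge0_integral_fsum//; last 2 first.
- by move=> y; exact/measurable_EFinP/measurable_funM.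
- by move=> y x _; rewrite nnfun_muleindic_ge0.
apply: eq_fsbigr => r; rewrite inE => -[y _ ry].
have r0 : (0 <= r)%R by rewrite -ry.
rewrite integralZl_indic_nnsfun// integral_indic//= nuE; last 2 first.
- by apply: measurableI.
- exact: subIsetr.
under [RHS]eq_integral do rewrite EFinM -muleA.
rewrite ge0_integralZl//; last 2 first.
- apply: emeasurable_funM; exact/measurable_EFinP.
- by move=> x [Dx _]; rewrite mule_ge0 ?lee_fin ?h0.
congr (_ * _).
rewrite (_ : D `&` _ = DA `&` phi @^-1` (f @^-1` [set r])); last first.
  by rewrite /DA eqEsubset; split=> x /=; tauto.
rewrite integral_mkcondr; apply: eq_integral => x _.
by rewrite muleC epatch_indic.
Qed.

(** On the subsets of [A], [nu] is the image under [phi] of the measure of density [h]; simple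
    functions and monotone convergence do the rest. The set-up serves twice: for a chart, with [h]
    the area element, and for the passage from the Caratheodory sigma-algebra to Borel sets, with
    [h = 1] and [phi] the identity. *)
Lemma ge0_integral_transfer (f : Y -> \bar R) :
  measurable_fun A f -> (forall y, A y -> 0 <= f y) ->
  \int[nu]_(y in A) f y = \int[mu]_(x in D `&` phi @^-1` A) (f (phi x) * (h x)%:E).
Proof.
move=> mf f0.
pose f_ := nnsfun_approx mA mf.
have fl y : A y -> f y = limn (fun n => (f_ n y)%:E).
  by move=> Ay; apply/esym/cvg_lim => //; exact: cvg_nnsfun_approx.
transitivity (limn (fun n => \int[nu]_(y in A) (f_ n y)%:E)).
  rewrite -monotone_convergence//.
  - by apply: eq_integral => y /[!inE] /fl.
  - by move=> n; exact/measurable_EFinP/measurable_funTS.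
  - by move=> n y _; rewrite lee_fin.
  - by move=> y _ m n mn; rewrite lee_fin; exact/lefP/nd_nnsfun_approx.
under eq_fun do rewrite transfer_nnsfun.
rewrite -monotone_convergence//.
- apply: eq_integral => x /[!inE] -[Dx Ax]; apply/cvg_lim => //.
  by apply: cvgeZr => //; exact: cvg_nnsfun_approx.
- move=> n; apply: emeasurable_funM; apply/measurable_EFinP => //.
  by apply: (measurable_comp measurableT).
- by move=> n x [Dx _]; rewrite mule_ge0 ?lee_fin ?h0.
- move=> x [Dx _] m n mn; rewrite lee_wpmul2r ?lee_fin ?h0//.
  exact/lefP/nd_nnsfun_approx.
Qed.

Lemma integral_transfer (f : Y -> \bar R) :
  measurable_fun A f ->
  \int[nu]_(y in A) f y = \int[mu]_(x in D `&` phi @^-1` A) (f (phi x) * (h x)%:E).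
Proof.
move=> mf; rewrite integralE [RHS]integralE; congr (_ - _).
- rewrite ge0_integral_transfer//; last exact: measurable_funepos.
  apply: eq_integral => x /[!inE] -[Dx _].
  by rewrite !funeposE maxe_pMl ?mul0e// lee_fin h0.
- rewrite ge0_integral_transfer//; last exact: measurable_funeneg.
  apply: eq_integral => x /[!inE] -[Dx _].
  by rewrite !funenegE maxe_pMl ?mul0e ?mulNe// lee_fin h0.
Qed.

End transfer.

(** [E] is arbitrary, so the inequality is one of outer measures: [E] is covered by open intervals,
    and the image of its part in an interval lies in a segment at most [c] times as long. *)
Lemma lipschitz_lebesgue_le (R : realType) (E : set R) (g : R -> R) (c : R) :
  0 < c -> (forall x y, E x -> E y -> `|g x - g y| <= c * `|x - y|) ->
  (lebesgue_measure (g @` E) <= c%:E * lebesgue_measure E)%E.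
Proof.
move=> c0 gc; rewrite -lee_pdivrMl//.
have -> : lebesgue_measure E = ((@wlength R idfun)^* E)%mu by [].
rewrite outer_measure_open_itv_cover.
apply: le_ereal_inf_tmp => _ [F [Fitv EF] <-]; rewrite lee_pdivrMl//.
pose X k := g @` (E `&` F k).
(* The infimum and supremum of an empty [X k] would be default values, hence the separate case. *)
pose H k : set R := if pselect (X k !=set0) then `[inf (X k), sup (X k)]%classic else set0.
have w0 k : (0 <= wlength idfun (F k))%E by exact: (@wlength_ge0 R idfun).
have XH k : X k `<=` H k /\ (lebesgue_measure (H k) <= c%:E * wlength idfun (F k))%E.
  rewrite /H; case: pselect => [X0|nX]; last first.
    split; first by move=> y Xy; apply: nX; exists y.
    by rewrite measure0; apply: mule_ge0; [rewrite lee_fin ltW|exact: w0].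
  have [[a b] _ /= Fab] : exists2 ab : R * R, True & F k = `]ab.1, ab.2[%classic.
    by have [ab ->] := Fitv k; exists ab.
  have dX y z : X k y -> X k z -> y - z <= c * (b - a).
    move=> [s [Es Fs] <-] [t [Et Ft] <-].
    apply: (le_trans (ler_norm _)); apply: (le_trans (gc _ _ Es Et)).
    apply: ler_wpM2l; first exact: ltW.
    move: Fs Ft; rewrite Fab /= !in_itv /= => /andP[? ?] /andP[? ?].
    by rewrite ler_norml; apply/andP; split; lra.
  have [y Xy] := X0.
  have ubX : has_ubound (X k).
    by exists (y + c * (b - a)) => z Xz; rewrite -lerBlDl dX.
  have lbX : has_lbound (X k).
    by exists (y - c * (b - a)) => z Xz; rewrite lerBlDr -lerBlDl dX.
  split.
    move=> z Xz; rewrite /= in_itv /=; apply/andP; split.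
      exact: ge_inf.
    exact: ub_le_sup.
  have ab : a < b.
    by case: Xy => s [_ +] _; rewrite Fab /= in_itv /= => /andP[]; exact: lt_trans.
  rewrite lebesgue_measure_itv /= Fab wlength_itv /= !lte_fin ab.
  case: ifP => _; rewrite -EFinB -EFinM lee_fin; last by rewrite mulr_ge0 ?subr_ge0 ?ltW.
  rewrite lerBlDr; apply: ge_sup => // z Xz.
  rewrite -lerBlDl; apply: lb_le_inf => // w Xw.
  by rewrite lerBlDl -lerBlDr dX.
have -> : g @` E = \bigcup_k X k.
  rewrite /X -image_bigcup -setI_bigcupr; congr (g @` _).
  by rewrite (setIidl EF).
have -> : lebesgue_measure (\bigcup_k X k) = ((@wlength R idfun)^* (\bigcup_k X k))%mu by [].
apply: (le_trans (outer_measure_sigma_subadditive _ _)).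
rewrite -nneseriesZl; last by move=> k _; exact: w0.
apply: lee_nneseries; [by move=> *; exact: outer_measure_ge0|move=> k _].
apply: le_trans (XH k).2; exact: (le_outer_measure _ _ _ (XH k).1).
Qed.

(** The hypothesis says that [p] is a Lipschitz function of [q]. The form with an index set [J]
    spares naming that function, which is convenient when both are coordinates of the same
    parameter. *)
Lemma paired_lebesgue_le (R : realType) (T : Type) (J : set T) (p q : T -> R) (c : R) :
  0 < c -> (forall i j, J i -> J j -> `|p i - p j| <= c * `|q i - q j|) ->
  (lebesgue_measure (p @` J) <= c%:E * lebesgue_measure (q @` J))%E.
Proof.
move=> c0 pq.
have [[i0 Ji0]|nJ] := pselect (J !=set0); last first.
  have -> : J = set0 by rewrite -subset0 => i Ji; apply: nJ; exists i.
  by rewrite !image_set0 measure0 mule0.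
have /choice[r rP] : forall y, exists i, J i /\ ((q @` J) y -> q i = y).
  move=> y; have [[i Ji <-]|n] := pselect ((q @` J) y); first by exists i.
  by exists i0.
have -> : p @` J = (p \o r) @` (q @` J).
  rewrite eqEsubset; split.
    move=> _ [i Ji <-]; exists (q i); first by exists i.
    have [Jr qr] := rP (q i).
    apply/eqP; rewrite /= -subr_eq0 -normr_le0; apply: (le_trans (pq _ _ Jr Ji)).
    by rewrite qr ?subrr ?normr0 ?mulr0//; exists i.
  by move=> _ [_ [i Ji <-] <-]; exists (r (q i)) => //; exact: (rP _).1.
apply: lipschitz_lebesgue_le => // _ _ [i Ji <-] [j Jj <-].
have [Jri qri] := rP (q i); have [Jrj qrj] := rP (q j).
apply: (le_trans (pq _ _ Jri Jrj)).
by rewrite qri; [rewrite qrj; [exact: lexx|exists j]|exists i].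
Qed.

Notation leb2 := (lebesgue_measure \x lebesgue_measure)%E (only parsing).

Section plane_measure.
Context {R : realType}.
Implicit Types A : set (R * R).

(** Fubini: both sets are cut along their common first coordinate [x], and in each section the
    previous comparison on the line applies. *)
Lemma paired_leb2_le (T : Type) (J : set T) (x p q : T -> R) (c : R) :
  0 < c ->
  (forall i j, J i -> J j -> x i = x j -> `|p i - p j| <= c * `|q i - q j|) ->
  measurable ((fun i => (x i, p i)) @` J) -> measurable ((fun i => (x i, q i)) @` J) ->
  (leb2 ((fun i => (x i, p i)) @` J) <= c%:E * leb2 ((fun i => (x i, q i)) @` J))%E.
Proof.
move=> c0 pq mp mq; rewrite /product_measure1.
rewrite -ge0_integralZl//; last 2 first.
- exact: measurable_fun_xsection.
- by rewrite lee_fin ltW.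
apply: ge0_le_integral => //.
- exact: measurable_fun_xsection.
- apply: emeasurable_funM => //; exact: measurable_fun_xsection.
move=> z _ /=.
have sec r : xsection ((fun i => (x i, r i)) @` J) z = r @` (J `&` [set i | x i = z]) :> set R.
  rewrite eqEsubset; split=> y; rewrite /xsection /= inE.
    by move=> [i Ji [xi <-]]; exists i.
  by move=> [i [Ji <-] <-]; exists i.
rewrite !sec; apply: paired_lebesgue_le => // i j [Ji xi] [Jj xj].
by apply: pq => //; rewrite xi.
Qed.

Lemma leb2_swap A : measurable A -> leb2 ((fun u => (u.2, u.1)) @` A) = leb2 A.
Proof.
move=> mA.
have E : (fun u : R * R => (u.2, u.1)) @` A = (fun u : R * R => (u.2, u.1)) @^-1` A.
  rewrite eqEsubset; split=> [_ [[a b] Aab <-]//|[a b] /= Aab].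
  by exists (b, a).
have mS : measurable ((fun u : R * R => (u.2, u.1)) @^-1` A) by rewrite -[X in measurable X]setTI; exact: (measurable_fun_pair measurable_snd measurable_fst).
rewrite E /=.
transitivity ((@lebesgue_measure R \x^ @lebesgue_measure R)%E ((fun u : R * R => (u.2, u.1)) @^-1` A)).
  by apply: product_measure_unique => // B C mB mC; exact: product_measure2E.
rewrite /product_measure2 /product_measure1.
by apply: eq_integral => z _ /=; congr (lebesgue_measure _).
Qed.

End plane_measure.

Set Implicit Arguments.
Unset Strict Implicit.
Unset Printing Implicit Defensive.

(** * Strict differentiability and charts *)

Section strict_differentiability.
Context {R : realType}.
Local Notation e1 := ((1, 0) : R * R).
Local Notation e2 := ((0, 1) : R * R).

Lemma prod_normr (V W : normedModType R) (v : V) (w : W) :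
  `|(v, w)| = Num.max `|v| `|w|.
Proof. by rewrite prod_normE. Qed.

Lemma norm_fst (V W : normedModType R) (v : V * W) : `|v.1| <= `|v|.
Proof. by case: v => a b; rewrite prod_normr le_max lexx. Qed.

Lemma norm_snd (V W : normedModType R) (v : V * W) : `|v.2| <= `|v|.
Proof. by case: v => a b; rewrite prod_normr le_max lexx orbT. Qed.

Lemma eps_differentiable (V W : normedModType R) (f : V -> W) (L : {linear V -> W}) x :
  continuous L ->
  (forall e, 0 < e -> \forall h \near 0, `|f (h + x) - f x - L h| <= e * `|h|) ->
  differentiable f x /\ 'd f x = L :> (V -> W).
Proof.
move=> cL H.
have E : f \o shift x = cst (f x) + L +o_ 0 id.
  apply/eqaddoP => e e0; near=> h.
  rewrite /= /shift /= opprD addrA; near: h; exact: H.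
have dfE : 'd f x = L :> (V -> W) by exact: diff_unique.
split=> //; apply/diff_locallyP; rewrite dfE; split => //.
Unshelve. all: by end_near. Qed.

(** Strict differentiability, with [A] and [B] the partial derivatives: the increment is controlled
    for all pairs of points near [u], not only for pairs containing [u]. This yields two-sided
    Lipschitz estimates on small boxes, which differentiability at [u] would not. *)
Definition sdiff {W : normedModType R} (f : R * R -> W) (u : R * R) (A B : W) :=
  forall e, 0 < e -> exists2 d, 0 < d & forall x y, `|x - u| < d -> `|y - u| < d ->
    `|f x - f y - ((x.1 - y.1) *: A + (x.2 - y.2) *: B)| <= e * `|x - y|.

Lemma is_derive_line (V W : normedModType R) (f : V -> W) a v d t :
  is_derive (a + t *: v) v f d -> is_derive t 1 (fun s => f (a + s *: v)) d.
Proof.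
move=> [df <-].
have E : (fun h => h^-1 *: (f (h *: v + (a + t *: v)) - f (a + t *: v))) =
         (fun h : R => h^-1 *: (f (a + (h *: 1 + t) *: v) - f (a + t *: v))).
  apply/funext => h; congr (_ *: (f _ - _)).
  by rewrite scalerDl addrCA; congr (_ + (_ + _)); rewrite /GRing.scale /= mulr1.
by split; [rewrite /derivable -E|rewrite /derive -E].
Qed.

Definition lin2 (W : normedModType R) (A B : W) (w : R * R) : W := w.1 *: A + w.2 *: B.

Lemma lin2_is_linear (W : normedModType R) (A B : W) : linear (lin2 A B).
Proof. by move=> k v w; rewrite /lin2 /= !scalerDl !scalerDr !scalerA addrACA. Qed.

HB.instance Definition _ (W : normedModType R) (A B : W) :=
  GRing.isLinear.Build R (R * R)%type W *:%R (lin2 A B) (lin2_is_linear A B).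

Lemma sdiff_differentiable (W : normedModType R) (f : R * R -> W) u A B :
  sdiff f u A B ->
  differentiable f u /\ forall w, 'D_w f u = w.1 *: A + w.2 *: B.
Proof.
move=> sf.
pose L : {linear (R * R)%type -> W} := lin2 A B.
have cL : continuous L.
  move=> w; rewrite /L /= /lin2; apply: cvgD; apply: cvgZr_tmp => //.
    exact: cvg_fst.
  exact: cvg_snd.
have [|df dfE] := @eps_differentiable _ _ f L u cL.
  move=> e e0; have [d d0 H] := sf e e0.
  apply/nbhs_normP; exists d => //= h; rewrite /ball_ /= sub0r normrN => hd.
  by have := H (h + u) u; rewrite addrK subrr normr0 /= !addrK; exact.
by split=> // w; rewrite deriveE// dfE.
Qed.

Lemma sdiff_unique (W : normedModType R) (f : R * R -> W) u A B A' B' :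
  sdiff f u A B -> sdiff f u A' B' -> A = A' /\ B = B'.
Proof.
move=> /sdiff_differentiable[_ D1] /sdiff_differentiable[_ D2]; split.
  by have := D1 e1; rewrite D2 /= !scale1r !scale0r !addr0.
by have := D1 e2; rewrite D2 /= !scale1r !scale0r !add0r.
Qed.

Lemma MVT_between (g dg : R -> R) (a b : R) :
  (forall s, Num.min a b <= s <= Num.max a b -> is_derive s 1 g (dg s)) ->
  exists2 s, Num.min a b <= s <= Num.max a b & g b - g a = dg s * (b - a).
Proof.
wlog ab : a b / a <= b.
  move=> H dgP; have [ab|ba0] := boolP (a <= b); first exact: (H a b ab dgP).
  have ba : b <= a by rewrite ltW // ltNge.
  have [|s sab E] := H b a ba; first by rewrite minC maxC.
  by exists s; [rewrite minC maxC|rewrite -opprB E -mulrN opprB].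
rewrite (min_idPl ab) (max_idPr ab) => dgP.
have [||s + E] := @MVT_segment R g dg a b ab.
- by move=> x; rewrite in_itv /= => /andP[? ?]; apply: dgP; rewrite !ltW.
- apply: derivable_within_continuous => x; rewrite in_itv /= => xab.
  by have [] := dgP x xab.
by rewrite in_itv /=; exists s.
Qed.

(** The increment is split along a path with one side parallel to each axis, and the mean value
    theorem is applied on each side. This is why it is stated for real values; vector values are
    handled coordinate by coordinate. *)
Lemma sdiff_real (f : R * R -> R) (V : set (R * R)) u :
  nbhs u V -> (forall v, V v -> differentiable f v) ->
  {for u, continuous (fun v => 'D_e1 f v)} -> {for u, continuous (fun v => 'D_e2 f v)} ->
  sdiff f u ('D_e1 f u) ('D_e2 f u).
Proof.
move=> uV dV c1 c2 e e0.
have e20 : 0 < e / 2 by rewrite divr_gt0.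
have : \forall v \near u, [/\ V v, `|'D_e1 f u - 'D_e1 f v| <= e / 2 &
    `|'D_e2 f u - 'D_e2 f v| <= e / 2].
  move/cvgr_dist_le : c1 => /(_ _ e20) h1; move/cvgr_dist_le : c2 => /(_ _ e20) h2.
  by apply: filterS3 uV h1 h2 => v.
move=> /nbhs_normP[d /= d0 H]; exists d => // -[x1 x2] [y1 y2] xd yd /=.
move: u uV c1 c2 H xd yd => [u1 u2] uV c1 c2 H.
rewrite !prod_normr !gt_max /= => /andP[xd1 xd2] /andP[yd1 yd2].
have Hb s t : `|s - u1| < d -> `|t - u2| < d -> [/\ differentiable f (s, t),
    `|'D_e1 f (u1, u2) - 'D_e1 f (s, t)| <= e / 2 & `|'D_e2 f (u1, u2) - 'D_e2 f (s, t)| <= e / 2].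
  move=> sd td; have [|? ? ?] := H (s, t); last by split => //; exact: dV.
  by rewrite /= prod_normr gt_max /= distrC sd distrC td.
have btw (a b c s : R) : `|a - c| < d -> `|b - c| < d ->
    Num.min a b <= s <= Num.max a b -> `|s - c| < d.
  rewrite ge_min le_max !ltr_norml => /andP[? ?] /andP[? ?] /andP[/orP[]? /orP[]?]; apply/andP; split; lra.
have [s sP Es] : exists2 s, `|s - u1| < d & f (x1, y2) - f (y1, y2) = 'D_e1 f (s, y2) * (x1 - y1).
  have [|s sI E] := @MVT_between (fun s => f (s, y2)) (fun s => 'D_e1 f (s, y2)) y1 x1.
    move=> s sI; have sd : `|s - u1| < d by exact: btw sI.
    have [df _ _] := Hb s y2 sd yd2.
    have -> : (fun s => f (s, y2)) = (fun s => f ((0, y2) + s *: e1)).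
      by apply/funext => r; congr f; congr (_, _) => /=; rewrite /GRing.scale /= ?mulr1 ?mulr0 ?add0r ?addr0.
    have E : (s, y2) = (0, y2) + s *: e1.
      by congr (_, _) => /=; rewrite /GRing.scale /= ?mulr1 ?mulr0 ?add0r ?addr0.
    by apply: is_derive_line; rewrite -E; apply/derivableP/diff_derivable.
  by exists s => //; exact: btw sI.
have [t tP Et] : exists2 t, `|t - u2| < d & f (x1, x2) - f (x1, y2) = 'D_e2 f (x1, t) * (x2 - y2).
  have [|s' sI E] := @MVT_between (fun s => f (x1, s)) (fun s => 'D_e2 f (x1, s)) y2 x2.
    move=> t sI; have sd : `|t - u2| < d by exact: btw sI.
    have [df _ _] := Hb x1 t xd1 sd.
    have -> : (fun s => f (x1, s)) = (fun s => f ((x1, 0) + s *: e2)).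
      by apply/funext => r; congr f; congr (_, _) => /=; rewrite /GRing.scale /= ?mulr1 ?mulr0 ?add0r ?addr0.
    have E : (x1, t) = (x1, 0) + t *: e2.
      by congr (_, _) => /=; rewrite /GRing.scale /= ?mulr1 ?mulr0 ?add0r ?addr0.
    by apply: is_derive_line; rewrite -E; apply/derivableP/diff_derivable.
  by exists s' => //; exact: btw sI.
have -> : f (x1, x2) - f (y1, y2) = 'D_e1 f (s, y2) * (x1 - y1) + 'D_e2 f (x1, t) * (x2 - y2).
  by rewrite -Es -Et; ring.
have [_ b1 _] := Hb s y2 sP yd2; have [_ _ b2] := Hb x1 t xd1 tP.
have -> : 'D_e1 f (s, y2) * (x1 - y1) + 'D_e2 f (x1, t) * (x2 - y2) -
  ((x1 - y1) *: 'D_e1 f (u1, u2) + (x2 - y2) *: 'D_e2 f (u1, u2)) =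
  - (('D_e1 f (u1, u2) - 'D_e1 f (s, y2)) * (x1 - y1) +
     ('D_e2 f (u1, u2) - 'D_e2 f (x1, t)) * (x2 - y2)).
  by rewrite /GRing.scale /=; ring.
rewrite normrN; apply: (le_trans (ler_normD _ _)); rewrite !normrM.
rewrite [e]splitr mulrDl; apply: lerD; apply: ler_pM => //.
- by rewrite le_max lexx.
- by rewrite le_max lexx orbT.
Qed.

Lemma sdiff_pair (V W : normedModType R) (f : R * R -> V) (g : R * R -> W) u A B A' B' :
  sdiff f u A B -> sdiff g u A' B' -> sdiff (fun v => (f v, g v)) u (A, A') (B, B').
Proof.
move=> sf sg e e0; have [d d0 Hd] := sf e e0; have [c c0 Hc] := sg e e0.
exists (Num.min d c); first by rewrite lt_min d0.
move=> x y; rewrite !lt_min => /andP[xd xc] /andP[yd yc].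
rewrite -[X in `|X|]/(f x - f y - ((x.1 - y.1) *: A + (x.2 - y.2) *: B),
  g x - g y - ((x.1 - y.1) *: A' + (x.2 - y.2) *: B')).
by rewrite prod_normr ge_max Hd// Hc.
Qed.

Lemma sdiff_near (W : normedModType R) (f g : R * R -> W) u A B :
  (\forall v \near u, f v = g v) -> sdiff f u A B -> sdiff g u A B.
Proof.
move=> /nbhs_normP[r /= r0 fg] sf e e0; have [d d0 H] := sf e e0.
exists (Num.min d r); first by rewrite lt_min d0.
move=> x y; rewrite !lt_min => /andP[xd xr] /andP[yd yr].
have Ex : f x = g x by apply: fg; rewrite /ball_ /= distrC.
have Ey : f y = g y by apply: fg; rewrite /ball_ /= distrC.
by rewrite -Ex -Ey; exact: H.
Qed.

Lemma sdiff_lipschitz (W : normedModType R) (f : R * R -> W) u A B :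
  sdiff f u A B -> exists2 C, 0 < C & exists2 d, 0 < d &
    forall x y, `|x - u| < d -> `|y - u| < d -> `|f x - f y| <= C * `|x - y|.
Proof.
move=> sf; have [d d0 H] := sf 1 ltr01.
exists (`|A| + `|B| + 1); first by rewrite ltr_wpDl ?addr_ge0.
exists d => // x y xd yd.
rewrite -[f x - f y](subrK ((x.1 - y.1) *: A + (x.2 - y.2) *: B)).
apply: (le_trans (ler_normD _ _)); rewrite mulrDl addrC.
apply: lerD; last by rewrite mul1r -[leRHS]mul1r H.
apply: (le_trans (ler_normD _ _)); rewrite !normrZ mulrDl.
by rewrite ![_ * `|x - y|]mulrC; apply: lerD; apply: ler_wpM2r => //; [exact: (norm_fst (x - y))|exact: (norm_snd (x - y))].
Qed.

Lemma sdiff_comp (W : normedModType R) (f : R * R -> W) (t : R * R -> R * R) u A B T1 T2 :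
  sdiff t u T1 T2 -> sdiff f (t u) A B ->
  sdiff (f \o t) u (T1.1 *: A + T1.2 *: B) (T2.1 *: A + T2.2 *: B).
Proof.
move=> st sf e e0.
have [C C0 [d1 d10 HC]] := sdiff_lipschitz st.
pose M := `|A| + `|B|.
have M0 : 0 <= M by rewrite addr_ge0.
have [d2 d20 Hf] := sf (e / (2 * C)) ltac:(by rewrite divr_gt0 // mulr_gt0).
(* [M + 1] in the denominator because [M] may be zero. *)
have [d3 d30 Ht] := st (e / (2 * (M + 1))) ltac:(by rewrite divr_gt0 // mulr_gt0 // ltr_wpDl).
exists (Num.min d1 (Num.min d3 (d2 / C))).
  by rewrite !lt_min d10 d30 divr_gt0.
move=> x y; rewrite !lt_min => /andP[x1 /andP[x3 x2]] /andP[y1 /andP[y3 y2]].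
have tu z : `|z - u| < d1 -> `|z - u| < d2 / C -> `|t z - t u| < d2.
  move=> z1 z2; apply: (le_lt_trans (HC _ _ z1 _)); first by rewrite subrr normr0.
  by rewrite mulrC -ltr_pdivlMr.
have Hf' := Hf (t x) (t y) (tu _ x1 x2) (tu _ y1 y2).
have Ht' := Ht x y x3 y3.
set D := t x - t y in Hf' Ht'.
set r := D - _ in Ht'.
have r1 : r.1 = D.1 - ((x.1 - y.1) * T1.1 + (x.2 - y.2) * T2.1) by [].
have r2 : r.2 = D.2 - ((x.1 - y.1) * T1.2 + (x.2 - y.2) * T2.2) by [].
clearbody r.
have -> : (f \o t) x - (f \o t) y - ((x.1 - y.1) *: (T1.1 *: A + T1.2 *: B) +
     (x.2 - y.2) *: (T2.1 *: A + T2.2 *: B)) =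
   (f (t x) - f (t y) - (D.1 *: A + D.2 *: B)) + (r.1 *: A + r.2 *: B).
  rewrite /= r1 r2; move: (x.1 - y.1) (x.2 - y.2) => a b.
  rewrite !scalerBl !scalerDl !scalerDr !scalerA.
  rewrite [X in _ = _ + X]addrACA -opprD [X in _ = _ + (_ - X)]addrACA.
  by rewrite [RHS]addrA subrK.
apply: (le_trans (ler_normD _ _)); rewrite [e]splitr mulrDl; apply: lerD.
  apply: (le_trans Hf'); rewrite -/D; apply: le_trans (_ : e / (2 * C) * (C * `|x - y|) <= _).
    by apply: ler_wpM2l; [rewrite divr_ge0 ?mulr_ge0 ?ltW|exact: HC].
  by rewrite le_eqVlt; apply/orP; left; apply/eqP; field; rewrite gt_eqF.
apply: (@le_trans _ _ (`|r| * M)).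
  apply: (le_trans (ler_normD _ _)); rewrite !normrZ mulrDr.
  by apply: lerD; apply: ler_wpM2r => //; [exact: norm_fst|exact: norm_snd].
apply: (@le_trans _ _ (e / (2 * (M + 1)) * `|x - y| * (M + 1))).
  by apply: ler_pM => //; rewrite lerDl.
by rewrite le_eqVlt; apply/orP; left; apply/eqP; field; rewrite gt_eqF// ltr_wpDl.
Qed.

End strict_differentiability.

Lemma differentiable_near_eq (R : realType) (V W : normedModType R) (f g : V -> W) x :
  (\forall y \near x, f y = g y) -> differentiable f x -> differentiable g x.
Proof.
move=> fg df; have fgx : f x = g x by exact: nbhs_singleton fg.
apply: (@eps_differentiable _ _ _ g ('d f x) x (diff_continuous df) _).1 => e e0.
have := (diff_locallyP x f).1 df => -[_] E.
have H : \forall h \near 0, `|f (h + x) - f x - 'd f x h| <= e * `|h|.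
  by move/eqaddoP : E => /(_ e e0); apply: filterS => h /=; rewrite opprD addrA.
have fg' : \forall h \near 0, f (h + x) = g (h + x).
  move: fg; rewrite (near_shift 0 x) /=; apply: filterS => h.
  by rewrite subr0.
near=> h; rewrite -fgx; have -> : g (h + x) = f (h + x) by apply/esym; near: h.
by near: h.
Unshelve. all: by end_near. Qed.

Section Ck_lemmas.
Context {R : realType} {V : normedModType R}.
Implicit Types (U : set V).

Lemma Ck_ext (W : normedModType R) k U (f g : V -> W) :
  open U -> (forall u, U u -> f u = g u) -> Ck k U f -> Ck k U g.
Proof.
move=> oU; elim: k f g => [|k IH] f g fg /=.
  move=> cf u Uu; have nU : \forall y \near u, f y = g y.
    by apply: filterS fg _; exact: open_nbhs_nbhs.
  have cfu : f y @[y --> u] --> f u by exact: cf.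
  rewrite (fg u Uu) in cfu; apply: cvg_trans cfu; apply: near_eq_cvg.
  by apply: filterS nU => y ->.
move=> [df Cf]; split=> [u Uu|v].
  apply: differentiable_near_eq (df u Uu).
  by apply: filterS fg _; exact: open_nbhs_nbhs.
apply: IH (Cf v) => u Uu; apply: near_eq_derive.
by apply: filterS fg _; exact: open_nbhs_nbhs.
Qed.

Lemma CkS (W : normedModType R) k U (f : V -> W) : Ck k.+1 U f -> Ck k U f.
Proof.
elim: k f => [|k IH] f [df Cf].
  by move=> u Uu; exact: (differentiable_continuous (df u Uu)).
by split=> // v; apply: IH; exact: Cf.
Qed.

Lemma Ck_subset (W : normedModType R) k U U' (f : V -> W) : U' `<=` U -> Ck k U f -> Ck k U' f.
Proof.
move=> sU; elim: k f => [|k IH] f /=; first by move=> cf u /sU; exact: cf.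
by move=> [df Cf]; split=> [u /sU|v]; [exact: df|exact/IH/Cf].
Qed.

Lemma CkD (W : normedModType R) k U (f g : V -> W) : open U ->
  Ck k U f -> Ck k U g -> Ck k U (fun u => f u + g u).
Proof.
move=> oU; elim: k f g => [|k IH] f g /=.
  by move=> cf cg u Uu; apply: cvgD; [exact: cf|exact: cg].
move=> [df Cf] [dg Cg]; split=> [u Uu|v].
  by apply: differentiableD; [exact: df|exact: dg].
apply: (Ck_ext oU) (IH _ _ (Cf v) (Cg v)) => u Uu.
by apply/esym/deriveD; apply/diff_derivable; [exact: df|exact: dg].
Qed.

Lemma CkZ (W : normedModType R) k U (c : R) (f : V -> W) : open U ->
  Ck k U f -> Ck k U (fun u => c *: f u).
Proof.
move=> oU; elim: k f => [|k IH] f /=.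
  by move=> cf u Uu; apply: cvgZl_tmp; exact: cf.
move=> [df Cf]; split=> [u Uu|v]; first by apply: differentiableZ; exact: df.
apply: (Ck_ext oU) (IH _ (Cf v)) => u Uu.
by apply/esym/deriveZ; apply/diff_derivable; exact: df.
Qed.

Lemma CkM k U (f g : V -> R) : open U ->
  Ck k U f -> Ck k U g -> Ck k U (fun u => f u * g u).
Proof.
move=> oU; elim: k f g => [|k IH] f g.
  by move=> cf cg u Uu; apply: cvgM; [exact: cf|exact: cg].
move=> Cf Cg; have Cf' := CkS Cf; have Cg' := CkS Cg; move: Cf Cg => [df Cf] [dg Cg].
split=> [u Uu|v].
  by apply: differentiableM; [exact: df|exact: dg].
apply: (Ck_ext oU) (CkD oU (IH _ _ Cf' (Cg v)) (IH _ _ Cg' (Cf v))) => u Uu.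
by apply/esym/deriveM; apply/diff_derivable; [exact: df|exact: dg].
Qed.

Lemma Ck_cst (W : normedModType R) k U (c : W) : open U -> Ck k U (fun=> c).
Proof.
move=> oU; elim: k c => [|k IH] c; first by move=> u _; exact: cvg_cst.
split=> [u _|v]; first exact: differentiable_cst.
by apply: (Ck_ext oU) (IH 0) => u _; rewrite derive_cst.
Qed.

Lemma derive_pair (W1 W2 : normedModType R) (f : V -> W1) (g : V -> W2) u v :
  differentiable f u -> differentiable g u ->
  'D_v (fun x => (f x, g x)) u = ('D_v f u, 'D_v g u).
Proof.
by move=> df dg; rewrite !deriveE ?diff_pair//; exact: differentiable_pair.
Qed.

Lemma Ck_pair (W1 W2 : normedModType R) k U (f : V -> W1) (g : V -> W2) : open U ->
  Ck k U f -> Ck k U g -> Ck k U (fun u => (f u, g u)).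
Proof.
move=> oU; elim: k f g => [|k IH] f g /=.
  by move=> cf cg u Uu; apply: cvg_pair; [exact: cf|exact: cg].
move=> [df Cf] [dg Cg]; split=> [u Uu|v].
  by apply: differentiable_pair; [exact: df|exact: dg].
apply: (Ck_ext oU) (IH _ _ (Cf v) (Cg v)) => u Uu.
by apply/esym/derive_pair; [exact: df|exact: dg].
Qed.

Lemma derive_linear (W1 W2 : normedModType R) (L : {linear W1 -> W2}) (f : V -> W1) u v :
  continuous L -> differentiable f u ->
  differentiable (L \o f) u /\ 'D_v (L \o f) u = L ('D_v f u).
Proof.
move=> cL df; have dL : differentiable L (f u) by exact: linear_differentiable.
have dLf := differentiable_comp df dL.
by split=> //; rewrite !deriveE// diff_comp//= diff_lin.
Qed.

Lemma Ck_linear (W1 W2 : normedModType R) (L : {linear W1 -> W2}) k U (f : V -> W1) : open U ->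
  continuous L -> Ck k U f -> Ck k U (L \o f).
Proof.
move=> oU cL; elim: k f => [|k IH] f /=.
  by move=> cf u Uu; apply: continuous_comp; [exact: cf|exact: cL].
move=> [df Cf]; split=> [u Uu|v]; first exact: (derive_linear 0 cL (df u Uu)).1.
by apply: (Ck_ext oU) (IH _ (Cf v)) => u Uu /=; rewrite (derive_linear v cL (df u Uu)).2.
Qed.

Lemma derive_comp1 (h h' : R -> R) (f : V -> R) u v :
  is_derive (f u) 1 h (h' (f u)) -> differentiable f u ->
  differentiable (fun x => h (f x)) u /\ 'D_v (fun x => h (f x)) u = h' (f u) * 'D_v f u.
Proof.
move=> [dh Eh] df.
have dh' : differentiable h (f u) by exact/derivable1_diffP.
have dhf := differentiable_comp df dh'.
split=> //; rewrite -[fun x => _]/(h \o f) !deriveE// diff_comp//= -[RHS]mulrC.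
by rewrite -Eh -derive1E diff1E.
Qed.

Lemma Ck1_comp (h h' : R -> R) U (f : V -> R) : open U ->
  (forall u, U u -> is_derive (f u) 1 h (h' (f u)) /\ {for f u, continuous h'}) ->
  Ck 1 U f -> Ck 1 U (fun x => h (f x)).
Proof.
move=> oU hP Cf; have cf := CkS Cf; move: Cf => [df Cf]; split=> [u Uu|v].
  exact: (derive_comp1 0 (hP u Uu).1 (df u Uu)).1.
have C0 : Ck 0 U (fun u => h' (f u) * 'D_v f u).
  move=> u Uu; apply: cvgM; last exact: Cf.
  by apply: continuous_comp; [exact: cf|exact: (hP u Uu).2].
by apply: (Ck_ext oU) C0 => u Uu; rewrite (derive_comp1 v (hP u Uu).1 (df u Uu)).2.
Qed.

End Ck_lemmas.

(** * Cross products in the left-invariant frame *)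

Section frame_cross_product.
Context {R : realType}.
Implicit Types (g v w : heis R).

(** Components of the cross product of [v] and [w] in the orthonormal frame [X1], [X2], [Tfield] at
    [g]; [theta g] supplies the third frame coordinate. *)
Definition cross1 g v w : R := v.1.2 * theta g w - theta g v * w.1.2.
Definition cross2 g v w : R := theta g v * w.1.1 - v.1.1 * theta g w.
Definition cross3 g v w : R := v.1.1 * w.1.2 - v.1.2 * w.1.1.
Definition cross_sq g v w : R := cross1 g v w ^+ 2 + cross2 g v w ^+ 2 + cross3 g v w ^+ 2.

Lemma cross_sq_ge0 g v w : 0 <= cross_sq g v w.
Proof. by rewrite !addr_ge0 ?sqr_ge0. Qed.

(** Lagrange's identity: the Gram determinant is the squared length of the cross product. *)
Lemma area_elementE (phi : R * R -> heis R) u :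
  area_element phi u = Num.sqrt (cross_sq (phi u) ('D_(1, 0) phi u) ('D_(0, 1) phi u)).
Proof.
rewrite /area_element; congr (Num.sqrt _).
move: ('D_(1, 0) phi u) ('D_(0, 1) phi u) (phi u) => v w g.
rewrite /cross_sq /cross1 /cross2 /cross3 /metric.
by move: (theta g v) (theta g w) v.1.1 v.1.2 w.1.1 w.1.2 => a b c d e f; ring.
Qed.

Lemma thetaD g v w : theta g (v + w) = theta g v + theta g w.
Proof. by rewrite /theta /=; field. Qed.

Lemma thetaZ g (k : R) v : theta g (k *: v) = k * theta g v.
Proof. by rewrite /theta /= /GRing.scale /=; field. Qed.

Lemma frame_eq0 g v : v.1.1 = 0 -> v.1.2 = 0 -> theta g v = 0 -> v = 0.
Proof.
case: v => [[a b] c] /= -> ->; rewrite /theta /= !mulr0 subrr mul0r subr0 => ->.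
by [].
Qed.

Lemma cross_sq_gt0 g v w :
  (forall x : R * R, x.1 *: v + x.2 *: w = 0 -> x = 0) -> 0 < cross_sq g v w.
Proof.
move=> ind; rewrite lt_neqAle cross_sq_ge0 andbT; apply/eqP => /esym/eqP.
rewrite /cross_sq !paddr_eq0 ?addr_ge0 ?sqr_ge0// !sqrf_eq0 => /andP[/andP[/eqP c1 /eqP c2] /eqP c3].
have dep (a b : R) : a *: v + b *: w = 0 -> a = 0 /\ b = 0.
  by move=> /(ind (a, b))[-> ->].
have z0 : 0 *: v + 0 *: w = 0 by rewrite !scale0r addr0.
have key (a b : R) : a * v.1.1 + b * w.1.1 = 0 -> a * v.1.2 + b * w.1.2 = 0 ->
    a * theta g v + b * theta g w = 0 -> a = 0 /\ b = 0.
  move=> h1 h2 h3; apply: dep; apply: (@frame_eq0 g); rewrite ?thetaD ?thetaZ//.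
(* If the cross product vanishes, then for each frame coordinate the pair made of that coordinate of
   [w] and minus that of [v] is a linear relation between [v] and [w]. By independence all
   coordinates vanish, and then [(1, 0)] is a relation as well. *)
have [w1 v1] := key w.1.1 (- v.1.1) ltac:(ring)
  ltac:(rewrite -(oppr0 R) -c3 /cross3; ring) ltac:(rewrite -c2 /cross2; ring).
have [w2 v2] := key w.1.2 (- v.1.2) ltac:(rewrite -c3 /cross3; ring) ltac:(ring)
  ltac:(rewrite -(oppr0 R) -c1 /cross1; ring).
have [w3 v3] := key (theta g w) (- theta g v) ltac:(rewrite -(oppr0 R) -c2 /cross2; ring)
  ltac:(rewrite -c1 /cross1; ring) ltac:(ring).
have [h _] := key 1 0 ltac:(move: v1 => /eqP; rewrite oppr_eq0 => /eqP ->; ring)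
  ltac:(move: v2 => /eqP; rewrite oppr_eq0 => /eqP ->; ring)
  ltac:(move: v3 => /eqP; rewrite oppr_eq0 => /eqP ->; ring).
by move/eqP: h; rewrite oner_eq0.
Qed.

Lemma heis_linear_bounded (p : {linear heis R -> (R * R)%type}) :
  exists2 C, 0 < C & forall w, `|p w| <= C * `|w|.
Proof.
pose E1 : heis R := (1, 0, 0); pose E2 : heis R := (0, 1, 0); pose E3 : heis R := (0, 0, 1).
exists (`|p E1| + `|p E2| + `|p E3| + 1); first by rewrite ltr_wpDl ?addr_ge0.
move=> w; have -> : p w = w.1.1 *: p E1 + w.1.2 *: p E2 + w.2 *: p E3.
  rewrite -!linearZ -!linearD; congr (p _); case: w => [[a b] c].
  by congr (_, _, _) => /=; rewrite /GRing.scale /=; ring.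
have n11 : `|w.1.1| <= `|w| by exact: le_trans (norm_fst _) (norm_fst _).
have n12 : `|w.1.2| <= `|w| by exact: le_trans (norm_snd _) (norm_fst _).
have n2 : `|w.2| <= `|w| by exact: norm_snd.
apply: (le_trans (ler_normD _ _)); apply: (le_trans (lerD (ler_normD _ _) (lexx _))).
rewrite !normrZ !mulrDl mul1r -[leLHS]addr0; apply: lerD => //.
by rewrite ![`|p _| * _]mulrC !lerD// ler_wpM2r.
Qed.

(** Cramer's rule through cross products: the coefficients, in terms of [v] and [w], of the
    orthogonal projection of [x] to their plane. The formula is defined for every [x], so it
    provides a linear left inverse of the derivative of a chart. *)
Definition left_inverse_fun g v w (x : heis R) : R * R :=
  ((cross1 g x w * cross1 g v w + cross2 g x w * cross2 g v w + cross3 g x w * cross3 g v w) /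
     cross_sq g v w,
   (cross1 g v x * cross1 g v w + cross2 g v x * cross2 g v w + cross3 g v x * cross3 g v w) /
     cross_sq g v w).

Lemma left_inverse_linear g v w : linear (left_inverse_fun g v w).
Proof.
move=> k x y; rewrite /left_inverse_fun /cross1 /cross2 /cross3 thetaD thetaZ.
rewrite -[RHS]/(k * _ + _, k * _ + _).
rewrite -[(k *: x + y).1.1]/(k * x.1.1 + y.1.1) -[(k *: x + y).1.2]/(k * x.1.2 + y.1.2).
move: (theta g v) (theta g w) (theta g x) (theta g y) v.1.1 v.1.2 w.1.1 w.1.2.
move: x.1.1 x.1.2 y.1.1 y.1.2 (cross_sq g v w)^-1 => *.
by congr (_, _) => /=; ring.
Qed.

HB.instance Definition _ g v w := GRing.isLinear.Build R (heis R) (R * R)%type *:%R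
  (left_inverse_fun g v w) (left_inverse_linear g v w).

Lemma left_inverseE g v w : 0 < cross_sq g v w ->
  left_inverse_fun g v w v = (1, 0) /\ left_inverse_fun g v w w = (0, 1).
Proof.
move=> c0; have c1 : cross_sq g v w != 0 by rewrite gt_eqF.
split; congr (_, _); rewrite -?(divff c1) /cross_sq /cross1 /cross2 /cross3.
- by congr (_ / _); ring.
- by rewrite -[RHS](mul0r (cross_sq g v w)^-1); congr (_ * _); ring.
- by rewrite -[RHS](mul0r (cross_sq g v w)^-1); congr (_ * _); ring.
- by congr (_ / _); ring.
Qed.

End frame_cross_product.

(** * Strict differentiability of transition maps *)

Section transition.
Context {R : realType}.

Lemma sdiff_left_inverse (W : normedModType R) (phi : R * R -> W) (v0 : R * R) A B
    (p : {linear W -> (R * R)%type}) C :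
  0 < C -> (forall w, `|p w| <= C * `|w|) -> p A = (1, 0) -> p B = (0, 1) ->
  sdiff phi v0 A B -> sdiff (p \o phi) v0 (1, 0) (0, 1).
Proof.
move=> C0 pC pA pB s e e0; have [d d0 H] := s (e / C) (divr_gt0 e0 C0).
exists d => // x y xd yd; rewrite -pA -pB /= -!linearZ -!linearD -!linearN -!linearD.
apply: (le_trans (pC _)); rewrite -ler_pdivlMl//; apply: (le_trans (H _ _ xd yd)).
by rewrite mulrAC [leLHS]mulrC.
Qed.

(** Composing [phi' \o t = phi] with [p] gives a map [p \o phi'] that is strictly differentiable
    with derivative the identity, so the increments of [t] follow those of [p \o phi]. Of [t] itself
    only continuity at [u] is known; this replaces the inverse function theorem. *)
Lemma sdiff_factor (W : normedModType R) (phi phi' : R * R -> W) (t : R * R -> R * R)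
    u A B A' B' (p : {linear W -> (R * R)%type}) C :
  0 < C -> (forall w, `|p w| <= C * `|w|) -> p A' = (1, 0) -> p B' = (0, 1) ->
  sdiff phi u A B -> sdiff phi' (t u) A' B' -> {for u, continuous t} ->
  (\forall v \near u, phi' (t v) = phi v) ->
  sdiff t u (p A) (p B).
Proof.
move=> C0 pC pA pB s s' ct pt.
have sp := sdiff_left_inverse C0 pC pA pB s'.
have idE (z : R * R) : z.1 *: (1, 0) + z.2 *: (0, 1) = z :> R * R.
  case: z => a b; rewrite -[LHS]/(a * 1 + b * 0, a * 0 + b * 1).
  by rewrite !mulr1 !mulr0 addr0 add0r.
pose M := `|p A| + `|p B|.
have M0 : 0 <= M by rewrite addr_ge0.
move=> e e0.
(* [k <= 1 / 2] lets the term [k * |D|] be absorbed into the left side, whence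
   [|D| <= (2 * M + 1) * |x - y|]; the total error is then at most [k * (2 * M + 3) * |x - y|],
   which the second bound on [k] keeps below [e * |x - y|]. *)
pose k := Num.min (1 / 2) (e / (2 * M + 3)).
have M3 : 0 < 2 * M + 3 by rewrite ltr_wpDl// mulr_ge0.
have k0 : 0 < k by rewrite lt_min !divr_gt0.
have k2 : k <= 1 / 2 by rewrite ge_min lexx.
have ke : k * (2 * M + 3) <= e by rewrite -ler_pdivlMr// ge_min lexx orbT.
have [d1 d10 H1] := sp k k0.
have [d2 d20 H2] := s (k / C) (divr_gt0 k0 C0).
have /nbhs_normP[d3 /= d30 H3] : \forall v \near u, `|t v - t u| < d1 /\ phi' (t v) = phi v.
  apply: filterI => //; move/cvgr_dist_lt : ct => /(_ _ d10).
  by apply: filterS => v; rewrite distrC.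
exists (Num.min d2 d3); first by rewrite lt_min d20.
move=> x y; rewrite !lt_min => /andP[x2 x3] /andP[y2 y3].
have [tx px] : `|t x - t u| < d1 /\ phi' (t x) = phi x by apply: H3; rewrite /ball_ /= distrC.
have [ty py] : `|t y - t u| < d1 /\ phi' (t y) = phi y by apply: H3; rewrite /ball_ /= distrC.
have E1 : `|p (phi x) - p (phi y) - (t x - t y)| <= k * `|t x - t y|.
  by rewrite -[X in `|_ - X|](idE (t x - t y)) -px -py; exact: H1.
have E2 : `|p (phi x) - p (phi y) - ((x.1 - y.1) *: p A + (x.2 - y.2) *: p B)| <= k * `|x - y|.
  rewrite -!linearZ -!linearD -!linearN -!linearD.
  apply: (le_trans (pC _)); rewrite -ler_pdivlMl//; apply: (le_trans (H2 _ _ x2 y2)).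
  by rewrite mulrAC [leLHS]mulrC.
set D := t x - t y in E1 *; set P := p (phi x) - p (phi y) in E1 E2.
set L := (x.1 - y.1) *: p A + (x.2 - y.2) *: p B in E2 *.
have LM : `|L| <= M * `|x - y|.
  apply: (le_trans (ler_normD _ _)); rewrite !normrZ mulrDl ![_ * `|x - y|]mulrC.
  apply: lerD; apply: ler_wpM2r => //; [exact: (norm_fst (x - y))|exact: (norm_snd (x - y))].
have E3 : `|D - L| <= k * `|D| + k * `|x - y|.
  have -> : D - L = - (P - D) + (P - L) by rewrite opprB addrA subrK.
  by apply: (le_trans (ler_normD _ _)); rewrite normrN; apply: lerD.
have DM : `|D| <= (2 * M + 1) * `|x - y|.
  have : `|D| <= `|D - L| + `|L| by rewrite -{1}[D](subrK L) ler_normD.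
  have : k * `|D| <= 1 / 2 * `|D| by exact: ler_wpM2r.
  have : k * `|x - y| <= 1 / 2 * `|x - y| by exact: ler_wpM2r.
  have -> : (2 * M + 1) * `|x - y| = 2 * (M * `|x - y|) + `|x - y| by ring.
  move: LM E3; lra.
apply: (le_trans E3); apply: (@le_trans _ _ (k * (2 * M + 3) * `|x - y|)); last exact: ler_wpM2r.
have : k * `|D| <= k * ((2 * M + 1) * `|x - y|) by rewrite ler_pM2l.
have : 0 <= k * `|x - y| by rewrite mulr_ge0// ltW.
have -> : k * (2 * M + 3) * `|x - y| = k * ((2 * M + 1) * `|x - y|) + 2 * (k * `|x - y|) by ring.
lra.
Qed.

End transition.

Section charts.
Context {R : realType}.
Implicit Types (S : set (heis R)) (U : set (R * R)) (phi : R * R -> heis R).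

Lemma chart_sdiff S U phi u : chart S U phi -> U u ->
  sdiff phi u ('D_(1, 0) phi u) ('D_(0, 1) phi u).
Proof.
move=> [oU Cphi _ _ _] Uu.
have nU : nbhs u U by exact: open_nbhs_nbhs.
have real (L : {linear heis R -> R}) : continuous L ->
    sdiff (L \o phi) u (L ('D_(1, 0) phi u)) (L ('D_(0, 1) phi u)).
  move=> cL; have [dL CL] := CkS (Ck_linear oU cL Cphi).
  have E1 : 'D_(1, 0) (L \o phi) u = L ('D_(1, 0) phi u).
    exact: (@derive_linear R (R * R)%type _ _ L phi u (1, 0) cL (Cphi.1 u Uu)).2.
  have E2 : 'D_(0, 1) (L \o phi) u = L ('D_(0, 1) phi u).
    exact: (@derive_linear R (R * R)%type _ _ L phi u (0, 1) cL (Cphi.1 u Uu)).2.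
  suff: sdiff (L \o phi) u ('D_(1, 0) (L \o phi) u) ('D_(0, 1) (L \o phi) u) by rewrite E1 E2.
  by apply: sdiff_real nU dL _ _; exact: CL.
have c1 : continuous (fst : R * R -> R) by move=> ?; exact: cvg_fst.
have c2 : continuous (snd : R * R -> R) by move=> ?; exact: cvg_snd.
have c12 : continuous (fst : heis R -> R * R) by move=> ?; exact: cvg_fst.
have c3 : continuous (snd : heis R -> R) by move=> ?; exact: cvg_snd.
have r1 := real (fst \o fst) (fun x => continuous_comp (c12 x) (c1 _)).
have r2 := real (snd \o fst) (fun x => continuous_comp (c12 x) (c2 _)).
have r3 := real snd c3.
have H := sdiff_pair (sdiff_pair r1 r2) r3.
have eta (x : heis R) : ((fst \o fst) x, (snd \o fst) x, snd x) = x by case: x => [[]].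
move: ('D_(1, 0) phi u) ('D_(0, 1) phi u) H => A B H.
rewrite -(eta A) -(eta B); apply: sdiff_near H.
by near=> v; exact: eta.
Unshelve. all: by end_near. Qed.

Lemma chart_derive S U phi u w : chart S U phi -> U u ->
  'D_w phi u = w.1 *: 'D_(1, 0) phi u + w.2 *: 'D_(0, 1) phi u.
Proof. by move=> c Uu; exact: (sdiff_differentiable (chart_sdiff c Uu)).2. Qed.

Lemma chart_cross_gt0 S U phi u : chart S U phi -> U u ->
  forall g, 0 < cross_sq g ('D_(1, 0) phi u) ('D_(0, 1) phi u).
Proof.
move=> c Uu g; apply: cross_sq_gt0 => x; rewrite -(chart_derive _ c Uu).
by have [_ _ + _ _] := c; exact.
Qed.

Lemma chart_continuous S U phi u : chart S U phi -> U u -> {for u, continuous phi}.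
Proof. by move=> [_ [df _] _ _ _] Uu; exact: differentiable_continuous (df u Uu). Qed.

Lemma chart_inj S U phi : chart S U phi -> {in U &, injective phi}.
Proof.
move=> [_ _ _ _ [psi _ psiK]] x y; rewrite !inE => Ux Uy E.
by rewrite -(psiK x Ux) E psiK.
Qed.

Lemma chart_sub S U phi u : chart S U phi -> U u -> S (phi u).
Proof.
move=> [_ _ _ [V _ E] _] Uu; have : (phi @` U) (phi u) by exists u.
by rewrite E => -[].
Qed.

(** Relative openness of the image and continuity of the inverse combine here into the form used by
    the local arguments: the points of [S] near [phi u] have parameters near [u]. *)
Lemma chart_image_near S U phi u (V : set (R * R)) : chart S U phi -> U u -> nbhs u V ->
  \forall g \near phi u, S g -> (phi @` (U `&` V)) g.
Proof.
move=> c Uu uV; have [oU Cphi _ [W oW E] [psi /subspace_continuousP cpsi psiK]] := c.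
have iu : (phi @` U) (phi u) by exists u.
have Wu : W (phi u) by move: (iu); rewrite E => -[].
have h : \forall g \near phi u, (phi @` U) g -> V (psi g).
  have uV' : nbhs (psi (phi u)) V by rewrite psiK.
  exact: (cpsi _ iu V uV').
near=> g => Sg.
have Wg : W g by near: g; exact: open_nbhs_nbhs.
have : (phi @` U) g by rewrite E.
move=> [v Uv vg]; exists v => //; split=> //.
rewrite -(psiK v Uv) vg; have : (phi @` U) g -> V (psi g) by near: g.
by apply; exists v.
Unshelve. all: by end_near. Qed.

Lemma chart_open S U V phi : chart S U phi -> open V -> V `<=` U ->
  exists2 W : set (heis R), open W & phi @` V = S `&` W.
Proof.
move=> c oV VU; exists (interior [set g | S g -> (phi @` V) g]); first exact: open_interior.
rewrite eqEsubset; split.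
  move=> _ [v Vv <-]; split; first exact: (chart_sub c (VU _ Vv)).
  rewrite /interior /=; have nV : nbhs v V by exact: open_nbhs_nbhs.
  have := chart_image_near c (VU _ Vv) nV; apply: filterS => g + Sg => /(_ Sg).
  by rewrite (setIidr VU).
by move=> g [Sg Ig]; exact: (interior_subset Ig Sg).
Qed.

Lemma chart_restrict S U V phi : chart S U phi -> open V -> V `<=` U -> chart S V phi.
Proof.
move=> c oV VU; have [oU Cphi ind _ [psi cpsi psiK]] := c; split=> //.
- exact: Ck_subset Cphi.
- by move=> u w /VU; exact: ind.
- exact: chart_open c oV VU.
- exists psi; last by move=> u /VU; exact: psiK.
  by apply: continuous_subspaceW cpsi; exact: image_subset.
Qed.

Lemma chart_preimage_open S U phi (W : set (heis R)) : chart S U phi -> open W ->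
  open (U `&` phi @^-1` W).
Proof.
move=> c oW; have [oU _ _ _ _] := c; rewrite openE => u [Uu Wu]; apply: filterI.
  exact: open_nbhs_nbhs.
by apply: (chart_continuous c Uu); exact: open_nbhs_nbhs.
Qed.

Lemma chart_inter S U phi (W : set (heis R)) : chart S U phi -> open W ->
  phi @` U `<=` W -> chart (S `&` W) U phi.
Proof.
move=> [oU Cphi ind [W' oW' E] inv] oW UW; split=> //.
exists W' => //; rewrite eqEsubset; split=> g; last by move=> [[Sg _] W'g]; rewrite E.
by move=> ig; have := ig; rewrite E => -[Sg W'g]; split=> //; split=> //; exact: UW.
Qed.

Lemma chart_ambient S U phi (W : set (heis R)) : chart (S `&` W) U phi -> open W ->
  chart S U phi.
Proof.
move=> [oU Cphi ind [W' oW' E] inv] oW; split=> //.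
by exists (W `&` W'); [exact: openI|rewrite E setIA].
Qed.

Lemma open_surface S W : C2_surface S -> open W -> C2_surface (S `&` W).
Proof.
move=> CS oW g [Sg Wg]; have [U [phi [c [u Uu ug]]]] := CS g Sg.
exists (U `&` phi @^-1` W), phi; split; last by exists u => //; split=> //=; rewrite ug.
apply: chart_inter => //; last by move=> _ [v [_ Wv] <-].
by apply: (chart_restrict c); [exact: chart_preimage_open c oW|exact: subIsetl].
Qed.

(** The transition [psi' \o phi] inherits continuity from the inverse of the second chart.
    [sdiff_factor], applied with the left inverse of the derivative of [phi'], upgrades it to strict
    differentiability; the chain rule and uniqueness of derivatives then relate the coordinate
    tangent vectors. *)
Lemma chart_transition S U phi U' phi' u u' :
  chart S U phi -> chart S U' phi' -> U u -> U' u' -> phi u = phi' u' ->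
  exists t T1 T2, [/\ t u = u', sdiff t u T1 T2,
    \forall v \near u, [/\ U v, U' (t v) & phi' (t v) = phi v],
    'D_(1, 0) phi u = T1.1 *: 'D_(1, 0) phi' u' + T1.2 *: 'D_(0, 1) phi' u' &
    'D_(0, 1) phi u = T2.1 *: 'D_(1, 0) phi' u' + T2.2 *: 'D_(0, 1) phi' u'].
Proof.
move=> c c' Uu Uu' E.
have [_ _ _ _ [psi' /subspace_continuousP cpsi' psiK']] := c'.
have [oU _ _ _ _] := c; have [oU' _ _ _ _] := c'.
pose t := psi' \o phi.
have tu : t u = u' by rewrite /t /= E psiK'.
have cphi := chart_continuous c Uu.
have nt : \forall v \near u, [/\ U v, U' (t v) & phi' (t v) = phi v].
  have n' : nbhs u' U' by exact: open_nbhs_nbhs.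
  have := chart_image_near c' Uu' n'; rewrite -E => H.
  have := cphi _ H; have : \forall v \near u, U v by exact: open_nbhs_nbhs.
  apply: filterS2 => v Uv /(_ (chart_sub c Uv)); rewrite setIid => -[w Uw wv].
  by rewrite /t /= -wv psiK'.
have ct : {for u, continuous t}.
  have iu : (phi' @` U') (phi u) by exists u'.
  move=> B /= tB; have h : \forall g \near phi u, (phi' @` U') g -> B (psi' g).
    exact: (cpsi' _ iu).
  have := cphi _ h; apply: filterS2 nt => v [Uv Utv e]; apply.
  by exists (t v).
have s := chart_sdiff c Uu; have s' := chart_sdiff c' Uu'.
have cg := chart_cross_gt0 c' Uu' (phi u).
move: ('D_(1, 0) phi u) ('D_(0, 1) phi u) ('D_(1, 0) phi' u') ('D_(0, 1) phi' u') s s' cg.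
move=> A B A' B' s s' cg.
pose p : {linear heis R -> (R * R)%type} := left_inverse_fun (phi u) A' B'.
have [C C0 pC] := heis_linear_bounded p.
have [p1 p2] := left_inverseE cg.
have ts' : sdiff phi' (t u) A' B' by rewrite tu.
have nt' : \forall v \near u, phi' (t v) = phi v by apply: filterS nt => v [].
have st : sdiff t u (p A) (p B).
  exact: (@sdiff_factor R _ phi phi' t u A B A' B' p C C0 pC p1 p2 s ts' ct nt').
exists t, (p A), (p B).
have sc := sdiff_near nt' (sdiff_comp st ts').
by have [? ?] := sdiff_unique s sc.
Qed.

(** [tder] selects a value by choice, so all candidates must be shown to agree. In the transition of
    charts the direction is determined by the tangent vector, because a chart is an immersion. *)
Lemma tder_chart (V : normedModType R) S U phi (F : heis R -> V) u w :
  chart S U phi -> U u -> differentiable (F \o phi) u ->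
  tder S F (phi u) ('D_w phi u) = 'D_w (F \o phi) u.
Proof.
move=> c Uu dF; rewrite /tder; case: xgetP => [d _|/(_ ('D_w (F \o phi) u))]; last first.
  case; exists U, phi, u, w; split=> //; exact/derivableP/diff_derivable.
move=> [U' [phi' [u' [w' [c' Uu' e Dw [_ <-]]]]]].
have [t [T1 [T2 [tu st nt E1 E2]]]] := chart_transition c' c Uu' Uu e.
have [dt Dt] := sdiff_differentiable st.
have -> : 'D_w' (F \o phi') u' = 'D_w' ((F \o phi) \o t) u'.
  by apply: near_eq_derive; apply: filterS nt => v [_ _ /= ->].
have dF' : differentiable (F \o phi) (t u') by rewrite tu.
have tw : 'D_w' t u' = w.
  rewrite Dt; have := chart_derive w' c' Uu'; rewrite Dw E1 E2.
  have [_ _ /(_ u (w'.1 *: T1 + w'.2 *: T2 - w) Uu) + _ _] := c.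
  rewrite (chart_derive _ c Uu) (chart_derive w c Uu).
  move: ('D_(1, 0) phi u) ('D_(0, 1) phi u) => A B H E.
  apply/eqP; rewrite -subr_eq0; apply/eqP/H.
  rewrite -[_.1]/(w'.1 * T1.1 + w'.2 * T2.1 - w.1) -[X in _ + X *: _]/(w'.1 * T1.2 + w'.2 * T2.2 - w.2).
  rewrite !scalerBl addrACA -opprD E; apply/eqP; rewrite subr_eq0; apply/eqP.
  by rewrite !scalerDr !scalerA addrACA -!scalerDl.
by rewrite (deriveE _ (differentiable_comp dt dF')) (diff_comp dt dF') /= -(deriveE w' dt) tw tu (deriveE w dF).
Qed.

End charts.

Section chart_regularity.
Context {R : realType}.
Implicit Types (S : set (heis R)) (U : set (R * R)) (phi : R * R -> heis R).

Definition coord_x : {linear heis R -> R} := fst \o fst.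
Definition coord_y : {linear heis R -> R} := snd \o fst.
Definition coord_t : {linear heis R -> R} := snd.

Lemma coord_x_continuous : continuous coord_x.
Proof. by move=> g; apply: continuous_comp; exact: cvg_fst. Qed.

Lemma coord_y_continuous : continuous coord_y.
Proof. by move=> g; apply: continuous_comp; [exact: cvg_fst|exact: cvg_snd]. Qed.

Lemma coord_t_continuous : continuous coord_t.
Proof. by move=> g; exact: cvg_snd. Qed.

Lemma Ck_coord k U (f : R * R -> heis R) : open U -> Ck k U f ->
  [/\ Ck k U (fun u => (f u).1.1), Ck k U (fun u => (f u).1.2) & Ck k U (fun u => (f u).2)].
Proof.
move=> oU Cf; split.
- exact: (Ck_linear oU coord_x_continuous Cf).
- exact: (Ck_linear oU coord_y_continuous Cf).
- exact: (Ck_linear oU coord_t_continuous Cf).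
Qed.

Lemma CkN k U (f : R * R -> R) : open U -> Ck k U f -> Ck k U (fun u => - f u).
Proof.
move=> oU Cf; apply: (Ck_ext oU) (CkZ (-1) oU Cf) => u _.
by rewrite scaleN1r.
Qed.

Lemma CkB k U (f g : R * R -> R) : open U -> Ck k U f -> Ck k U g ->
  Ck k U (fun u => f u - g u).
Proof. by move=> oU Cf Cg; apply: (CkD oU Cf); exact: CkN. Qed.

Lemma Ck_theta k U (f v : R * R -> heis R) : open U -> Ck k U f -> Ck k U v ->
  Ck k U (fun u => theta (f u) (v u)).
Proof.
move=> oU /(Ck_coord oU)[f1 f2 f3] /(Ck_coord oU)[v1 v2 v3].
apply: (CkB oU v3).
apply: (Ck_ext oU) (CkZ (2^-1) oU (CkB oU (CkM oU f1 v2) (CkM oU f2 v1))) => u _.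
by rewrite /GRing.scale /= mulrC.
Qed.

Lemma Ck_cross k U (f v w : R * R -> heis R) : open U -> Ck k U f -> Ck k U v -> Ck k U w ->
  [/\ Ck k U (fun u => cross1 (f u) (v u) (w u)), Ck k U (fun u => cross2 (f u) (v u) (w u)) &
      Ck k U (fun u => cross3 (f u) (v u) (w u))].
Proof.
move=> oU Cf Cv Cw.
have tv := Ck_theta oU Cf Cv; have tw := Ck_theta oU Cf Cw.
have [v1 v2 _] := Ck_coord oU Cv; have [w1 w2 _] := Ck_coord oU Cw.
split.
- exact: (CkB oU (CkM oU v2 tw) (CkM oU tv w2)).
- exact: (CkB oU (CkM oU tv w1) (CkM oU v1 tw)).
- exact: (CkB oU (CkM oU v1 w2) (CkM oU v2 w1)).
Qed.

Lemma Ck1_sqrt U (f : R * R -> R) : open U -> (forall u, U u -> 0 < f u) -> Ck 1 U f ->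
  Ck 1 U (fun u => Num.sqrt (f u)).
Proof.
move=> oU f0; apply: (@Ck1_comp _ _ _ (fun x => (2 * Num.sqrt x)^-1) _ _ oU) => u Uu.
have fu := f0 u Uu; split; first exact: is_derive1_sqrt.
apply: cvgV; first by rewrite mulf_neq0 // sqrtr_eq0 -ltNge.
by apply: cvgMr; exact: sqrt_continuous.
Qed.

Lemma Ck1_inv U (f : R * R -> R) : open U -> (forall u, U u -> f u != 0) -> Ck 1 U f ->
  Ck 1 U (fun u => (f u)^-1).
Proof.
move=> oU f0; apply: (@Ck1_comp _ _ _ (fun x => - x ^- 2) _ _ oU) => u Uu.
have fu := f0 u Uu; split.
  apply: is_derive_eq; first exact: (is_deriveV (f := id)).
  by rewrite /GRing.scale /= mulr1.
apply: cvgN; apply: cvgV; first by rewrite expf_neq0.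
by apply: (@exprn_continuous R 2).
Qed.

Lemma chart_cross_Ck S U phi : chart S U phi ->
  [/\ Ck 1 U (fun u => cross1 (phi u) ('D_(1, 0) phi u) ('D_(0, 1) phi u)),
      Ck 1 U (fun u => cross2 (phi u) ('D_(1, 0) phi u) ('D_(0, 1) phi u)) &
      Ck 1 U (fun u => cross3 (phi u) ('D_(1, 0) phi u) ('D_(0, 1) phi u))].
Proof.
move=> [oU C2 _ _ _]; have [_ CD] := C2.
by apply: (Ck_cross oU (CkS C2)); exact: CD.
Qed.

Lemma chart_area_Ck S U phi : chart S U phi -> Ck 1 U (area_element phi).
Proof.
move=> c; have [oU _ _ _ _] := c; have [c1 c2 c3] := chart_cross_Ck c.
have Csq := CkD oU (CkD oU (CkM oU c1 c1) (CkM oU c2 c2)) (CkM oU c3 c3).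
have C : Ck 1 U (fun u => cross_sq (phi u) ('D_(1, 0) phi u) ('D_(0, 1) phi u)).
  by apply: (Ck_ext oU) Csq => u _; rewrite /cross_sq !expr2.
apply: (Ck_ext oU) (Ck1_sqrt oU _ C) => u Uu; first by rewrite area_elementE.
exact: chart_cross_gt0 c Uu _.
Qed.

Lemma chart_area_gt0 S U phi u : chart S U phi -> U u -> 0 < area_element phi u.
Proof. by move=> c Uu; rewrite area_elementE sqrtr_gt0; exact: chart_cross_gt0 c Uu _. Qed.

Lemma Ck0_measurable U (f : R * R -> R) : open U -> Ck 0 U f -> measurable_fun U f.
Proof.
move=> oU cf; apply: measurable_fun_open_preimage => V oV; apply: open_measurable2.
rewrite openE => u [Uu Vu]; apply: filterI; first exact: open_nbhs_nbhs.
by apply: (cf u Uu); exact: open_nbhs_nbhs.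
Qed.

End chart_regularity.

(** * Surface area in charts *)

Section chart_area.
Context {R : realType}.
Implicit Types (S A : set (heis R)) (U : set (R * R)) (phi : R * R -> heis R).

Definition chart_area U phi A : \bar R :=
  (\int[lebesgue_measure \x lebesgue_measure]_(u in U `&` phi @^-1` A) (area_element phi u)%:E)%E.

Lemma chart_measurable S U phi : chart S U phi -> measurable_fun U phi.
Proof.
move=> c; have [oU _ _ _ _] := c.
have mU : measurable U by exact: open_measurable2.
move=> _; pose G : set (set (heis R)) := [set A | measurable (U `&` phi @^-1` A)].
suff : @measurable _ (heis R) `<=` G by move=> + A mA => /(_ A mA).
apply: open_generates3; last first.
  by move=> W oW; apply: open_measurable2; exact: chart_preimage_open c oW.
split.
- by rewrite /G /= preimage_set0 setI0.
- move=> A GA; rewrite /G /= setTD preimage_setC.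
  have -> : U `&` ~` (phi @^-1` A) = U `\` (U `&` phi @^-1` A).
    by rewrite setDIr setDv set0U setDE.
  exact: measurableD.
- by move=> F GF; rewrite /G /= preimage_bigcup setI_bigcupr; exact: bigcupT_measurable.
Qed.

Lemma chart_preimage_measurable S U phi A : chart S U phi -> measurable A ->
  measurable (U `&` phi @^-1` A).
Proof.
move=> c mA; have [oU _ _ _ _] := c.
by apply: (chart_measurable c) => //; exact: open_measurable2.
Qed.

Definition box (u : R * R) (r : R) : set (R * R) :=
  `[u.1 - r, u.1 + r]%classic `*` `[u.2 - r, u.2 + r]%classic.

Lemma boxE u r v : box u r v <-> `|v - u| <= r.
Proof.
case: u v => [a b] [c d]; rewrite /box /= !in_itv /= prod_normr ge_max /=.
by rewrite -!ler_distl; split=> [[-> ->]|/andP[-> ->]].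
Qed.

Lemma box_compact u r : compact (box u r).
Proof. by apply: compact_setX; exact: segment_compact. Qed.

Lemma box_nbhs u r : 0 < r -> nbhs u (box u r).
Proof.
move=> r0; apply: filterS (nbhsx_ballx u r r0) => v [/= /ltW b1 /ltW b2].
by apply/boxE; case: u v b1 b2 => [a b] [c d] /= b1 b2; rewrite prod_normr ge_max /= !(distrC _ a) !(distrC _ b) b1 b2.
Qed.

Lemma nbhs_box u (V : set (R * R)) : nbhs u V -> exists2 r, 0 < r & box u r `<=` V.
Proof.
move=> /nbhs_normP[r /= r0 rV]; exists (r / 2); first by rewrite divr_gt0.
move=> v /boxE vr; apply: rV; rewrite /ball_ /= distrC; apply: (le_lt_trans vr).
by rewrite ltr_pdivrMr// ltr_pMr// ltr1n.
Qed.

End chart_area.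

Section chart_comparison.
Context {R : realType}.
Implicit Types (S A : set (heis R)) (U : set (R * R)) (phi : R * R -> heis R).

Local Notation leb := (lebesgue_measure \x lebesgue_measure)%E.

Lemma sdiff_image_measurable (J C : set (R * R)) (h : R * R -> R * R) :
  compact C -> {within C, continuous h} -> {in C &, injective h} ->
  measurable J -> J `<=` C -> measurable (h @` J).
Proof.
move=> cC ch ih mJ JC.
apply: (@injective_image_measurable R _ (R * R)%type (R * R)%type id C h) => //.
exact: closed_measurable2.
Qed.

(** The passage from [u] to [t u] is factored into two steps, each exchanging one coordinate: from
    [(u.2, u.1)] to [(u.2, i (t u))], then from [(i (t u), u.2)] to [(i (t u), j (t u))]. Each step
    is Lipschitz along lines, so no change of variables formula in the plane is involved. *)
Lemma paired_comparison (J J' : set (R * R)) (C : set (R * R)) (t : R * R -> R * R)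
    (i j : R * R -> R) (c1 c2 : R) :
  0 < c1 -> 0 < c2 -> measurable J -> J `<=` C -> compact C ->
  {within C, continuous (fun u => i (t u))} ->
  (forall u v, C u -> C v -> u.2 = v.2 -> `|u.1 - v.1| <= c1 * `|i (t u) - i (t v)|) ->
  (forall u v, J u -> J v -> i (t u) = i (t v) ->
     `|u.2 - v.2| <= c2 * `|j (t u) - j (t v)|) ->
  measurable J' -> J' = (fun u => (i (t u), j (t u))) @` J ->
  (leb J <= (c1 * c2)%:E * leb J')%E.
Proof.
move=> c10 c20 mJ JC cC ci H1 H2 mJ' EJ'.
have inj (u v : R * R) : C u -> C v -> u.2 = v.2 -> i (t u) = i (t v) -> u = v.
  move=> Cu Cv e2 ei; have := H1 _ _ Cu Cv e2; rewrite ei subrr normr0 mulr0 normr_le0 subr_eq0.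
  by move=> /eqP e1; rewrite (surjective_pairing u) e1 e2 -surjective_pairing.
have cs : {within C, continuous (snd : R * R -> R)}.
  by apply: continuous_subspaceT => x; exact: cvg_snd.
have m1 : measurable ((fun u => (u.2, i (t u))) @` J).
  apply: (sdiff_image_measurable cC) => //.
  - by move=> u; exact: (cvg_pair (cs u) (ci u)).
  - by move=> u v; rewrite !inE => Cu Cv [e2 ei]; exact: inj.
have m2 : measurable ((fun u => (i (t u), u.2)) @` J).
  apply: (sdiff_image_measurable cC) => //.
  - by move=> u; exact: (cvg_pair (ci u) (cs u)).
  - by move=> u v; rewrite !inE => Cu Cv [ei e2]; exact: inj.
have mS : measurable ((fun u : R * R => (u.2, u.1)) @` J).
  have -> : (fun u : R * R => (u.2, u.1)) @` J = (fun u : R * R => (u.2, u.1)) @^-1` J.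
    rewrite eqEsubset; split=> [_ [[a b] ? <-]//|[a b] /= ?].
    by exists (b, a).
  by rewrite -[X in measurable X]setTI; exact: (measurable_fun_pair measurable_snd measurable_fst).
rewrite -(leb2_swap _ mJ) EFinM -muleA.
apply: (@le_trans _ _ (c1%:E * leb ((fun u => (u.2, i (t u))) @` J))%E).
  apply: (@paired_leb2_le R _ J snd fst (fun u => i (t u))) => //.
  by move=> u v Ju Jv; apply: H1; exact: JC.
apply: lee_pmul => //; first by rewrite lee_fin ltW.
have -> : leb ((fun u => (u.2, i (t u))) @` J) = leb ((fun u => (i (t u), u.2)) @` J).
  rewrite -(leb2_swap _ m2); congr (leb _).
  by rewrite image_comp.
rewrite EJ'; apply: (@paired_leb2_le R _ J (fun u => i (t u)) snd (fun u => j (t u))) => //.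
by rewrite -EJ'.
Qed.

(** In the first identity both sides are the squared length of the cross product of [a] and [b'], in
    the second that of [a] and [a'], expanded in the two bases of the plane. *)
Lemma cross_sq_span (g a b a' b' : heis R) (T1 T2 S1 S2 : R * R) :
  a = T1.1 *: a' + T1.2 *: b' -> b = T2.1 *: a' + T2.2 *: b' ->
  a' = S1.1 *: a + S1.2 *: b -> b' = S2.1 *: a + S2.2 *: b ->
  S2.2 ^+ 2 * cross_sq g a b = T1.1 ^+ 2 * cross_sq g a' b' /\
  S1.2 ^+ 2 * cross_sq g a b = T1.2 ^+ 2 * cross_sq g a' b'.
Proof.
move=> Ea Eb Ea' Eb'.
have E x y (s : R) (z : heis R) : x = s *: z -> cross_sq g y x = s ^+ 2 * cross_sq g y z.
  by move=> ->; rewrite /cross_sq /cross1 /cross2 /cross3 thetaZ /=;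
     move: (theta g y) (theta g z) => *; rewrite /GRing.scale /=; ring.
have Esym x y : cross_sq g x y = cross_sq g y x.
  rewrite /cross_sq /cross1 /cross2 /cross3; move: (theta g x) (theta g y) => *; ring.
have Eadd x y (s : R) : cross_sq g x (s *: x + y) = cross_sq g x y.
  rewrite /cross_sq /cross1 /cross2 /cross3 thetaD thetaZ /=.
  by move: (theta g x) (theta g y) => *; rewrite /GRing.scale /=; ring.
split.
- rewrite -(E _ a S2.2 b erefl) -(Eadd a _ S2.1) -Eb' Ea Esym addrC Eadd.
  by rewrite (E _ _ _ _ erefl) Esym.
- rewrite -(E _ a S1.2 b erefl) -(Eadd a _ S1.1) -Ea' Ea Esym Eadd.
  by rewrite (E _ _ _ _ erefl).
Qed.

Lemma continuous_le_near (f : R * R -> R) u c : {for u, continuous f} -> 0 < f u -> 1 < c ->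
  \forall v \near u, f v <= c * f u /\ f u <= c * f v.
Proof.
move=> cf f0 c1; have c0 : 0 < c by exact: lt_trans c1.
have e0 : 0 < f u * (1 - c^-1) by rewrite mulr_gt0// subr_gt0 invf_lt1.
move/cvgr_dist_le : cf => /(_ _ e0); apply: filterS => v; rewrite ler_norml => /andP[h1 h2].
have k : (c - 1) * (1 - c^-1) >= 0 by rewrite mulr_ge0// subr_ge0 ?invf_le1// ltW.
have ck : c * c^-1 = 1 by rewrite divff// gt_eqF.
split.
  have : f u * ((c - 1) * (1 - c^-1)) >= 0 by rewrite mulr_ge0// ltW.
  have -> : f u * ((c - 1) * (1 - c^-1)) = f u * (c + c^-1 - 1 - c * c^-1) by ring.
  rewrite ck; lra.
have : f u * c^-1 <= f v by lra.
by rewrite ler_pdivrMr// mulrC.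
Qed.

End chart_comparison.

Section local_comparison.
Context {R : realType}.
Implicit Types (S A : set (heis R)) (U : set (R * R)) (phi : R * R -> heis R).

Local Notation leb := (lebesgue_measure \x lebesgue_measure)%E.

Lemma sdiff_fst (t : R * R -> R * R) u T1 T2 : sdiff t u T1 T2 ->
  sdiff (fun x => (t x).1) u T1.1 T2.1.
Proof.
move=> st e e0; have [d d0 H] := st e e0; exists d => // x y xd yd.
exact: le_trans (norm_fst (t x - t y - ((x.1 - y.1) *: T1 + (x.2 - y.2) *: T2))) (H x y xd yd).
Qed.

Lemma sdiff_snd (t : R * R -> R * R) u T1 T2 : sdiff t u T1 T2 ->
  sdiff (fun x => (t x).2) u T1.2 T2.2.
Proof.
move=> st e e0; have [d d0 H] := st e e0; exists d => // x y xd yd.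
exact: le_trans (norm_snd (t x - t y - ((x.1 - y.1) *: T1 + (x.2 - y.2) *: T2))) (H x y xd yd).
Qed.

(** Along the first axis the increment of [f] is [A] times the length, up to a relative error that
    shrinking the box brings below [1 - 1 / c]. *)
Lemma sdiff_lower (f : R * R -> R) u (A B c : R) : sdiff f u A B -> A != 0 -> 1 < c ->
  \forall r \near 0^'+, forall x y, box u r x -> box u r y -> x.2 = y.2 ->
    `|x.1 - y.1| <= c / `|A| * `|f x - f y|.
Proof.
move=> sf A0 c1; have c0 : 0 < c by exact: lt_trans c1.
have e0 : 0 < `|A| * (1 - c^-1) by rewrite mulr_gt0 ?normr_gt0// subr_gt0 invf_lt1.
have [d d0 H] := sf _ e0; near=> r => x y /boxE xr /boxE yr e2.
have rd : r < d by near: r; exact: nbhs_right_lt.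
have := H x y (le_lt_trans xr rd) (le_lt_trans yr rd).
have -> : `|x - y| = `|x.1 - y.1|.
  rewrite -[x - y]/(x.1 - y.1, x.2 - y.2) prod_normr e2 subrr normr0.
  by rewrite max_l.
rewrite e2 subrr scale0r addr0 => h.
have An : 0 < `|A| by rewrite normr_gt0.
have : `|A| * `|x.1 - y.1| <= `|f x - f y| + `|A| * (1 - c^-1) * `|x.1 - y.1|.
  rewrite -normrM mulrC -[X in `|X|]/((x.1 - y.1) *: A).
  have -> : (x.1 - y.1) *: A = (f x - f y) - (f x - f y - (x.1 - y.1) *: A) by rewrite subKr.
  by apply: (le_trans (ler_normB _ _)); rewrite lerD2l.
have -> : `|A| * (1 - c^-1) * `|x.1 - y.1| = `|A| * `|x.1 - y.1| - `|A| * `|x.1 - y.1| / c by ring.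
rewrite -ler_pdivrMl ?divr_gt0// invf_div => k.
have : `|A| * `|x.1 - y.1| / c <= `|f x - f y| by lra.
by rewrite mulrAC.
Unshelve. all: by end_near. Qed.

Lemma sdiff_upper (f : R * R -> R) u (A B c : R) : sdiff f u A B -> 1 < c ->
  (B != 0 -> \forall r \near 0^'+, forall x y, box u r x -> box u r y -> x.1 = y.1 ->
    `|f x - f y| <= c * `|B| * `|x.2 - y.2|) /\
  (A != 0 -> \forall r \near 0^'+, forall x y, box u r x -> box u r y -> x.2 = y.2 ->
    `|f x - f y| <= c * `|A| * `|x.1 - y.1|).
Proof.
move=> sf c1; split => [B0|A0].
  have e0 : 0 < `|B| * (c - 1) by rewrite mulr_gt0 ?normr_gt0// subr_gt0.
  have [d d0 H] := sf _ e0; near=> r => x y /boxE xr /boxE yr e2.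
  have rd : r < d by near: r; exact: nbhs_right_lt.
  have := H x y (le_lt_trans xr rd) (le_lt_trans yr rd).
  have -> : `|x - y| = `|x.2 - y.2|.
    rewrite -[x - y]/(x.1 - y.1, x.2 - y.2) prod_normr e2 subrr normr0.
    by rewrite max_r.
  rewrite e2 subrr scale0r add0r => h.
  rewrite -[f x - f y](subrK ((x.2 - y.2) *: B)).
  apply: (le_trans (ler_normD _ _)); apply: (le_trans (lerD h (lexx _))).
  by rewrite normrZ le_eqVlt; apply/orP; left; apply/eqP; ring.
have e0 : 0 < `|A| * (c - 1) by rewrite mulr_gt0 ?normr_gt0// subr_gt0.
have [d d0 H] := sf _ e0; near=> r => x y /boxE xr /boxE yr e2.
have rd : r < d by near: r; exact: nbhs_right_lt.
have := H x y (le_lt_trans xr rd) (le_lt_trans yr rd).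
have -> : `|x - y| = `|x.1 - y.1|.
  rewrite -[x - y]/(x.1 - y.1, x.2 - y.2) prod_normr e2 subrr normr0.
  by rewrite max_l.
rewrite e2 subrr scale0r addr0 => h.
rewrite -[f x - f y](subrK ((x.1 - y.1) *: A)).
apply: (le_trans (ler_normD _ _)); apply: (le_trans (lerD h (lexx _))).
by rewrite normrZ le_eqVlt; apply/orP; left; apply/eqP; ring.
Unshelve. all: by end_near. Qed.

Lemma sdiff_within_continuous (f : R * R -> R) u (A B : R) : sdiff f u A B ->
  \forall r \near 0^'+, {within box u r, continuous f}.
Proof.
move=> sf; have [C C0 [d d0 H]] := sdiff_lipschitz sf.
near=> r; have rd : r < d by near: r; exact: nbhs_right_lt.
apply/subspace_continuousP => x xr.
have xd : `|x - u| < d by move/boxE : (xr) => /le_lt_trans; apply.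
apply/cvgrPdist_le => e e0.
suff : \forall y \near x, box u r y -> `|f x - f y| <= e by [].
near=> y => yr.
have yd : `|y - u| < d by move/boxE : (yr) => /le_lt_trans; apply.
apply: (le_trans (H x y xd yd)); rewrite -ler_pdivlMl//.
near: y; apply: cvgr_dist_le; first exact: cvg_id.
by rewrite mulr_gt0// invr_gt0.
Unshelve. all: by end_near. Qed.

Lemma chart_area_continuous S U phi u : chart S U phi -> U u ->
  {for u, continuous (area_element phi)}.
Proof. by move=> c Uu; have := CkS (chart_area_Ck c); exact. Qed.

(** [i] and [j] are the two coordinates in a suitable order; [tau] and [sig] stand for the absolute
    values of one entry of the derivative of [t] and one of its inverse [s], and [sig / tau] for the
    Jacobian of [s], matching the ratio of area elements. The exponent 4 counts the losses: one
    factor [c] for each coordinate exchange and one for each area element. *)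
Lemma chart_area_near_aux S U phi U' phi' u0 v0 (t s : R * R -> R * R) (i j : R * R -> R)
    (tau sig c : R) :
  chart S U phi -> chart S U' phi' -> U u0 -> U' v0 -> phi u0 = phi' v0 -> t u0 = v0 ->
  (forall J, (fun u => (i (t u), j (t u))) @` J = t @` J \/
     (fun u => (i (t u), j (t u))) @` J = (fun u => (u.2, u.1)) @` (t @` J)) ->
  0 < tau -> 0 < sig -> 1 < c -> area_element phi u0 * sig = area_element phi' v0 * tau ->
  (\forall v \near u0, [/\ U v, U' (t v) & phi' (t v) = phi v]) ->
  (\forall v \near v0, [/\ U' v, U (s v) & phi (s v) = phi' v]) ->
  (\forall r \near 0^'+, forall x y, box u0 r x -> box u0 r y -> x.2 = y.2 ->
    `|x.1 - y.1| <= c / tau * `|i (t x) - i (t y)|) ->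
  (\forall r \near 0^'+, {within box u0 r, continuous (fun x => i (t x))}) ->
  (\forall r \near 0^'+, forall x y, box v0 r x -> box v0 r y -> i x = i y ->
    `|(s x).2 - (s y).2| <= c * sig * `|j x - j y|) ->
  exists W, [/\ open W, W (phi u0) & forall A, measurable A -> A `<=` W ->
    (chart_area U phi A <= (c ^+ 4)%:E * chart_area U' phi' A)%E].
Proof.
move=> cU cU' Uu0 Uv0 e0 tu0 ij tau0 sig0 c1 key nt ns H1 Hc H2.
have c0 : 0 < c by exact: lt_trans c1.
have [oU _ _ _ _] := cU; have [oU' _ _ _ _] := cU'.
have a0 := chart_area_gt0 cU Uu0; have a0' := chart_area_gt0 cU' Uv0.
set a := area_element phi u0 in a0 key *; set a' := area_element phi' v0 in a0' key *.
have [d1 d10 nt'] := nbhs_box nt; have [d2 d20 ns'] := nbhs_box ns.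
have ca := continuous_le_near (chart_area_continuous cU Uu0) a0 c1.
have ca' := continuous_le_near (chart_area_continuous cU' Uv0) a0' c1.
have [d3 d30 ca1] := nbhs_box ca; have [d4 d40 ca2] := nbhs_box ca'.
near (0 : R)^'+ => r.
have r0 : 0 < r by near: r; exact: nbhs_right_gt.
have sub (w : R * R) (d d' : R) : d <= d' -> box w d `<=` box w d'.
  by move=> dd x /boxE xd; apply/boxE; exact: le_trans dd.
have rd1 : r <= d1 by near: r; exact: nbhs_right_le.
have rd2 : r <= d2 by near: r; exact: nbhs_right_le.
have rd3 : r <= d3 by near: r; exact: nbhs_right_le.
have rd4 : r <= d4 by near: r; exact: nbhs_right_le.
have K1 : forall x y, box u0 r x -> box u0 r y -> x.2 = y.2 ->
    `|x.1 - y.1| <= c / tau * `|i (t x) - i (t y)| by near: r.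
have K2 : forall x y, box v0 r x -> box v0 r y -> i x = i y ->
    `|(s x).2 - (s y).2| <= c * sig * `|j x - j y| by near: r.
have Kc : {within box u0 r, continuous (fun x => i (t x))} by near: r.
have n1 := chart_image_near cU Uu0 (box_nbhs u0 r0).
have n2 := chart_image_near cU' Uv0 (box_nbhs v0 r0).
rewrite -e0 in n2.
(* In this neighbourhood the points of [S] have parameters in the small boxes of both charts, so the
   parameter sets [J] and [J'] of any [A] inside it lie where all the estimates hold. *)
exists (interior [set g | (S g -> (phi @` (U `&` box u0 r)) g) /\
   (S g -> (phi' @` (U' `&` box v0 r)) g)]); split.
- exact: open_interior.
- by apply: filterI.
move=> A mA AW.
pose J := U `&` phi @^-1` A; pose J' := U' `&` phi' @^-1` A.
have Jb u : J u -> box u0 r u.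
  move=> [Uu Au]; have [+ _] := interior_subset (AW _ Au).
  move=> /(_ (chart_sub cU Uu))[w [Uw bw]] /(chart_inj cU).
  by rewrite !inE => <-.
have Jb' u : J' u -> box v0 r u.
  move=> [Uu Au]; have [_] := interior_subset (AW _ Au).
  move=> /(_ (chart_sub cU' Uu))[w [Uw bw]] /(chart_inj cU').
  by rewrite !inE => <-.
have tJ u : J u -> J' (t u) /\ s (t u) = u.
  move=> Ju; have [Uu Utu pt] := nt' u (sub _ _ _ rd1 _ (Jb u Ju)).
  have J'tu : J' (t u) by split=> //=; rewrite pt; exact: Ju.2.
  split=> //; have [_ Us ps] := ns' _ (sub _ _ _ rd2 _ (Jb' _ J'tu)).
  by apply: (chart_inj cU); rewrite ?inE// ps pt.
have EJ' : J' = t @` J.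
  rewrite eqEsubset; split=> [v J'v|_ [u Ju <-]]; last exact: (tJ u Ju).1.
  have [_ Us ps] := ns' _ (sub _ _ _ rd2 _ (Jb' _ J'v)).
  have Jsv : J (s v) by split=> //=; rewrite ps; exact: J'v.2.
  exists (s v) => //; have [[Uts _] _] := tJ _ Jsv.
  have [_ _ pt] := nt' _ (sub _ _ _ rd1 _ (Jb _ Jsv)).
  by apply: (chart_inj cU'); rewrite ?inE//; [exact: J'v.1|rewrite pt ps].
have mJ : measurable J by exact: chart_preimage_measurable cU mA.
have mJ' : measurable J' by exact: chart_preimage_measurable cU' mA.
pose J2 := (fun u => (i (t u), j (t u))) @` J.
have [mJ2 lJ2] : measurable J2 /\ leb J2 = leb J'.
  rewrite /J2; case: (ij J) => ->; rewrite -EJ' //; split; last exact: leb2_swap.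
  have -> : (fun u : R * R => (u.2, u.1)) @` J' = (fun u : R * R => (u.2, u.1)) @^-1` J'.
    rewrite eqEsubset; split=> [_ [[x y] ? <-]//|[x y] /= ?].
    by exists (y, x).
  by rewrite -[X in measurable X]setTI; exact: (measurable_fun_pair measurable_snd measurable_fst).
have ct0 : 0 < c / tau by exact: divr_gt0.
have cs0 : 0 < c * sig by exact: mulr_gt0.
have main : (leb J <= (c / tau * (c * sig))%:E * leb J')%E.
  rewrite -lJ2; apply: (@paired_comparison R J J2 (box u0 r) t i j) => //.
  - exact: box_compact.
  - move=> u v Ju Jv; have [Ju' su] := tJ u Ju; have [Jv' sv] := tJ v Jv.
    by move=> /(K2 _ _ (Jb' _ Ju') (Jb' _ Jv')); rewrite su sv.
have mar : measurable_fun J (EFin \o area_element phi).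
  apply/measurable_EFinP; apply: measurable_funS (Ck0_measurable oU (CkS (chart_area_Ck cU))).
    exact: open_measurable2.
  exact: subIsetl.
have mar' : measurable_fun J' (EFin \o area_element phi').
  apply/measurable_EFinP; apply: measurable_funS (Ck0_measurable oU' (CkS (chart_area_Ck cU'))).
    exact: open_measurable2.
  exact: subIsetl.
have up : (chart_area U phi A <= (c * a)%:E * leb J)%E.
  have <- : (\int[leb]_(u in J) (c * a)%:E = (c * a)%:E * leb J)%E.
    by have := integral_cst leb mJ (c * a)%:E.
  rewrite /chart_area -/J; apply: ge0_le_integral.
  - exact: mJ.
  - by move=> u _; rewrite lee_fin sqrtr_ge0.
  - exact: mar.
  - exact: measurable_cst.
  - by move=> u Ju; rewrite lee_fin; exact: (ca1 _ (sub _ _ _ rd3 _ (Jb u Ju))).1.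
have lo : ((a' / c)%:E * leb J' <= chart_area U' phi' A)%E.
  have <- : (\int[leb]_(u in J') (a' / c)%:E = (a' / c)%:E * leb J')%E.
    by have := integral_cst leb mJ' (a' / c)%:E.
  rewrite /chart_area -/J'; apply: ge0_le_integral.
  - exact: mJ'.
  - by move=> u _; rewrite lee_fin; apply: divr_ge0; exact: ltW.
  - exact: measurable_cst.
  - exact: mar'.
  - move=> u Ju; rewrite lee_fin ler_pdivrMr// mulrC.
    exact: (ca2 _ (sub _ _ _ rd4 _ (Jb' u Ju))).2.
clear ca ca' ca1 ca2; clearbody a a'.
apply: (le_trans up); have ca0 : (0 <= (c * a)%:E)%E by rewrite lee_fin mulr_ge0// ltW.
apply: (le_trans (lee_wpmul2l ca0 main)); rewrite muleA -EFinM.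
have -> : c * a * (c / tau * (c * sig)) = c ^+ 4 * (a' / c).
  have -> : c * a * (c / tau * (c * sig)) = c ^+ 3 * (a * sig) / tau by ring.
  by rewrite key; field; rewrite !gt_eqF.
by rewrite EFinM -muleA; apply: lee_wpmul2l => //; rewrite lee_fin exprn_ge0// ltW.
Unshelve. all: by end_near. Qed.

(** The coordinate exchanged first must have a nonzero derivative along the first axis. Since [a] is
    not zero, one of its two coefficients [T1.1], [T1.2] will do, and the two cases correspond to
    the two orders of the coordinates. *)
Lemma transition_scalars (g a b a' b' : heis R) (T1 T2 S1 S2 : R * R) :
  a = T1.1 *: a' + T1.2 *: b' -> b = T2.1 *: a' + T2.2 *: b' ->
  a' = S1.1 *: a + S1.2 *: b -> b' = S2.1 *: a + S2.2 *: b ->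
  0 < cross_sq g a b -> 0 < cross_sq g a' b' ->
  [/\ T1.1 != 0, S2.2 != 0 &
    Num.sqrt (cross_sq g a b) * `|S2.2| = Num.sqrt (cross_sq g a' b') * `|T1.1|] \/
  [/\ T1.2 != 0, S1.2 != 0 &
    Num.sqrt (cross_sq g a b) * `|S1.2| = Num.sqrt (cross_sq g a' b') * `|T1.2|].
Proof.
move=> E1 E2 E1' E2' cr cr'; have [K2 K1] := cross_sq_span g E1 E2 E1' E2'.
have sq (X Y x y : R) : 0 < X -> 0 < Y -> x ^+ 2 * X = y ^+ 2 * Y ->
    Num.sqrt X * `|x| = Num.sqrt Y * `|y|.
  move=> /ltW X0 /ltW Y0 h; rewrite -(sqrtr_sqr x) -(sqrtr_sqr y) -(sqrtrM _ X0) -(sqrtrM _ Y0).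
  by congr (Num.sqrt _); rewrite mulrC h mulrC.
have nz (X Y x y : R) : 0 < Y -> x ^+ 2 * X = y ^+ 2 * Y -> y != 0 -> x != 0.
  move=> Y0 h y0; apply/eqP => x0; move: h; rewrite x0 expr0n mul0r => /esym/eqP.
  by rewrite mulf_eq0 sqrf_eq0 (negbTE y0) gt_eqF.
have [T0|T0] := eqVneq T1.1 0; last first.
  by left; split=> //; [exact: nz K2 T0|exact: sq].
right; have T12 : T1.2 != 0.
  apply/eqP => T12; move: cr; rewrite E1 T0 T12 !scale0r addr0.
  by rewrite /cross_sq /cross1 /cross2 /cross3 /theta /= !(mul0r, mulr0, subrr, subr0, expr0n, addr0) ltxx.
by split=> //; [exact: nz K1 T12|exact: sq].
Qed.

Lemma chart_area_near S U phi U' phi' u0 v0 c :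
  chart S U phi -> chart S U' phi' -> U u0 -> U' v0 -> phi u0 = phi' v0 -> 1 < c ->
  exists W, [/\ open W, W (phi u0) & forall A, measurable A -> A `<=` W ->
    (chart_area U phi A <= (c ^+ 4)%:E * chart_area U' phi' A)%E].
Proof.
move=> cU cU' Uu0 Uv0 e0 c1.
have [t [T1 [T2 [tu0 st nt E1 E2]]]] := chart_transition cU cU' Uu0 Uv0 e0.
have [s [S1 [S2 [sv0 ss ns E1' E2']]]] := chart_transition cU' cU Uv0 Uu0 (esym e0).
have cr := chart_cross_gt0 cU Uu0 (phi u0); have cr' := chart_cross_gt0 cU' Uv0 (phi u0).
have aE : area_element phi u0 = Num.sqrt (cross_sq (phi u0) ('D_(1, 0) phi u0) ('D_(0, 1) phi u0)).
  exact: area_elementE.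
have aE' : area_element phi' v0 = Num.sqrt (cross_sq (phi u0) ('D_(1, 0) phi' v0) ('D_(0, 1) phi' v0)).
  by rewrite e0; exact: area_elementE.
case: (transition_scalars E1 E2 E1' E2' cr cr') => -[T0 S0 key].
  have key2 : area_element phi u0 * `|S2.2| = area_element phi' v0 * `|T1.1|.
    by rewrite aE aE'; exact: key.
  have nT : 0 < `|T1.1| by rewrite normr_gt0.
  have nS : 0 < `|S2.2| by rewrite normr_gt0.
  have ij J : (fun u => ((t u).1, (t u).2)) @` J = t @` J \/
     (fun u => ((t u).1, (t u).2)) @` J = (fun u => (u.2, u.1)) @` (t @` J).
    by left; apply: eq_imagel => u _; rewrite -surjective_pairing.
  exact: (@chart_area_near_aux S U phi U' phi' u0 v0 t s fst snd `|T1.1| `|S2.2| c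
    cU cU' Uu0 Uv0 e0 tu0 ij nT nS c1 key2 nt ns (sdiff_lower (sdiff_fst st) T0 c1)
    (sdiff_within_continuous (sdiff_fst st)) ((sdiff_upper (sdiff_snd ss) c1).1 S0)).
have key2 : area_element phi u0 * `|S1.2| = area_element phi' v0 * `|T1.2|.
  by rewrite aE aE'; exact: key.
have nT : 0 < `|T1.2| by rewrite normr_gt0.
have nS : 0 < `|S1.2| by rewrite normr_gt0.
have ij J : (fun u => ((t u).2, (t u).1)) @` J = t @` J \/
   (fun u => ((t u).2, (t u).1)) @` J = (fun u => (u.2, u.1)) @` (t @` J).
  by right; rewrite image_comp.
exact: (@chart_area_near_aux S U phi U' phi' u0 v0 t s snd fst `|T1.2| `|S1.2| c
  cU cU' Uu0 Uv0 e0 tu0 ij nT nS c1 key2 nt ns (sdiff_lower (sdiff_snd st) T0 c1)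
  (sdiff_within_continuous (sdiff_snd st)) ((sdiff_upper (sdiff_snd ss) c1).2 S0)).
Qed.

End local_comparison.

Section surface_area_in_charts.
Context {R : realType}.
Implicit Types (S A : set (heis R)) (U : set (R * R)) (phi : R * R -> heis R).

Local Notation leb := (lebesgue_measure \x lebesgue_measure)%E.

Lemma chart_area_measurable S U phi J : chart S U phi -> J `<=` U ->
  measurable_fun J (EFin \o area_element phi).
Proof.
move=> c JU; have [oU _ _ _ _] := c.
apply/measurable_EFinP; apply: measurable_funS (Ck0_measurable oU (CkS (chart_area_Ck c))) => //.
exact: open_measurable2.
Qed.

Lemma chart_area_bigcup S U phi (F : (set (heis R))^nat) : chart S U phi ->
  (forall k, measurable (F k)) -> trivIset setT F ->
  chart_area U phi (\bigcup_k F k) = (\sum_(k <oo) chart_area U phi (F k))%E.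
Proof.
move=> c mF tF; rewrite /chart_area preimage_bigcup setI_bigcupr.
apply: ge0_integral_bigcup.
- by move=> k; exact: chart_preimage_measurable c (mF k).
- by apply: (chart_area_measurable c); apply: bigcup_sub => k _; exact: subIsetl.
- by move=> u _; rewrite lee_fin sqrtr_ge0.
- apply/trivIsetP => i j _ _ ij; move/trivIsetP : tF => /(_ i j I I ij) Fij.
  by rewrite setIACA setIid -preimage_setI Fij preimage_set0 setI0.
Qed.

Lemma chart_area_ge0 U phi A : (0 <= chart_area U phi A)%E.
Proof. by apply: integral_ge0 => u _; rewrite lee_fin sqrtr_ge0. Qed.

Lemma chart_area_mono S U phi A B : chart S U phi -> measurable A -> measurable B ->
  A `<=` B -> (chart_area U phi A <= chart_area U phi B)%E.
Proof.
move=> c mA mB AB; apply: ge0_subset_integral.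
- exact: chart_preimage_measurable c mA.
- exact: chart_preimage_measurable c mB.
- by apply: (chart_area_measurable c); exact: subIsetl.
- by move=> u _; rewrite lee_fin sqrtr_ge0.
- by move=> u [Uu Au]; split=> //; exact: AB.
Qed.

Lemma chart_area_inS S U phi A B : chart S U phi -> S `&` A = S `&` B ->
  chart_area U phi A = chart_area U phi B.
Proof.
move=> c AB; rewrite /chart_area; congr (integral _ _ _).
rewrite eqEsubset; split=> u [Uu Au]; split=> //; have Su := chart_sub c Uu.
  by have : (S `&` A) (phi u) by []; rewrite AB => -[].
by have : (S `&` B) (phi u) by []; rewrite -AB => -[].
Qed.

Lemma le_forall_mul (x y : \bar R) : (0 <= y)%E ->
  (forall d, 1 < d -> (x <= d%:E * y)%E) -> (x <= y)%E.
Proof.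
case: y => [y| |] // y0 H; last by rewrite leey.
rewrite lee_fin in y0; apply/lee_addgt0Pr => e e0.
have y1 : 0 < y + 1 by rewrite ltr_wpDl.
have d1 : 1 < 1 + e / (y + 1) by rewrite ltrDl divr_gt0.
apply: (le_trans (H _ d1)); rewrite -EFinM -EFinD lee_fin mulrDl mul1r lerD2l.
by rewrite mulrAC ler_pdivrMr// ler_pM2l// lerDl.
Qed.

(** The local comparison, with [c] the fourth root of [d], holds on members of a countable basis
    that cover the part of [S] in [A]; made disjoint, they give the comparison on [A] with the
    factor [d], and [d] tends to 1. Since the charts play symmetric roles, the areas are equal. *)
Lemma chart_area_le S U phi U' phi' A : chart S U phi -> chart S U' phi' -> measurable A ->
  S `&` A `<=` phi @` U -> S `&` A `<=` phi' @` U' ->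
  (chart_area U phi A <= chart_area U' phi' A)%E.
Proof.
move=> cU cU' mA AU AU'; apply: le_forall_mul; first exact: chart_area_ge0.
move=> d d1; pose c := Num.sqrt (Num.sqrt d).
have sq1 (x : R) : 1 < x -> 1 < Num.sqrt x.
  by move=> x1; rewrite -[ltLHS]sqrtr1 ltr_sqrt// (lt_trans ltr01).
have c1 : 1 < c by apply: (sq1 _); exact: (sq1 _).
have -> : d = c ^+ 4.
  have d0 : 0 <= d by rewrite ltW// (lt_trans ltr01).
  by rewrite (exprM c 2 2) sqr_sqrtr ?sqrtr_ge0// sqr_sqrtr.
have [B [mB oB nB]] := @heis_basis R.
pose good n := forall A, measurable A -> A `<=` B n ->
  (chart_area U phi A <= (c ^+ 4)%:E * chart_area U' phi' A)%E.
pose G n := if pselect (good n) then B n else set0.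
have mG n : measurable (G n) by rewrite /G; case: pselect => ?; [exact: mB|exact: measurable0].
have mD n : measurable (seqDU G n).
  by apply: measurableD => //; apply: bigsetU_measurable.
have AG : S `&` A `<=` \bigcup_n G n.
  move=> g Ag; have [u Uu ug] := AU g Ag; have [u' Uu' ug'] := AU' g Ag.
  have [W [oW Wg HW]] := chart_area_near cU cU' Uu Uu' (etrans ug (esym ug')) c1.
  rewrite ug in Wg; have [n [ng nW]] := nB g W (open_nbhs_nbhs (conj oW Wg)).
  exists n => //; rewrite /G; case: pselect => // -[] A' mA' A'B.
  by apply: HW => //; exact: subset_trans nW.
have EA : S `&` A = S `&` \bigcup_n (A `&` seqDU G n).
  rewrite -setI_bigcupr -seqDU_bigcup_eq eqEsubset; split=> g.
    by move=> SAg; have := AG g SAg; case: SAg.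
  by move=> [Sg [Ag _]].
have tD : trivIset setT (fun n => A `&` seqDU G n).
  by apply: trivIset_setIl; exact: trivIset_seqDU.
rewrite (chart_area_inS cU EA) (chart_area_inS cU' EA).
rewrite (chart_area_bigcup cU)//; last by move=> k; exact: measurableI.
rewrite (chart_area_bigcup cU')//; last by move=> k; exact: measurableI.
rewrite -nneseriesZl//; last by move=> k _; exact: chart_area_ge0.
apply: lee_nneseries; first by move=> k _ _; exact: chart_area_ge0.
move=> n _; have [gn|ngn] := pselect (good n).
  apply: gn; first exact: measurableI.
  by move=> g [_ [+ _]]; rewrite /G; case: pselect.
have -> : A `&` seqDU G n = set0.
  by rewrite -subset0 => g [_ [+ _]]; rewrite /G; case: pselect.
have m0 V (f : R * R -> heis R) : chart_area V f set0 = 0%E.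
  by rewrite /chart_area preimage_set0 setI0; exact: integral_set0.
by rewrite !m0 mule0.
Qed.

Lemma patch_areaE S U phi A : chart S U phi -> measurable A -> S `&` A `<=` phi @` U ->
  patch_area S A = chart_area U phi A.
Proof.
move=> c mA AU; apply/eqP; rewrite eq_le; apply/andP; split.
  by apply: ereal_inf_lbound; exists U, phi.
apply: le_ereal_inf_tmp => _ [U' [phi' [c' AU' ->]]].
exact: chart_area_le c c' mA AU AU'.
Qed.

(** For the lower bound, a cover of [A] by patches is replaced by disjoint pieces seen in the single
    chart [phi], and each piece is compared with whatever chart computes the area of its patch. *)
Lemma surface_areaE S U phi A : chart S U phi -> measurable A -> S `&` A `<=` phi @` U ->
  surface_area S A = chart_area U phi A.
Proof.
move=> c mA AU; apply/eqP; rewrite eq_le; apply/andP; split.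
  rewrite -(patch_areaE c mA AU); apply: ereal_inf_lbound.
  exists (fun k => if k == 0%N then A else set0).
    split; first by move=> i; case: ifP => _; [exact: mA|exact: measurable0].
    by move=> g Ag; exists 0%N.
  rewrite nneseries_recl//=; last by move=> k _; exact: patch_area_ge0.
  rewrite eseries0 ?adde0// => -[|k]//= _ _.
  exact: patch_area0.
apply: le_ereal_inf_tmp => _ [F [mF AF] <-].
have mAF k : measurable (A `&` F k) by exact: measurableI.
have mD n : measurable (seqDU (fun k => A `&` F k) n).
  by apply: measurableD => //; apply: bigsetU_measurable.
have EA : A = \bigcup_n (seqDU (fun k => A `&` F k) n).
  by rewrite -seqDU_bigcup_eq -setI_bigcupr; apply/esym/setIidPl.
rewrite [in leLHS]EA (chart_area_bigcup c mD (@trivIset_seqDU _ _)).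
apply: lee_nneseries; first by move=> *; exact: chart_area_ge0.
move=> k _; apply: (@le_trans _ _ (chart_area U phi (A `&` F k))).
  by apply: (chart_area_mono c) => //; exact: subDsetl.
(* A patch contained in no chart has infinite area, the infimum being over the empty set, and
   requires nothing. *)
apply: le_ereal_inf_tmp => _ [U' [phi' [c' FU' ->]]].
rewrite -/(chart_area U' phi' (F k)).
apply: (@le_trans _ _ (chart_area U' phi' (A `&` F k))).
  apply: (chart_area_le c c') => //.
  - by apply: subset_trans AU => g [Sg [Ag _]].
  - by apply: subset_trans FU' => g [Sg [_ Fg]].
by apply: (chart_area_mono c') => //; exact: subIsetr.
Qed.

Lemma chart_area_split S U phi A B : chart S U phi -> measurable A -> measurable B ->
  (chart_area U phi A = chart_area U phi (A `&` B) + chart_area U phi (A `&` ~` B))%E.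
Proof.
move=> c mA mB.
have mAB : measurable (A `&` B) by exact: measurableI.
have mAC : measurable (A `&` ~` B) by apply: measurableI => //; exact: measurableC.
rewrite /chart_area -ge0_integral_setU.
- by rewrite -setIUr -preimage_setU -setIUr setUCr setIT.
- exact: chart_preimage_measurable c mAB.
- exact: chart_preimage_measurable c mAC.
- by apply: (chart_area_measurable c) => u [] [].
- by move=> u _; rewrite lee_fin sqrtr_ge0.
- by apply/disj_setPS => u [[_ [_ Bu]] [_ [_ nBu]]].
Qed.

Lemma patch_area_split S A B : measurable A -> measurable B ->
  (patch_area S (A `&` B) + patch_area S (A `&` ~` B) <= patch_area S A)%E.
Proof.
move=> mA mB; apply: le_ereal_inf_tmp => _ [U [phi [c AU ->]]].
have mAB : measurable (A `&` B) by exact: measurableI.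
have mAC : measurable (A `&` ~` B) by apply: measurableI => //; exact: measurableC.
rewrite (patch_areaE c mAB); last by apply: subset_trans AU => g [Sg [Ag _]].
rewrite (patch_areaE c mAC); last by apply: subset_trans AU => g [Sg [Ag _]].
rewrite -/(chart_area U phi A).
rewrite (chart_area_split c mA mB); exact: lexx.
Qed.

(** The area in a chart is additive on Borel sets, so cutting each member of a cover along [A] does
    not increase the total area of the cover. *)
Lemma borel_caratheodory S A : measurable A -> caratheodory_measurable (surface_area S) A.
Proof.
move=> mA; apply: le_caratheodory_measurable => X.
apply: le_ereal_inf_tmp => _ [F [mF XF] <-].
apply: (@le_trans _ _ (\sum_(k <oo) (patch_area S (F k `&` A) + patch_area S (F k `&` ~` A)))%E); last first.
  apply: lee_nneseries; first by move=> *; apply: adde_ge0; exact: patch_area_ge0.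
  by move=> k _; exact: patch_area_split.
rewrite nneseriesD; [|by move=> *; exact: patch_area_ge0..].
apply: leeD; apply: ereal_inf_lbound.
- exists (fun k => F k `&` A) => //; split; first by move=> k; exact: measurableI.
  by rewrite -setI_bigcupl; exact: setSI.
- exists (fun k => F k `&` ~` A) => //; split.
    by move=> k; apply: measurableI => //; exact: measurableC.
  by rewrite -setI_bigcupl; exact: setSI.
Qed.

End surface_area_in_charts.

Section borel_surface_measure.
Context {R : realType}.
Implicit Types (S A : set (heis R)) (U : set (R * R)) (phi : R * R -> heis R).

Local Notation leb := (lebesgue_measure \x lebesgue_measure)%E.

(** The countable basis makes [S] a countable union of chart pieces. The pieces are kept inside
    images of compact parameter sets, so that they and their images under deformations are Borel
    sets. *)
Lemma surface_cover S : C2_surface S -> exists B : nat -> set (heis R),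
  [/\ forall n, measurable (B n), S `<=` \bigcup_n B n, trivIset setT B &
    forall n, exists U phi C, [/\ chart S U phi, compact C, C `<=` U & S `&` B n `<=` phi @` C]].
Proof.
move=> CS; have [B [mB oB nB]] := @heis_basis R.
pose good n := exists U phi C, [/\ chart S U phi, compact C, C `<=` U & S `&` B n `<=` phi @` C].
pose G n := if pselect (good n) then B n else set0.
have mG n : measurable (G n).
  by rewrite /G; case: pselect => ?; [exact: mB|exact: measurable0].
exists (seqDU G); split.
- by move=> n; apply: measurableD => //; exact: bigsetU_measurable.
- rewrite -seqDU_bigcup_eq => g Sg; have [U [phi [c [u Uu ug]]]] := CS g Sg.
  have [oU _ _ _ _] := c.
  have [r r0 rU] := nbhs_box (open_nbhs_nbhs (conj oU Uu)).
  have := chart_image_near c Uu (box_nbhs u r0); rewrite ug => /nB[n [ng nW]].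
  exists n => //; rewrite /G; case: pselect => // -[].
  exists U, phi, (box u r); split=> //; first exact: box_compact.
  by move=> h [Sh /nW /(_ Sh)[v [_ bv] vh]]; exists v.
- exact: trivIset_seqDU.
move=> n; have [gn|ngn] := pselect (good n).
  have [U [phi [C [c cC CU BC]]]] := gn; exists U, phi, C; split=> //.
  apply: subset_trans BC => g [Sg [Gg _]]; split=> //.
  by move: Gg; rewrite /G; case: pselect.
exists set0, (fun=> 0), set0; split=> //; [exact: chart_set0|exact: compact0|].
by move=> g [_ [+ _]]; rewrite /G; case: pselect.
Qed.

Lemma chart_compact_image S U phi C : chart S U phi -> compact C -> C `<=` U ->
  compact (phi @` C).
Proof.
move=> c cC CU; apply: continuous_compact => //.
apply: continuous_in_subspaceT => u; rewrite inE => Cu.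
exact: (chart_continuous c (CU u Cu)).
Qed.

Lemma heis_compact_measurable (K : set (heis R)) : compact K -> measurable K.
Proof.
by move=> cK; apply: closed_measurable3; apply: compact_closed => //; exact: norm_hausdorff.
Qed.

Lemma surface_piece_measurable S U phi C A : chart S U phi -> compact C -> C `<=` U ->
  S `&` A `<=` phi @` C -> measurable A -> measurable (S `&` A).
Proof.
move=> c cC CU AC mA.
have -> : S `&` A = phi @` C `&` A.
  rewrite eqEsubset; split=> g [h Ag]; split=> //; first exact: AC.
  by case: h => u Cu <-; apply: (chart_sub c); exact: CU.
apply: measurableI => //; apply: heis_compact_measurable; exact: chart_compact_image c cC CU.
Qed.

Lemma surface_measurable S : C2_surface S -> measurable S.
Proof.
move=> /surface_cover[B [mB SB _ cB]].
have -> : S = \bigcup_n (S `&` B n) by rewrite -setI_bigcupr; apply/esym/setIidPl.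
apply: bigcupT_measurable => n; have [U [phi [C [c cC CU BC]]]] := cB n.
exact: surface_piece_measurable c cC CU BC (mB n).
Qed.

Definition surf_continuous S (f : heis R -> R) :=
  forall U phi, chart S U phi -> Ck 0 U (f \o phi).

Lemma surf_continuous_open S f (V : set R) : C2_surface S -> surf_continuous S f -> open V ->
  exists2 W : set (heis R), open W & S `&` f @^-1` V = S `&` W.
Proof.
move=> CS cf oV; exists (interior [set g | S g -> V (f g)]); first exact: open_interior.
rewrite eqEsubset; split=> g [Sg].
  move=> Vg; split=> //; have [U [phi [c [u Uu ug]]]] := CS g Sg.
  have nV : nbhs u ((f \o phi) @^-1` V).
    by apply: (cf _ _ c u Uu); apply: open_nbhs_nbhs; split=> //=; rewrite ug.
  have := chart_image_near c Uu nV; rewrite ug; apply: filterS => h + Sh.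
  by move=> /(_ Sh)[v [_ Vv] <-].
by move=> Ig; split=> //; exact: (interior_subset Ig).
Qed.

Lemma surf_continuous_measurable S A f : C2_surface S -> surf_continuous S f ->
  measurable A -> A `<=` S -> measurable_fun A f.
Proof.
move=> CS cf mA AS; apply: measurable_fun_open_preimage => V oV.
have [W oW E] := surf_continuous_open CS cf oV.
have -> : A `&` f @^-1` V = A `&` W.
  rewrite -[in LHS](setIidl AS) -[in RHS](setIidl AS) -!setIA.
  by rewrite E.
by apply: measurableI => //; exact: open_measurable3.
Qed.

(** The same set function, regarded as a measure on the Borel sets of R^3: integrals against it can
    be pulled back through charts, which are Borel measurable. *)
Definition borel_area S : set (heis R) -> \bar R := surface_area S.

Lemma borel_area0 S : borel_area S set0 = 0%E.
Proof. exact: surface_area0. Qed.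

Lemma borel_area_ge0 S A : (0 <= borel_area S A)%E.
Proof. exact: surface_area_ge0. Qed.

Lemma borel_area_sigma_additive S : semi_sigma_additive (borel_area S).
Proof.
move=> F mF tF mUF.
have H := @measure_semi_sigma_additive _ (caratheodory_type (surface_outer_measure S)) R
  (surface_measure S) F.
apply: H => //; last exact: borel_caratheodory.
by move=> i; exact: borel_caratheodory.
Qed.

HB.instance Definition _ S := isMeasure.Build _ (heis R) R (borel_area S)
  (borel_area0 S) (borel_area_ge0 S) (@borel_area_sigma_additive S).

Lemma borel_areaE S U phi A : chart S U phi -> measurable A -> S `&` A `<=` phi @` U ->
  borel_area S A = chart_area U phi A.
Proof. exact: surface_areaE. Qed.

Lemma integral_surface_measure S A (f : heis R -> \bar R) : measurable A ->
  measurable_fun A f ->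
  (\int[surface_measure S]_(g in A) f g = \int[borel_area S]_(g in A) f g)%E.
Proof.
move=> mA mf.
have mT : measurable (setT : set (caratheodory_type (surface_outer_measure S))).
  exact: measurableT.
have nuE B : measurable B -> B `<=` A -> borel_area S B =
    (\int[surface_measure S]_(g in setT `&` id @^-1` B) 1%:E)%E.
  move=> mB BA; rewrite setTI; have mB' := @borel_caratheodory R S B mB.
  by have := integral_cst (surface_measure S) mB' 1%:E; rewrite mul1e.
have mid : measurable_fun (setT : set (caratheodory_type (surface_outer_measure S)))
    (id : _ -> heis R).
  by move=> _ B mB; rewrite setTI; exact: borel_caratheodory.
have H := @integral_transfer _ _ (caratheodory_type (surface_outer_measure S)) (heis R) R
  (surface_measure S) (borel_area S) setT (fun=> 1) id A mT (measurable_cst _)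
  (fun _ _ => ler01) mid mA nuE f mf.
rewrite H setTI; apply: eq_integral => g _; rewrite mule1 //.
Qed.

Lemma integral_chart S U phi A (f : heis R -> \bar R) : chart S U phi -> measurable A ->
  A `<=` phi @` U -> measurable_fun A f ->
  (\int[borel_area S]_(g in A) f g =
   \int[leb]_(u in U `&` phi @^-1` A) (f (phi u) * (area_element phi u)%:E))%E.
Proof.
move=> c mA AU mf; have [oU _ _ _ _] := c.
have nuE B : measurable B -> B `<=` A -> borel_area S B =
    (\int[leb]_(u in U `&` phi @^-1` B) (area_element phi u)%:E)%E.
  by move=> mB BA; apply: (borel_areaE c mB) => g [_ /BA]; exact: AU.
have mh : measurable_fun U (area_element phi).
  exact: (Ck0_measurable oU (CkS (chart_area_Ck c))).
have h0 u : U u -> 0 <= area_element phi u by move=> Uu; exact: ltW (chart_area_gt0 c Uu).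
have H := @integral_transfer _ _ (measurableTypeR R * measurableTypeR R)%type (heis R) R leb (borel_area S) U
  (area_element phi) phi A (open_measurable2 _ U oU) mh h0 (chart_measurable c) mA nuE f mf.
exact: H.
Qed.

End borel_surface_measure.

(** * The density of the horizontal perimeter *)

Section horizontal_density.
Context {R : realType}.
Implicit Types (S M A : set (heis R)) (U : set (R * R)) (phi : R * R -> heis R) (N : heis R -> heis R).

Local Notation leb := (lebesgue_measure \x lebesgue_measure)%E.

Lemma theta_X1 (g : heis R) : theta g (X1 g) = 0.
Proof. by rewrite /theta /X1 /=; field. Qed.

Lemma theta_X2 (g : heis R) : theta g (X2 g) = 0.
Proof. by rewrite /theta /X2 /=; field. Qed.

Lemma theta_T (g : heis R) : theta g (Tfield g) = 1.
Proof. by rewrite /theta /Tfield /=; field. Qed.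

Lemma pNE N g : pN N g = (N g).1.1.
Proof. by rewrite /pN /metric theta_X1 /X1 /= !mulr0 mulr1 !addr0. Qed.

Lemma qNE N g : qN N g = (N g).1.2.
Proof. by rewrite /qN /metric theta_X2 /X2 /= !mulr0 mulr1 add0r addr0. Qed.

Lemma omegaNE N g : omegaN N g = theta g (N g).
Proof. by rewrite /omegaN /metric theta_T /Tfield /= !mulr0 mulr1 !add0r. Qed.

Lemma normsqE (g v : heis R) : normsq g v = v.1.1 ^+ 2 + v.1.2 ^+ 2 + theta g v ^+ 2.
Proof. by rewrite /normsq /metric !expr2. Qed.

Lemma normsq_ge0 (g v : heis R) : 0 <= normsq g v.
Proof. by rewrite normsqE !addr_ge0 ?sqr_ge0. Qed.

Lemma normsq_eq0 (g v : heis R) : normsq g v = 0 -> v = 0.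
Proof.
move=> /eqP; rewrite normsqE !paddr_eq0 ?addr_ge0 ?sqr_ge0// !sqrf_eq0.
by move=> /andP[/andP[/eqP h1 /eqP h2] /eqP h3]; exact: (@frame_eq0 R g).
Qed.

Lemma normsq_gt0 (g v : heis R) : v != 0 -> 0 < normsq g v.
Proof.
move=> v0; rewrite lt_neqAle normsq_ge0 andbT; apply/eqP => /esym /normsq_eq0 h.
by rewrite h eqxx in v0.
Qed.

Definition cross_dot (g n v w : heis R) : R :=
  n.1.1 * cross1 g v w + n.1.2 * cross2 g v w + theta g n * cross3 g v w.

(** A vector orthogonal to [v] and [w] is parallel to their cross product; the three identities
    express this without division. *)
Lemma normal_cross (g n v w : heis R) : metric g n v = 0 -> metric g n w = 0 ->
  [/\ cross_sq g v w * n.1.1 = cross_dot g n v w * cross1 g v w,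
      cross_sq g v w * n.1.2 = cross_dot g n v w * cross2 g v w &
      cross_sq g v w * theta g n = cross_dot g n v w * cross3 g v w].
Proof.
rewrite /metric /cross_sq /cross_dot /cross1 /cross2 /cross3.
move: (theta g n) (theta g v) (theta g w) n.1.1 n.1.2 v.1.1 v.1.2 w.1.1 w.1.2.
move=> n3 v3 w3 n1 n2 v1 v2 w1 w2 hv hw.
pose c1 := v2 * w3 - v3 * w2; pose c2 := v3 * w1 - v1 * w3; pose c3 := v1 * w2 - v2 * w1.
split; apply/eqP; rewrite -subr_eq0; apply/eqP.
- transitivity ((n1 * w1 + n2 * w2 + n3 * w3) * (v3 * c2 - v2 * c3)
    - (n1 * v1 + n2 * v2 + n3 * v3) * (w3 * c2 - w2 * c3)); last by rewrite hv hw !mul0r subrr.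
  by rewrite /c2 /c3; ring.
- transitivity ((n1 * w1 + n2 * w2 + n3 * w3) * (v1 * c3 - v3 * c1)
    - (n1 * v1 + n2 * v2 + n3 * v3) * (w1 * c3 - w3 * c1)); last by rewrite hv hw !mul0r subrr.
  by rewrite /c1 /c3; ring.
- transitivity ((n1 * w1 + n2 * w2 + n3 * w3) * (v2 * c1 - v1 * c2)
    - (n1 * v1 + n2 * v2 + n3 * v3) * (w2 * c1 - w1 * c2)); last by rewrite hv hw !mul0r subrr.
  by rewrite /c1 /c2; ring.
Qed.

Definition hor_sq (g v w : heis R) : R := cross1 g v w ^+ 2 + cross2 g v w ^+ 2.

Definition hor_element phi (u : R * R) : R :=
  Num.sqrt (hor_sq (phi u) ('D_(1, 0) phi u) ('D_(0, 1) phi u)).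

Definition hdens N (g : heis R) : R := Wnorm N g / Num.sqrt (normsq g (N g)).

(** As [n] is a multiple of the cross product, both have the same ratio of horizontal length to
    length. Comparing squares removes the sign of the multiple and includes the case of vanishing
    horizontal part. *)
Lemma horizontal_ratio (g n v w : heis R) : n != 0 -> 0 < cross_sq g v w ->
  metric g n v = 0 -> metric g n w = 0 ->
  Num.sqrt (n.1.1 ^+ 2 + n.1.2 ^+ 2) / Num.sqrt (normsq g n) * Num.sqrt (cross_sq g v w) =
  Num.sqrt (hor_sq g v w).
Proof.
move=> n0 c0 nv nw; have [e1 e2 e3] := normal_cross nv nw.
have q0 := normsq_gt0 g n0.
have sq0 : Num.sqrt (normsq g n) != 0 by rewrite sqrtr_eq0 -ltNge.
apply: (mulfI sq0); rewrite mulrA mulrCA divff// mulr1.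
rewrite -!sqrtrM ?normsq_ge0 ?addr_ge0 ?sqr_ge0//; congr (Num.sqrt _).
apply: (mulfI (lt0r_neq0 c0)); rewrite /hor_sq normsqE.
have -> : cross_sq g v w * ((n.1.1 ^+ 2 + n.1.2 ^+ 2) * cross_sq g v w) =
  (cross_sq g v w * n.1.1) ^+ 2 + (cross_sq g v w * n.1.2) ^+ 2 by ring.
have h : cross_dot g n v w ^+ 2 = cross_sq g v w * (n.1.1 ^+ 2 + n.1.2 ^+ 2 + theta g n ^+ 2).
  apply: (mulfI (lt0r_neq0 c0)); rewrite [RHS]mulrA -[X in _ = X * _]expr2.
  have -> : cross_sq g v w ^+ 2 * (n.1.1 ^+ 2 + n.1.2 ^+ 2 + theta g n ^+ 2) =
    (cross_sq g v w * n.1.1) ^+ 2 + (cross_sq g v w * n.1.2) ^+ 2 + (cross_sq g v w * theta g n) ^+ 2 by ring.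
  by rewrite e1 e2 e3 /cross_sq; ring.
by rewrite e1 e2 mulrA -h; ring.
Qed.

Lemma span_comp (a b a' b' : heis R) (w T1 T2 : R * R) :
  a' = T1.1 *: a + T1.2 *: b -> b' = T2.1 *: a + T2.2 *: b ->
  w.1 *: a' + w.2 *: b' = (w.1 *: T1 + w.2 *: T2).1 *: a + (w.1 *: T1 + w.2 *: T2).2 *: b.
Proof. by move=> -> ->; rewrite !scalerDr !scalerA addrACA -!scalerDl. Qed.

Lemma tangent_span S U phi u v : chart S U phi -> U u -> tangent S (phi u) v ->
  exists w, v = 'D_w phi u.
Proof.
move=> c Uu [U' [phi' [u' [w' [c' Uu' e <-]]]]].
have [t [T1 [T2 [_ _ _ E1 E2]]]] := chart_transition c' c Uu' Uu e.
exists (w'.1 *: T1 + w'.2 *: T2).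
exact: etrans (chart_derive w' c' Uu') (etrans (span_comp w' E1 E2) (esym (chart_derive _ c Uu))).
Qed.

Lemma chart_tangent S U phi u w : chart S U phi -> U u -> tangent S (phi u) ('D_w phi u).
Proof. by move=> c Uu; exists U, phi, u, w. Qed.

Lemma normal_dep S U phi u n : chart S U phi -> U u ->
  normal_to S (phi u) n <->
  (metric (phi u) n ('D_(1, 0) phi u) = 0 /\ metric (phi u) n ('D_(0, 1) phi u) = 0).
Proof.
move=> c Uu; split=> [nn|[n1 n2] v /(tangent_span c Uu)[w ->]].
  by split; apply: nn; exact: chart_tangent c Uu.
have -> := chart_derive w c Uu; move: n1 n2.
move: ('D_(1, 0) phi u) ('D_(0, 1) phi u) (phi u) => a b g; rewrite /metric !thetaD !thetaZ => n1 n2.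
transitivity (w.1 * (n.1.1 * a.1.1 + n.1.2 * a.1.2 + theta g n * theta g a) +
  w.2 * (n.1.1 * b.1.1 + n.1.2 * b.1.2 + theta g n * theta g b)); last first.
  by rewrite n1 n2 !mulr0 addr0.
rewrite -[(_ + _).1.1]/(w.1 * a.1.1 + w.2 * b.1.1) -[(_ + _).1.2]/(w.1 * a.1.2 + w.2 * b.1.2).
by move: (theta g n) (theta g a) (theta g b) a.1.1 a.1.2 b.1.1 b.1.2 => *; ring.
Qed.

Lemma hdens_chart S U phi u N : chart S U phi -> U u -> N (phi u) != 0 ->
  normal_to S (phi u) (N (phi u)) ->
  hdens N (phi u) * area_element phi u = hor_element phi u.
Proof.
move=> c Uu n0 /(normal_dep _ c Uu)[n1 n2].
rewrite /hdens /Wnorm pNE qNE area_elementE /hor_element.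
exact: (horizontal_ratio n0 (chart_cross_gt0 c Uu _) n1 n2).
Qed.

Definition normal_field S N := forall g, S g -> N g != 0 /\ normal_to S g (N g).

(** The cross product of the coordinate tangent vectors of a chart is a nonzero normal, so the
    default value of the choice is never taken. *)
Lemma some_normal_field S : C2_surface S -> normal_field S (some_normal S).
Proof.
move=> CS g Sg; have [U [phi [c [u Uu <-]]]] := CS g Sg.
rewrite /some_normal; case: xgetP => [n _ //|].
set v := 'D_(1, 0) phi u; set w := 'D_(0, 1) phi u.
pose n : heis R := cross1 (phi u) v w *: X1 (phi u) + cross2 (phi u) v w *: X2 (phi u)
  + cross3 (phi u) v w *: Tfield (phi u).
have tn : theta (phi u) n = cross3 (phi u) v w.
  by rewrite /n !thetaD !thetaZ theta_X1 theta_X2 theta_T !mulr0 !add0r mulr1.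
have n1 : n.1.1 = cross1 (phi u) v w.
  by rewrite /n /X1 /X2 /Tfield /= /GRing.scale /= !mulr0 !addr0 mulr1.
have n2 : n.1.2 = cross2 (phi u) v w.
  by rewrite /n /X1 /X2 /Tfield /= /GRing.scale /= !mulr0 add0r addr0 mulr1.
have c0 := chart_cross_gt0 c Uu (phi u).
move=> /(_ n); case; split.
  apply/eqP => n0; move: c0; rewrite /cross_sq -/v -/w -n1 -n2 -tn n0.
  by rewrite /theta /= !mulr0 subrr mul0r subr0 expr0n !addr0 ltxx.
apply/(normal_dep _ c Uu); rewrite -/v -/w; clearbody v w.
rewrite /metric n1 n2 tn /cross1 /cross2 /cross3.
by move: (theta (phi u) v) (theta (phi u) w) => *; split; ring.
Qed.

Lemma chart_hor_sq_Ck S U phi : chart S U phi ->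
  Ck 1 U (fun u => hor_sq (phi u) ('D_(1, 0) phi u) ('D_(0, 1) phi u)).
Proof.
move=> c; have [oU _ _ _ _] := c; have [c1 c2 c3] := chart_cross_Ck c.
apply: (Ck_ext oU) (CkD oU (CkM oU c1 c1) (CkM oU c2 c2)) => u _.
by rewrite /hor_sq !expr2.
Qed.

Lemma Ck_hor S U phi : chart S U phi -> Ck 0 U (hor_element phi).
Proof.
move=> c; have Csq := CkS (chart_hor_sq_Ck c).
move=> u Uu; apply: continuous_comp; last exact: sqrt_continuous.
exact: Csq.
Qed.

(** In a chart the density is the quotient of [hor_element] by the area element, whence continuity
    without any continuity of [N]. This matters for [some_normal], which is chosen point by
    point. *)
Lemma hdens_continuous S N : normal_field S N -> surf_continuous S (hdens N).
Proof.
move=> nN U phi c; have [oU _ _ _ _] := c.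
have C : Ck 0 U (fun u => hor_element phi u / area_element phi u).
  move=> u Uu; apply: cvgM; first exact: (Ck_hor c).
  apply: cvgV; last exact: chart_area_continuous c Uu.
  by rewrite gt_eqF//; exact: chart_area_gt0 c Uu.
apply: (Ck_ext oU) C => u Uu; have [n0 nn] := nN _ (chart_sub c Uu).
rewrite -(hdens_chart c Uu n0 nn) mulfK//.
by rewrite gt_eqF//; exact: chart_area_gt0 c Uu.
Qed.

Lemma hdens_ge0 N g : 0 <= hdens N g.
Proof. by rewrite divr_ge0 ?sqrtr_ge0. Qed.

Lemma integral_hdens_chart S U phi A N (f : heis R -> R) : C2_surface S -> normal_field S N ->
  chart S U phi -> measurable A -> A `<=` phi @` U -> measurable_fun A f ->
  (\int[borel_area S]_(g in A) (f g * hdens N g)%:E =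
   \int[leb]_(u in U `&` phi @^-1` A) (f (phi u) * hor_element phi u)%:E)%E.
Proof.
move=> CS nN c mA AU mf.
have AS : A `<=` S by move=> g /AU[u Uu <-]; exact: chart_sub c Uu.
have mh := surf_continuous_measurable CS (hdens_continuous nN) mA AS.
rewrite (integral_chart c mA AU); last by apply/measurable_EFinP; exact: measurable_funM.
apply: eq_integral => u; rewrite inE => -[Uu Au].
have [n0 nn] := nN _ (chart_sub c Uu).
by rewrite -EFinM -mulrA (hdens_chart c Uu n0 nn).
Qed.

End horizontal_density.

(** * Integrals of exact forms *)

Section plane_calculus.
Context {R : realType}.
Local Notation leb := (@lebesgue_measure R \x @lebesgue_measure R)%E.
Implicit Types (u v : R * R) (h f g : R * R -> R).

Lemma box_measurable u r : measurable (box u r).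
Proof. by apply: measurableX; exact: measurable_itv. Qed.

Lemma box_finite u r : (leb (box u r) < +oo)%E.
Proof.
have fin a : exists m : R, lebesgue_measure (`[a - r, a + r]%classic : set R) = m%:E.
  by rewrite lebesgue_measure_itv; case: ifP => _; [exists (a + r - (a - r)); rewrite EFinB|exists 0].
rewrite /box product_measure1E; [|exact: measurable_itv..].
have [m1 E1] := fin u.1; have [m2 E2] := fin u.2.
by rewrite [X in (X * _ < _)%E]E1 [X in (_ * X < _)%E]E2 -EFinM ltry.
Qed.

Lemma compact_continuous_bounded (T : topologicalType) (K : set T) (f : T -> R) : compact K ->
  {within K, continuous f} -> exists2 M, 0 < M & forall x, K x -> `|f x| <= M.
Proof.
move=> cK cf; have := compact_bounded (continuous_compact cf cK).
move=> [M [_ HM]]; exists (Num.max 1 (M + 1)); first by rewrite lt_max ltr01.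
move=> x Kx; apply: (HM (Num.max 1 (M + 1))); last by exists x.
by rewrite lt_max ltrDl ltr01 orbT.
Qed.

Lemma box_integrable u r h : (forall v, box u r v -> {for v, continuous h}) ->
  leb.-integrable (box u r) (EFin \o h).
Proof.
move=> ch; apply: measurable_bounded_integrable.
- exact: box_measurable.
- exact: box_finite.
- apply: measurable_fun_open_preimage => V oV.
  have -> : box u r `&` h @^-1` V = box u r `&` interior [set v | box u r v -> V (h v)].
    rewrite eqEsubset; split=> v [bv].
      move=> Vv; split=> //; have nV : \forall w \near v, V (h w).
        by apply: (ch v bv); exact: open_nbhs_nbhs.
      by rewrite /interior /=; apply: filterS nV => w Vw _.
    by move=> Iv; split=> //; exact: (interior_subset Iv).
  apply: measurableI; first exact: box_measurable.
  by apply: open_measurable2; exact: open_interior.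
- have [|M M0 HM] := @compact_continuous_bounded _ (box u r) h (@box_compact R u r).
    by apply: continuous_in_subspaceT => v; rewrite inE; exact: ch.
  exists M; split; first by rewrite num_real.
  by move=> x Mx v bv; apply: (le_trans (HM v bv)); exact: ltW.
Qed.

Lemma box_fubini u r h : (forall v, box u r v -> {for v, continuous h}) ->
  (\int[leb]_(v in box u r) (h v)%:E =
    \int[lebesgue_measure]_(x in `[(u.1 - r)%R, (u.1 + r)%R])
      \int[lebesgue_measure]_(y in `[(u.2 - r)%R, (u.2 + r)%R]) (h (x, y))%:E)%E /\
  (\int[leb]_(v in box u r) (h v)%:E =
    \int[lebesgue_measure]_(y in `[(u.2 - r)%R, (u.2 + r)%R])
      \int[lebesgue_measure]_(x in `[(u.1 - r)%R, (u.1 + r)%R]) (h (x, y))%:E)%E.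
Proof.
move=> ch; have ih := box_integrable ch.
have iT : leb.-integrable setT ((EFin \o h) \_ (box u r)).
  exact: ((@integrable_mkcond _ _ _ leb (box u r) (EFin \o h) (box_measurable u r)).1 ih).
pose I1 := `[u.1 - r, u.1 + r]%classic; pose I2 := `[u.2 - r, u.2 + r]%classic.
have sec x y : ((EFin \o h) \_ (box u r)) (x, y) =
    if x \in I1 then (if y \in I2 then (h (x, y))%:E else 0%E) else 0%E.
  rewrite /patch; case: ifPn => [|nb].
    by rewrite inE => -[/= bx by_]; rewrite !ifT// inE.
  case: ifPn => // xb; case: ifPn => // yb; move: nb; rewrite notin_setE => -[].
  by rewrite !inE in xb yb.
split.
- rewrite integral_mkcond -(integral12_prod_meas1 iT) [RHS]integral_mkcond.
  apply: eq_integral => x _; rewrite /fubini_F [RHS]/patch -/I1 -/I2; case: ifPn => xb.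
    by rewrite [RHS]integral_mkcond; apply: eq_integral => y _; rewrite sec xb.
  rewrite -[RHS](integral0 lebesgue_measure setT); apply: eq_integral => y _.
  by rewrite sec (negbTE xb).
- rewrite integral_mkcond -(integral21_prod_meas1 iT) [RHS]integral_mkcond.
  apply: eq_integral => y _; rewrite /fubini_G [RHS]/patch -/I1 -/I2; case: ifPn => yb.
    by rewrite [RHS]integral_mkcond; apply: eq_integral => x _; rewrite sec yb.
  rewrite -[RHS](integral0 lebesgue_measure setT); apply: eq_integral => x _.
  by rewrite sec (negbTE yb) if_same.
Qed.

Lemma partial2_line h x y : differentiable h (x, y) ->
  is_derive y 1 (fun s => h (x, s)) ('D_(0, 1) h (x, y)).
Proof.
move=> dh; have -> : (fun s => h (x, s)) = (fun s => h ((x, 0) + s *: (0, 1))).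
  apply/funext => s; congr h; rewrite -[RHS]/(x + s * 0, 0 + s * 1).
  by rewrite mulr0 mulr1 addr0 add0r.
apply: is_derive_line; have -> : (x, 0) + y *: (0, 1) = (x, y) :> R * R.
  by rewrite -[LHS]/(x + y * 0, 0 + y * 1) mulr0 mulr1 addr0 add0r.
exact/derivableP/diff_derivable.
Qed.

Lemma partial1_line h x y : differentiable h (x, y) ->
  is_derive x 1 (fun s => h (s, y)) ('D_(1, 0) h (x, y)).
Proof.
move=> dh; have -> : (fun s => h (s, y)) = (fun s => h ((0, y) + s *: (1, 0))).
  apply/funext => s; congr h; rewrite -[RHS]/(0 + s * 1, y + s * 0).
  by rewrite mulr0 mulr1 addr0 add0r.
apply: is_derive_line; have -> : (0, y) + x *: (1, 0) = (x, y) :> R * R.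
  by rewrite -[LHS]/(0 + x * 1, y + x * 0) mulr0 mulr1 addr0 add0r.
exact/derivableP/diff_derivable.
Qed.

Lemma line_integral0 (k dk : R -> R) (a b : R) : a < b ->
  (forall s, a <= s <= b -> is_derive s 1 k (dk s)) ->
  (forall s, a <= s <= b -> {for s, continuous dk}) -> k a = k b ->
  (\int[lebesgue_measure]_(s in `[a, b]) (dk s)%:E = 0)%E.
Proof.
move=> ab dkP cdk kab.
have ck s : a <= s <= b -> {for s, continuous k}.
  by move=> /dkP[dk' _]; exact/differentiable_continuous/derivable1_diffP.
rewrite (@continuous_FTC2 _ dk k a b)//.
- by rewrite kab -EFinB subrr.
- by apply: continuous_in_subspaceT => s; rewrite inE /= in_itv /=; exact: cdk.
- split.
  + by move=> s; rewrite in_itv /= => /andP[/ltW sa /ltW sb]; have [|] := dkP s; first by rewrite sa.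
  + by apply: cvg_at_right_filter; apply: ck; rewrite lexx ltW.
  + by apply: cvg_at_left_filter; apply: ck; rewrite lexx ltW.
- move=> s; rewrite in_itv /= => /andP[/ltW sa /ltW sb]; rewrite derive1E.
  by have [|_ ->] := dkP s; first by rewrite sa.
Qed.

Lemma continuous_pair1 h x y : {for (x, y), continuous h} -> {for y, continuous (fun s => h (x, s))}.
Proof.
move=> ch; apply: (@continuous_comp _ _ _ (fun s => (x, s)) h) => //.
exact: (cvg_pair (cvg_cst x) (@cvg_id _ (nbhs y))).
Qed.

Lemma continuous_pair2 h x y : {for (x, y), continuous h} -> {for x, continuous (fun s => h (s, y))}.
Proof.
move=> ch; apply: (@continuous_comp _ _ _ (fun s => (s, y)) h) => //.
exact: (cvg_pair (@cvg_id _ (nbhs x)) (cvg_cst y)).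
Qed.

Lemma divergence2 u r h : 0 < r -> (forall v, box u r v -> differentiable h v) ->
  (forall v, box u r v -> {for v, continuous (fun w => 'D_(0, 1) h w)}) ->
  (forall x, h (x, u.2 - r) = 0 /\ h (x, u.2 + r) = 0) ->
  (\int[leb]_(v in box u r) ('D_(0, 1) h v)%:E = 0)%E.
Proof.
move=> r0 dh ch h0; rewrite (box_fubini ch).1.
rewrite -[RHS](integral0 lebesgue_measure `[(u.1 - r)%R, (u.1 + r)%R]); apply: eq_integral => x.
rewrite inE /= => xI.
have b y : u.2 - r <= y <= u.2 + r -> box u r (x, y) by move=> yI; split; rewrite /= in_itv.
apply: (@line_integral0 (fun y => h (x, y))).
- by rewrite ltrBlDr -addrA ltrDl addr_gt0.
- by move=> y /b bxy; apply: partial2_line; exact: dh.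
- by move=> y /b bxy; apply: (@continuous_pair1 (fun w => 'D_(0, 1) h w)); exact: ch.
- by have [-> ->] := h0 x.
Qed.

(** A shift by [d] changes the interval of integration, but the support of [k] stays at distance at
    least [r] from the original end points, so neither end of the shifted interval reaches it. *)
Lemma translate_product (k m : R -> R) (c r d : R) : 0 < r -> `|d| < r ->
  continuous k -> (forall x, r < `|x - c| -> k x = 0) ->
  (forall x, c - 2 * r <= x <= c + 2 * r -> {for x, continuous m}) ->
  (\int[lebesgue_measure]_(x in `[(c - 2 * r)%R, (c + 2 * r)%R]) (k (x + d)%R * m x)%:E =
   \int[lebesgue_measure]_(x in `[(c - 2 * r)%R, (c + 2 * r)%R]) (k x * m (x - d)%R)%:E)%E.
Proof.
move=> r0 dr ck k0 cm.
have cmd x : c - 2 * r + d <= x <= c + 2 * r + d -> {for x, continuous (fun x => m (x - d))}.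
  move=> xI; apply: continuous_comp; first by apply: cvgB; [exact: cvg_id|exact: cvg_cst].
  by apply: cm; move: xI => /andP[? ?]; apply/andP; split; lra.
have dF (x : R) : is_derive x (1 : R) (fun x : R => x + d : R) (1 : R).
  by apply: is_derive_eq; rewrite addr0.
have dF1 : derive1 (fun x : R => x + d : R) = cst (1 : R).
  by apply/funext => x; rewrite derive1E; have [_ ->] := dF x.
have := @integration_by_substitution_increasing R (fun x : R => x + d : R) (fun x => k x * m (x - d))
  (c - 2 * r) (c + 2 * r).
rewrite dF1 => H.
have {}H : (\int[lebesgue_measure]_(x in `[(c - 2 * r + d)%R, (c + 2 * r + d)%R]) (k x * m (x - d)%R)%:E =
  \int[lebesgue_measure]_(x in `[(c - 2 * r)%R, (c + 2 * r)%R]) (k (x + d)%R * m x)%:E)%E.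
  rewrite H.
  - by apply: eq_integral => x _; rewrite !fctE /= mulr1; congr (k _ * m _)%:E; ring.
  - by rewrite lerD2l; lra.
  - by move=> x y _ _ xy; rewrite ltrD2r.
  - by move=> x _; exact: cvg_cst.
  - exact: is_cvg_cst.
  - exact: is_cvg_cst.
  - have cF x : {for x, continuous (fun x : R => x + d)} by apply: cvgD; [exact: cvg_id|exact: cvg_cst].
    split; [by move=> x _; have [] := dF x| |].
    + by apply: cvg_at_right_filter; exact: cF.
    + by apply: cvg_at_left_filter; exact: cF.
  - apply: continuous_in_subspaceT => x; rewrite inE /= in_itv /= => xI.
    by apply: cvgM; [exact: ck|exact: cmd].
move: dr; rewrite ltr_norml => /andP[dr1 dr2].
have kz x : ~ (c - r <= x <= c + r) -> k x * m (x - d) = 0.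
  move=> nx; rewrite k0 ?mul0r// ltNge; apply/negP => xc; apply: nx.
  by move: xc; rewrite ler_norml => /andP[? ?]; apply/andP; split; lra.
rewrite -H integral_mkcond [RHS]integral_mkcond; apply: eq_integral => x _.
rewrite /patch; case: ifPn => xI; case: ifPn => // xJ; rewrite kz// => /andP[? ?].
- by move: xJ; rewrite notin_setE; apply; rewrite /= in_itv /=; apply/andP; split; lra.
- by move: xI; rewrite notin_setE; apply; rewrite /= in_itv /=; apply/andP; split; lra.
Qed.

(** By the mean value theorem the second difference [Dl] of [f] over a square of side [h] is [h]
    times an increment of either first derivative. Strict differentiability of these derivatives
    turns it into [h ^ 2 q] and into [h ^ 2 p], each up to [e / 2 * h ^ 2]. *)
Lemma schwarz_mixed (U : set (R * R)) f v : open U -> U v -> Ck 2 U f ->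
  'D_(1, 0) (fun w => 'D_(0, 1) f w) v = 'D_(0, 1) (fun w => 'D_(1, 0) f w) v.
Proof.
move=> oU Uv [df Cf].
have nU : nbhs v U by exact: open_nbhs_nbhs.
have s1 := sdiff_real nU (Cf (1, 0)).1 ((Cf (1, 0)).2 (1, 0) v Uv) ((Cf (1, 0)).2 (0, 1) v Uv).
have s2 := sdiff_real nU (Cf (0, 1)).1 ((Cf (0, 1)).2 (1, 0) v Uv) ((Cf (0, 1)).2 (0, 1) v Uv).
set p := 'D_(1, 0) (fun w => 'D_(0, 1) f w) v in s2 *.
set q := 'D_(0, 1) (fun w => 'D_(1, 0) f w) v in s1 *.
apply/eqP; rewrite -subr_eq0 -normr_le0; apply/ler_addgt0Pr => e e0; rewrite add0r.
have [d1 d10 H1] := s1 _ (divr_gt0 e0 (ltr0n _ 2)); have [d2 d20 H2] := s2 _ (divr_gt0 e0 (ltr0n _ 2)).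
have [d3 d30 H3] := nbhs_box nU.
move: p q s1 s2 H1 H2 => p q _ _ H1 H2; case: v Uv nU H1 H2 H3 => [a b] Uv nU H1 H2 H3.
pose h := Num.min (d1 / 2) (Num.min (d2 / 2) d3).
have h0 : 0 < h by rewrite !lt_min !divr_gt0.
have hd1 : h < d1 by apply: (@le_lt_trans _ _ (d1 / 2)); [rewrite ge_min lexx|lra].
have hd2 : h < d2 by apply: (@le_lt_trans _ _ (d2 / 2)); [rewrite !ge_min lexx orbT|lra].
have hd3 : h <= d3 by rewrite !ge_min lexx !orbT.
clearbody h.
have bx x y : a <= x <= a + h -> b <= y <= b + h -> [/\ U (x, y), `|(x, y) - (a, b)| <= h & `|(x, y) - (a, b)| <= h].
  move=> /andP[? ?] /andP[? ?].
  have n : `|(x, y) - (a, b)| <= h.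
    by rewrite prod_normr ge_max /= !ler_norml; apply/andP; split; apply/andP; split; lra.
  by split=> //; apply: H3; apply/boxE; exact: le_trans hd3.
have hI : a <= a <= a + h /\ a <= a + h <= a + h by rewrite !lexx !lerDl !(ltW h0).
have hJ : b <= b <= b + h /\ b <= b + h <= b + h by rewrite !lexx !lerDl !(ltW h0).
have mm (x : R) : Num.min x (x + h) = x by rewrite min_l// lerDl ltW.
have mM (x : R) : Num.max x (x + h) = x + h by rewrite max_r// lerDl ltW.
pose Dl := f (a + h, b + h) - f (a + h, b) - f (a, b + h) + f (a, b).
have [x xI E1] : exists2 x, a <= x <= a + h & Dl = h * ('D_(1, 0) f (x, b + h) - 'D_(1, 0) f (x, b)).
  have [|x] := @MVT_between R (fun s => f (s, b + h) - f (s, b))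
      (fun s => 'D_(1, 0) f (s, b + h) - 'D_(1, 0) f (s, b)) a (a + h).
    rewrite mm mM => s sI; have [U1 _ _] := bx s _ sI hJ.2; have [U2 _ _] := bx s _ sI hJ.1.
    by apply: is_deriveB; apply: partial1_line; exact: df.
  rewrite mm mM => xI E; exists x => //; move: E => /=.
  rewrite [_ + h - _]addrAC subrr add0r mulrC => <-; rewrite /Dl.
  by move: (f _) (f _) (f _) (f _) => ? ? ? ?; ring.
have [y yI E2] : exists2 y, b <= y <= b + h & Dl = h * ('D_(0, 1) f (a + h, y) - 'D_(0, 1) f (a, y)).
  have [|y] := @MVT_between R (fun s => f (a + h, s) - f (a, s))
      (fun s => 'D_(0, 1) f (a + h, s) - 'D_(0, 1) f (a, s)) b (b + h).
    rewrite mm mM => s sI; have [U1 _ _] := bx _ s hI.2 sI; have [U2 _ _] := bx _ s hI.1 sI.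
    by apply: is_deriveB; apply: partial2_line; exact: df.
  rewrite mm mM => yI E; exists y => //; move: E => /=.
  rewrite [_ + h - _]addrAC subrr add0r mulrC => <-; rewrite /Dl.
  by move: (f _) (f _) (f _) (f _) => ? ? ? ?; ring.
have [_ n1 _] := bx x _ xI hJ.2; have [_ n2 _] := bx x _ xI hJ.1.
have [_ n3 _] := bx _ y hI.2 yI; have [_ n4 _] := bx _ y hI.1 yI.
have K1 := H1 _ _ (le_lt_trans n1 hd1) (le_lt_trans n2 hd1).
have K2 := H2 _ _ (le_lt_trans n3 hd2) (le_lt_trans n4 hd2).
rewrite /= in K1 K2.
have h0' : `|h| = h by exact: gtr0_norm.
have e1 : `|(x, b + h) - (x, b)| = h.
  by rewrite prod_normr /= [x - x]subrr normr0 [_ + h - _]addrAC subrr add0r h0' max_r// ltW.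
have e2 : `|(a + h, y) - (a, y)| = h.
  by rewrite prod_normr /= [y - y]subrr normr0 [_ + h - _]addrAC subrr add0r h0' max_l// ltW.
have l1 z A' q' (x' b' c : R) : `|z - ((x' - x') *: A' + (b' + h - b') *: q')| <= e / 2 * c -> c = h ->
    forall D', D' = h * z -> `|D' - h * (h * q')| <= h * (e / 2 * h).
  move=> + ch D' ->; rewrite ch subrr scale0r add0r [_ + h - _]addrAC subrr add0r => zq.
  by rewrite -mulrBr normrM h0' ler_pM2l.
have l2 z A' q' (x' b' c : R) : `|z - ((b' + h - b') *: q' + (x' - x') *: A')| <= e / 2 * c -> c = h ->
    forall D', D' = h * z -> `|D' - h * (h * q')| <= h * (e / 2 * h).
  by rewrite [_ *: q' + _]addrC; exact: l1.
have {}K1 := l1 _ _ _ _ _ _ K1 e1 _ E1; have {}K2 := l2 _ _ _ _ _ _ K2 e2 _ E2.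
clear E1 E2 H1 H2 n1 n2 n3 n4 bx; move: Dl K1 K2 => Dl K1 K2.
have : `|h * (h * p - h * q)| <= h * (e / 2 * h + e / 2 * h).
  have -> : h * (h * p - h * q) = (Dl - h * (h * q)) - (Dl - h * (h * p)) by ring.
  by apply: (le_trans (ler_normB _ _)); rewrite mulrDr lerD.
rewrite -mulrBr !normrM h0' -mulrDl -splitr [e * h]mulrC.
by rewrite !(ler_pM2l h0).
Qed.

Lemma box_derive_under u r (f df : R -> R * R -> R) (e M : R) : 0 < e ->
  (forall d v, `|d| < e -> box u r v -> {for v, continuous (f d)}) ->
  (forall (d : R) v, `|d| < e -> box u r v -> is_derive d (1 : R) (f^~ v) (df d v)) ->
  (forall d v, `|d| < e -> box u r v -> `|df d v| <= M) ->
  h^-1 *: ((\int[leb]_(v in box u r) f (h + 0) v) - (\int[leb]_(v in box u r) f 0 v)) @[h --> (0 : R)^'] -->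
  (\int[leb]_(v in box u r) df 0 v : R).
Proof.
move=> e0 cf df_ dM.
have I0 : `]- e, e[%classic (0 : R) by rewrite /= in_itv /= oppr_lt0 e0.
have Ie x : `]- e, e[%classic x -> `|x| < e by rewrite /= in_itv /= ltr_norml.
have dE x v : `|x| < e -> box u r v -> partial1of2 f x v = df x v.
  by move=> xe bv; rewrite partial1of2E; have [_ ->] := df_ x v xe bv.
have := @cvg_differentiation_under_integral R _ _ leb f (box u r) (box_measurable u r) 0 (- e) e I0.
move=> /(_ _ _ (fun=> `|M|)) H.
have -> : (\int[leb]_(v in box u r) df 0 v : R) = \int[leb]_(v in box u r) (partial1of2 f 0 v).
  by apply: eq_Rintegral => v; rewrite inE => bv; rewrite dE// normr0.
apply: H.
- by move=> x /Ie xe; apply: box_integrable => v; exact: cf.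
- by move=> x v /Ie xe bv; have [] := df_ x v xe bv.
- by [].
- by apply: (@box_integrable u r (fun=> `|M|)) => v _; exact: cvg_cst.
- by move=> x v /Ie xe bv; rewrite dE//; exact: le_trans (dM _ _ xe bv) (ler_norm _).
Qed.

End plane_calculus.

Section plane_exact.
Context {R : realType}.
Local Notation leb := (@lebesgue_measure R \x @lebesgue_measure R)%E.
Implicit Types (u v : R * R) (h f g : R * R -> R).

Lemma is_derive_shift (h : R * R -> R) (v w : R * R) (d : R) : differentiable h (v + d *: w) ->
  is_derive d (1 : R) (fun s => h (v + s *: w)) ('D_w h (v + d *: w)).
Proof. by move=> dh; apply: is_derive_line; exact/derivableP/diff_derivable. Qed.

Lemma derive_translate (h : R * R -> R) (v w c : R * R) : differentiable h (v + c) ->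
  differentiable (fun z => h (z + c)) v /\ 'D_w (fun z => h (z + c)) v = 'D_w h (v + c).
Proof.
move=> dh; split.
  have d1 : differentiable (id : R * R -> R * R) v by exact: ex_diff.
  have d2 : differentiable (fun z : R * R => z + c) v.
    exact: (differentiableD d1 (differentiable_cst c v)).
  exact: (differentiable_comp d2 dh).
rewrite /derive (_ : (fun k : R => k^-1 *: (((fun z => h (z + c)) \o shift v) (k *: w) - h (v + c))) =
  (fun k => k^-1 *: ((h \o shift (v + c)) (k *: w) - h (v + c))))//.
by apply/funext => t /=; rewrite addrA.
Qed.

Lemma derive_mul (V : normedModType R) (f g : V -> R) (v w : V) : differentiable f v ->
  differentiable g v ->
  differentiable (fun z => f z * g z) v /\
  'D_w (fun z => f z * g z) v = 'D_w f v * g v + f v * 'D_w g v.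
Proof.
move=> df dg; split; first exact: differentiableM.
rewrite (@deriveM _ _ f g); [|exact: diff_derivable..].
by rewrite -[g v *: _]/(g v * _) -[f v *: _]/(f v * _) addrC [g v * _]mulrC.
Qed.

Lemma derive_zero_outside (F : R * R -> R) u0 (r : R) (w v : R * R) :
  (forall v, r <= `|v - u0| -> F v = 0) -> r < `|v - u0| -> 'D_w F v = 0.
Proof.
move=> F0 rv; rewrite -(derive_cst (0 : R) v w); apply: near_eq_derive.
have : (fun z : R * R => `|z - u0|) @ v --> `|v - u0|.
  by apply: cvg_norm; apply: cvgB; [exact: cvg_id|exact: cvg_cst].
move=> /cvgr_gt -/(_ _ rv) nr; near=> z; rewrite F0//.
by apply: ltW; near: z.
Unshelve. all: by end_near. Qed.

Lemma shift_line v (d : R) : v + d *: ((1, 0) : R * R) = (v.1 + d, v.2).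
Proof. by rewrite -[LHS]/(v.1 + d * 1, v.2 + d * 0) mulr1 mulr0 addr0. Qed.

Lemma is_derive_mulr (f : R -> R) (c x d : R) :
  is_derive x (1 : R) f d -> is_derive x (1 : R) (fun s => f s * c) (d * c).
Proof.
move=> D; have -> : (fun s => f s * c) = (c \*: f) by apply/funext => s; rewrite mulrC.
by rewrite mulrC; exact: is_deriveZ.
Qed.

Lemma is_derive_mull (f : R -> R) (c x d : R) :
  is_derive x (1 : R) f d -> is_derive x (1 : R) (fun s => c * f s) (c * d).
Proof. by move=> D; exact: is_deriveZ. Qed.

Lemma derive_opp (V W : normedModType R) (f : V -> W) (v w : V) : differentiable f v ->
  'D_(- w) f v = - 'D_w f v.
Proof. by move=> df; rewrite !deriveE// linearN. Qed.

(* [F] and [g] being only of class C^1, the form [dF /\ dg] is not the classical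
   differential of [F dg]; instead the translates of [F] along the first axis are
   integrated by parts along the second axis, and the outcome is differentiated
   with respect to the translation. *)
Lemma plane_exact (U : set (R * R)) u0 (r : R) (F g : R * R -> R) : 0 < r -> open U -> box u0 (3 * r) `<=` U ->
  Ck 1 setT F -> (forall v, r <= `|v - u0| -> F v = 0) -> Ck 1 U g ->
  (\int[leb]_(v in box u0 (2 * r))
    ('D_(1, 0) F v * 'D_(0, 1) g v - 'D_(0, 1) F v * 'D_(1, 0) g v)%:E = 0)%E.
Proof.
move=> r0 oU bU [dF cF] F0 [dg cg].
have r20 : 0 < 2 * r by rewrite mulr_gt0.
pose Q := box u0 (2 * r).
have Q3 v (d : R) : Q v -> `|d| < r -> box u0 (3 * r) (v + d *: (1, 0)).
  move=> /boxE Qv dr; apply/boxE; rewrite addrAC.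
  apply: (le_trans (ler_normD _ _)); rewrite [3 * r](_ : _ = 2 * r + r); last by ring.
  apply: lerD => //; rewrite normrZ prod_normr /= normr1 normr0 max_l// mulr1.
  exact: ltW.
have QU v (d : R) (Qv : Q v) (dr : `|d| < r) := bU _ (Q3 v d Qv dr).
have QU0 v : Q v -> U v by move=> Qv; have := QU v 0 Qv; rewrite normr0 scale0r addr0; exact.
have ctF w : continuous (fun v => 'D_w F v) by move=> v; exact: cF.
have cFc : continuous F by move=> v; exact/differentiable_continuous/dF.
have cgc v : U v -> {for v, continuous g} by move=> Uv; exact/differentiable_continuous/dg.
have cs v (d : R) : {for v, continuous (fun z : R * R => z + d *: (1, 0))}.
  by apply: cvgD; [exact: cvg_id|exact: cvg_cst].
pose fA d v := F (v + d *: (1, 0)) * 'D_(0, 1) g v.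
pose dA d v := 'D_(1, 0) F (v + d *: (1, 0)) * 'D_(0, 1) g v.
pose fB d v := 'D_(0, 1) F (v + d *: (1, 0)) * g v.
pose fC d v := 'D_(0, 1) F v * g (v + (- d) *: (1, 0)).
pose dC d v := 'D_(0, 1) F v * - 'D_(1, 0) g (v + (- d) *: (1, 0)).
have cA d v : Q v -> {for v, continuous (fA d)}.
  move=> Qv; apply: (@cvgM _ _ _ _ _ _ (F (v + d *: (1, 0))) ('D_(0, 1) g v)).
    exact: (continuous_comp (cs v d) (cFc _)).
  by apply: cg; exact: QU0.
have cB d v : Q v -> {for v, continuous (fB d)}.
  move=> Qv; apply: (@cvgM _ _ _ _ _ _ ('D_(0, 1) F (v + d *: (1, 0))) (g v)).
    exact: (continuous_comp (cs v d) (ctF (0, 1) _)).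
  by apply: cgc; exact: QU0.
have cC d v : `|d| < r -> Q v -> {for v, continuous (fC d)}.
  move=> dr Qv; apply: (@cvgM _ _ _ _ _ _ ('D_(0, 1) F v) (g (v + (- d) *: (1, 0)))).
    exact: ctF.
  by apply: (continuous_comp (cs v (- d)) (cgc _ _)); apply: QU => //; rewrite normrN.
(* The shift is moved onto [g]: the other factor is already a derivative of [F] and cannot be
   differentiated in [d]. *)
have BC d : `|d| < r -> (\int[leb]_(v in Q) (fB d v)%:E = \int[leb]_(v in Q) (fC d v)%:E)%E.
  move=> dr; rewrite (box_fubini (cB d)).2 (box_fubini (fun v => cC d v dr)).2.
  apply: eq_integral => y; rewrite inE /= => yI.
  have := @translate_product R (fun x => 'D_(0, 1) F (x, y)) (fun x => g (x, y)) u0.1 r d r0 dr.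
  have E1 x : fB d (x, y) = 'D_(0, 1) F (x + d, y) * g (x, y) by rewrite /fB shift_line.
  have E2 x : fC d (x, y) = 'D_(0, 1) F (x, y) * g (x - d, y) by rewrite /fC shift_line.
  under [in X in _ -> X]eq_integral do rewrite E1.
  under [in X in _ -> _ = X]eq_integral do rewrite E2.
  apply.
  - by move=> x; apply: (@continuous_pair2 _ (fun z => 'D_(0, 1) F z)); exact: ctF.
  - move=> x rx; apply: (@derive_zero_outside F u0 r) => //.
    by rewrite prod_normr lt_max /= rx.
  - by move=> x xI; apply: continuous_pair2; apply: cgc; apply: QU0; split; rewrite /= in_itv.
(* The shift is along the first axis, so the second coordinate alone keeps the sides at
   [u0.2 - 2 * r] and [u0.2 + 2 * r] outside the support, whatever [d]. *)
have dv d : (\int[leb]_(v in Q) (fA d v + fB d v)%:E = 0)%E.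
  pose h v := F (v + d *: (1, 0)) * g v.
  have hE v : U v -> differentiable h v /\ 'D_(0, 1) h v = fA d v + fB d v.
    move=> Uv; have [dt Dt] := @derive_translate F v (0, 1) (d *: (1, 0)) (dF _ I).
    have [dh E] := derive_mul ((0, 1) : R * R) dt (dg _ Uv); split; first exact: dh.
    by rewrite [LHS]E Dt addrC.
  have DV : (\int[leb]_(v in box u0 (2 * r)) ('D_(0, 1) h v)%:E = 0)%E; last first.
    by rewrite -{}DV; apply: eq_integral => v; rewrite inE => /QU0 Uv; rewrite (hE v Uv).2.
  apply: divergence2; first exact: r20.
  - by move=> v /QU0 /hE[].
  - move=> v Qv; have Uv := QU0 v Qv.
    have nE : \forall z \near v, fA d z + fB d z = 'D_(0, 1) h z.
      have nU : \forall z \near v, U z by exact: open_nbhs_nbhs.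
      by apply: filterS nU => z /hE[_ ->].
    have c1 : (fA d z + fB d z) @[z --> v] --> fA d v + fB d v.
      by apply: cvgD; [exact: cA|exact: cB].
    have := (hE v Uv).2 => E; rewrite /continuous_at /prop_for /= E.
    exact: cvg_trans (near_eq_cvg nE) c1.
  - move=> x; split; rewrite /h F0 ?mul0r// shift_line prod_normr le_max /=; apply/orP; right.
    + by rewrite addrAC subrr add0r normrN gtr0_norm//; lra.
    + by rewrite addrAC subrr add0r gtr0_norm//; lra.
have AC d : `|d| < r -> \int[leb]_(v in Q) fA d v + \int[leb]_(v in Q) fC d v = 0.
  move=> dr; have iA := box_integrable (cA d); have iB := box_integrable (cB d).
  rewrite [X in _ + X]/Rintegral -BC// -(@RintegralD _ _ _ leb _ _ _ (box_measurable _ _) iA iB).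
  by rewrite /Rintegral dv.
have bd (k : R * R -> R) : (forall v, U v -> {for v, continuous k}) ->
    exists2 M, 0 < M & forall v (d : R), Q v -> `|d| < r -> `|k (v + d *: (1, 0))| <= M.
  move=> ck; have [|M M0 HM] := @compact_continuous_bounded _ _ _ k (@box_compact R u0 (3 * r)).
    by apply: continuous_in_subspaceT => v; rewrite inE => /bU; exact: ck.
  by exists M => // v d Qv dr; apply: HM; exact: Q3.
have [M1 M10 H1] := bd _ (fun v _ => ctF (1, 0) v).
have [M2 M20 H2] := bd _ (cg (0, 1)).
have [M3 M30 H3] := bd _ (fun v _ => ctF (0, 1) v).
have [M4 M40 H4] := bd _ (cg (1, 0)).
have z0 v : v + (0 : R) *: ((1, 0) : R * R) = v by rewrite scale0r addr0.
have n0 : `|0 : R| < r by rewrite normr0.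
have H20 v : Q v -> `|'D_(0, 1) g v| <= M2 by move=> Qv; have := H2 v 0 Qv n0; rewrite z0.
have H30 v : Q v -> `|'D_(0, 1) F v| <= M3 by move=> Qv; have := H3 v 0 Qv n0; rewrite z0.
have LA := @box_derive_under R u0 (2 * r) fA dA r (M1 * M2) r0 (fun d v _ => cA d v).
have LC := @box_derive_under R u0 (2 * r) fC dC r (M3 * M4) r0 cC.
have {}LA := LA _ _; have {}LC := LC _ _.
have dfA (d : R) v : `|d| < r -> Q v -> is_derive d (1 : R) (fA^~ v) (dA d v).
  by move=> dr Qv; exact: (is_derive_mulr _ (@is_derive_shift F v (1, 0) d (dF _ I))).
have dfC (d : R) v : `|d| < r -> Q v -> is_derive d (1 : R) (fC^~ v) (dC d v).
  move=> dr Qv; apply: is_derive_mull.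
  have E s : v + - s *: ((1, 0) : R * R) = v + s *: (- (1, 0)) by rewrite scaleNr scalerN.
  have dgv : differentiable g (v + d *: (- (1, 0))) by rewrite -E; apply/dg/QU => //; rewrite normrN.
  rewrite E -derive_opp//; under eq_fun do rewrite E.
  exact: is_derive_shift.
have {}LA := LA dfA; have {}LC := LC dfC.
have mM (x y a b : R) : `|x| <= a -> `|y| <= b -> `|x * y| <= a * b.
  by move=> xa yb; rewrite normrM ler_pM.
have {}LA := LA (fun d v dr Qv => mM _ _ _ _ (H1 v d Qv dr) (H20 v Qv)).
have bC (d : R) v : `|d| < r -> Q v -> `|dC d v| <= M3 * M4.
  by move=> dr Qv; apply: mM; [exact: H30|rewrite normrN; apply: H4; rewrite ?normrN].
have {}LC := LC bC.
have Z0 : \int[leb]_(v in Q) dA 0 v + \int[leb]_(v in Q) dC 0 v = 0.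
  suff -> : \int[leb]_(v in Q) dA 0 v = - \int[leb]_(v in Q) dC 0 v by rewrite addNr.
  rewrite -(cvg_lim (@Rhausdorff R) LA); apply: cvg_lim; first exact: Rhausdorff.
  suff nE : \forall h \near (0 : R)^',
      - (h^-1 *: ((\int[leb]_(v in Q) fC (h + 0) v) - \int[leb]_(v in Q) fC 0 v)) =
      h^-1 *: ((\int[leb]_(v in Q) fA (h + 0) v) - \int[leb]_(v in Q) fA 0 v).
    by apply: cvg_trans (near_eq_cvg nE) _; apply: cvgN.
  have : \forall h \near (0 : R)^', `|h| < r.
    by apply: nbhs_dnbhs; apply/nbhs_ballP; exists r => // h; rewrite /ball /= sub0r normrN.
  apply: filterS => h hr; rewrite addr0 -scalerN opprB; congr (_ *: _).
  move: (AC _ hr) (AC _ n0) => /eqP + /eqP; rewrite !addr_eq0 => /eqP -> /eqP ->.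
  by rewrite opprK addrC.
have cg2 v : Q v -> {for v, continuous (fun z => 'D_(0, 1) g z)} by move=> /QU0 Uv; exact: cg.
have cdA v : Q v -> {for v, continuous (dA 0)}.
  move=> Qv; apply: (@cvgM _ _ _ _ _ _ ('D_(1, 0) F (v + (0 : R) *: (1, 0))) ('D_(0, 1) g v)).
    exact: (continuous_comp (cs v 0) (ctF (1, 0) _)).
  exact: cg2.
have cdC v : Q v -> {for v, continuous (dC 0)}.
  move=> Qv; apply: (@cvgM _ _ _ _ _ _ ('D_(0, 1) F v) (- 'D_(1, 0) g (v + (- 0 : R) *: (1, 0)))).
    exact: ctF.
  apply: cvgN; apply: (continuous_comp (cs v (- 0)) (cg (1, 0) _ _)).
  by apply: QU => //; rewrite normrN.
have iA := box_integrable cdA; have iC := box_integrable cdC.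
move: Z0; rewrite -(@RintegralD _ _ _ leb _ _ _ (box_measurable _ _) iA iC) /Rintegral => Z0.
have fn : (\int[leb]_(v in Q) (dA 0 v + dC 0 v)%:E)%E \is a fin_num.
  have cS v : Q v -> {for v, continuous (fun v => dA 0 v + dC 0 v)}.
    by move=> Qv; apply: cvgD; [exact: cdA|exact: cdC].
  have iS := box_integrable cS.
  exact: (@integrable_fin_num _ _ _ leb Q (box_measurable u0 (2 * r))
    (EFin \o (fun v => dA 0 v + dC 0 v)) iS).
have pw v : 'D_(1, 0) F v * 'D_(0, 1) g v - 'D_(0, 1) F v * 'D_(1, 0) g v = dA 0 v + dC 0 v.
  by rewrite /dA /dC oppr0 (z0 v) mulrN.
have E : (\int[leb]_(v in Q) (dA 0 v + dC 0 v)%:E = 0)%E.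
  by rewrite -[LHS](fineK fn); exact: (congr1 EFin Z0).
by apply: etrans E; apply: eq_integral => v _; exact: (congr1 EFin (pw v)).
Qed.

End plane_exact.

(** * The normalized normal and its adapted tangent frame *)

Section unit_normal.
Context {R : realType}.
Implicit Types (S M A : set (heis R)) (U : set (R * R)) (phi : R * R -> heis R) (N : heis R -> heis R).
Implicit Types (g v w n x : heis R).

Lemma Ck_local (V W : normedModType R) k (U : set V) (f : V -> W) :
  (forall u : V, U u -> exists A : set V, [/\ open A, A u & Ck k A f]) -> Ck k U f.
Proof.
elim: k f => [f H u Uu|k IH f H]; first by have [A [_ Au]] := H u Uu; apply.
split=> [u Uu|d]; first by have [A [_ Au [dA _]]] := H u Uu; exact: dA.
by apply: IH => u Uu; have [A [oA Au [_ CA]]] := H u Uu; exists A; split=> //; exact: CA.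
Qed.

Lemma metric_frame g n x : metric g n x = n.1.1 * x.1.1 + n.1.2 * x.1.2 + theta g n * theta g x.
Proof. by []. Qed.

(** [n] is a nonzero multiple of the cross product, so [x] is orthogonal to it. What the projection
    of [x] to the plane of [v] and [w] leaves over is a multiple of that cross product with this
    inner product as a factor. *)
Lemma span_coeff g v w n x : 0 < cross_sq g v w -> n != 0 ->
  metric g n v = 0 -> metric g n w = 0 -> metric g n x = 0 ->
  x = (left_inverse_fun g v w x).1 *: v + (left_inverse_fun g v w x).2 *: w.
Proof.
move=> c0 n0 nv nw nx; have [E1 E2 E3] := normal_cross nv nw.
have c0' : cross_sq g v w != 0 by rewrite gt_eqF.
have d0 : cross_dot g n v w != 0.
  apply/eqP => d0; move/eqP: n0; apply; apply: (@frame_eq0 _ g).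
  - by apply/eqP; move: E1; rewrite d0 mul0r => /eqP; rewrite mulf_eq0 (negbTE c0').
  - by apply/eqP; move: E2; rewrite d0 mul0r => /eqP; rewrite mulf_eq0 (negbTE c0').
  - by apply/eqP; move: E3; rewrite d0 mul0r => /eqP; rewrite mulf_eq0 (negbTE c0').
have xc : x.1.1 * cross1 g v w + x.1.2 * cross2 g v w + theta g x * cross3 g v w = 0.
  apply: (mulfI d0); rewrite mulr0 -[RHS](mulr0 (cross_sq g v w)) -nx metric_frame.
  move: (cross_dot g n v w) (cross_sq g v w) (cross1 g v w) (cross2 g v w) (cross3 g v w) E1 E2 E3.
  move=> d cs c1 c2 c3 E1 E2 E3.
  transitivity (d * c1 * x.1.1 + d * c2 * x.1.2 + d * c3 * theta g x); first by ring.
  by rewrite -E1 -E2 -E3; ring.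
apply/eqP; rewrite -subr_eq0; apply/eqP; apply: (@frame_eq0 _ g).
- rewrite /left_inverse_fun /=; apply: (mulfI c0'); rewrite mulr0.
  rewrite -[RHS](mul0r (cross1 g v w)) -xc -![_ *: _]/(_ * _) /=.
  move: c0'; rewrite /cross_sq /cross1 /cross2 /cross3 => c0'; field; exact: c0'.
- rewrite /left_inverse_fun /=; apply: (mulfI c0'); rewrite mulr0.
  rewrite -[RHS](mul0r (cross2 g v w)) -xc -![_ *: _]/(_ * _) /=.
  move: c0'; rewrite /cross_sq /cross1 /cross2 /cross3 => c0'; field; exact: c0'.
- rewrite /left_inverse_fun -scaleN1r !(thetaD, thetaZ) /=; apply: (mulfI c0'); rewrite mulr0.
  rewrite -[RHS](mul0r (cross3 g v w)) -xc.
  move: c0'; rewrite /cross_sq /cross1 /cross2 /cross3 => c0'; field; exact: c0'.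
Qed.

Lemma cross_comb g v w (z e : R * R) :
  let v' := z.1 *: v + z.2 *: w in let w' := e.1 *: v + e.2 *: w in
  let d := z.1 * e.2 - z.2 * e.1 in
  [/\ cross1 g v' w' = d * cross1 g v w, cross2 g v' w' = d * cross2 g v w &
      cross3 g v' w' = d * cross3 g v w].
Proof.
rewrite /cross1 /cross2 /cross3 /= !(thetaD, thetaZ) -![_ *: _]/(_ * _).
by split; ring.
Qed.

(** [n] is the cross product times a scalar, and division by the horizontal length leaves only the
    sign of that scalar. *)
Lemma unit_normal_cross g v w n : 0 < cross_sq g v w -> n != 0 ->
  metric g n v = 0 -> metric g n w = 0 ->
  let W := Num.sqrt (n.1.1 ^+ 2 + n.1.2 ^+ 2) in
  let s := Num.sg (cross_dot g n v w) in let h := Num.sqrt (hor_sq g v w) in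
  [/\ cross_dot g n v w != 0, W = `|cross_dot g n v w| / cross_sq g v w * h,
    n.1.1 / W = s * (cross1 g v w / h), n.1.2 / W = s * (cross2 g v w / h) &
    theta g n / W = s * (cross3 g v w / h)].
Proof.
move=> c0 n0 nv nw W s h; have [E1 E2 E3] := normal_cross nv nw.
have c0' : cross_sq g v w != 0 by rewrite gt_eqF.
set d := cross_dot g n v w in s *.
have {}E1 : n.1.1 = d / cross_sq g v w * cross1 g v w by rewrite mulrAC -E1 mulrC mulKf.
have {}E2 : n.1.2 = d / cross_sq g v w * cross2 g v w by rewrite mulrAC -E2 mulrC mulKf.
have {}E3 : theta g n = d / cross_sq g v w * cross3 g v w by rewrite mulrAC -E3 mulrC mulKf.
have d0 : d != 0.
  apply/eqP => d0; move/eqP: n0; apply; apply: (@frame_eq0 _ g).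
  - by rewrite E1 d0 !mul0r.
  - by rewrite E2 d0 !mul0r.
  - by rewrite E3 d0 !mul0r.
have WE : W = `|d| / cross_sq g v w * h.
  have -> : W = Num.sqrt ((d / cross_sq g v w) ^+ 2 * hor_sq g v w).
    by rewrite /W E1 E2 /hor_sq; congr Num.sqrt; ring.
  by rewrite sqrtrM ?sqr_ge0// sqrtr_sqr normrM normfV (gtr0_norm c0).
have sd (c : R) : d / cross_sq g v w * c / W = s * (c / h).
  (* For [h = 0] both sides are zero, the inverse of 0 being 0. *)
  rewrite WE; have [->|h0] := eqVneq h 0; first by rewrite mulr0 invr0 !mulr0.
  have -> : s = d / `|d| by rewrite {1}[d]numEsg mulfK// normr_eq0.
  by field; rewrite h0 c0' normr_eq0 d0.
by rewrite E1 E2 E3 !sd.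
Qed.

(** Chosen so that the cross product of [Zfield] and [Efield] has the frame components [pbar],
    [qbar], [omegabar]. Its horizontal part has length 1: the pair spans unit area for sigma_H, and
    no factor [W] appears later. *)
Definition Efield N g : heis R := omegabar N g *: nuH N g - Tfield g.

Lemma Zfield_frame N g :
  [/\ (Zfield N g).1.1 = qbar N g, (Zfield N g).1.2 = - pbar N g & theta g (Zfield N g) = 0].
Proof.
rewrite /Zfield -scaleN1r !(thetaD, thetaZ) theta_X1 theta_X2 !mulr0 addr0.
rewrite /X1 /X2 /= -![_ *: _]/(_ * _); split; ring.
Qed.

Lemma Efield_frame N g :
  [/\ (Efield N g).1.1 = omegabar N g * pbar N g, (Efield N g).1.2 = omegabar N g * qbar N g &
      theta g (Efield N g) = -1].
Proof.
rewrite /Efield /nuH -scaleN1r !(thetaD, thetaZ) theta_X1 theta_X2 theta_T !mulr0.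
rewrite /X1 /X2 /Tfield /= -![_ *: _]/(_ * _); split; ring.
Qed.

Lemma unit_hor N g : Wnorm N g != 0 -> pbar N g ^+ 2 + qbar N g ^+ 2 = 1.
Proof.
move=> W0; have WE : Wnorm N g ^+ 2 = pN N g ^+ 2 + qN N g ^+ 2 by rewrite sqr_sqrtr// addr_ge0 ?sqr_ge0.
by rewrite /pbar /qbar !expr_div_n -mulrDl -WE divff// expf_neq0.
Qed.

Lemma unit_normal N g : Wnorm N g != 0 ->
  [/\ (N g).1.1 = Wnorm N g * pbar N g, (N g).1.2 = Wnorm N g * qbar N g &
     theta g (N g) = Wnorm N g * omegabar N g].
Proof.
by move=> W0; rewrite /pbar /qbar /omegabar pNE qNE omegaNE; split; rewrite mulrC divfK.
Qed.

Lemma Zfield_tangent N g : Wnorm N g != 0 -> metric g (N g) (Zfield N g) = 0.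
Proof.
move=> W0; rewrite metric_frame; have [-> -> ->] := unit_normal W0.
by have [-> -> ->] := Zfield_frame N g; ring.
Qed.

Lemma Efield_tangent N g : Wnorm N g != 0 -> metric g (N g) (Efield N g) = 0.
Proof.
move=> W0; rewrite metric_frame; have [-> -> ->] := unit_normal W0.
have [-> -> ->] := Efield_frame N g; have := unit_hor W0.
move: (Wnorm N g) (pbar N g) (qbar N g) (omegabar N g) => W p q o pq.
have -> : W * p * (o * p) + W * q * (o * q) + W * o * -1 = W * o * (p ^+ 2 + q ^+ 2 - 1) by ring.
by rewrite pq subrr mulr0.
Qed.

Lemma cross_ZE N g : Wnorm N g != 0 ->
  [/\ cross1 g (Zfield N g) (Efield N g) = pbar N g, cross2 g (Zfield N g) (Efield N g) = qbar N g &
      cross3 g (Zfield N g) (Efield N g) = omegabar N g].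
Proof.
move=> W0; rewrite /cross1 /cross2 /cross3; have [-> -> ->] := Zfield_frame N g.
have [-> -> ->] := Efield_frame N g; have := unit_hor W0.
move: (pbar N g) (qbar N g) (omegabar N g) => p q o pq; split; [by ring|by ring|].
have -> : q * (o * q) - - p * (o * p) = o * (p ^+ 2 + q ^+ 2) by ring.
by rewrite pq mulr1.
Qed.

Definition surfCk {W : normedModType R} k S (f : heis R -> W) :=
  forall U phi, chart S U phi -> Ck k U (f \o phi).

(** [M] is the part of [S] off the characteristic set. Since its charts are charts of [S],
    tangential derivatives can be taken on [S] throughout, even for functions that are regular on
    [M] only. *)
Definition regular_part S M N := [/\ forall U phi, chart M U phi -> chart S U phi, C2_surface M,
  {within M, continuous N}, normal_field M N & forall g, M g -> Wnorm N g != 0].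

Variables (S M : set (heis R)) (N : heis R -> heis R).
Hypothesis reg : regular_part S M N.

(** The orientation of the chart relative to [N]. *)
Definition chart_sign phi u : R :=
  Num.sg (cross_dot (phi u) (N (phi u)) ('D_(1, 0) phi u) ('D_(0, 1) phi u)).

Lemma chart_unit_normal U phi u : chart M U phi -> U u ->
  [/\ `|chart_sign phi u| = 1, 0 < hor_element phi u,
    pbar N (phi u) = chart_sign phi u *
      (cross1 (phi u) ('D_(1, 0) phi u) ('D_(0, 1) phi u) / hor_element phi u),
    qbar N (phi u) = chart_sign phi u *
      (cross2 (phi u) ('D_(1, 0) phi u) ('D_(0, 1) phi u) / hor_element phi u) &
    omegabar N (phi u) = chart_sign phi u *
      (cross3 (phi u) ('D_(1, 0) phi u) ('D_(0, 1) phi u) / hor_element phi u)].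
Proof.
case: reg => _ _ _ nN W0 c Uu; have [n0 nn] := nN _ (chart_sub c Uu).
have := W0 _ (chart_sub c Uu); have [n1 n2] := (normal_dep _ c Uu).1 nn.
have [d0 WE E1 E2 E3] := unit_normal_cross (chart_cross_gt0 c Uu _) n0 n1 n2.
rewrite /pbar /qbar /omegabar /Wnorm pNE qNE omegaNE => W0'.
rewrite /chart_sign /hor_element; split=> //; first by rewrite normr_sg d0.
rewrite lt_neqAle sqrtr_ge0 andbT; apply/eqP => h0; move: W0'; rewrite WE -h0 mulr0.
by rewrite eqxx.
Qed.

Lemma chart_sign_near U phi u : chart M U phi -> U u ->
  exists A : set (R * R), [/\ open A, A u, A `<=` U &
    forall z, A z -> chart_sign phi z = chart_sign phi u].
Proof.
case: (reg) => _ _ cN nN W0 c Uu; have [oU C2 _ _ _] := c.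
have [c1 c2 c3] := chart_cross_Ck c.
pose d (v : R * R) := cross_dot (phi v) (N (phi v)) ('D_(1, 0) phi v) ('D_(0, 1) phi v).
have CN : Ck 0 U (N \o phi).
  move=> v Uv; have Mv := chart_sub c Uv; have cp := chart_continuous c Uv.
  have /subspace_continuousP cN' := cN.
  move=> A nA; have := cN' _ Mv _ nA.
  rewrite /nbhs /= => nW; have nU : nbhs v U by exact: open_nbhs_nbhs.
  have := cp _ nW; rewrite /nbhs /= => nW'.
  by apply: filterS2 nU nW' => z Uz; apply; exact: chart_sub c Uz.
have [N1 N2 _] := Ck_coord oU CN.
have Nt := Ck_theta oU (CkS (CkS C2)) CN.
have Cd : Ck 0 U d.
  apply: (Ck_ext oU) (CkD oU (CkD oU (CkM oU N1 (CkS c1)) (CkM oU N2 (CkS c2))) (CkM oU Nt (CkS c3))).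
  by move=> v _.
have d0 : d u != 0.
  have [s1 _ _ _ _] := chart_unit_normal c Uu; apply/eqP => du0.
  by move: s1; rewrite /chart_sign -/(d u) du0 sgr0 normr0 => /eqP; rewrite eq_sym oner_eq0.
have nU : \forall v \near u, U v by exact: open_nbhs_nbhs.
have nd : \forall v \near u, Num.sg (d v) = Num.sg (d u).
  have [dp|dn|//] := ltgtP (d u) 0; last by move=> E; rewrite E eqxx in d0.
  - move: (Cd u Uu : d @ u --> d u) => /cvgr_lt -/(_ _ dp).
    by apply: filterS => z dz; exact: etrans (ltr0_sg dz) (esym (ltr0_sg dp)).
  - move: (Cd u Uu : d @ u --> d u) => /cvgr_gt -/(_ _ dn).
    by apply: filterS => z dz; exact: etrans (gtr0_sg dz) (esym (gtr0_sg dn)).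
have nA : nbhs u [set z : R * R | U z /\ Num.sg (d z) = Num.sg (d u)].
  by apply: filterS2 nU nd => z ? ?; split.
exists (interior [set z : R * R | U z /\ Num.sg (d z) = Num.sg (d u)]); split.
- exact: open_interior.
- exact: nA.
- by move=> z /interior_subset[].
- by move=> z /interior_subset[_]; exact.
Qed.

Lemma chart_unit_Ck (c f : heis R -> R) (k : R * R -> R) U phi : chart M U phi -> Ck 1 U k ->
  (forall u, U u -> f (phi u) = chart_sign phi u * (k u / hor_element phi u)) -> Ck 1 U (f \o phi).
Proof.
move=> ch Ckk fE; have [oU _ _ _ _] := ch; apply: Ck_local => u Uu.
have [A [oA Au AU sA]] := chart_sign_near ch Uu; exists A; split=> //.
have hs (v : R * R) : U v -> 0 < hor_sq (phi v) ('D_(1, 0) phi v) ('D_(0, 1) phi v).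
  by move=> Uv; have [_] := chart_unit_normal ch Uv; rewrite sqrtr_gt0.
have Ch := Ck1_sqrt oU hs (chart_hor_sq_Ck ch).
have h0 (v : R * R) : U v -> hor_element phi v != 0.
  by move=> Uv; rewrite gt_eqF//; have [] := chart_unit_normal ch Uv.
have C := Ck_subset AU (CkZ (chart_sign phi u) oU (CkM oU Ckk (Ck1_inv oU h0 Ch))).
by apply: (Ck_ext oA) C => v Av; rewrite /= (fE v (AU _ Av)) (sA v Av).
Qed.

(** [N] is only continuous. Nevertheless these quotients are of class C^1, because in a chart they
    are components of the cross product of the coordinate tangent vectors divided by [hor_element],
    up to a locally constant sign. *)
Lemma unit_normal_Ck : [/\ surfCk 1 M (pbar N), surfCk 1 M (qbar N) & surfCk 1 M (omegabar N)].
Proof.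
split=> U phi c; have [c1 c2 c3] := chart_cross_Ck c.
- by apply: (chart_unit_Ck (pbar N) c c1) => u Uu; have [] := chart_unit_normal c Uu.
- by apply: (chart_unit_Ck (pbar N) c c2) => u Uu; have [] := chart_unit_normal c Uu.
- by apply: (chart_unit_Ck (pbar N) c c3) => u Uu; have [] := chart_unit_normal c Uu.
Qed.

Definition chart_coeff (X : heis R -> heis R) phi u : R * R :=
  left_inverse_fun (phi u) ('D_(1, 0) phi u) ('D_(0, 1) phi u) (X (phi u)).

Lemma chart_coeffE X U phi u : chart M U phi -> U u -> metric (phi u) (N (phi u)) (X (phi u)) = 0 ->
  X (phi u) = 'D_(chart_coeff X phi u) phi u.
Proof.
case: reg => _ _ _ nN _ c Uu X0; have [n0 nn] := nN _ (chart_sub c Uu).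
have [n1 n2] := (normal_dep _ c Uu).1 nn.
rewrite (chart_derive _ c Uu); exact: (span_coeff (chart_cross_gt0 c Uu _) n0 n1 n2 X0).
Qed.

Lemma chart_coeff_Ck X U phi : chart M U phi -> Ck 0 U (X \o phi) ->
  Ck 0 U (fun u => (chart_coeff X phi u).1) /\ Ck 0 U (fun u => (chart_coeff X phi u).2).
Proof.
move=> c CX; have [oU C2 _ _ _] := c; have [c1 c2 c3] := chart_cross_Ck c.
have Cp : Ck 0 U phi := CkS (CkS C2).
have C0 (f : R * R -> R) : Ck 1 U f -> Ck 0 U f by exact: CkS.
have Csq := CkD oU (CkD oU (CkM oU c1 c1) (CkM oU c2 c2)) (CkM oU c3 c3).
have Ci : Ck 0 U (fun u => (cross_sq (phi u) ('D_(1, 0) phi u) ('D_(0, 1) phi u))^-1).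
  apply: CkS; apply: Ck1_inv => //.
    by move=> u Uu; rewrite gt_eqF//; exact: chart_cross_gt0 c Uu _.
have CD (w : R * R) : Ck 1 U (fun u => 'D_w phi u) := C2.2 w.
have [x1 x2 x3] := Ck_cross oU Cp CX (CkS (CD (0, 1))).
have [y1 y2 y3] := Ck_cross oU Cp (CkS (CD (1, 0))) CX.
split.
- exact: (CkM oU (CkD oU (CkD oU (CkM oU x1 (C0 _ c1)) (CkM oU x2 (C0 _ c2))) (CkM oU x3 (C0 _ c3))) Ci).
- exact: (CkM oU (CkD oU (CkD oU (CkM oU y1 (C0 _ c1)) (CkM oU y2 (C0 _ c2))) (CkM oU y3 (C0 _ c3))) Ci).
Qed.

Lemma ZE_Ck U phi : chart M U phi -> Ck 0 U (Zfield N \o phi) /\ Ck 0 U (Efield N \o phi).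
Proof.
move=> c; have [oU C2 _ _ _] := c; have [p q o'] := unit_normal_Ck.
have Cp := CkS (p _ _ c); have Cq := CkS (q _ _ c); have Co := CkS (o' _ _ c).
have [Cx Cy _] := Ck_coord oU (CkS (CkS C2)).
have Ch k : Ck 0 U (fun=> k : R) by exact: Ck_cst.
split.
- apply: (Ck_ext oU) (Ck_pair oU (Ck_pair oU Cq (CkN oU Cp))
    (CkN oU (CkM oU (CkD oU (CkM oU Cq Cy) (CkM oU Cp Cx)) (Ch 2^-1)))) => u _.
  apply/eqP; rewrite -subr_eq0; apply/eqP; apply: (@frame_eq0 _ (phi u)).
  + by rewrite /Zfield /X1 /X2 /= -![_ *: _]/(_ * _); ring.
  + by rewrite /Zfield /X1 /X2 /= -![_ *: _]/(_ * _); ring.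
  + by rewrite /Zfield /theta /X1 /X2 /= -![_ *: _]/(_ * _); field.
- apply: (Ck_ext oU) (Ck_pair oU (Ck_pair oU (CkM oU Co Cp) (CkM oU Co Cq))
    (CkB oU (CkM oU (CkM oU Co (CkB oU (CkM oU Cq Cx) (CkM oU Cp Cy))) (Ch 2^-1)) (Ch 1))) => u _.
  apply/eqP; rewrite -subr_eq0; apply/eqP; apply: (@frame_eq0 _ (phi u)).
  + by rewrite /Efield /nuH /X1 /X2 /Tfield /= -![_ *: _]/(_ * _); ring.
  + by rewrite /Efield /nuH /X1 /X2 /Tfield /= -![_ *: _]/(_ * _); ring.
  + by rewrite /Efield /nuH /theta /X1 /X2 /Tfield /= -![_ *: _]/(_ * _); field.
Qed.

Definition dZ f g : R := tder S f g (Zfield N g).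
Definition dE f g : R := tder S f g (Efield N g).

Lemma dZE_chart U phi u f : chart M U phi -> U u -> differentiable (f \o phi) u ->
  dZ f (phi u) = 'D_(chart_coeff (Zfield N) phi u) (f \o phi) u /\
  dE f (phi u) = 'D_(chart_coeff (Efield N) phi u) (f \o phi) u.
Proof.
case: (reg) => cS _ _ _ W0 c Uu df; have W := W0 _ (chart_sub c Uu).
have EZ := chart_coeffE c Uu (Zfield_tangent W); have EE := chart_coeffE c Uu (Efield_tangent W).
rewrite /dZ /dE [X in tder S f _ X = _ /\ _]EZ [X in _ /\ tder S f _ X = _]EE.
by split; exact: (tder_chart _ (cS _ _ c) Uu df).
Qed.

Lemma derive_plane (f : R * R -> R) (u w : R * R) : differentiable f u ->
  'D_w f u = w.1 * 'D_(1, 0) f u + w.2 * 'D_(0, 1) f u.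
Proof.
move=> df; have {1}-> : w = w.1 *: (1, 0) + w.2 *: (0, 1).
  case: w => a b; rewrite -[RHS]/(a * 1 + b * 0, a * 0 + b * 1).
  by rewrite !mulr1 !mulr0 addr0 add0r.
by rewrite !deriveE// linearD !linearZ.
Qed.

Lemma dZE_Ck f : surfCk 1 M f -> surfCk 0 M (dZ f) /\ surfCk 0 M (dE f).
Proof.
move=> Cf; split=> U phi c; have [oU _ _ _ _] := c; have [df Df] := Cf _ _ c.
- have [z1 z2] := chart_coeff_Ck c (ZE_Ck c).1.
  apply: (Ck_ext oU) (CkD oU (CkM oU z1 (Df (1, 0))) (CkM oU z2 (Df (0, 1)))) => u Uu.
  exact: (etrans (esym (derive_plane _ (df u Uu))) (esym (dZE_chart c Uu (df u Uu)).1)).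
- have [z1 z2] := chart_coeff_Ck c (ZE_Ck c).2.
  apply: (Ck_ext oU) (CkD oU (CkM oU z1 (Df (1, 0))) (CkM oU z2 (Df (0, 1)))) => u Uu.
  exact: (etrans (esym (derive_plane _ (df u Uu))) (esym (dZE_chart c Uu (df u Uu)).2)).
Qed.

(** The 2-form df1 /\ df2 evaluated on the pair [Zfield], [Efield]. *)
Definition jac f1 f2 g : R := dZ f1 g * dE f2 g - dE f1 g * dZ f2 g.

(** The determinant of the coordinates of [Zfield] and [Efield] is the ratio of their cross product
    to that of the coordinate vectors. The former has horizontal part of length 1 and the latter of
    length [hor_element], so only the orientation remains. *)
Lemma chart_coeff_det U phi u : chart M U phi -> U u ->
  ((chart_coeff (Zfield N) phi u).1 * (chart_coeff (Efield N) phi u).2 -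
   (chart_coeff (Zfield N) phi u).2 * (chart_coeff (Efield N) phi u).1) * hor_element phi u =
  chart_sign phi u.
Proof.
move=> c Uu; case: (reg) => _ _ _ _ W0; have W := W0 _ (chart_sub c Uu).
have EZ := chart_coeffE c Uu (Zfield_tangent W); have EE := chart_coeffE c Uu (Efield_tangent W).
have [X1 X2 _] := cross_ZE W; have [_ h0 P1 P2 _] := chart_unit_normal c Uu.
rewrite (chart_derive _ c Uu) in EZ; rewrite (chart_derive _ c Uu) in EE.
have [Y1 Y2 _] := cross_comb (phi u) ('D_(1, 0) phi u) ('D_(0, 1) phi u)
  (chart_coeff (Zfield N) phi u) (chart_coeff (Efield N) phi u).
rewrite /= -EZ -EE X1 P1 in Y1; rewrite /= -EZ -EE X2 P2 in Y2.
have hE : hor_element phi u ^+ 2 = hor_sq (phi u) ('D_(1, 0) phi u) ('D_(0, 1) phi u).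
  by rewrite sqr_sqrtr// addr_ge0 ?sqr_ge0.
have alg (d c1 c2 h s : R) : 0 < h -> s * (c1 / h) = d * c1 -> s * (c2 / h) = d * c2 ->
    h ^+ 2 = c1 ^+ 2 + c2 ^+ 2 -> d * h = s.
  move=> h1 y1 y2 hh; have h0' : h != 0 by rewrite gt_eqF.
  apply: (mulIf h0'); rewrite -mulrA -expr2 hh mulrDr !expr2 !mulrA -y1 -y2.
  have -> : s * (c1 / h) * c1 + s * (c2 / h) * c2 = s * ((c1 ^+ 2 + c2 ^+ 2) / h) by field.
  by rewrite -hh expr2 mulfK.
exact: (alg _ _ _ _ _ h0 Y1 Y2 hE).
Qed.

Lemma jac_chart U phi u f1 f2 : chart M U phi -> U u ->
  differentiable (f1 \o phi) u -> differentiable (f2 \o phi) u ->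
  jac f1 f2 (phi u) * hor_element phi u = chart_sign phi u *
    ('D_(1, 0) (f1 \o phi) u * 'D_(0, 1) (f2 \o phi) u -
     'D_(0, 1) (f1 \o phi) u * 'D_(1, 0) (f2 \o phi) u).
Proof.
move=> c Uu d1 d2.
have alg (z e : R * R) (a1 a2 b1 b2 h s za ea zb eb : R) : za = z.1 * a1 + z.2 * a2 ->
    ea = e.1 * a1 + e.2 * a2 -> zb = z.1 * b1 + z.2 * b2 -> eb = e.1 * b1 + e.2 * b2 ->
    (z.1 * e.2 - z.2 * e.1) * h = s -> (za * eb - ea * zb) * h = s * (a1 * b2 - a2 * b1).
  by move=> -> -> -> -> <-; ring.
have [Z1 E1] := dZE_chart c Uu d1; have [Z2 E2] := dZE_chart c Uu d2.
exact: (alg _ _ _ _ _ _ _ _ _ _ _ _ (etrans Z1 (derive_plane _ d1)) (etrans E1 (derive_plane _ d1))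
  (etrans Z2 (derive_plane _ d2)) (etrans E2 (derive_plane _ d2)) (chart_coeff_det c Uu)).
Qed.

End unit_normal.

Lemma integral_support d (T : measurableType d) (R : realType) (mu : {measure set T -> \bar R})
    (A B : set T) (f : T -> \bar R) :
  (forall x, A x -> ~ B x -> f x = 0%E) -> (forall x, B x -> ~ A x -> f x = 0%E) ->
  (\int[mu]_(x in A) f x = \int[mu]_(x in B) f x)%E.
Proof.
move=> AB BA; rewrite integral_mkcond [RHS]integral_mkcond; apply: eq_integral => x _.
rewrite /patch; case: ifPn => xA; case: ifPn => // xB.
- by apply: AB; [rewrite inE in xA|rewrite notin_setE in xB].
- by apply/esym/BA; [rewrite inE in xB|rewrite notin_setE in xA].
Qed.

(** * Vanishing of integrals of Jacobians with a compactly supported factor *)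

Section exactness.
Context {R : realType}.
Implicit Types (A : set (heis R)) (U : set (R * R)) (phi : R * R -> heis R) (f : heis R -> R).

Local Notation leb := (lebesgue_measure \x lebesgue_measure)%E.

Lemma near_dist (V : normedModType R) (x : V) (d : R) : 0 < d -> \forall y \near x, `|y - x| < d.
Proof. by move=> d0; apply/nbhs_normP; exists d => //= y; rewrite /ball_ /= distrC. Qed.

Lemma compact_openC (V : normedModType R) (K : set V) : compact K -> open (~` K).
Proof. by move=> cK; apply: closed_openC; apply: compact_closed => //; exact: norm_hausdorff. Qed.

Lemma surf_within_continuous (M : set (heis R)) f : C2_surface M -> surf_continuous M f ->
  {within M, continuous f}.
Proof.
move=> CM cf; apply/subspace_continuousP => x Mx V nV.
have : nbhs (f x) (interior V) by exact: nbhs_interior.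
move=> /nbhs_singleton Vx; have [W oW E] := surf_continuous_open CM cf (open_interior V).
have Wx : W x by have : (M `&` f @^-1` interior V) x; [by split|rewrite E => -[]].
have nW : nbhs x W by exact: open_nbhs_nbhs.
apply: filterS nW => y Wy My; apply: (@interior_subset _ V).
by have : (M `&` W) y; [by split|rewrite -E => -[]].
Qed.

(** By compactness it suffices to treat the image of a small box of parameters, where the area
    element is continuous and hence integrable. *)
Lemma compact_area_finite (S K : set (heis R)) : C2_surface S -> compact K -> K `<=` S ->
  (borel_area S K < +oo)%E.
Proof.
move=> CS cK KS.
pose P A := exists B, [/\ measurable B, A `&` S `<=` B & (borel_area S B < +oo)%E].
suff [B [mB KB fB]] : P K.
  apply: le_lt_trans fB; apply: le_measure; rewrite ?inE//; first exact: heis_compact_measurable.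
  by move=> x Kx; apply: KB; split=> //; exact: KS.
apply: (@compact_ind _ _ P cK).
- by exists set0; split; [exact: measurable0|rewrite set0I|rewrite measure0 ltry].
- move=> A B [A' [mA AA fA]] [B' [mB BB fB]]; exists (A' `|` B'); split.
  + exact: measurableU.
  + by move=> x [[Ax|Bx] Sx]; [left; exact: AA|right; exact: BB].
  + by apply: (le_lt_trans (measureU2 _ _ _)) => //; rewrite lte_add_pinfty.
- by move=> A B AB [B' [mB BB fB]]; exists B'; split=> // x [Ax Sx]; apply: BB; split=> //; exact: AB.
- move=> x /KS Sx; have [U [phi [c [u Uu ux]]]] := CS x Sx; have [oU _ _ _ _] := c.
  have [r r0 rU] := nbhs_box (open_nbhs_nbhs (conj oU Uu)).
  have := chart_image_near c Uu (box_nbhs u r0); rewrite ux => nO.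
  have cC := chart_compact_image c (@box_compact R u r) rU.
  exists [set g | S g -> (phi @` (U `&` box u r)) g]; first exact: nO.
  exists (phi @` box u r); split; first exact: heis_compact_measurable.
    by move=> g [gO Sg]; have [v [_ bv] <-] := gO Sg; exists v.
  rewrite (borel_areaE c (heis_compact_measurable cC)); last first.
    by move=> g [_ [v bv <-]]; exists v => //; exact: rU.
  rewrite /chart_area.
  have -> : U `&` phi @^-1` (phi @` box u r) = box u r.
    rewrite eqEsubset; split=> [v [Uv [w bw E]]|v bv]; last by split; [exact: rU|exists v].
    by rewrite -(chart_inj c _ _ E) ?inE//; exact: rU.
  have ca v : box u r v -> {for v, continuous (area_element phi)}.
    by move=> bv; exact: (chart_area_continuous c (rU _ bv)).
  exact: (@integrable_lty _ _ _ (lebesgue_measure \x lebesgue_measure)%E _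
    (box_measurable u r) _ (box_integrable ca)).
Qed.

Lemma surf_compact_bounded (M K : set (heis R)) f : C2_surface M -> surf_continuous M f ->
  compact K -> K `<=` M -> exists2 B, 0 < B & forall x, K x -> `|f x| <= B.
Proof.
move=> CM cf cK KM; apply: compact_continuous_bounded => //.
by apply: (continuous_subspaceW KM); exact: surf_within_continuous.
Qed.

Lemma surf_integrable (S M K : set (heis R)) f : C2_surface S -> C2_surface M -> M `<=` S ->
  surf_continuous M f -> compact K -> K `<=` M -> (borel_area S).-integrable K (EFin \o f).
Proof.
move=> CS CM MS cf cK KM; apply: measurable_bounded_integrable.
- exact: heis_compact_measurable.
- by apply: compact_area_finite => //; exact: subset_trans MS.
- by apply: (surf_continuous_measurable CM cf) => //; exact: heis_compact_measurable.
- have [B B0 HB] := surf_compact_bounded CM cf cK KM.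
  exists B; split; first by rewrite num_real.
  by move=> x Bx v Kv; apply: (le_trans (HB v Kv)); exact: ltW.
Qed.

(** A cutoff profile of class C^1, which is all that is asked of the functions in [exactness]. *)
Definition pos_sq (s : R) : R := Num.max 0 s ^+ 2.

Lemma pos_sq_derive (s : R) : is_derive s (1 : R) pos_sq (2 * Num.max 0 s) /\
  {for s, continuous (fun s : R => 2 * Num.max 0 s)}.
Proof.
have cm : continuous (fun s : R => Num.max 0 s).
  by move=> x; apply: continuous_max; [exact: cst_continuous|exact: cvg_id].
split; last by apply: cvgM; [exact: cvg_cst|exact: cm].
have [s0|] := boolP (s < 0); last rewrite -leNgt le_eqVlt => /predU1P[<-|s0]; last first.
- rewrite max_r ?ltW//.
  apply: (@near_eq_is_derive R R R (fun z : R => z * z : R)).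
  + near=> z; rewrite /pos_sq max_r ?expr2//; apply: ltW; near: z.
    by apply: (cvgr_gt s) => //; exact: cvg_id.
  + have D := @is_deriveM R R id id s 1 1 1 (is_derive_id s 1) (is_derive_id s 1).
    have -> : 2 * s = s *: 1 + s *: 1 by rewrite -![_ *: _]/(_ * _); ring.
    exact: D.
- rewrite maxxx mulr0.
  have [||df dE0] := @eps_differentiable R R R pos_sq ( *:%R (0 : R)) 0.
    exact: scaler_continuous.
    move=> e e0; apply/nbhs_ballP; exists e => // h; rewrite /ball /= sub0r normrN => he.
    rewrite addr0 /pos_sq maxxx expr0n /= subr0 scale0r subr0.
    have h0 : 0 <= Num.max 0 h by rewrite le_max lexx.
    have hh : Num.max 0 h <= `|h| by rewrite ge_max normr_ge0 ler_norm.
    rewrite ger0_norm ?exprn_ge0// expr2; apply: ler_pM => //.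
    exact: le_trans hh (ltW he).
  apply: DeriveDef; first exact: diff_derivable.
  by rewrite deriveE// dE0 /= scale0r.
- rewrite max_l ?ltW// mulr0.
  apply: (@near_eq_is_derive R R R (cst 0)).
  + near=> z; rewrite /pos_sq max_l ?expr0n//; apply: ltW; near: z.
    by apply: (cvgr_lt s) => //; exact: cvg_id.
Unshelve. all: by end_near. Qed.

(** A product of three one-variable cutoffs is positive exactly on a ball of the maximum norm, which
    is the norm of the product space. *)
Lemma bump_function (x : heis R) (d : R) : 0 < d -> exists chi : heis R -> R,
  [/\ forall U phi, open U -> Ck 1 U phi -> Ck 1 U (chi \o phi),
      forall y, 0 <= chi y, forall y, `|y - x| < d -> 0 < chi y &
      forall y, chi y != 0 -> `|y - x| < d].
Proof.
move=> d0; pose q (a b : R) := pos_sq (d ^+ 2 - (a - b) ^+ 2).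
have q0 a b : 0 <= q a b by exact: sqr_ge0.
have qp a b : `|a - b| < d -> 0 < q a b.
  move=> ab; rewrite exprn_gt0// lt_max subr_gt0; apply/orP; right.
  by rewrite -[ltLHS]real_normK ?num_real// ltr_pXn2r// ?nnegrE ?ltW.
have qn a b : q a b != 0 -> `|a - b| < d.
  rewrite /q expf_eq0 /= => qab; rewrite ltNge; apply/negP => ab; move/negP: qab; apply.
  apply/eqP/max_l; rewrite subr_le0 -[leRHS]real_normK ?num_real//.
  by rewrite lerXn2r// nnegrE ltW.
have Cq U (f : R * R -> R) b : open U -> Ck 1 U f -> Ck 1 U (fun u => q (f u) b).
  move=> oU Cf; have Cs (a : R) : Ck 1 U (fun=> a) by exact: Ck_cst.
  have Cb : Ck 1 U (fun u => f u - b) := CkB oU Cf (Cs b).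
  have Cd : Ck 1 U (fun u => d ^+ 2 - (f u - b) ^+ 2) := CkB oU (Cs (d ^+ 2)) (CkM oU Cb Cb).
  have H u (_ : U u) := pos_sq_derive (d ^+ 2 - (f u - b) ^+ 2).
  exact: (@Ck1_comp _ _ pos_sq (fun s => 2 * Num.max 0 s) _ _ oU H Cd).
clearbody q.
exists (fun y => q y.1.1 x.1.1 * q y.1.2 x.1.2 * q y.2 x.2); split.
- move=> U phi oU C; have [C1 C2 C3] := Ck_coord oU C.
  exact: CkM oU (CkM oU (Cq _ _ _ oU C1) (Cq _ _ _ oU C2)) (Cq _ _ _ oU C3).
- by move=> y; rewrite !mulr_ge0 ?q0.
- move=> y; rewrite !prod_normr !gt_max /= => /andP[/andP[y1 y2] y3].
  by rewrite mulr_gt0 ?(qp _ _ y3)// mulr_gt0 ?(qp _ _ y1) ?(qp _ _ y2).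
- move=> y; rewrite !mulf_eq0 !negb_or -andbA => /and3P[y1 y2 y3].
  by rewrite !prod_normr !gt_max /= (qn _ _ y1) (qn _ _ y2) (qn _ _ y3).
Qed.

Variables (S M : set (heis R)) (N : heis R -> heis R) (K : set (heis R)).
Hypotheses (reg : regular_part S M N) (CS : C2_surface S) (nS : normal_field S N).
Hypotheses (cK : compact K) (KM : K `<=` M).

Local Notation dZ := (dZ S N).
Local Notation dE := (dE S N).
Local Notation jac := (jac S N).

Lemma regular_sub : M `<=` S.
Proof.
case: reg => cS CM _ _ _ x Mx; have [U [phi [c [u Uu <-]]]] := CM x Mx.
exact: chart_sub (cS _ _ c) Uu.
Qed.

Lemma dZE_zero f x : M x -> (\forall y \near x, M y -> f y = 0) -> dZ f x = 0 /\ dE f x = 0.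
Proof.
case: (reg) => _ CM _ _ _ Mx f0; have [U [phi [c [u Uu ux]]]] := CM x Mx.
have [oU _ _ _ _] := c; have nU : \forall v \near u, U v by exact: open_nbhs_nbhs.
have n0 : \forall v \near u, 0 = (f \o phi) v.
  have cp : phi @ u --> phi u := chart_continuous c Uu.
  move: f0; rewrite -ux => /cp; rewrite /nbhs /= => nv.
  by apply: filterS2 nU nv => v Uv /(_ (chart_sub c Uv)) fv; rewrite /= fv.
have df : differentiable (f \o phi) u.
  exact: (differentiable_near_eq n0 (differentiable_cst 0 u)).
have D0 w : 'D_w (f \o phi) u = 0.
  by rewrite -(near_eq_derive w n0) derive_cst.
by rewrite -ux; have [-> ->] := dZE_chart reg c Uu df; rewrite !D0.
Qed.

Lemma dZE_add f1 f2 x : surfCk 1 M f1 -> surfCk 1 M f2 -> M x ->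
  dZ (fun y => f1 y + f2 y) x = dZ f1 x + dZ f2 x /\
  dE (fun y => f1 y + f2 y) x = dE f1 x + dE f2 x.
Proof.
case: (reg) => _ CM _ _ _ C1 C2 Mx; have [U [phi [c [u Uu ux]]]] := CM x Mx.
have d1 := (C1 _ _ c).1 u Uu; have d2 := (C2 _ _ c).1 u Uu.
have d3 : differentiable ((fun y => f1 y + f2 y) \o phi) u := differentiableD d1 d2.
rewrite -ux; have [-> ->] := dZE_chart reg c Uu d1; have [-> ->] := dZE_chart reg c Uu d2.
have [-> ->] := dZE_chart reg c Uu d3.
by split; apply: deriveD; exact: diff_derivable.
Qed.

Lemma dZE_mul f1 f2 x : surfCk 1 M f1 -> surfCk 1 M f2 -> M x ->
  dZ (fun y => f1 y * f2 y) x = dZ f1 x * f2 x + f1 x * dZ f2 x /\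
  dE (fun y => f1 y * f2 y) x = dE f1 x * f2 x + f1 x * dE f2 x.
Proof.
case: (reg) => _ CM _ _ _ C1 C2 Mx; have [U [phi [c [u Uu ux]]]] := CM x Mx.
have d1 := (C1 _ _ c).1 u Uu; have d2 := (C2 _ _ c).1 u Uu.
have d3 : differentiable ((fun y => f1 y * f2 y) \o phi) u := differentiableM d1 d2.
rewrite -ux; have [-> ->] := dZE_chart reg c Uu d1; have [-> ->] := dZE_chart reg c Uu d2.
have [-> ->] := dZE_chart reg c Uu d3.
by split; exact: (derive_mul _ d1 d2).2.
Qed.

Lemma surfCkM k f1 f2 : surfCk k M f1 -> surfCk k M f2 -> surfCk k M (fun x => f1 x * f2 x : R).
Proof. by move=> C1 C2 U phi c; have [oU _ _ _ _] := c; exact: CkM oU (C1 _ _ c) (C2 _ _ c). Qed.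

Lemma surfCkD k f1 f2 : surfCk k M f1 -> surfCk k M f2 -> surfCk k M (fun x => f1 x + f2 x : R).
Proof. by move=> C1 C2 U phi c; have [oU _ _ _ _] := c; exact: CkD oU (C1 _ _ c) (C2 _ _ c). Qed.

Lemma surfCkB k f1 f2 : surfCk k M f1 -> surfCk k M f2 -> surfCk k M (fun x => f1 x - f2 x : R).
Proof. by move=> C1 C2 U phi c; have [oU _ _ _ _] := c; exact: CkB oU (C1 _ _ c) (C2 _ _ c). Qed.

Lemma jac_continuous f1 f2 : surfCk 1 M f1 -> surfCk 1 M f2 -> surf_continuous M (jac f1 f2).
Proof.
move=> C1 C2; have [z1 e1] := dZE_Ck reg C1; have [z2 e2] := dZE_Ck reg C2.
exact: surfCkB (surfCkM z1 e2) (surfCkM e1 z2).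
Qed.

Lemma hdens_regular : surf_continuous M (hdens N).
Proof. by case: reg => _ _ _ nM _; exact: hdens_continuous. Qed.

Lemma jac_integrable f1 f2 : surfCk 1 M f1 -> surfCk 1 M f2 ->
  (borel_area S).-integrable K (EFin \o (fun y => jac f1 f2 y * hdens N y)).
Proof.
case: (reg) => _ CM _ _ _ C1 C2; apply: (surf_integrable CS CM regular_sub) => //.
exact: surfCkM (jac_continuous C1 C2) hdens_regular.
Qed.

Lemma jac_zero f1 f2 x : M x -> (\forall y \near x, M y -> f1 y = 0) -> jac f1 f2 x = 0.
Proof. by move=> Mx n0; rewrite /jac; have [-> ->] := dZE_zero Mx n0; rewrite !mul0r subrr. Qed.

(** The cutoff [chi] is concentrated in a piece of one chart with constant orientation, so [f] times
    [chi] can be treated in the plane. It depends on [x] only, not on [f] and [g], and its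
    positivity near [x] is kept so that it can later be divided out. *)
Lemma exact_local x : K x -> exists2 A, nbhs x A & exists chi : heis R -> R,
  [/\ surfCk 1 M chi, forall y, 0 <= chi y, forall y, A y -> 0 < chi y &
    forall f g, surfCk 1 M f -> (forall y, ~ K y -> f y = 0) -> surfCk 1 M g ->
    (\int[borel_area S]_(y in K) (jac (fun y => f y * chi y) g y * hdens N y)%:E = 0)%E].
Proof.
case: (reg) => cS CM _ nM _ Kx; have [U [phi [c [u0 Uu0 ux]]]] := CM x (KM Kx).
have [A [oA Au AU sA]] := chart_sign_near reg c Uu0.
have [r3 r30 rA] := nbhs_box (open_nbhs_nbhs (conj oA Au)).
(* [plane_exact] asks for a support within radius [r] and regularity on radius [3 r], and integrates
   over radius [2 r]. The support is placed within [r / 2] to leave room for strict inequalities. *)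
pose r := r3 / 3; have r0 : 0 < r by rewrite divr_gt0.
have {}rA : box u0 (3 * r) `<=` A by rewrite /r mulrC divfK// gt_eqF.
have r20 : 0 < r / 2 by rewrite divr_gt0.
have := chart_image_near c Uu0 (box_nbhs u0 r20); rewrite ux => /nbhs_normP[d /= d0 dM].
have [chi [Cchi chi0 chip chin]] := @bump_function x d d0.
have Cc : surfCk 1 M chi by move=> V psi cV; have [oV C2 _ _ _] := cV; exact: Cchi oV (CkS C2).
exists [set y | `|y - x| < d].
  exact: (@near_dist (R * R * R)%type x d d0).
exists chi; split=> //.
move=> f g Cf f0 Cg; pose f1 y := f y * chi y; have Cf1 : surfCk 1 M f1 := surfCkM Cf Cc.
have sub2 : box u0 (2 * r) `<=` A.
  by move=> v /boxE bv; apply: rA; apply/boxE; apply: le_trans bv _; rewrite ler_pM2r// ler_nat.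
have inb v : U v -> f1 (phi v) != 0 -> `|v - u0| <= r / 2.
  move=> Uv; rewrite mulf_eq0 negb_or => /andP[_ /chin cv].
  have [|w [Uw /boxE bw] E] := dM (phi v) _ (chart_sub c Uv); first by rewrite /ball_ /= distrC.
  by rewrite -(chart_inj c _ _ E) ?inE.
pose B := phi @` box u0 (2 * r).
have cB : compact B by apply: (chart_compact_image c (@box_compact R u0 _)); exact: subset_trans AU.
have BU : B `<=` phi @` U by move=> y [v bv <-]; exists v => //; exact/AU/sub2.
have BM : B `<=` M by move=> y /BU[v Uv <-]; exact: chart_sub c Uv.
have f1B y : M y -> f1 y != 0 -> (phi @` box u0 (r / 2)) y.
  move=> My f1y; have : chi y != 0 by move: f1y; rewrite mulf_eq0 negb_or => /andP[].
  move=> /chin cy; have [|w [Uw bw] E] := dM y _ My; first by rewrite /ball_ /= distrC.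
  by exists w.
have near_out (C : set (heis R)) y : compact C -> (forall z, M z -> f1 z != 0 -> C z) -> ~ C y ->
    \forall z \near y, M z -> f1 z = 0.
  move=> cC HC nC; have oC : open (~` C).
    exact: compact_openC.
  have : nbhs y (~` C) by exact: open_nbhs_nbhs.
  by apply: filterS => z nz Mz; apply/eqP; apply: contra_notT nz; exact: HC.
have cK' : forall z, M z -> f1 z != 0 -> K z.
  move=> z _; rewrite mulf_eq0 negb_or => /andP[fz _]; apply: contrapT => /f0 E.
  by rewrite E eqxx in fz.
rewrite (@integral_support _ _ _ (borel_area S) K B); first last.
- move=> y By nK; rewrite (jac_zero _ (BM _ By)) ?mul0r//.
  exact: (near_out K y).
- move=> y Ky nB; rewrite (jac_zero _ (KM Ky)) ?mul0r//.
  apply: (near_out (phi @` box u0 (r / 2))) => //.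
    apply: (chart_compact_image c (@box_compact R u0 _)).
    by move=> v /boxE bv; apply/AU/sub2/boxE; apply: (le_trans bv); lra.
  move=> [v /boxE bv E]; apply: nB; exists v => //; apply/boxE; apply: (le_trans bv); lra.
have mB := heis_compact_measurable cB.
have mJ : measurable_fun B (jac f1 g).
  exact: surf_continuous_measurable CM (jac_continuous Cf1 Cg) mB BM.
rewrite (integral_hdens_chart CS nS (cS _ _ c) mB BU mJ).
have -> : U `&` phi @^-1` B = box u0 (2 * r).
  rewrite eqEsubset; split=> [v [Uv [w bw E]]|v bv]; last by split; [exact/AU/sub2|exists v].
  by rewrite -(chart_inj c _ _ E) ?inE//; exact/AU/sub2.
(* The function in the chart, extended by zero to the whole plane; it is of class C^1 because it
   vanishes near every point outside the inner box. *)
pose F v := if v \in A then f1 (phi v) else 0.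
have FE v : A v -> F v = f1 (phi v) by move=> Av; rewrite /F mem_set.
have F0 v : ~ box u0 (r / 2) v -> F v = 0.
  move=> nb; rewrite /F; case: ifPn => //; rewrite inE => /AU Uv; apply/eqP.
  by apply: contra_notT nb => /(inb v Uv) H; apply/boxE.
have CF : Ck 1 setT F.
  apply: Ck_local => v _; have [Av|nAv] := pselect (A v).
    exists A; split=> //; apply: (Ck_ext oA) (Ck_subset AU (Cf1 _ _ c)) => w Aw.
    by rewrite FE.
  exists (~` box u0 (r / 2)); split.
  - exact: (compact_openC (@box_compact R u0 (r / 2))).
  - by move=> /boxE bv; apply: nAv; apply/sub2/boxE; apply: (le_trans bv); lra.
  - have oC : open (~` box u0 (r / 2)).
      exact: (compact_openC (@box_compact R u0 (r / 2))).
    have C0 : Ck 1 (~` box u0 (r / 2)) (fun=> 0 : R) by exact: Ck_cst.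
    by apply: (Ck_ext oC _ C0) => w /F0 ->.
have F0' v : r <= `|v - u0| -> F v = 0.
  by move=> rv; apply: F0 => /boxE bv; have := le_trans rv bv; lra.
have := plane_exact r0 oA rA CF F0' (Ck_subset AU (Cg _ _ c)).
set s := chart_sign N phi u0 => P0.
have PE v : box u0 (2 * r) v -> jac f1 g (phi v) * hor_element phi v =
    s * ('D_(1, 0) F v * 'D_(0, 1) (g \o phi) v - 'D_(0, 1) F v * 'D_(1, 0) (g \o phi) v).
  move=> /sub2 Av; have Uv := AU _ Av.
  have nF : \forall z \near v, (f1 \o phi) z = F z.
    by have : nbhs v A by [exact: open_nbhs_nbhs]; apply: filterS => z /FE ->.
  have DF w : 'D_w (f1 \o phi) v = 'D_w F v := near_eq_derive w nF.
  have := jac_chart reg c Uv ((Cf1 _ _ c).1 v Uv) ((Cg _ _ c).1 v Uv).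
  by rewrite (sA v Av) !DF.
transitivity (\int[leb]_(v in box u0 (2 * r)) (s%:E *
   ('D_(1, 0) F v * 'D_(0, 1) (g \o phi) v - 'D_(0, 1) F v * 'D_(1, 0) (g \o phi) v)%:E))%E.
  by apply: eq_integral => v; rewrite inE => bv; rewrite (PE v bv) EFinM.
have cJ v : box u0 (2 * r) v -> {for v, continuous (fun v =>
    'D_(1, 0) F v * 'D_(0, 1) (g \o phi) v - 'D_(0, 1) F v * 'D_(1, 0) (g \o phi) v)}.
  move=> /sub2 /AU Uv; have cF w := CF.2 w v I; have cg w := (Cg _ _ c).2 w v Uv.
  exact: cvgB (cvgM (cF (1, 0)) (cg (0, 1))) (cvgM (cF (0, 1)) (cg (1, 0))).
have iJ := box_integrable cJ.
rewrite (@integralZl _ _ _ (lebesgue_measure \x lebesgue_measure)%E _ (box_measurable u0 (2 * r)) _ iJ).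
by rewrite P0 mule0.
Qed.

(** A partition of unity in disguise: by compactness the local cutoffs add up to one function [chi],
    positive on [K], for which the statement holds with [f * chi] in place of [f]. It is then
    applied to [f / chi]. *)
Theorem exactness f g : surfCk 1 M f -> (forall y, ~ K y -> f y = 0) -> surfCk 1 M g ->
  (\int[borel_area S]_(y in K) (jac f g y * hdens N y)%:E = 0)%E.
Proof.
move=> Cf f0 Cg.
pose P A := exists chi : heis R -> R, [/\ surfCk 1 M chi, forall y, 0 <= chi y,
    forall y, A y -> 0 < chi y &
    forall f g, surfCk 1 M f -> (forall y, ~ K y -> f y = 0) -> surfCk 1 M g ->
    (\int[borel_area S]_(y in K) (jac (fun y => f y * chi y) g y * hdens N y)%:E = 0)%E].
have [chi [Cc c0 cp I0]] : P K; last first.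
  (* Near a point of [K] the denominator is positive, and near a point off [K] the numerator is
     identically zero; so the quotient is of class C^1 even where [chi] vanishes. *)
  have Cq : surfCk 1 M (fun y => f y / chi y).
    move=> U phi c; have [oU _ _ _ _] := c; apply: Ck_local => u Uu.
    have [Ku|nK] := pselect (K (phi u)).
      pose A := interior [set v | U v /\ 0 < chi (phi v)].
      have oA : open A by exact: open_interior.
      have nA : nbhs u [set v | U v /\ 0 < chi (phi v)].
        have nU : \forall v \near u, U v by exact: open_nbhs_nbhs.
        move: (CkS (Cc _ _ c) u Uu : (chi \o phi) @ u --> chi (phi u)) => /cvgr_gt -/(_ _ (cp _ Ku)) nc.
        by apply: filterS2 nU nc => v ? ?; split.
      exists A; split; [exact: oA|exact: nA|].
      have nz v : A v -> chi (phi v) != 0 by move=> /interior_subset[_ v0]; rewrite gt_eqF.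
      have CA (h : heis R -> R) : surfCk 1 M h -> Ck 1 A (h \o phi).
        by move=> Ch; apply: Ck_subset (Ch _ _ c) => v /interior_subset[].
      exact: CkM oA (CA _ Cf) (Ck1_inv oA nz (CA _ Cc)).
    have oK : open (~` K) := compact_openC cK.
    have oA := chart_preimage_open c oK.
    exists (U `&` phi @^-1` (~` K)); split=> //.
    have C0 : Ck 1 (U `&` phi @^-1` (~` K)) (fun=> 0 : R) by exact: Ck_cst.
    by apply: (Ck_ext oA _ C0) => v [_ /f0 fv]; rewrite /= fv mul0r.
  have := I0 (fun y => f y / chi y) g Cq _ Cg; rewrite (_ : (fun y => f y / chi y * chi y) = f).
    by apply=> y nK; rewrite f0 ?mul0r.
  apply/funext => y; have [Ky|nK] := pselect (K y); last by rewrite f0 ?mul0r.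
  by rewrite divfK// gt_eqF ?cp.
apply: (@compact_ind _ _ P cK).
- exists (fun=> 0); split; [|by []|by move=> y []|].
    by move=> U phi c; have [oU _ _ _ _] := c; exact: Ck_cst.
  move=> f1 g1 _ _ _; have jz (y : R * R * R) : M y -> jac (fun y => f1 y * 0) g1 y = 0.
    move=> My; apply: jac_zero; first exact: My.
    by apply: filterS (near_dist y ltr01) => z _ _; rewrite mulr0.
  rewrite -[RHS](integral0 (borel_area S) K); apply: eq_integral => y.
  by rewrite inE => /KM /jz ->; rewrite mul0r.
- move=> A B [c1 [C1 p1 q1 I1]] [c2 [C2 p2 q2 I2]]; exists (fun y => c1 y + c2 y); split.
  + exact: surfCkD.
  + by move=> y; rewrite addr_ge0.
  + by move=> y [/q1|/q2] H; [rewrite ltr_pwDl|rewrite ltr_wpDl].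
  + move=> f1 g1 Cf1 f10 Cg1.
    have J1 := jac_integrable (surfCkM Cf1 C1) Cg1; have J2 := jac_integrable (surfCkM Cf1 C2) Cg1.
    transitivity (\int[borel_area S]_(y in K) ((jac (fun y => f1 y * c1 y) g1 y * hdens N y)%:E +
        (jac (fun y => f1 y * c2 y) g1 y * hdens N y)%:E))%E.
      apply: eq_integral => y; rewrite inE => /KM My; rewrite -EFinD -mulrDl; congr (_ * _)%:E.
      rewrite /jac (_ : (fun y => f1 y * (c1 y + c2 y)) = (fun y => f1 y * c1 y + f1 y * c2 y)).
        have [-> ->] := dZE_add (surfCkM Cf1 C1) (surfCkM Cf1 C2) My; ring.
      by apply/funext => z; rewrite mulrDr.
    rewrite (integralD (heis_compact_measurable cK) J1 J2).
    by rewrite [X in (X + _)%E]I1// [X in (_ + X)%E]I2// adde0.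
- by move=> A B AB [c1 [C1 p1 q1 I1]]; exists c1; split=> // y /AB; exact: q1.
- exact: exact_local.
Qed.

End exactness.

(** * Deformed surfaces *)

Section deformation.
Context {R : realType}.
Implicit Types (S M D K : set (heis R)) (U : set (R * R)) (phi : R * R -> heis R) (f : heis R -> R).

(** The complement of [K] and the relatively open set [M] cover [S]; on the former the function is
    zero, so it extends across the characteristic points. *)
Lemma surfCk_extend k S M (W : set (heis R)) K f : M = S `&` W -> open W -> compact K -> K `<=` M ->
  (forall g, ~ K g -> f g = 0) -> surfCk k M f -> surfCk k S f.
Proof.
move=> ME oW cK KM f0 Cf U phi c; have [oU _ _ _ _] := c; apply: Ck_local => u Uu.
have [Ku|nK] := pselect (K (phi u)).
  have oA := chart_preimage_open c oW; have Mu := KM _ Ku.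
  exists (U `&` phi @^-1` W); split=> //; first by move: Mu; rewrite ME => -[_ Wu]; split.
  apply: Cf; rewrite ME; apply: chart_inter => //; last by move=> _ [v [_ Wv] <-].
  by apply: chart_restrict c oA _ => v [].
have oA := chart_preimage_open c (compact_openC cK).
exists (U `&` phi @^-1` (~` K)); split=> //.
have C0 : Ck k (U `&` phi @^-1` (~` K)) (fun=> 0 : R) by exact: Ck_cst.
by apply: (Ck_ext oA _ C0) => v [_ /f0 fv]; rewrite /= fv.
Qed.

(** Composed with a left inverse [p] of its derivative, [phi] becomes strictly differentiable with
    derivative the identity, so near [u] the increments of [p \o phi] differ from those of the
    identity by at most half the distance. *)
Lemma chart_inverse_lipschitz S U phi u : chart S U phi -> U u ->
  exists2 C, 0 < C & exists2 d, 0 < d &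
    forall x y, `|x - u| < d -> `|y - u| < d -> `|x - y| <= C * `|phi x - phi y|.
Proof.
move=> c Uu; have s := chart_sdiff c Uu; have cg := chart_cross_gt0 c Uu (phi u).
move: ('D_(1, 0) phi u) ('D_(0, 1) phi u) s cg => A B s cg.
pose p : {linear heis R -> (R * R)%type} := left_inverse_fun (phi u) A B.
have [C C0 pC] := heis_linear_bounded p; have [p1 p2] := left_inverseE cg.
have sp := @sdiff_left_inverse R _ phi u A B p C C0 pC p1 p2 s.
have h2 : 0 < 2^-1 :> R by rewrite invr_gt0.
have [d d0 H] := sp _ h2.
exists (2 * C); first by rewrite mulr_gt0.
exists d => // x y xd yd; have := H x y xd yd.
have -> : (x.1 - y.1) *: ((1, 0) : R * R) + (x.2 - y.2) *: (0, 1) = x - y.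
  case: x y {xd yd} => [x1 x2] [y1 y2] /=.
  rewrite -[LHS]/((x1 - y1) * 1 + (x2 - y2) * 0, (x1 - y1) * 0 + (x2 - y2) * 1).
  by rewrite !mulr1 !mulr0 addr0 add0r.
move=> H1; have H2 : `|p (phi x) - p (phi y)| <= C * `|phi x - phi y| by rewrite -linearB.
have := ler_normB (p (phi x) - p (phi y)) (p (phi x) - p (phi y) - (x - y)).
rewrite subKr; move: H1 H2; rewrite /=; set n1 := `|_ - (x - y)|; set n2 := `|p _ - p _|; set n3 := `|x - y|; set n4 := `|phi x - phi y|.
by move=> H1 H2 H3; lra.
Qed.

(** The distance is that of R^3, not the intrinsic one. Points closer than a uniform [d] lie in one
    chart, where the function and the inverse of the chart are both Lipschitz; for points farther
    apart the bound [B] on the function suffices. *)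
Lemma surf_lipschitz S K f : C2_surface S -> compact K -> K `<=` S -> surfCk 1 S f ->
  (forall g, ~ K g -> f g = 0) ->
  exists2 L, 0 < L & forall g h, S g -> S h -> `|f g - f h| <= L * `|g - h|.
Proof.
move=> CS cK KS Cf f0.
have cf : surf_continuous S f by move=> U phi c; exact: CkS (Cf _ _ c).
have [B B0 HB] := surf_compact_bounded CS cf cK KS.
have {}HB g : `|f g| <= B by have [/HB//|/f0 ->] := pselect (K g); rewrite normr0 ltW.
pose P A := exists L d, [/\ 0 < L, 0 < d & forall g h, A g -> S g -> S h -> `|g - h| < d ->
   `|f g - f h| <= L * `|g - h|].
suff [L [d [L0 d0 H]]] : P K.
  have M0 : 0 < Num.max L (2 * B / d) by rewrite lt_max L0.
  exists (Num.max L (2 * B / d)) => //.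
  have H1 g h : K g -> S h -> `|f g - f h| <= Num.max L (2 * B / d) * `|g - h|.
    move=> Kg Sh; have [gd|gd] := ltP `|g - h| d.
      apply: (le_trans (H g h Kg (KS _ Kg) Sh gd)); rewrite ler_wpM2r// le_max lexx //.
    apply: (@le_trans _ _ (2 * B / d * `|g - h|)); last by rewrite ler_wpM2r// le_max lexx orbT.
    apply: (le_trans (ler_normB _ _)); apply: (@le_trans _ _ (2 * B)).
      by rewrite mulrDl !mul1r lerD.
    by rewrite -mulrA ler_pMr ?mulr_gt0// mulrC ler_pdivlMr// mul1r.
  move=> g h Sg Sh; have [Kg|nKg] := pselect (K g); first exact: H1.
  have [Kh|nKh] := pselect (K h); first by rewrite distrC [`|g - h|]distrC; exact: H1.
  by rewrite !f0// subrr normr0 mulr_ge0// ltW.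
apply: (@compact_ind _ _ P cK).
- by exists 1, 1; split.
- move=> A1 A2 [L1 [d1 [L10 d10 H1]]] [L2 [d2 [L20 d20 H2]]].
  exists (L1 + L2), (Num.min d1 d2); split; [exact: addr_gt0|by rewrite lt_min d10|].
  move=> g h [Ag|Ag] Sg Sh; rewrite lt_min => /andP[g1 g2].
  + by apply: (le_trans (H1 g h Ag Sg Sh g1)); rewrite ler_wpM2r// lerDl ltW.
  + by apply: (le_trans (H2 g h Ag Sg Sh g2)); rewrite ler_wpM2r// lerDr ltW.
- by move=> A1 A2 sA [L [d [L0 d0 H]]]; exists L, d; split=> // g h /sA; exact: H.
- move=> x /KS Sx; have [U [phi [c [u Uu ux]]]] := CS x Sx; have [oU _ _ _ _] := c.
  have [df Df] := Cf _ _ c; have nU : nbhs u U by exact: open_nbhs_nbhs.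
  have sf := sdiff_real nU df (Df (1, 0) u Uu) (Df (0, 1) u Uu).
  have [C1 C10 [d1 d10 H1]] := sdiff_lipschitz sf.
  have [C2 C20 [d2 d20 H2]] := chart_inverse_lipschitz c Uu.
  have nd : nbhs u [set v | `|v - u| < Num.min d1 d2].
    by apply: (@near_dist R (R * R)%type u); rewrite lt_min d10.
  have := chart_image_near c Uu nd; rewrite ux => /nbhs_normP[d /= d0 Hd].
  exists [set y | `|y - x| < d / 2].
    by apply: (@near_dist R (R * R * R)%type x); rewrite divr_gt0.
  exists (C1 * C2), (d / 2); split; [exact: mulr_gt0|by rewrite divr_gt0|].
  move=> g h gx Sg Sh gh.
  have gd : `|g - x| < d by apply: (lt_trans gx); rewrite ltr_pdivrMr// ltr_pMr// ltr1n.
  have hd : `|h - x| < d.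
    have -> : h - x = (g - x) - (g - h) by rewrite opprB [RHS]addrC addrA subrK.
    by apply: (le_lt_trans (ler_normB _ _)); rewrite [d]splitr; exact: ltrD.
  have [|v [Uv]] := Hd g _ Sg; first by rewrite /ball_ /= distrC.
  rewrite /= lt_min => /andP[v1 v2] <-.
  have [|w [Uw]] := Hd h _ Sh; first by rewrite /ball_ /= distrC.
  rewrite /= lt_min => /andP[w1 w2] <-.
  apply: (le_trans (H1 v w v1 w1)); rewrite -mulrA ler_wpM2l ?(ltW C10)//.
  exact: H2.
Qed.

(** The lower Lipschitz bound alone yields whatever is needed of the image chart besides smoothness:
    injectivity, the immersion property by passing to difference quotients, relative openness, and
    continuity of the inverse. *)
Lemma chart_image D U phi (F : heis R -> heis R) : chart D U phi -> Ck 2 U (F \o phi) ->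
  (forall g h, D g -> D h -> `|g - h| <= 2 * `|F g - F h|) -> chart (F @` D) U (F \o phi).
Proof.
move=> c CF biL; have [oU Cp imm [W oW WE] [psi /subspace_continuousP cpsi psiK]] := c.
have sub u : U u -> D (phi u) := chart_sub c.
have injF g h : D g -> D h -> F g = F h -> g = h.
  move=> Dg Dh E; apply/eqP; rewrite -subr_eq0 -normr_le0.
  by apply: (le_trans (biL g h Dg Dh)); rewrite E subrr normr0 mulr0.
split=> //.
- move=> u w Uu D0; apply: imm (Uu) _; apply/eqP; rewrite -normr_le0.
  have d1 : derivable phi u w by apply: diff_derivable; exact: Cp.1.
  have d2 : derivable (F \o phi) u w by apply: diff_derivable; exact: CF.1.
  have c1 : (fun h : R => `|h^-1 *: ((phi \o shift u) (h *: w) - phi u)|) @ (0 : R)^' --> `|'D_w phi u|.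
    by apply: cvg_norm; exact: d1.
  have c2 : (fun h : R => 2 * `|h^-1 *: (((F \o phi) \o shift u) (h *: w) - (F \o phi) u)|) @ (0 : R)^'
      --> 2 * `|'D_w (F \o phi) u|.
    by apply: cvgM; [exact: cvg_cst|apply: cvg_norm; exact: d2].
  rewrite D0 normr0 mulr0 in c2; apply: (ler_cvg_to c1 c2).
  have nU : \forall h \near (0 : R), U (h *: w + u).
    have ch : (fun h : R => h *: w + u) @ (0 : R) --> (0 : R) *: w + u.
      by apply: cvgD; [apply: cvgZr_tmp; exact: cvg_id|exact: cvg_cst].
    by apply: ch; rewrite scale0r add0r; exact: open_nbhs_nbhs.
  apply: nbhs_dnbhs; apply: filterS nU => h Uh /=.
  by rewrite !normrZ mulrCA ler_wpM2l//; apply: biL; exact: sub.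
- exists (interior [set y | (F @` D) y -> ((F \o phi) @` U) y]); first exact: open_interior.
  rewrite eqEsubset; split=> [_ [u Uu <-]|y [Dy /interior_subset]]; last exact.
  split; first by exists (phi u) => //; exact: sub.
  have : nbhs (phi u) W.
    apply: open_nbhs_nbhs; split=> //; have : (phi @` U) (phi u) by exists u.
    by rewrite WE => -[].
  move=> /nbhs_normP[r /= r0 rW].
  have r20 : 0 < r / 2 by rewrite divr_gt0.
  apply: filterS (@near_dist R (R * R * R)%type (F (phi u)) (r / 2) r20) => y yr [g Dg gy].
  have : (D `&` W) g.
    split=> //; apply: rW; rewrite /ball_ /= distrC.
    apply: (le_lt_trans (biL _ _ Dg (sub _ Uu))).
    by rewrite gy mulrC -ltr_pdivlMr.
  by rewrite -WE => -[v Uv vg]; exists v => //=; rewrite vg.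
- exists (fun y => psi (xget (phi point) [set g | D g /\ F g = y])); last first.
    move=> u Uu; case: xgetP => [g _ [Dg Fg]|/(_ (phi u))[]]; last by split=> //; exact: sub.
    by rewrite (injF g (phi u) Dg (sub _ Uu) Fg) psiK.
  have xE u : U u -> xget (phi point) [set g | D g /\ F g = F (phi u)] = phi u.
    move=> Uu; case: xgetP => [g _ [Dg Fg]|/(_ (phi u))[]]; last by split=> //; exact: sub.
    exact: injF Dg (sub _ Uu) Fg.
  apply/subspace_continuousP => _ [u Uu <-] V nV0.
  have nV : nbhs (psi (phi u)) V by rewrite -{1}(xE u Uu).
  have iu : (phi @` U) (phi u) by exists u.
  have : \forall g \near phi u, (phi @` U) g -> V (psi g) by exact: (cpsi _ iu).
  move=> /nbhs_normP[r /= r0 rV]; have r20 : 0 < r / 2 by rewrite divr_gt0.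
  apply: filterS (@near_dist R (R * R * R)%type (F (phi u)) (r / 2) r20) => y yr [v Uv vy].
  have {}vy : F (phi v) = y := vy.
  have E : psi (xget (phi point) [set g | D g /\ F g = y]) = psi (phi v) by rewrite -vy (xE v Uv).
  suff : V (psi (phi v)) by rewrite -E.
  apply: rV; last by exists v.
  rewrite /ball_ /= distrC; apply: (le_lt_trans (biL _ _ (sub _ Uv) (sub _ Uu))).
  by rewrite vy mulrC -ltr_pdivlMr.
Qed.

Variables (a b k : heis R -> R).
Local Notation X := (variation_field a b k).

Lemma variation_fieldE g : X g = (a g, b g, k g + 2^-1 * (b g * g.1.1) + - 2^-1 * (a g * g.1.2)).
Proof.
apply/eqP; rewrite -subr_eq0; apply/eqP; apply: (@frame_eq0 _ g).
- by rewrite /variation_field /X1 /X2 /Tfield /= -![_ *: _]/(_ * _); ring.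
- by rewrite /variation_field /X1 /X2 /Tfield /= -![_ *: _]/(_ * _); ring.
- by rewrite /variation_field /theta /X1 /X2 /Tfield /= -![_ *: _]/(_ * _); field.
Qed.

Definition deform_map (l : R) (g : heis R) : heis R := g + l *: X g.

Variables (S K : set (heis R)).
Hypotheses (CS : C2_surface S) (cK : compact K) (KS : K `<=` S).
Hypotheses (Ca : surfCk 2 S a) (Cb : surfCk 2 S b) (Ck_ : surfCk 2 S k).
Hypothesis abk0 : forall g, ~ K g -> [/\ a g = 0, b g = 0 & k g = 0].

Lemma variation_third_Ck : surfCk 2 S (fun g => k g + 2^-1 * (b g * g.1.1) + - 2^-1 * (a g * g.1.2)).
Proof.
move=> U phi c; have [oU C2 _ _ _] := c; have [Cx Cy _] := Ck_coord oU C2.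
have h (x : R) : Ck 2 U (fun=> x) by exact: Ck_cst.
have C1 := CkD oU (Ck_ c) (CkM oU (h 2^-1) (CkM oU (Cb c) Cx)).
exact: (CkD oU C1 (CkM oU (h (- 2^-1)) (CkM oU (Ca c) Cy))).
Qed.

Lemma deform_chart_Ck l U phi : chart S U phi -> Ck 2 U (deform_map l \o phi).
Proof.
move=> c; have [oU C2 _ _ _] := c.
apply: (Ck_ext oU) (CkD oU C2 (CkZ l oU (Ck_pair oU (Ck_pair oU (Ca c) (Cb c))
  (variation_third_Ck c)))) => u _.
by rewrite /deform_map /= variation_fieldE.
Qed.

Lemma deform_bilipschitz : exists2 e, 0 < e & forall l, `|l| < e -> forall g h, S g -> S h ->
  `|g - h| <= 2 * `|deform_map l g - deform_map l h|.
Proof.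
have lip f : surfCk 2 S f -> (forall g, ~ K g -> f g = 0) ->
    exists2 L, 0 < L & forall g h, S g -> S h -> `|f g - f h| <= L * `|g - h|.
  by move=> Cf; apply: surf_lipschitz => // U phi c; exact: CkS (Cf _ _ c).
have [L1 L10 H1] := lip a Ca (fun g nK => let: And3 x _ _ := abk0 nK in x).
have [L2 L20 H2] := lip b Cb (fun g nK => let: And3 _ x _ := abk0 nK in x).
have [|L3 L30 H3] := lip _ variation_third_Ck.
  by move=> g /abk0[-> -> ->]; rewrite !mul0r !mulr0 !addr0.
pose L := L1 + L2 + L3; have L0 : 0 < L by rewrite !addr_gt0.
have HX g h : S g -> S h -> `|X g - X h| <= L * `|g - h|.
  move=> Sg Sh; rewrite !variation_fieldE !prod_normr !ge_max /=.
  have n0 : 0 <= `|g - h| by [].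
  have l1 : 0 <= L1 * `|g - h| by rewrite mulr_ge0// ltW.
  have l2 : 0 <= L2 * `|g - h| by rewrite mulr_ge0// ltW.
  have l3 : 0 <= L3 * `|g - h| by rewrite mulr_ge0// ltW.
  rewrite /L !mulrDl; apply/andP; split; [apply/andP; split|].
  + by apply: (le_trans (H1 g h Sg Sh)); rewrite -addrA lerDl addr_ge0.
  + by apply: (le_trans (H2 g h Sg Sh)); rewrite addrAC lerDr addr_ge0.
  + by apply: (le_trans (H3 g h Sg Sh)); rewrite lerDr addr_ge0.
(* For such [l] the displacement has Lipschitz constant at most 1/2, so the map shortens distances
   at most by the factor 2. *)
exists (2 * L)^-1; first by rewrite invr_gt0 mulr_gt0.
move=> l ll g h Sg Sh.
have -> : deform_map l g - deform_map l h = (g - h) + l *: (X g - X h).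
  by rewrite /deform_map scalerBr opprD addrACA.
have H : `|l *: (X g - X h)| <= 2^-1 * `|g - h|.
  rewrite normrZ; apply: (@le_trans _ _ ((2 * L)^-1 * (L * `|g - h|))).
    by apply: ler_pM => //; [exact: ltW|exact: HX].
  by rewrite mulrA invfM mulfVK ?gt_eqF.
have := lerB_normD (g - h) (l *: (X g - X h)).
move: H; move: (`|l *: _|) (`|g - h|) (`|_ + _|) => n1 n2 n3; lra.
Qed.

Lemma derive_addl (V : normedModType R) (f g : V -> R) (l : R) (u w : V) : differentiable f u -> differentiable g u ->
  differentiable (fun z => f z + l * g z) u /\
  'D_w (fun z => f z + l * g z) u = 'D_w f u + l * 'D_w g u.
Proof.
move=> df dg; have dl : differentiable (l \*: g) u by exact: differentiableZ.
split; first exact: differentiableD df dl.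
have -> : (fun z => f z + l * g z) = f + (l \*: g) by [].
rewrite deriveD; [|exact: diff_derivable..].
by rewrite deriveZ//; exact: diff_derivable.
Qed.

Lemma deform_mapE l g : deform_map l g = (g.1.1 + l * a g, g.1.2 + l * b g,
  g.2 + l * (k g + 2^-1 * (b g * g.1.1) + - 2^-1 * (a g * g.1.2))).
Proof. by rewrite /deform_map variation_fieldE. Qed.

(** The contact form is taken at the displaced point. The displacement of the base point and that of
    the vector combine into a term of second order in [l], while the horizontal coordinates stay
    affine. *)
Lemma deform_derive l U phi u w : chart S U phi -> U u ->
  let v := 'D_w phi u in let v' := 'D_w (deform_map l \o phi) u in
  let da := 'D_w (a \o phi) u in let db := 'D_w (b \o phi) u in let dk := 'D_w (k \o phi) u in
  [/\ v'.1.1 = v.1.1 + l * da, v'.1.2 = v.1.2 + l * db &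
    theta (deform_map l (phi u)) v' = theta (phi u) v +
      l * (dk + b (phi u) * v.1.1 - a (phi u) * v.1.2) -
      l ^+ 2 / 2 * (a (phi u) * db - b (phi u) * da)].
Proof.
move=> c Uu v v' da db dk; have [oU C2 _ _ _] := c.
have dp := C2.1 u Uu; have dF := (deform_chart_Ck l c).1 u Uu.
have ea := (Ca c).1 u Uu; have eb := (Cb c).1 u Uu; have ek := (Ck_ c).1 u Uu.
have [px Px] := @derive_linear R (R * R)%type _ _ (@coord_x R) phi u w (@coord_x_continuous R) dp.
have [py Py] := @derive_linear R (R * R)%type _ _ (@coord_y R) phi u w (@coord_y_continuous R) dp.
have [pt Pt] := @derive_linear R (R * R)%type _ _ (@coord_t R) phi u w (@coord_t_continuous R) dp.
have [_ Fx] := @derive_linear R (R * R)%type _ _ (@coord_x R) _ u w (@coord_x_continuous R) dF.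
have [_ Fy] := @derive_linear R (R * R)%type _ _ (@coord_y R) _ u w (@coord_y_continuous R) dF.
have [_ Ft] := @derive_linear R (R * R)%type _ _ (@coord_t R) _ u w (@coord_t_continuous R) dF.
have E1 : v'.1.1 = v.1.1 + l * da.
  rewrite -[LHS]Fx -[v.1.1]Px -(derive_addl l w px ea).2; congr ('D_w _ u); apply/funext => z.
  exact: (congr1 (fun g : heis R => g.1.1) (deform_mapE l (phi z))).
have E2 : v'.1.2 = v.1.2 + l * db.
  rewrite -[LHS]Fy -[v.1.2]Py -(derive_addl l w py eb).2; congr ('D_w _ u); apply/funext => z.
  exact: (congr1 (fun g : heis R => g.1.2) (deform_mapE l (phi z))).
have [dbx Dbx] := derive_mul w eb px; have [day Day] := derive_mul w ea py.
have [d1 D1] := derive_addl 2^-1 w ek dbx; have [d2 D2] := derive_addl (- 2^-1) w d1 day.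
have E3 : v'.2 = v.2 + l * (dk + 2^-1 * (db * (phi u).1.1 + b (phi u) * v.1.1) +
    - 2^-1 * (da * (phi u).1.2 + a (phi u) * v.1.2)).
  have [_ D3] := derive_addl l w pt d2; move: D3; rewrite D2 D1 Dbx Day Pt Px Py => <-.
  rewrite -[LHS]Ft; congr ('D_w _ u); apply/funext => z.
  exact: (congr1 (fun g : heis R => g.2) (deform_mapE l (phi z))).
have alg (g F x x' : heis R) (A B p q s : R) : F.1.1 = g.1.1 + l * A -> F.1.2 = g.1.2 + l * B ->
    x'.1.1 = x.1.1 + l * p -> x'.1.2 = x.1.2 + l * q ->
    x'.2 = x.2 + l * (s + 2^-1 * (q * g.1.1 + B * x.1.1) + - 2^-1 * (p * g.1.2 + A * x.1.2)) ->
    theta F x' = theta g x + l * (s + B * x.1.1 - A * x.1.2) - l ^+ 2 / 2 * (A * q - B * p).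
  rewrite /theta => -> -> -> -> ->.
  by move: x.1.1 x.1.2 x.2 g.1.1 g.1.2 => *; field.
have F1 : (deform_map l (phi u)).1.1 = (phi u).1.1 + l * a (phi u) by rewrite deform_mapE.
have F2 : (deform_map l (phi u)).1.2 = (phi u).1.2 + l * b (phi u) by rewrite deform_mapE.
exact: And3 E1 E2 (alg _ _ _ _ _ _ _ _ _ F1 F2 E1 E2 E3).
Qed.

End deformation.

(** * The perimeter of the deformed surface as an integral over the original one *)

Section perimeter.
Context {R : realType}.
Implicit Types (U : set (R * R)) (phi : R * R -> heis R) (f : heis R -> R) (g : heis R).

Local Notation leb := (lebesgue_measure \x lebesgue_measure)%E.

Variables (S M D K W : set (heis R)) (N : heis R -> heis R) (a b k : heis R -> R).
Hypotheses (reg : regular_part S M N) (CS : C2_surface S) (nS : normal_field S N).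
Hypotheses (oW : open W) (DE : D = S `&` W).
Hypotheses (cK : compact K) (KM : K `<=` M) (KD : K `<=` D).
Hypotheses (Ca : surfCk 2 S a) (Cb : surfCk 2 S b) (Ck_ : surfCk 2 S k).
Hypothesis abk0 : forall g, ~ K g -> [/\ a g = 0, b g = 0 & k g = 0].

Local Notation dZ := (dZ S N).
Local Notation dE := (dE S N).
Local Notation p := (pbar N).
Local Notation q := (qbar N).
Local Notation w := (omegabar N).
Local Notation Phi := (deform_map a b k).

(* The frame coordinates of the images of [Zfield] and [Efield] under the differential of
   [deform_map l]; [defP] and [defQ] are the horizontal coordinates of their cross product. *)
Definition deform_theta (l A B th x1 x2 da db dk : R) : R :=
  th + l * (dk + B * x1 - A * x2) - l ^+ 2 / 2 * (A * db - B * da).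

Definition defZ3 l g := deform_theta l (a g) (b g) 0 (q g) (- p g) (dZ a g) (dZ b g) (dZ k g).
Definition defE3 l g := deform_theta l (a g) (b g) (-1) (w g * p g) (w g * q g) (dE a g) (dE b g) (dE k g).
Definition defP l g := (- p g + l * dZ b g) * defE3 l g - defZ3 l g * (w g * q g + l * dE b g).
Definition defQ l g := defZ3 l g * (w g * p g + l * dE a g) - (q g + l * dZ a g) * defE3 l g.
(** The density of the deformed perimeter relative to sigma_H. Outside [K], where nothing moves, the
    value 1 is prescribed, because the formula makes no sense at characteristic points. *)
Definition deform_ratio l g := if g \in K then Num.sqrt (defP l g ^+ 2 + defQ l g ^+ 2) else 1.

Lemma sub_regular U phi : chart M U phi -> chart S U phi.
Proof. by case: reg => + _ _ _ _; exact. Qed.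

Lemma regular_Ck n f : surfCk n S f -> surfCk n M f.
Proof. by move=> Cf U phi c; apply: Cf; exact: sub_regular. Qed.

(** In the deformed chart the images of [Zfield] and [Efield] have the coefficients that these
    fields have in [phi], so their cross product is that of the new coordinate vectors times the
    same determinant, which by [chart_coeff_det] is the inverse of [hor_element] up to sign. *)
Lemma hor_deform_regular l U phi u : chart M U phi -> U u ->
  (forall g h, S g -> S h -> `|g - h| <= 2 * `|Phi l g - Phi l h|) ->
  hor_element (Phi l \o phi) u =
    Num.sqrt (defP l (phi u) ^+ 2 + defQ l (phi u) ^+ 2) * hor_element phi u.
Proof.
move=> c Uu biL; have cS := sub_regular c.
have c' := chart_image cS (deform_chart_Ck Ca Cb Ck_ l cS) biL.
case: (reg) => _ _ _ _ W0; have Wu := W0 _ (chart_sub c Uu).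
have EZ := chart_coeffE reg c Uu (Zfield_tangent Wu); have EE := chart_coeffE reg c Uu (Efield_tangent Wu).
have dt f : surfCk 2 S f -> differentiable (f \o phi) u by move=> Cf; exact: (Cf _ _ cS).1.
have [Za Ea] := dZE_chart reg c Uu (dt a Ca); have [Zb Eb] := dZE_chart reg c Uu (dt b Cb).
have [Zk Ek] := dZE_chart reg c Uu (dt k Ck_).
have [z1 z2 z3] := deform_derive Ca Cb Ck_ l (chart_coeff (Zfield N) phi u) cS Uu.
have [e1 e2 e3] := deform_derive Ca Cb Ck_ l (chart_coeff (Efield N) phi u) cS Uu.
have [FZ1 FZ2 FZ3] := Zfield_frame N (phi u); have [FE1 FE2 FE3] := Efield_frame N (phi u).
have alg0 (F g X Y X' Y' : heis R) A B xa xb xk ya yb yk da db dk ea eb ek x1 x2 y1 y2 y3 :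
    X.1.1 = x1 -> X.1.2 = x2 -> theta g X = 0 -> Y.1.1 = y1 -> Y.1.2 = y2 -> theta g Y = y3 ->
    da = xa -> db = xb -> dk = xk -> ea = ya -> eb = yb -> ek = yk ->
    X'.1.1 = X.1.1 + l * xa -> X'.1.2 = X.1.2 + l * xb ->
    theta F X' = deform_theta l A B (theta g X) X.1.1 X.1.2 xa xb xk ->
    Y'.1.1 = Y.1.1 + l * ya -> Y'.1.2 = Y.1.2 + l * yb ->
    theta F Y' = deform_theta l A B (theta g Y) Y.1.1 Y.1.2 ya yb yk ->
    cross1 F X' Y' = (x2 + l * db) * deform_theta l A B y3 y1 y2 ea eb ek -
      deform_theta l A B 0 x1 x2 da db dk * (y2 + l * eb) /\
    cross2 F X' Y' = deform_theta l A B 0 x1 x2 da db dk * (y1 + l * ea) -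
      (x1 + l * da) * deform_theta l A B y3 y1 y2 ea eb ek.
  by rewrite /cross1 /cross2 => -> -> -> -> -> -> -> -> -> -> -> -> -> -> -> -> -> ->.
have pr (V : Type) (h : heis R -> V) x y r : x = y -> h x = r -> h y = r by move=> ->.
have [P1 P2] := alg0 _ _ _ _ _ _ _ _ _ _ _ _ _ _ _ _ _ _ _ _ _ _ _ _ _
  (pr _ (fun v => v.1.1) _ _ _ EZ FZ1) (pr _ (fun v => v.1.2) _ _ _ EZ FZ2)
  (pr _ (theta (phi u)) _ _ _ EZ FZ3)
  (pr _ (fun v => v.1.1) _ _ _ EE FE1) (pr _ (fun v => v.1.2) _ _ _ EE FE2)
  (pr _ (theta (phi u)) _ _ _ EE FE3) Za Zb Zk Ea Eb Ek z1 z2 z3 e1 e2 e3.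
have alg1 (F v w X Y : heis R) (x y : R * R) : X = x.1 *: v + x.2 *: w -> Y = y.1 *: v + y.2 *: w ->
    cross1 F X Y = (x.1 * y.2 - x.2 * y.1) * cross1 F v w /\
    cross2 F X Y = (x.1 * y.2 - x.2 * y.1) * cross2 F v w.
  by move=> -> ->; have [-> -> _] := cross_comb F v w x y.
have [X1 X2] := alg1 (Phi l (phi u)) _ _ _ _ _ _ (chart_derive (chart_coeff (Zfield N) phi u) c' Uu)
  (chart_derive (chart_coeff (Efield N) phi u) c' Uu).
have [s1 h0 _ _ _] := chart_unit_normal reg c Uu.
have alg (P Q c1 c2 d h s : R) : P = d * c1 -> Q = d * c2 -> `|s| = 1 -> 0 < h -> d * h = s ->
    Num.sqrt (c1 ^+ 2 + c2 ^+ 2) = Num.sqrt (P ^+ 2 + Q ^+ 2) * h.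
  move=> -> -> s1' h1 dh; rewrite !exprMn -mulrDr sqrtrM ?sqr_ge0// sqrtr_sqr mulrAC.
  by rewrite -[X in _ * X * _](gtr0_norm h1) -normrM dh s1' mul1r.
exact: (alg _ _ _ _ _ _ _ (etrans (esym P1) X1) (etrans (esym P2) X2) s1 h0 (chart_coeff_det reg c Uu)).
Qed.

Lemma near_derive_eq (V : normedModType R) (f1 f2 : R * R -> V) (u v : R * R) :
  (\forall z \near u, f1 z = f2 z) -> 'D_v f1 u = 'D_v f2 u.
Proof. exact: near_eq_derive. Qed.

(** The chart may meet the characteristic set. Over [K] it is exchanged locally for a chart of [M],
    both sides being multiplied by the absolute determinant of the transition; off [K] the
    deformation is the identity in a neighbourhood. *)
Lemma hor_deform l U phi u : chart S U phi -> U u ->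
  (forall g h, S g -> S h -> `|g - h| <= 2 * `|Phi l g - Phi l h|) ->
  hor_element (Phi l \o phi) u = deform_ratio l (phi u) * hor_element phi u.
Proof.
move=> c Uu biL; rewrite /deform_ratio; case: ifPn => [|]; rewrite ?inE ?notin_setE => Ku.
  case: (reg) => cM CM _ _ _; have [U' [phi' [c' [u' Uu' E]]]] := CM _ (KM Ku).
  have [t [T1 [T2 [tu st nt E1 E2]]]] := chart_transition c (cM _ _ c') Uu Uu' (esym E).
  have cD := chart_image c (deform_chart_Ck Ca Cb Ck_ l c) biL.
  have cD' := chart_image (cM _ _ c') (deform_chart_Ck Ca Cb Ck_ l (cM _ _ c')) biL.
  subst u'; have st' := chart_sdiff cD' Uu'; have scomp := sdiff_comp st st'.
  have nE : \forall v \near u, ((Phi l \o phi') \o t) v = (Phi l \o phi) v.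
    by apply: filterS nt => v [_ _ /= ->].
  have [F1 F2] := sdiff_unique (chart_sdiff cD Uu) (sdiff_near nE scomp).
  have H := hor_deform_regular c' Uu' biL.
  have sq (d c1 c2 : R) : Num.sqrt ((d * c1) ^+ 2 + (d * c2) ^+ 2) = `|d| * Num.sqrt (c1 ^+ 2 + c2 ^+ 2).
    by rewrite !exprMn -mulrDr sqrtrM ?sqr_ge0// sqrtr_sqr.
  have alg (x y v1 v2 v1' v2' w1 w2 w1' w2' : heis R) (r : heis R -> R) : y = x ->
      v1 = T1.1 *: v1' + T1.2 *: v2' -> v2 = T2.1 *: v1' + T2.2 *: v2' ->
      w1 = T1.1 *: w1' + T1.2 *: w2' -> w2 = T2.1 *: w1' + T2.2 *: w2' ->
      Num.sqrt (hor_sq (Phi l y) w1' w2') = r y * Num.sqrt (hor_sq y v1' v2') ->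
      Num.sqrt (hor_sq (Phi l x) w1 w2) = r x * Num.sqrt (hor_sq x v1 v2).
    move=> -> -> -> -> ->; rewrite /hor_sq.
    have [-> -> _] := cross_comb x v1' v2' T1 T2; have [-> -> _] := cross_comb (Phi l x) w1' w2' T1 T2.
    by rewrite !sq => ->; rewrite mulrCA.
  exact: (alg _ _ _ _ _ _ _ _ _ _ (fun x => Num.sqrt (defP l x ^+ 2 + defQ l x ^+ 2)) E E1 E2 F1 F2 H).
have oK := compact_openC cK.
have nE : \forall v \near u, (Phi l \o phi) v = phi v.
  have nK : \forall g \near phi u, ~ K g by exact: open_nbhs_nbhs.
  have cp : phi @ u --> phi u := chart_continuous c Uu.
  have := cp _ nK; rewrite /nbhs /=; apply: filterS => v /abk0[E1 E2 E3].
  rewrite /= deform_mapE E1 E2 E3 !mul0r !mulr0 !addr0 mulr0 !addr0.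
  by case: (phi v) => [[]].
rewrite mul1r /hor_element (near_derive_eq _ nE) (near_derive_eq (0, 1) nE).
by have := nbhs_singleton nE; rewrite /= => ->.
Qed.

Lemma ratio_ge0 l g : 0 <= deform_ratio l g.
Proof. by rewrite /deform_ratio; case: ifP. Qed.

Lemma frame_functions_continuous f : surfCk 2 S f -> surfCk 0 M (dZ f) /\ surfCk 0 M (dE f).
Proof. by move=> Cf; apply: dZE_Ck => // U phi c; exact: CkS (regular_Ck Cf c). Qed.

Lemma defPQ_continuous l : surfCk 0 M (defP l) /\ surfCk 0 M (defQ l).
Proof.
have [za ea] := frame_functions_continuous Ca; have [zb eb] := frame_functions_continuous Cb.
have [zk ek] := frame_functions_continuous Ck_.
have C0 f : surfCk 2 S f -> surfCk 0 M f by move=> Cf U phi c; exact: CkS (CkS (regular_Ck Cf c)).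
have [p1 q1 w1] := unit_normal_Ck reg.
have Cc (x : R) : surfCk 0 M (fun=> x) by move=> U phi c; have [oU _ _ _ _] := c; exact: Ck_cst.
have Cp : surfCk 0 M p by move=> U phi c; exact: CkS (p1 _ _ c).
have Cq : surfCk 0 M q by move=> U phi c; exact: CkS (q1 _ _ c).
have Cw : surfCk 0 M w by move=> U phi c; exact: CkS (w1 _ _ c).
have Cth A B th x1 x2 da db dk : surfCk 0 M A -> surfCk 0 M B -> surfCk 0 M th -> surfCk 0 M x1 ->
    surfCk 0 M x2 -> surfCk 0 M da -> surfCk 0 M db -> surfCk 0 M dk ->
    surfCk 0 M (fun g => deform_theta l (A g) (B g) (th g) (x1 g) (x2 g) (da g) (db g) (dk g)).
  move=> h1 h2 h3 h4 h5 h6 h7 h8.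
  exact: surfCkB (surfCkD h3 (surfCkM (Cc l) (surfCkB (surfCkD h8 (surfCkM h2 h4)) (surfCkM h1 h5))))
    (surfCkM (Cc (l ^+ 2 / 2)) (surfCkB (surfCkM h1 h7) (surfCkM h2 h6))).
have Cnp : surfCk 0 M (fun g => - p g) by move=> U phi c; have [oU _ _ _ _] := c; exact: CkN oU (Cp _ _ c).
have C3 := Cth _ _ _ _ _ _ _ _ (C0 _ Ca) (C0 _ Cb) (Cc 0) Cq Cnp za zb zk.
have C4 := Cth _ _ _ _ _ _ _ _ (C0 _ Ca) (C0 _ Cb) (Cc (-1)) (surfCkM Cw Cp) (surfCkM Cw Cq) ea eb ek.
split.
- exact: surfCkB (surfCkM (surfCkD Cnp (surfCkM (Cc l) zb)) C4)
    (surfCkM C3 (surfCkD (surfCkM Cw Cq) (surfCkM (Cc l) eb))).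
- exact: surfCkB (surfCkM C3 (surfCkD (surfCkM Cw Cp) (surfCkM (Cc l) ea)))
    (surfCkM (surfCkD Cq (surfCkM (Cc l) za)) C4).
Qed.

Lemma sqrt_defPQ_continuous l : surfCk 0 M (fun g => Num.sqrt (defP l g ^+ 2 + defQ l g ^+ 2)).
Proof.
have [CP CQ] := defPQ_continuous l; move=> U phi c u Uu.
have H : surfCk 0 M (fun g => defP l g * defP l g + defQ l g * defQ l g).
  exact: surfCkD (surfCkM CP CP) (surfCkM CQ CQ).
apply: (@continuous_comp _ _ _
  (fun u => defP l (phi u) * defP l (phi u) + defQ l (phi u) * defQ l (phi u)) Num.sqrt).
  exact: (H U phi c u Uu).
exact: sqrt_continuous.
Qed.

Lemma ratio_measurable l A : measurable A -> A `<=` S -> measurable_fun A (deform_ratio l).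
Proof.
move=> mA AS; have mK := heis_compact_measurable cK.
case: (reg) => _ CM _ _ _.
have -> : A = (A `&` K) `|` (A `\` K) by rewrite setUIDK.
apply/measurable_funU; [exact: measurableI|exact: measurableD|split].
- have AKM : A `&` K `<=` M by move=> g [_ /KM].
  have Cs : surfCk 0 M (fun g => Num.sqrt (defP l g ^+ 2 + defQ l g ^+ 2)) by exact: sqrt_defPQ_continuous.
  have H := surf_continuous_measurable CM Cs (measurableI _ _ mA mK) AKM.
  apply: eq_measurable_fun H.
  by move=> g; rewrite inE => -[_ Kg]; rewrite /deform_ratio mem_set.
- have H1 : measurable_fun (A `\` K) (cst (1 : R)) by exact: measurable_cst.
  apply: eq_measurable_fun H1.
  by move=> g; rewrite inE => -[_ Kg]; rewrite /deform_ratio memNset.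
Qed.

(** [D] is cut into countably many disjoint pieces, each inside a compact part of one chart. A piece
    and its image have the same parameter set, so the integrals are compared pointwise; the pieces
    are added up by countable additivity. *)
Lemma perimeter_deform l :
  (forall g h, S g -> S h -> `|g - h| <= 2 * `|Phi l g - Phi l h|) ->
  (H_perimeter (deform a b k l D) =
   \int[borel_area S]_(g in D) (deform_ratio l g * hdens N g)%:E)%E.
Proof.
move=> biL; pose Dl := Phi l @` D; rewrite -[deform a b k l D]/Dl.
have DS : D `<=` S by rewrite DE; exact: subIsetl.
have CD : C2_surface D by rewrite DE; exact: open_surface.
have cDS U phi : chart D U phi -> chart S U phi by rewrite DE => c; exact: chart_ambient c oW.
have biD g h : D g -> D h -> `|g - h| <= 2 * `|Phi l g - Phi l h|.
  by move=> /DS Sg /DS Sh; exact: biL.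
have injP g h : D g -> D h -> Phi l g = Phi l h -> g = h.
  move=> Dg Dh E; apply/eqP; rewrite -subr_eq0 -normr_le0.
  by apply: (le_trans (biD g h Dg Dh)); rewrite E subrr normr0 mulr0.
have cDl U phi : chart D U phi -> chart Dl U (Phi l \o phi).
  by move=> c; apply: chart_image => //; exact: (deform_chart_Ck Ca Cb Ck_ l (cDS _ _ c)).
have CDl : C2_surface Dl.
  move=> _ [g Dg <-]; have [U [phi [c [u Uu ug]]]] := CD g Dg.
  by exists U, (Phi l \o phi); split; [exact: cDl|exists u => //=; rewrite ug].
have nDl := some_normal_field CDl.
have mDl := surface_measurable CDl; have mD := surface_measurable CD.
have mh : measurable_fun Dl (hdens (some_normal Dl)).
  exact: (surf_continuous_measurable CDl (hdens_continuous nDl) mDl).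
have mh1 : measurable_fun Dl (fun g => 1 * hdens (some_normal Dl) g).
  by apply: measurable_funM => //; exact: measurable_cst.
have mE : measurable_fun Dl (fun g => (1 * hdens (some_normal Dl) g)%:E).
  exact: (measurable_EFinP _ _).2 mh1.
transitivity (\int[borel_area Dl]_(g in Dl) (1 * hdens (some_normal Dl) g)%:E)%E.
  exact: (integral_surface_measure Dl mDl mE).
have [B [mB DB tB cB]] := surface_cover CD.
pose T n := D `&` B n.
have DT : D = \bigcup_n T n by rewrite -setI_bigcupr; apply/esym/setIidPl.
have mT n : measurable (T n) by exact: measurableI.
have tT : trivIset setT T by exact: trivIset_setIl.
have DlT : Dl = \bigcup_n (Phi l @` T n) by rewrite -image_bigcup -DT.
have TD n : T n `<=` D by exact: subIsetl.
have tPT : trivIset setT (fun n => Phi l @` T n).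
  move=> i j _ _ [y [[g Tg gy] [h Th hy]]]; apply: tT => //.
  have E : g = h by apply: injP; [exact: TD Tg|exact: TD Th|rewrite gy hy].
  by exists g; split=> //; rewrite E.
have piece n : measurable (Phi l @` T n) /\
    (\int[borel_area Dl]_(g in Phi l @` T n) (1 * hdens (some_normal Dl) g)%:E =
     \int[borel_area S]_(g in T n) (deform_ratio l g * hdens N g)%:E)%E.
  have [U [phi [C [c cC CU TC]]]] := cB n; have c' := cDl _ _ c; have cS := cDS _ _ c.
  have [oU _ _ _ _] := c.
  have inj u v : U u -> U v -> phi u = phi v -> u = v.
    by move=> Uu Uv; apply: (chart_inj c); rewrite inE.
  have JC : U `&` phi @^-1` T n `<=` C.
    move=> u [Uu Tu]; have [v Cv E] := TC _ Tu.
    by rewrite -(inj v u (CU _ Cv) Uu E).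
  have mJ := chart_preimage_measurable cS (mT n).
  have EJ : Phi l @` T n = (Phi l \o phi) @` (U `&` phi @^-1` T n).
    rewrite eqEsubset; split=> [_ [g Tg <-]|_ [u [_ Tu] <-]]; last by exists (phi u).
    by have [v Cv E] := TC _ Tg; exists v; [split; [exact: CU|rewrite /= E]|rewrite /= E].
  have mI : measurable (Phi l @` T n).
    rewrite EJ.
    have cc : {within C, continuous (id \o (Phi l \o phi))}.
      apply: continuous_in_subspaceT => u; rewrite inE => /CU Uu.
      exact: (chart_continuous c' Uu).
    have ii : {in C &, injective (Phi l \o phi)}.
      by move=> u v; rewrite !inE => /CU Uu /CU Uv; apply: (chart_inj c'); rewrite inE.
    apply: (@injective_image_measurable R _ (R * R * R)%type (R * R * R)%type id C (Phi l \o phi)) => //.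
    exact: closed_measurable3.
  split; first exact: mI.
  have TU : T n `<=` phi @` U by move=> g /TC[v /CU Uv <-]; exists v.
  have TU' : Phi l @` T n `<=` (Phi l \o phi) @` U.
    by move=> _ [g /TU[v Uv <-] <-]; exists v.
  have m1 : measurable_fun (Phi l @` T n) (fun=> 1 : R) by exact: measurable_cst.
  have I1 := integral_hdens_chart CDl nDl c' mI TU' m1.
  have mr : measurable_fun (T n) (deform_ratio l).
    by apply: ratio_measurable => //; exact: subset_trans DS.
  have I2 := integral_hdens_chart CS nS cS (mT n) TU mr.
  have EU : U `&` (Phi l \o phi) @^-1` (Phi l @` T n) = U `&` phi @^-1` T n.
    rewrite eqEsubset; split=> u [Uu]; last by move=> Tu; split=> //; exists (phi u).
    move=> [g Tg E]; split=> //=.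
    by rewrite -(injP g (phi u) (TD _ _ Tg) (chart_sub c Uu) E).
  rewrite EU in I1; apply: (etrans I1); apply: (etrans _ (esym I2)).
  apply: eq_integral => u; rewrite inE => -[Uu _].
  have E : 1 * hor_element (Phi l \o phi) u = deform_ratio l (phi u) * hor_element phi u.
    by rewrite mul1r; exact: (hor_deform cS Uu biL).
  exact: (congr1 EFin E).
have mE' : measurable_fun (\bigcup_n (Phi l @` T n)) (fun g => (1 * hdens (some_normal Dl) g)%:E).
  by rewrite -DlT.
have J1 := @ge0_integral_bigcup _ _ R (borel_area Dl) _ _ (fun n => (piece n).1) mE'
  (fun g _ => ltac:(by rewrite lee_fin mul1r hdens_ge0)) tPT.
have mR : measurable_fun (\bigcup_n T n) (fun g => (deform_ratio l g * hdens N g)%:E).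
  rewrite -DT; apply: (measurable_EFinP _ _).2; apply: measurable_funM; first exact: ratio_measurable.
  exact: (surf_continuous_measurable CS (hdens_continuous nS) mD).
have J2 := @ge0_integral_bigcup _ _ R (borel_area S) _ _ mT mR
  (fun g _ => ltac:(by rewrite lee_fin mulr_ge0 ?ratio_ge0 ?hdens_ge0)) tT.
rewrite /= -DlT in J1; rewrite /= -DT in J2.
apply: (etrans J1); apply: (etrans _ (esym J2)).
by apply: eq_eseriesr => n _; exact: (piece n).2.
Qed.

End perimeter.

(** * The second variation *)

Section second_derivative.
Context {R : realType} d (T : measurableType d) (mu : {measure set T -> \bar R}).
Variables (K : set T) (G G1 G2 : R -> T -> R) (w : T -> R) (C : R).
Hypotheses (mK : measurable K) (fK : (mu K < +oo)%E).
Hypotheses (mG : forall l, measurable_fun K (G l)) (mG1 : forall l, measurable_fun K (G1 l)).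
Hypotheses (mw : measurable_fun K w) (C0 : 0 < C) (wC : forall g, K g -> `|w g| <= C).
Hypothesis dG : forall (l : R) g, `|l| < 1 -> K g -> is_derive l (1 : R) (G^~ g) (G1 l g).
Hypothesis dG1 : forall (l : R) g, `|l| < 1 -> K g -> is_derive l (1 : R) (G1^~ g) (G2 l g).
Hypothesis bG : forall (l : R) g, `|l| < 1 -> K g -> `|G1 l g| <= C /\ `|G2 l g| <= C.
Hypothesis G01 : forall g, K g -> G 0 g = 1.

(** For [|l| < e] the value [G l] differs from [G 0 = 1] by at most [C * e <= 1 / 2], so the square
    root stays away from its singular point. *)
Let e : R := (2 * C + 2)^-1.

Let e0 : 0 < e. Proof. by rewrite invr_gt0 addr_gt0// mulr_gt0. Qed.

Let e1 (l : R) : `|l| < e -> `|l| < 1.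
Proof.
move=> le; apply: (lt_le_trans le); rewrite invf_le1 ?addr_gt0 ?mulr_gt0//.
by rewrite -[leLHS]add0r lerD ?mulr_ge0 ?(ltW C0)// ler1n.
Qed.

(* The square root, modified below 1/4 so as to be bounded away from 0. *)
Let sr (x : R) : R := Num.max 2^-1 (Num.sqrt x).

Let sr_continuous : continuous sr.
Proof.
have cm : continuous (fun s : R => Num.max 2^-1 s).
  move=> x; have c1 : {for x, continuous (fun _ : R => 2^-1 : R)} by exact: cst_continuous.
  have c2 : {for x, continuous (fun s : R => s)} by exact: cvg_id.
  exact: (continuous_max c1 c2).
by move=> x; apply: (continuous_comp (@sqrt_continuous R x) (cm _)).
Qed.

Let sr_ge x : 2^-1 <= sr x. Proof. by rewrite le_max lexx. Qed.

Let sr_gt0 x : 0 < sr x. Proof. by apply: lt_le_trans (sr_ge x); rewrite invr_gt0. Qed.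

Let G_ge l g : `|l| < e -> K g -> 4^-1 <= G l g.
Proof.
move=> le Kg.
have [s|s sI E] := @MVT_between R (G^~ g) (G1^~ g) 0 l.
  move=> sI; apply: dG => //; apply: e1; apply: le_lt_trans le.
  by move: sI; rewrite ge_min le_max => /andP[]; case: (ler0P l) => ? /orP[] ? /orP[] ?;
    rewrite ler_norml; apply/andP; split; lra.
have ls : `|s| < 1.
  apply: e1; apply: le_lt_trans le.
  by move: sI; rewrite ge_min le_max => /andP[]; case: (ler0P l) => ? /orP[] ? /orP[] ?;
    rewrite ler_norml; apply/andP; split; lra.
have [b1 _] := bG ls Kg; rewrite G01// subr0 in E.
have H : `|G l g - 1| <= 2^-1.
  rewrite E normrM; apply: (@le_trans _ _ (C * e)); first by apply: ler_pM => //; exact: ltW.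
  by rewrite /e ler_pdivrMr ?addr_gt0 ?mulr_gt0//; lra.
by move: H; rewrite ler_norml => /andP[? _]; lra.
Qed.

Let srE l g : `|l| < e -> K g -> sr (G l g) = Num.sqrt (G l g) /\ 0 < G l g.
Proof.
move=> le Kg; have h := G_ge le Kg; split; last by apply: lt_le_trans h; rewrite invr_gt0.
rewrite /sr max_r// -[leLHS]ger0_norm ?invr_ge0// -sqrtr_sqr ler_wsqrtr//.
by apply: le_trans h; rewrite exprVn; have -> : 2 ^+ 2 = 4 :> R by ring.
Qed.

(** The first and second derivatives in [l] of the square root of [G], with [sr] in the
    denominators: the two agree for [|l| < e], and with [sr] the functions are measurable for every
    [l]. *)
Let r1 l g := G1 l g / (2 * sr (G l g)).
Let r2 l g := G2 l g / (2 * sr (G l g)) - G1 l g ^+ 2 / (4 * sr (G l g) ^+ 3).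

Let sqrtG_derive (l : R) g : `|l| < e -> K g ->
  is_derive l (1 : R) (fun l => Num.sqrt (G l g)) (r1 l g).
Proof.
move=> le Kg; have [sE Gp] := srE le Kg.
have D := is_derive1_comp (is_derive1_sqrt Gp) (dG (e1 le) Kg).
by rewrite /r1 sE mulrC; exact: D.
Qed.

Let near_e (l : R) : `|l| < e -> \forall s \near l, `|s| < e.
Proof.
move=> le; have d0 : 0 < e - `|l| by rewrite subr_gt0.
apply: filterS (@near_dist R R l _ d0) => s sl.
rewrite -[s](subrK l); apply: (le_lt_trans (ler_normD _ _)).
by rewrite -ltrBrDr.
Qed.

Let r1_derive (l : R) g : `|l| < e -> K g -> is_derive l (1 : R) (r1^~ g) (r2 l g).
Proof.
move=> le Kg; have [sE Gp] := srE le Kg.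
have s0 : Num.sqrt (G l g) != 0 by rewrite gt_eqF// sqrtr_gt0.
have Ds := sqrtG_derive le Kg.
have s20 : 2 * Num.sqrt (G l g) != 0 by rewrite mulf_neq0.
have D2 : is_derive l (1 : R) (fun s => 2 * Num.sqrt (G s g)) (2 * r1 l g) := is_derive_mull 2 Ds.
have DV := @is_deriveV R (fun s => 2 * Num.sqrt (G s g)) l _ 1 s20 D2.
have DM := is_deriveM (dG1 (e1 le) Kg) DV.
apply: (@near_eq_is_derive R R R (fun s => G1 s g * (2 * Num.sqrt (G s g))^-1)).
  by apply: filterS (near_e le) => s se; rewrite /r1 (srE se Kg).1.
apply: (is_derive_eq DM).
rewrite /r1 /r2 sE -![_ *: _]/(_ * _); field.
by rewrite s0.
Qed.

Let rb (l : R) g : `|l| < e -> K g -> `|r1 l g| <= C /\ `|r2 l g| <= C + 2 * C ^+ 2.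
Proof.
move=> le Kg; have [b1 b2] := bG (e1 le) Kg; have sg := sr_ge (G l g); have s0 := sr_gt0 (G l g).
have i2 : (2 * sr (G l g))^-1 <= 1.
  by rewrite invf_le1 ?mulr_gt0//; lra.
have i20 : 0 <= (2 * sr (G l g))^-1 by rewrite invr_ge0 mulr_ge0// ltW.
have i3 : (4 * sr (G l g) ^+ 3)^-1 <= 2.
  have h : 2^-1 ^+ 3 <= sr (G l g) ^+ 3 by rewrite lerXn2r// nnegrE ?invr_ge0// ltW.
  have E : 2^-1 ^+ 3 = 8^-1 :> R by rewrite exprVn; congr _^-1; ring.
  rewrite -[leRHS]invrK lef_pV2 ?posrE ?invr_gt0 ?mulr_gt0 ?exprn_gt0//.
  by rewrite E in h; lra.
have i30 : 0 <= (4 * sr (G l g) ^+ 3)^-1 by rewrite invr_ge0 mulr_ge0// exprn_ge0// ltW.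
have B (x y M M' : R) : `|x| <= M -> 0 <= y -> y <= M' -> `|x * y| <= M * M'.
  by move=> xM y0 yM; rewrite normrM (ger0_norm y0); apply: ler_pM.
split; first by rewrite -[leRHS]mulr1; exact: B.
apply: (le_trans (ler_normB _ _)); apply: lerD.
  by rewrite -[leRHS]mulr1; exact: B.
rewrite [leRHS]mulrC; apply: B => //; rewrite normrX.
by apply: lerXn2r => //; rewrite nnegrE // ltW.
Qed.

Let mcomp (f : R -> R) l : continuous f -> measurable_fun K (fun g => f (G l g)).
Proof. by move=> cf; apply: measurableT_comp; [exact: continuous_measurable_fun|exact: mG]. Qed.

Let bounded_integrable (f : T -> R) (M : R) : measurable_fun K f -> (forall g, K g -> `|f g| <= M) ->
  mu.-integrable K (EFin \o f).
Proof.
move=> mf bf; apply: measurable_bounded_integrable => //.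
exists M; split; first by rewrite num_real.
by move=> x Mx g Kg; apply: (le_trans (bf g Kg)); exact: ltW.
Qed.

Let sqrtG_bound (l : R) g : `|l| < e -> K g -> `|Num.sqrt (G l g)| <= 1 + C.
Proof.
move=> le Kg.
have [s|s sI E] := @MVT_between R (fun l => Num.sqrt (G l g)) (r1^~ g) 0 l.
  move=> sI; apply: sqrtG_derive => //; apply: le_lt_trans le.
  by move: sI; rewrite ge_min le_max => /andP[]; case: (ler0P l) => ? /orP[] ? /orP[] ?;
    rewrite ler_norml; apply/andP; split; lra.
have ls : `|s| < e.
  apply: le_lt_trans le.
  by move: sI; rewrite ge_min le_max => /andP[]; case: (ler0P l) => ? /orP[] ? /orP[] ?;
    rewrite ler_norml; apply/andP; split; lra.
have [b1 _] := rb ls Kg; rewrite G01// sqrtr1 subr0 in E.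
have -> : Num.sqrt (G l g) = 1 + r1 s g * l by rewrite -E addrC subrK.
apply: (le_trans (ler_normD _ _)); rewrite normr1 lerD2l normrM -[leRHS]mulr1.
by apply: ler_pM => //; exact: ltW (e1 le).
Qed.

Let I l := \int[mu]_(g in K) (Num.sqrt (G l g) * w g).
Let I1 l := \int[mu]_(g in K) (r1 l g * w g).

Lemma sqrtG_integrable l : `|l| < e -> mu.-integrable K (EFin \o (fun g => Num.sqrt (G l g) * w g)).
Proof.
move=> le; apply: (@bounded_integrable _ ((1 + C) * C)).
  by apply: measurable_funM => //; apply: mcomp; exact: sqrt_continuous.
by move=> g Kg; rewrite normrM; apply: ler_pM => //; [exact: sqrtG_bound|exact: wC].
Qed.

Let r1_integrable l : `|l| < e -> mu.-integrable K (EFin \o (fun g => r1 l g * w g)).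
Proof.
move=> le; apply: (@bounded_integrable _ (C * C)).
  apply: measurable_funM => //; apply: measurable_funM => //.
  apply: (mcomp (f := fun x => (2 * sr x)^-1)) => x; apply: cvgV.
    by rewrite mulf_neq0// gt_eqF.
  by apply: cvgM; [exact: cvg_cst|exact: sr_continuous].
by move=> g Kg; rewrite normrM; apply: ler_pM => //; [exact: (rb le Kg).1|exact: wC].
Qed.

Let under (f df : R -> T -> R) (M l : R) : `|l| < e ->
  (forall s, `|s| < e -> mu.-integrable K (EFin \o f s)) ->
  (forall (s : R) g, `|s| < e -> K g -> is_derive s (1 : R) (f^~ g) (df s g)) ->
  (forall (s : R) g, `|s| < e -> K g -> `|df s g| <= M) ->
  derivable (fun s => \int[mu]_(g in K) f s g) l 1 /\
  derive1 (fun s => \int[mu]_(g in K) f s g) l = \int[mu]_(g in K) df l g.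
Proof.
move=> le intf df_ dfM.
have Ie x : `]- e, e[%classic x -> `|x| < e by rewrite /= in_itv /= ltr_norml.
have Il : `]- e, e[%classic l by rewrite /= in_itv /= -ltr_norml.
have intM : mu.-integrable K (EFin \o (fun=> `|M|)).
  by apply: (@bounded_integrable _ `|M|); [exact: measurable_cst|move=> g _; rewrite normr_id].
have dE x g : `|x| < e -> K g -> partial1of2 f x g = df x g.
  by move=> xe Kg; rewrite partial1of2E; have [_ ->] := df_ x g xe Kg.
have H1 x : `]- e, e[%classic x -> mu.-integrable K (EFin \o f x) by move=> /Ie; exact: intf.
have H2 x g : `]- e, e[%classic x -> K g -> derivable (f^~ g) x 1.
  by move=> /Ie xe Kg; have [] := df_ x g xe Kg.
have H3 x g : `]- e, e[%classic x -> K g -> `|partial1of2 f x g| <= `|M|.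
  by move=> /Ie xe Kg; rewrite dE//; exact: le_trans (dfM _ _ xe Kg) (ler_norm _).
split.
  exact: (@derivable_under_integral R _ _ mu f K mK l (- e) e Il H1 H2 (fun=> `|M|) (fun=> normr_ge0 M) intM H3).
rewrite (@differentiation_under_integral R _ _ mu f K mK l (- e) e Il H1 H2 (fun=> `|M|) (fun=> normr_ge0 M) intM H3).
by apply: eq_Rintegral => g; rewrite inE => Kg; exact: dE.
Qed.

Lemma sqrt_integral_derive2 :
  [/\ forall l, `|l| < e -> derivable I l 1, derivable (derive1 I) 0 1 &
    derive1 (derive1 I) 0 = \int[mu]_(g in K) ((G2 0 g / 2 - G1 0 g ^+ 2 / 4) * w g)].
Proof.
have D1 l : `|l| < e -> derivable I l 1 /\ derive1 I l = I1 l.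
  move=> le; apply: (@under (fun l g => Num.sqrt (G l g) * w g) (fun l g => r1 l g * w g) (C * C)) => //.
  - exact: sqrtG_integrable.
  - by move=> s g se Kg; apply: is_derive_mulr; exact: sqrtG_derive.
  - by move=> s g se Kg; rewrite normrM; apply: ler_pM => //; [exact: (rb se Kg).1|exact: wC].
have n0 : `|0 : R| < e by rewrite normr0.
have [D2 E2] : derivable I1 0 1 /\ derive1 I1 0 = \int[mu]_(g in K) (r2 0 g * w g).
  apply: (@under (fun l g => r1 l g * w g) (fun l g => r2 l g * w g) ((C + 2 * C ^+ 2) * C)) => //.
  - by move=> s g se Kg; apply: is_derive_mulr; exact: r1_derive.
  - by move=> s g se Kg; rewrite normrM; apply: ler_pM => //; [exact: (rb se Kg).2|exact: wC].
have nE : \forall s \near (0 : R), I1 s = derive1 I s.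
  by apply: filterS (near_e n0) => s se; rewrite (D1 s se).2.
split.
- by move=> l le; exact: (D1 l le).1.
- exact: (near_eq_derivable nE D2).
- rewrite derive1E -(near_eq_derive (1 : R) nE) -derive1E E2; apply: eq_Rintegral => g; rewrite inE => Kg.
  rewrite /r2 (srE n0 Kg).1 G01// sqrtr1 expr1n !mulr1.
  by [].
Qed.

Lemma threshold_gt0 : 0 < e. Proof. exact: e0. Qed.

End second_derivative.

Lemma cubic_derive (R : realType) (a b c d l : R) :
  is_derive l (1 : R) (fun l : R => a + l * b + l ^+ 2 * c + l ^+ 3 * d)
    (b + 2 * l * c + 3 * l ^+ 2 * d).
Proof.
have i := is_derive_id l (1 : R).
have h2 : is_derive l (1 : R) (fun l : R => l * l) (2 * l).
  by apply: (is_derive_eq (is_deriveM i i)); rewrite -![_ *: _]/(_ * _); ring.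
have h3 : is_derive l (1 : R) (fun l : R => l * l * l) (3 * l ^+ 2).
  by apply: (is_derive_eq (is_deriveM h2 i)); rewrite -![_ *: _]/(_ * _); ring.
have -> : (fun l : R => a + l * b + l ^+ 2 * c + l ^+ 3 * d) =
  (fun l => a + l * b + l * l * c + l * l * l * d) by apply/funext => s; ring.
have H := is_deriveD (is_deriveD (is_deriveD (is_derive_cst a l 1) (is_derive_mulr b i))
  (is_derive_mulr c h2)) (is_derive_mulr d h3).
by apply: (is_derive_eq H); ring.
Qed.

(** * The pointwise identity for the second derivative of the density *)

Section pointwise_identity.
Context {R : realType}.
Implicit Types (U : set (R * R)) (phi : R * R -> heis R) (f : heis R -> R).

Variables (S M : set (heis R)) (N : heis R -> heis R).
Hypothesis reg : regular_part S M N.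

Local Notation dZ := (dZ S N).
Local Notation dE := (dE S N).
Local Notation jac := (jac S N).
Local Notation p := (pbar N).
Local Notation q := (qbar N).
Local Notation w := (omegabar N).

(** Keeps the regularity, the value and the two frame derivatives of a function at a point together,
    so that those of sums and products can be assembled symbolically from their factors. *)
Definition jet f g (v z e : R) := [/\ surfCk 1 M f, f g = v, dZ f g = z & dE f g = e].

Lemma jetE f g : surfCk 1 M f -> jet f g (f g) (dZ f g) (dE f g).
Proof. by split. Qed.

Lemma jetD f1 f2 g v1 z1 e1 v2 z2 e2 : M g -> jet f1 g v1 z1 e1 -> jet f2 g v2 z2 e2 ->
  jet (fun y => f1 y + f2 y) g (v1 + v2) (z1 + z2) (e1 + e2).
Proof.
move=> Mg [C1 <- <- <-] [C2 <- <- <-]; have [Z E] := dZE_add reg C1 C2 Mg.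
exact: And4 (surfCkD C1 C2) erefl Z E.
Qed.

Lemma jetM f1 f2 g v1 z1 e1 v2 z2 e2 : M g -> jet f1 g v1 z1 e1 -> jet f2 g v2 z2 e2 ->
  jet (fun y => f1 y * f2 y) g (v1 * v2) (z1 * v2 + v1 * z2) (e1 * v2 + v1 * e2).
Proof.
move=> Mg [C1 <- <- <-] [C2 <- <- <-]; have [Z E] := dZE_mul reg C1 C2 Mg.
exact: And4 (surfCkM C1 C2) erefl Z E.
Qed.

Lemma jet_cst (c : R) g : M g -> jet (fun=> c) g c 0 0.
Proof.
case: (reg) => _ CM _ _ _ Mg; have [U [phi [ch [u Uu ug]]]] := CM g Mg.
have df : differentiable ((fun=> c) \o phi) u by exact: differentiable_cst.
have D0 v : 'D_v ((fun=> c) \o phi) u = 0 by exact: derive_cst.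
have [Z E] := dZE_chart reg ch Uu df; rewrite ug !D0 in Z E.
by split=> // V psi cV; have [oV _ _ _ _] := cV; exact: Ck_cst.
Qed.

Lemma jac_jet f1 f2 g v1 z1 e1 v2 z2 e2 : jet f1 g v1 z1 e1 -> jet f2 g v2 z2 e2 ->
  jac f1 f2 g = z1 * e2 - e1 * z2.
Proof. by move=> [_ _ <- <-] [_ _ <- <-]. Qed.

Lemma jet_coord g : M g ->
  [/\ jet (fun y => y.1.1) g g.1.1 (q g) (w g * p g),
      jet (fun y => y.1.2) g g.1.2 (- p g) (w g * q g) &
      jet (fun y => y.2) g g.2 ((g.1.1 * - p g - g.1.2 * q g) / 2)
        (-1 + (g.1.1 * (w g * q g) - g.1.2 * (w g * p g)) / 2)].
Proof.
case: (reg) => _ CM _ _ W0 Mg; have [U [phi [c [u Uu ug]]]] := CM g Mg.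
have [oU C2 _ _ _] := c; have Wg := W0 _ Mg.
have CC V psi : chart M V psi -> [/\ Ck 1 V (fun u => (psi u).1.1), Ck 1 V (fun u => (psi u).1.2) &
    Ck 1 V (fun u => (psi u).2)].
  by move=> cV; have [oV C2' _ _ _] := cV; exact: Ck_coord oV (CkS C2').
have dp := C2.1 u Uu.
have EZ := chart_coeffE reg c Uu (ltac:(by rewrite ug; exact: Zfield_tangent)).
have EE := chart_coeffE reg c Uu (ltac:(by rewrite ug; exact: Efield_tangent)).
have [Z1 Z2 Z3] := Zfield_frame N g; have [E1 E2 E3] := Efield_frame N g.
have [px _] := @derive_linear R (R * R)%type _ _ (@coord_x R) phi u (1, 0) (@coord_x_continuous R) dp.
have [py _] := @derive_linear R (R * R)%type _ _ (@coord_y R) phi u (1, 0) (@coord_y_continuous R) dp.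
have [pt _] := @derive_linear R (R * R)%type _ _ (@coord_t R) phi u (1, 0) (@coord_t_continuous R) dp.
have Dx v := (@derive_linear R (R * R)%type _ _ (@coord_x R) phi u v (@coord_x_continuous R) dp).2.
have Dy v := (@derive_linear R (R * R)%type _ _ (@coord_y R) phi u v (@coord_y_continuous R) dp).2.
have Dt v := (@derive_linear R (R * R)%type _ _ (@coord_t R) phi u v (@coord_t_continuous R) dp).2.
have [zx ex] := dZE_chart reg c Uu px; have [zy ey] := dZE_chart reg c Uu py.
have [zt et] := dZE_chart reg c Uu pt.
have {}zx := etrans zx (etrans (Dx _) (congr1 (fun v : heis R => v.1.1) (esym EZ))).
have {}ex := etrans ex (etrans (Dx _) (congr1 (fun v : heis R => v.1.1) (esym EE))).
have {}zy := etrans zy (etrans (Dy _) (congr1 (fun v : heis R => v.1.2) (esym EZ))).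
have {}ey := etrans ey (etrans (Dy _) (congr1 (fun v : heis R => v.1.2) (esym EE))).
have {}zt := etrans zt (etrans (Dt _) (congr1 (fun v : heis R => v.2) (esym EZ))).
have {}et := etrans et (etrans (Dt _) (congr1 (fun v : heis R => v.2) (esym EE))).
rewrite ug in zx ex zy ey zt et.
have th (v : heis R) : v.2 = theta g v + (g.1.1 * v.1.2 - g.1.2 * v.1.1) / 2 by rewrite /theta subrK.
have Sx : surfCk 1 M (fun y : heis R => y.1.1).
  by move=> V psi cV; have [H _ _] := CC _ _ cV; exact: H.
have Sy : surfCk 1 M (fun y : heis R => y.1.2).
  by move=> V psi cV; have [_ H _] := CC _ _ cV; exact: H.
have St : surfCk 1 M (fun y : heis R => y.2).
  by move=> V psi cV; have [_ _ H] := CC _ _ cV; exact: H.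
have T1 : (Zfield N g).2 = (g.1.1 * - p g - g.1.2 * q g) / 2 by rewrite th Z1 Z2 Z3 add0r.
have T2 : (Efield N g).2 = -1 + (g.1.1 * (w g * q g) - g.1.2 * (w g * p g)) / 2 by rewrite th E1 E2 E3.
exact: And3 (And4 Sx erefl (etrans zx Z1) (etrans ex E1)) (And4 Sy erefl (etrans zy Z2) (etrans ey E2))
  (And4 St erefl (etrans zt T1) (etrans et T2)).
Qed.

(** The first two relations come from [p ^ 2 + q ^ 2 = 1]. For the last, the form p dx + q dy +
    omegabar theta vanishes on the surface, hence so does dp /\ dx + dq /\ dy + d omegabar /\ theta
    - omegabar dx /\ dy. Since p, q and omegabar are only C^1, this is obtained by
    cross-differentiating the two coordinate components in a chart. *)
Lemma normal_structure g : M g -> exists m, [/\ dZ p g * p g + dZ q g * q g = 0,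
  dE p g * p g + dE q g * q g = 0 &
  dZ p g = 0 -> dZ q g = 0 -> dE p g = - (m * q g) /\ dE q g = m * p g /\ m = dZ w g + w g ^+ 2].
Proof.
case: (reg) => _ CM _ nM W0 Mg; have [Cp Cq Cw] := unit_normal_Ck reg.
have pq1 y : M y -> p y * p y + q y * q y = 1 by move=> My; rewrite -!expr2 unit_hor// W0.
have [U [phi [c [u Uu ug]]]] := CM g Mg; have [oU C2 _ _ _] := c.
have jp := jetE g Cp; have jq := jetE g Cq; have jw := jetE g Cw.
have [_ _ Z1 E1] := jetD Mg (jetM Mg jp jp) (jetM Mg jq jq).
have n1 : \forall y \near g, M y -> p y * p y + q y * q y + -1 = 0.
  by apply: filterS (@near_dist R (R * R * R)%type g 1 ltr01) => y _ /pq1 ->; rewrite subrr.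
have [Z0 E0] := dZE_zero reg Mg n1.
have [_ _ Z2 E2] := jetD Mg (jetD Mg (jetM Mg jp jp) (jetM Mg jq jq)) (jet_cst (-1) Mg).
have SZ : dZ p g * p g + dZ q g * q g = 0 by move: Z2; rewrite Z0; lra.
have SE : dE p g * p g + dE q g * q g = 0 by move: E2; rewrite E0; lra.
(* The vector [(p, q)] has length 1, so its derivative along [Efield] is this number times the
   rotated vector [(- q, p)]. *)
exists (p g * dE q g - q g * dE p g); split=> // zp zq.
have PQ := pq1 g Mg.
split; first by rewrite -[LHS]mulr1 -PQ; move: SE; move: (dE p g) (dE q g) (p g) (q g) => ep eq x y h;
  apply/eqP; rewrite -subr_eq0; apply/eqP; transitivity (x * (ep * x + eq * y)); [ring|rewrite h mulr0].
split; first by rewrite -[LHS]mulr1 -PQ; move: SE; move: (dE p g) (dE q g) (p g) (q g) => ep eq x y h;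
  apply/eqP; rewrite -subr_eq0; apply/eqP; transitivity (y * (ep * x + eq * y)); [ring|rewrite h mulr0].
have [Cx Cy Ct] := Ck_coord oU C2.
have Cpp := Cp _ _ c; have Cqp := Cq _ _ c; have Cwp := Cw _ _ c.
have nv v z : U z -> p (phi z) * ('D_v phi z).1.1 + q (phi z) * ('D_v phi z).1.2 +
    w (phi z) * theta (phi z) ('D_v phi z) = 0.
  move=> Uz; have Mz := chart_sub c Uz; have Wz := W0 _ Mz.
  have [_ nn] := nM _ Mz; have := nn _ (chart_tangent v c Uz).
  rewrite metric_frame; have [-> -> ->] := unit_normal Wz => H; apply: (mulfI Wz).
  by rewrite mulr0 -H; move: (Wnorm N (phi z)) (p (phi z)) => *; ring.
have Dx v z : U z -> ('D_v phi z).1.1 = 'D_v (fun u => (phi u).1.1) z.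
  by move=> Uz; apply: esym; exact: (@derive_linear R (R * R)%type _ _ (@coord_x R) phi z v (@coord_x_continuous R) (C2.1 z Uz)).2.
have Dy v z : U z -> ('D_v phi z).1.2 = 'D_v (fun u => (phi u).1.2) z.
  by move=> Uz; apply: esym; exact: (@derive_linear R (R * R)%type _ _ (@coord_y R) phi z v (@coord_y_continuous R) (C2.1 z Uz)).2.
have Dt v z : U z -> ('D_v phi z).2 = 'D_v (fun u => (phi u).2) z.
  by move=> Uz; apply: esym; exact: (@derive_linear R (R * R)%type _ _ (@coord_t R) phi z v (@coord_t_continuous R) (C2.1 z Uz)).2.
(* The normal form evaluated on the coordinate vector in direction [v], written through derivatives
   of real functions; it vanishes identically on [U]. *)
pose n v z := (p \o phi) z * 'D_v (fun u => (phi u).1.1) z + (q \o phi) z * 'D_v (fun u => (phi u).1.2) z +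
  (w \o phi) z * ('D_v (fun u => (phi u).2) z + - 2^-1 * ((phi z).1.1 * 'D_v (fun u => (phi u).1.2) z) +
     2^-1 * ((phi z).1.2 * 'D_v (fun u => (phi u).1.1) z)).
have n0 v z : U z -> n v z = 0.
  move=> Uz; rewrite -[RHS](nv v z Uz) /n /theta (Dx v z Uz) (Dy v z Uz) (Dt v z Uz) /=.
  by move: ('D_v _ z) ('D_v _ z) ('D_v _ z) => X Y T; field.
have dn v v' : 'D_v (n v') u = 0.
  have nU : nbhs u U by exact: open_nbhs_nbhs.
  have nz : \forall z \near u, 0 = n v' z by apply: filterS nU => z Uz; rewrite n0.
  by rewrite -(near_derive_eq v nz) derive_cst.
have Dn v v' : 'D_v (n v') u = 'D_v (p \o phi) u * 'D_v' (fun u => (phi u).1.1) u +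
   (p \o phi) u * 'D_v (fun z => 'D_v' (fun u => (phi u).1.1) z) u +
   ('D_v (q \o phi) u * 'D_v' (fun u => (phi u).1.2) u +
   (q \o phi) u * 'D_v (fun z => 'D_v' (fun u => (phi u).1.2) z) u) +
   ('D_v (w \o phi) u * ('D_v' (fun u => (phi u).2) u + - 2^-1 * ((phi u).1.1 * 'D_v' (fun u => (phi u).1.2) u) +
     2^-1 * ((phi u).1.2 * 'D_v' (fun u => (phi u).1.1) u)) +
   (w \o phi) u * ('D_v (fun z => 'D_v' (fun u => (phi u).2) z) u + - 2^-1 *
     ('D_v (fun u => (phi u).1.1) u * 'D_v' (fun u => (phi u).1.2) u +
      (phi u).1.1 * 'D_v (fun z => 'D_v' (fun u => (phi u).1.2) z) u) + 2^-1 *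
     ('D_v (fun u => (phi u).1.2) u * 'D_v' (fun u => (phi u).1.1) u +
      (phi u).1.2 * 'D_v (fun z => 'D_v' (fun u => (phi u).1.1) z) u))).
  have X1 := derive_mul v (Cpp.1 u Uu) ((Cx.2 v').1 u Uu).
  have Y1 := derive_mul v (Cqp.1 u Uu) ((Cy.2 v').1 u Uu).
  have A1 := derive_mul v (Cx.1 u Uu) ((Cy.2 v').1 u Uu).
  have A2 := derive_mul v (Cy.1 u Uu) ((Cx.2 v').1 u Uu).
  have B1 := derive_addl (- 2^-1) v ((Ct.2 v').1 u Uu) A1.1.
  have B2 := derive_addl 2^-1 v B1.1 A2.1.
  have B3 := derive_mul v (Cwp.1 u Uu) B2.1.
  have add (f1 f2 : R * R -> R) : differentiable f1 u -> differentiable f2 u ->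
      differentiable (fun z => f1 z + f2 z) u /\ 'D_v (fun z => f1 z + f2 z) u = 'D_v f1 u + 'D_v f2 u.
    move=> d1 d2; split; first exact: differentiableD d1 d2.
    by apply: deriveD; exact: diff_derivable.
  have S1 := add _ _ X1.1 Y1.1; have S2 := add _ _ S1.1 B3.1.
  apply: (etrans S2.2); apply: (f_equal2 +%R); first exact: (etrans S1.2 (f_equal2 +%R X1.2 Y1.2)).
  apply: (etrans B3.2); apply: (f_equal2 +%R) => //; apply: (f_equal2 *%R) => //.
  apply: (etrans B2.2); apply: (f_equal2 +%R); last by rewrite A2.2.
  by apply: (etrans B1.2); rewrite A1.2.
have H1 := etrans (esym (Dn (1, 0) (0, 1))) (dn (1, 0) (0, 1)).
have H2 := etrans (esym (Dn (0, 1) (1, 0))) (dn (0, 1) (1, 0)).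
have Sx := schwarz_mixed oU Uu Cx; have Sy := schwarz_mixed oU Uu Cy; have St := schwarz_mixed oU Uu Ct.
have J f1 f2 (d1 : differentiable (f1 \o phi) u) (d2 : differentiable (f2 \o phi) u) := jac_chart reg c Uu d1 d2.
have Jpx := J p (fun y : heis R => y.1.1) (Cpp.1 u Uu) (Cx.1 u Uu).
have Jqy := J q (fun y : heis R => y.1.2) (Cqp.1 u Uu) (Cy.1 u Uu).
have Jwt := J w (fun y : heis R => y.2) (Cwp.1 u Uu) (Ct.1 u Uu).
have Jwx := J w (fun y : heis R => y.1.1) (Cwp.1 u Uu) (Cx.1 u Uu).
have Jwy := J w (fun y : heis R => y.1.2) (Cwp.1 u Uu) (Cy.1 u Uu).
have Jxy := J (fun y : heis R => y.1.1) (fun y : heis R => y.1.2) (Cx.1 u Uu) (Cy.1 u Uu).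
have alg (P1 P2 Q1 Q2 O1 O2 X1 X2 Y1 Y2 T1 T2 x12 x21 y12 y21 t12 t21 pv qv wv x y h s j1 j2 j3 j4 j5 j6 : R) :
    P1 * X2 + pv * x12 + (Q1 * Y2 + qv * y12) + (O1 * (T2 + - 2^-1 * (x * Y2) + 2^-1 * (y * X2)) +
      wv * (t12 + - 2^-1 * (X1 * Y2 + x * y12) + 2^-1 * (Y1 * X2 + y * x12))) = 0 ->
    P2 * X1 + pv * x21 + (Q2 * Y1 + qv * y21) + (O2 * (T1 + - 2^-1 * (x * Y1) + 2^-1 * (y * X1)) +
      wv * (t21 + - 2^-1 * (X2 * Y1 + x * y21) + 2^-1 * (Y2 * X1 + y * x21))) = 0 ->
    x12 = x21 -> y12 = y21 -> t12 = t21 ->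
    j1 * h = s * (P1 * X2 - P2 * X1) -> j2 * h = s * (Q1 * Y2 - Q2 * Y1) ->
    j3 * h = s * (O1 * T2 - O2 * T1) -> j4 * h = s * (O1 * X2 - O2 * X1) ->
    j5 * h = s * (O1 * Y2 - O2 * Y1) -> j6 * h = s * (X1 * Y2 - X2 * Y1) -> 0 < h ->
    j1 + j2 + j3 - (x * j5 - y * j4) / 2 - wv * j6 = 0.
  move=> HA HB ex ey et h1 h2 h3 h4 h5 h6 hp; subst x12 y12 t12.
  have H0 := f_equal2 (fun x y : R => x - y) HA HB; rewrite /= subrr in H0.
  apply: (@mulIf _ h); first by rewrite gt_eqF.
  transitivity (s * 0); last by rewrite mulr0 mul0r.
  have -> : (j1 + j2 + j3 - (x * j5 - y * j4) / 2 - wv * j6) * h =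
    j1 * h + j2 * h + j3 * h - (x * (j5 * h) - y * (j4 * h)) / 2 - wv * (j6 * h) by field.
  by rewrite h1 h2 h3 h4 h5 h6 -H0; field.
have [_ hp _ _ _] := chart_unit_normal reg c Uu.
have K0 := alg _ _ _ _ _ _ _ _ _ _ _ _ _ _ _ _ _ _ _ _ _ _ _ _ _ _ _ _ _ _ _ H1 H2 Sx Sy St Jpx Jqy Jwt Jwx Jwy Jxy hp.
rewrite [(w \o phi) u]/(w (phi u)) ug -/(omegabar N g) in K0; have [jx jy jt] := jet_coord Mg.
rewrite (jac_jet jp jx) (jac_jet jq jy) (jac_jet jw jt) (jac_jet jw jx) (jac_jet jw jy) (jac_jet jx jy) in K0.
rewrite zp zq in K0; move: K0 PQ; move: (p g) (q g) (w g) (dE p g) (dE q g) (dZ w g) (dE w g) g.1.1 g.1.2.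
move=> pv qv wv ep eq zw ew x y K0 PQ.
apply/eqP; rewrite -subr_eq0; apply/eqP; rewrite -[RHS]K0.
apply/eqP; rewrite -subr_eq0; apply/eqP.
transitivity (wv ^+ 2 * (pv * pv + qv * qv - 1)); last by rewrite PQ subrr mulr0.
by field.
Qed.

(** The prefixes [z] and [e] denote derivatives along [Zfield] and [Efield]. The left side is the
    second derivative at 0 of the length of a polynomial vector with constant term [(p, q)] of
    length 1. The zeros on the right are the derivatives of [p] and [q] along [Zfield]; [ep] and
    [eq] are those given by [normal_structure]. The bracket lists the Jacobians that integrate to
    zero. *)
Lemma second_variation_algebra (p q w a b k za zb zk ea eb ek zw ew x y : R) :
  p ^+ 2 + q ^+ 2 = 1 ->
  let m := zw + w ^+ 2 in
  let ep := - (m * q) in let eq := m * p in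
  let z31 := zk + b * q + a * p in let z32 := (a * zb - b * za) / 2 in
  let e31 := ek + b * (w * p) - a * (w * q) in let e32 := (a * eb - b * ea) / 2 in
  let c1 := - zb - p * e31 - z31 * (w * q) in
  let c2 := zb * e31 + p * e32 - z31 * eb + z32 * (w * q) in
  let d1 := z31 * (w * p) + za - q * e31 in
  let d2 := z31 * ea - z32 * (w * p) - za * e31 + q * e32 in
  let al := p * a + q * b in let zal := p * za + q * zb in
  let eal := ep * a + p * ea + (eq * b + q * eb) in
  let be := q * a - p * b in let zbe := q * za - p * zb in
  let ebe := eq * a + q * ea - (ep * b + p * eb) in
  let F := al + w * k in let zF := zal + (zw * k + w * zk) in let eF := eal + (ew * k + w * ek) in
  let f2 := 2 * (al * k) + w * (k * k) in
  let zf2 := 2 * (zal * k + al * zk) + (zw * (k * k) + w * (zk * k + k * zk)) in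
  let ef2 := 2 * (eal * k + al * ek) + (ew * (k * k) + w * (ek * k + k * ek)) in
  let s := F * F + be * be in let zs := zF * F + F * zF + (zbe * be + be * zbe) in
  let es := eF * F + F * eF + (ebe * be + be * ebe) in
  let f3 := w * s in let zf3 := zw * s + w * zs in let ef3 := ew * s + w * es in
  let ab := al * be in let zab := zal * be + al * zbe in let eab := eal * be + al * ebe in
  let zx := q in let zy := - p in let ex := w * p in let ey := w * q in
  let zt := (x * - p - y * q) / 2 in let et := -1 + (x * (w * q) - y * (w * p)) / 2 in
  c1 ^+ 2 + d1 ^+ 2 + 2 * (p * c2 + q * d2) - (p * c1 + q * d1) ^+ 2 =
  zF ^+ 2 + (- 2 * zw - w ^+ 2) * F ^+ 2 +
  (2 * (zk * ebe - ek * zbe)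
   + (-1 * ((zab * q + ab * 0) * ex - (eab * q + ab * eq) * zx)
   + (1 * ((zab * p + ab * 0) * ey - (eab * p + ab * ep) * zy)
   + (-1 * (zf3 * et - ef3 * zt)
   + (2^-1 * ((zf3 * x + f3 * zx) * ey - (ef3 * x + f3 * ex) * zy)
   + (- 2^-1 * ((zf3 * y + f3 * zy) * ex - (ef3 * y + f3 * ey) * zx)
   + (-1 * ((zf2 * p + f2 * 0) * eq - (ef2 * p + f2 * ep) * 0)
   + 1 * ((zf2 * q + f2 * 0) * ep - (ef2 * q + f2 * eq) * 0)))))))).
Proof.
move=> pq /=; apply/eqP; rewrite -subr_eq0; apply/eqP.
(* the factor is the quotient of the division of the difference by [p ^+ 2 + q ^+ 2 - 1] *)
transitivity ((p ^+ 2 + q ^+ 2 - 1) * (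
      w ^+ 2 * zk ^+ 2 + 4 * q * w ^+ 2 * b * zk + (- (q ^+ 2 * w ^+ 2 * b ^+ 2)) + 4 * p * w ^+ 2 *
      a * zk + (- (2 * p ^+ 2 * w * b * zb)) + (- (2 * p * zb * ek)) + 2 * p * q * w * a * zb + (- (2
      * p ^+ 3 * w * b * ek)) + (- (p ^+ 2 * ek ^+ 2)) + 2 * p ^+ 2 * q * w * a * ek + (- (p ^+ 4 * w
      ^+ 2 * b ^+ 2)) + 2 * p ^+ 3 * q * w ^+ 2 * a * b + (- (p ^+ 2 * q ^+ 2 * w ^+ 2 * b ^+ 2)) + 2
      * p * q * w * b * za + (- (2 * p * q ^+ 2 * w * b * ek)) + 2 * p * q ^+ 3 * w ^+ 2 * a * b + (-
      (p ^+ 2 * q ^+ 2 * w ^+ 2 * a ^+ 2)) + (- (za ^+ 2)) + 2 * q * za * ek + (- (2 * q ^+ 2 * w * a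
      * za)) + (- (q ^+ 2 * ek ^+ 2)) + 2 * q ^+ 3 * w * a * ek + (- (q ^+ 4 * w ^+ 2 * a ^+ 2)) + (-
      (zb ^+ 2)) + q ^+ 2 * a ^+ 2 * zw + (- (4 * p * q * a * b * zw)) + (- (2 * p * q * w ^+ 2 * a *
      b)) + (- (q ^+ 2 * b ^+ 2 * zw)) + (- (2 * p * q * a * ea)) + (- (q ^+ 2 * b * ea)) + (- (q ^+
      2 * a * eb)) + 2 * p * q * b * eb + (- (2 * p * w ^+ 3 * a * k)) + (- (2 * q * w ^+ 3 * b * k))
      + (- (w ^+ 4 * k ^+ 2)) + k ^+ 2 * zw ^+ 2 + w ^+ 2 * k ^+ 2 * zw + 2 * p * k * za * zw + 2 * p
      * w ^+ 2 * k * za + 2 * q * k * zb * zw + 2 * q * w ^+ 2 * k * zb + 2 * p * a * zk * zw + 2 * q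
      * b * zk * zw + 2 * w * k * zk * zw + 2 * w ^+ 3 * k * zk + (- (p ^+ 2 * w ^+ 2 * a ^+ 2)) + (-
      (p ^+ 2 * a ^+ 2 * zw)) + p ^+ 2 * b ^+ 2 * zw + p ^+ 2 * b * ea + p ^+ 2 * a * eb)).
  by field.
by rewrite pq subrr mul0r.
Qed.

End pointwise_identity.

Lemma bound_aux (R : realType) (x1 x2 x3 x4 x5 x6 b B : R) : 0 < B -> 0 <= b ->
  `|x1| <= 4 * 6 * b -> `|x2| <= 4 * 6 * b -> `|x3| <= 6 * 6 * b -> `|x4| <= 6 * 6 * b ->
  `|x5| <= 4 * 8 * b -> `|x6| <= 4 * 8 * b ->
  `|2 * (x1 + x2)| <= 400 * b + B /\ `|2 * (x3 + x5 + (x4 + x6))| <= 400 * b + B.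
Proof.
rewrite !ler_norml => B0 b0 /andP[? ?] /andP[? ?] /andP[? ?] /andP[? ?] /andP[? ?] /andP[? ?].
by split; apply/andP; split; lra.
Qed.

Section cubic.
Context {R : realType} d (T : measurableType d) (mu : {measure set T -> \bar R}).

Definition cubic (c : nat -> T -> R) (l : R) g : R := c 0%N g + l * c 1%N g + l ^+ 2 * c 2%N g + l ^+ 3 * c 3%N g.
Definition cubic1 (c : nat -> T -> R) (l : R) g : R := c 1%N g + 2 * l * c 2%N g + 3 * l ^+ 2 * c 3%N g.
Definition cubic2 (c : nat -> T -> R) (l : R) g : R := 2 * c 2%N g + 6 * l * c 3%N g.

Variables (K : set T) (c e : nat -> T -> R) (w : T -> R) (B : R).
Hypotheses (mK : measurable K) (fK : (mu K < +oo)%E) (B0 : 0 < B).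
Hypotheses (mc : forall i, measurable_fun K (c i)) (me : forall i, measurable_fun K (e i)).
Hypotheses (bc : forall i g, K g -> `|c i g| <= B) (be : forall i g, K g -> `|e i g| <= B).
Hypotheses (mw : measurable_fun K w) (bw : forall g, K g -> `|w g| <= B).
Hypothesis unit0 : forall g, K g -> c 0%N g ^+ 2 + e 0%N g ^+ 2 = 1.

Let cubic_bound (f : nat -> T -> R) (l : R) g : (forall i g, K g -> `|f i g| <= B) -> `|l| < 1 -> K g ->
  [/\ `|cubic f l g| <= 4 * B, `|cubic1 f l g| <= 6 * B & `|cubic2 f l g| <= 8 * B].
Proof.
move=> bf l1 Kg; have l0 : 0 <= `|l| by [].
have l2 : `|l ^+ 2| <= 1 by rewrite normrX expr_le1// ltW.
have l3 : `|l ^+ 3| <= 1 by rewrite normrX expr_le1// ltW.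
have b i := bf i g Kg.
have H (x y : R) : `|x| <= 1 -> `|y| <= B -> `|x * y| <= B.
  by move=> h1 h2; rewrite normrM -[leRHS]mul1r; apply: ler_pM.
have h1 := H l (f 1%N g) (ltW l1) (b 1%N); have h2 := H _ (f 2%N g) l2 (b 2%N).
have h3 := H _ (f 3%N g) l3 (b 3%N); have h4 := H l (f 2%N g) (ltW l1) (b 2%N).
have h5 := H l (f 3%N g) (ltW l1) (b 3%N); have h6 := H _ (f 3%N g) l2 (b 3%N).
have := b 0%N; have := b 1%N; have := b 2%N; move: h1 h2 h3 h4 h5 h6.
rewrite /cubic /cubic1 /cubic2 -!mulrA !ler_norml.
move: (l * f 1%N g) (l ^+ 2 * f 2%N g) (l ^+ 3 * f 3%N g) (l * f 2%N g) (l * f 3%N g) (l ^+ 2 * f 3%N g).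
move=> x1 x2 x3 x4 x5 x6 /andP[? ?] /andP[? ?] /andP[? ?] /andP[? ?] /andP[? ?] /andP[? ?].
by move=> /andP[? ?] /andP[? ?] /andP[? ?]; split; apply/andP; split; lra.
Qed.

Let G l g := cubic c l g ^+ 2 + cubic e l g ^+ 2.
Let G1 l g := 2 * (cubic c l g * cubic1 c l g + cubic e l g * cubic1 e l g).
Let G2 l g := 2 * (cubic1 c l g ^+ 2 + cubic c l g * cubic2 c l g +
  (cubic1 e l g ^+ 2 + cubic e l g * cubic2 e l g)).

Let cubic_is_derive f (l : R) g : is_derive l (1 : R) (fun l => cubic f l g) (cubic1 f l g) /\
  is_derive l (1 : R) (fun l => cubic1 f l g) (cubic2 f l g).
Proof.
split; first exact: cubic_derive.
have D := cubic_derive (f 1%N g) (2 * f 2%N g) (3 * f 3%N g) 0 l.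
have -> : (fun l => cubic1 f l g) =
    (fun l => f 1%N g + l * (2 * f 2%N g) + l ^+ 2 * (3 * f 3%N g) + l ^+ 3 * 0).
  by apply/funext => s; rewrite /cubic1; ring.
by apply: (is_derive_eq D); rewrite /cubic2; ring.
Qed.

Let mul_is_derive (f f' g g' : R -> R) (l : R) : is_derive l (1 : R) f (f' l) -> is_derive l (1 : R) g (g' l) ->
  is_derive l (1 : R) (fun l => f l * g l) (f' l * g l + f l * g' l).
Proof.
move=> df dg; apply: (is_derive_eq (is_deriveM df dg)).
by rewrite -![_ *: _]/(_ * _) addrC [g l * _]mulrC.
Qed.

Let measurable_cubic f l : (forall i, measurable_fun K (f i)) ->
  measurable_fun K (cubic f l) /\ measurable_fun K (cubic1 f l).
Proof.
move=> mf; have mZ x i : measurable_fun K (fun g => x * f i g).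
  by apply: measurable_funM => //; exact: measurable_cst.
split.
- exact: measurable_funD (measurable_funD (measurable_funD (mf _) (mZ _ _)) (mZ _ _)) (mZ _ _).
- exact: measurable_funD (measurable_funD (mf _) (mZ _ _)) (mZ _ _).
Qed.

(** The squared length [G] of the polynomial vector is 1 at [l = 0], so the second derivative of its
    square root there is [G'' / 2 - G' ^ 2 / 4]. *)
Lemma cubic_sqrt_derive2 : exists2 r, 0 < r & let I l := \int[mu]_(g in K)
    (Num.sqrt (cubic c l g ^+ 2 + cubic e l g ^+ 2) * w g) in
  [/\ forall l, `|l| < r -> mu.-integrable K (EFin \o (fun g =>
        Num.sqrt (cubic c l g ^+ 2 + cubic e l g ^+ 2) * w g)),
      forall l, `|l| < r -> derivable I l 1, derivable (derive1 I) 0 1 &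
      derive1 (derive1 I) 0 = \int[mu]_(g in K) ((c 1%N g ^+ 2 + e 1%N g ^+ 2 +
        2 * (c 0%N g * c 2%N g + e 0%N g * e 2%N g) - (c 0%N g * c 1%N g + e 0%N g * e 1%N g) ^+ 2) * w g)].
Proof.
have mcl l := measurable_cubic l mc; have mel l := measurable_cubic l me.
have mG l : measurable_fun K (G l).
  apply: (@eq_measurable_fun _ _ _ _ _ (fun g => cubic c l g * cubic c l g + cubic e l g * cubic e l g)) => //.
  exact: measurable_funD (measurable_funM (mcl l).1 (mcl l).1) (measurable_funM (mel l).1 (mel l).1).
have mG1 l : measurable_fun K (G1 l).
  apply: measurable_funM; first exact: measurable_cst.
  exact: measurable_funD (measurable_funM (mcl l).1 (mcl l).2) (measurable_funM (mel l).1 (mel l).2).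
(* The bounds [4 B], [6 B], [8 B] for a cubic and its derivatives give at most
   [2 * (36 + 32 + 36 + 32) * B ^ 2] for the second derivative of [G]; the summand [B] makes [C] a
   bound for [w] too. *)
pose C := 400 * B ^+ 2 + B.
have C0 : 0 < C by apply: addr_gt0 B0; apply: mulr_gt0; [rewrite ltr0n|exact: exprn_gt0].
have BC : B <= C by rewrite lerDr; apply: mulr_ge0; [rewrite ler0n|exact: sqr_ge0].
have wC g : K g -> `|w g| <= C by move=> /bw h; exact: le_trans h BC.
have dG (l : R) g : `|l| < 1 -> K g -> is_derive l (1 : R) (G^~ g) (G1 l g).
  move=> _ _; have [D1 _] := cubic_is_derive c l g; have [D2 _] := cubic_is_derive e l g.
  have D := is_deriveD (mul_is_derive (f' := cubic1 c ^~ g) (g' := cubic1 c ^~ g) D1 D1)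
    (mul_is_derive (f' := cubic1 e ^~ g) (g' := cubic1 e ^~ g) D2 D2).
  by apply: (is_derive_eq D); rewrite /G1; ring.
have dG1 (l : R) g : `|l| < 1 -> K g -> is_derive l (1 : R) (G1^~ g) (G2 l g).
  move=> _ _; have [D1 D1'] := cubic_is_derive c l g; have [D2 D2'] := cubic_is_derive e l g.
  have D := is_derive_mull 2 (is_deriveD
    (mul_is_derive (f' := cubic1 c ^~ g) (g' := cubic2 c ^~ g) D1 D1')
    (mul_is_derive (f' := cubic1 e ^~ g) (g' := cubic2 e ^~ g) D2 D2')).
  by apply: (is_derive_eq D); rewrite /G2; ring.
have bG (l : R) g : `|l| < 1 -> K g -> `|G1 l g| <= C /\ `|G2 l g| <= C.
  move=> l1 Kg; have [p0 p1 p2] := cubic_bound bc l1 Kg; have [q0 q1 q2] := cubic_bound be l1 Kg.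
  have M (x y s t : R) : `|x| <= s * B -> `|y| <= t * B -> `|x * y| <= s * t * (B * B).
    by move=> h1 h2; rewrite normrM mulrACA; apply: ler_pM.
  have m1 := M _ _ _ _ p0 p1; have m2 := M _ _ _ _ q0 q1; have m3 := M _ _ _ _ p1 p1.
  have m4 := M _ _ _ _ q1 q1; have m5 := M _ _ _ _ p0 p2; have m6 := M _ _ _ _ q0 q2.
  have b2 : 0 <= B * B by rewrite mulr_ge0// ltW.
  rewrite /G1 /G2 /C ![_ ^+ 2]expr2; exact: (bound_aux B0 b2 m1 m2 m3 m4 m5 m6).
have c0 f g : cubic f 0 g = f 0%N g by rewrite /cubic; ring.
have c1 f g : cubic1 f 0 g = f 1%N g by rewrite /cubic1; ring.
have c2 f g : cubic2 f 0 g = 2 * f 2%N g by rewrite /cubic2; ring.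
have G01 g : K g -> G 0 g = 1 by move=> Kg; rewrite /G !c0 unit0.
have [D1 D2 E] := sqrt_integral_derive2 mK fK mG mG1 mw C0 wC dG dG1 bG G01.
have int := sqrtG_integrable mK fK mG mw C0 wC dG bG G01.
exists (2 * C + 2)^-1; first exact: threshold_gt0.
split=> //; rewrite [LHS]E; apply: eq_Rintegral => g _; congr (_ * _).
by rewrite /G1 /G2 !c0 !c1 !c2; field.
Qed.

End cubic.

(** * Minimality and the horizontal normal along Z *)

Section minimality.
Context {R : realType}.
Implicit Types (U : set (R * R)) (phi : R * R -> heis R) (f : heis R -> R) (g v w : heis R).

Lemma derive_theta g v u : differentiable (theta^~ v) g /\
  'D_u (theta^~ v) g = - (u.1.1 * v.1.2 - u.1.2 * v.1.1) / 2.
Proof.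
have did : differentiable (id : heis R -> heis R) g by exact: ex_diff.
have Did : 'D_u (id : heis R -> heis R) g = u by rewrite deriveE// diff_val.
have [px Px] := @derive_linear R (heis R) _ _ (@coord_x R) id g u (@coord_x_continuous R) did.
have [py Py] := @derive_linear R (heis R) _ _ (@coord_y R) id g u (@coord_y_continuous R) did.
have [d1 D1] := derive_addl (- v.1.2 / 2) u (differentiable_cst v.2 g) px.
have [d2 D2] := derive_addl (v.1.1 / 2) u d1 py.
have -> : theta^~ v = (fun z => cst v.2 z + - v.1.2 / 2 * (coord_x \o id) z + v.1.1 / 2 * (coord_y \o id) z).
  by apply/funext => z; rewrite /theta /=; field.
split=> //; rewrite D2 D1 derive_cst Px Py Did /=.
by move: u.1.1 u.1.2 => *; field.
Qed.

Lemma derive_metric g v w u :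
  'D_u (fun h => metric h v w) g = - (u.1.1 * v.1.2 - u.1.2 * v.1.1) / 2 * theta g w +
    theta g v * (- (u.1.1 * w.1.2 - u.1.2 * w.1.1) / 2).
Proof.
have [d1 D1] := derive_theta g v u; have [d2 D2] := derive_theta g w u.
have [d3 D3] := derive_mul u d1 d2.
have [_ D4] := derive_addl 1 u (differentiable_cst (v.1.1 * w.1.1 + v.1.2 * w.1.2) g) d3.
have E : (fun h => metric h v w) =
    (fun z => cst (v.1.1 * w.1.1 + v.1.2 * w.1.2) z + 1 * (theta z v * theta z w)).
  by apply/funext => h; rewrite /metric mul1r.
by rewrite E D4 derive_cst add0r mul1r D3 D1 D2.
Qed.

Variables (S M : set (heis R)) (N : heis R -> heis R).
Hypothesis reg : regular_part S M N.

(** Because [Zfield] is horizontal, the Christoffel terms cancel, and the curvature reduces up to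
    sign to [pbar Z(qbar) - qbar Z(pbar)]. Together with [pbar Z(pbar) + qbar Z(qbar) = 0] this is a
    linear system of determinant 1. *)
Lemma minimal_normal g : M g -> H_curvature S N g = 0 ->
  dZ S N (pbar N) g = 0 /\ dZ S N (qbar N) g = 0.
Proof.
case: (reg) => cS CM _ _ W0 Mg; have Wg := W0 _ Mg; have [Z1 Z2 Z3] := Zfield_frame N g.
have LC v : LC_inner S (Zfield N) g (Zfield N g) v = metric g (tder S (Zfield N) g (Zfield N g)) v.
  rewrite /LC_inner !derive_metric Z3 !mul0r.
  by move: (Zfield N g).1.1 (Zfield N g).1.2 (theta g v) => *; field.
rewrite /H_curvature /nabla !LC; set t := tder S _ g _.
have mX1 : metric g t (X1 g) = t.1.1 by rewrite /metric theta_X1 /X1 /=; ring.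
have mX2 : metric g t (X2 g) = t.1.2 by rewrite /metric theta_X2 /X2 /=; ring.
have mnu (x y z : R) : metric g (x *: X1 g + y *: X2 g + z *: Tfield g) (nuH N g) = x * pbar N g + y * qbar N g.
  rewrite /nuH /metric !(thetaD, thetaZ) theta_X1 theta_X2 theta_T /X1 /X2 /Tfield /=.
  by rewrite -![_ *: _]/(_ * _); ring.
rewrite mnu mX1 mX2.
have [U [phi [c [u Uu ug]]]] := CM g Mg; have [oU C2 _ _ _] := c.
have [Cp Cq _] := unit_normal_Ck reg; have [Cx Cy _] := Ck_coord oU (CkS C2).
have dF : differentiable (Zfield N \o phi) u.
  have Ch : Ck 1 U (fun=> 2^-1 : R) by exact: Ck_cst.
  have CF : Ck 1 U (Zfield N \o phi).
    apply: (Ck_ext oU) (Ck_pair oU (Ck_pair oU (Cq _ _ c) (CkN oU (Cp _ _ c)))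
      (CkN oU (CkM oU (CkD oU (CkM oU (Cq _ _ c) Cy) (CkM oU (Cp _ _ c) Cx)) Ch))) => v _.
    apply/eqP; rewrite -subr_eq0; apply/eqP; apply: (@frame_eq0 _ (phi v)).
    + by rewrite /Zfield /X1 /X2 /= -![_ *: _]/(_ * _); ring.
    + by rewrite /Zfield /X1 /X2 /= -![_ *: _]/(_ * _); ring.
    + by rewrite /Zfield /theta /X1 /X2 /= -![_ *: _]/(_ * _); field.
  exact: CF.1.
have EZ := chart_coeffE reg c Uu (ltac:(by rewrite ug; exact: Zfield_tangent)).
have tE : t = 'D_(chart_coeff (Zfield N) phi u) (Zfield N \o phi) u.
  by rewrite /t -ug [X in tder _ _ _ X]EZ; exact: (tder_chart _ (cS _ _ c) Uu dF).
have dp := (Cp _ _ c).1 u Uu; have dq := (Cq _ _ c).1 u Uu.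
have [zp _] := dZE_chart reg c Uu dp; have [zq _] := dZE_chart reg c Uu dq.
rewrite ug in zp zq; set v := chart_coeff _ phi u in tE zp zq.
have t1 : t.1.1 = dZ S N (qbar N) g.
  have [_ D] := @derive_linear R (R * R)%type _ _ (@coord_x R) _ u v (@coord_x_continuous R) dF.
  rewrite tE zq; apply: (etrans (esym D)); congr ('D_v _ u); apply/funext => z.
  by have [H _ _] := Zfield_frame N (phi z).
have t2 : t.1.2 = - dZ S N (pbar N) g.
  have [_ D] := @derive_linear R (R * R)%type _ _ (@coord_y R) _ u v (@coord_y_continuous R) dF.
  have dN : 'D_v (- (pbar N \o phi)) u = - 'D_v (pbar N \o phi) u.
    by apply: deriveN; exact: diff_derivable.
  rewrite tE zp -dN; apply: (etrans (esym D)); congr ('D_v _ u); apply/funext => z.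
  by have [_ H _] := Zfield_frame N (phi z).
rewrite t1 t2; have [m [E1 _ _]] := normal_structure reg Mg; have := unit_hor Wg.
move: E1; move: (dZ S N (pbar N) g) (dZ S N (qbar N) g) (pbar N g) (qbar N g) => zp' zq' x y E1 xy E2.
have zp0 : zp' * (x ^+ 2 + y ^+ 2) = x * (zp' * x + zq' * y) - y * (zq' * x + - zp' * y) by ring.
have zq0 : zq' * (x ^+ 2 + y ^+ 2) = y * (zp' * x + zq' * y) + x * (zq' * x + - zp' * y) by ring.
move/eqP: E2; rewrite oppr_eq0 => /eqP E2.
by move: zp0 zq0; rewrite xy !mulr1 E1 E2 !mulr0 subrr addr0.
Qed.

End minimality.

(** * The second variation over a region with finite perimeter outside the support *)

Section region.
Context {R : realType}.
Implicit Types (U : set (R * R)) (phi : R * R -> heis R) (f : heis R -> R) (g : heis R).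

Variables (S M D K W : set (heis R)) (N : heis R -> heis R) (a b k : heis R -> R).
Hypotheses (reg : regular_part S M N) (CS : C2_surface S) (nS : normal_field S N).
Hypotheses (oW : open W) (DE : D = S `&` W).
Hypotheses (cK : compact K) (KM : K `<=` M) (KD : K `<=` D).
Hypotheses (Ca : surfCk 2 S a) (Cb : surfCk 2 S b) (Ck_ : surfCk 2 S k).
Hypothesis abk0 : forall g, ~ K g -> [/\ a g = 0, b g = 0 & k g = 0].
Hypothesis minimal : forall g, M g -> H_curvature S N g = 0.

Local Notation dZ := (dZ S N).
Local Notation dE := (dE S N).
Local Notation jac := (jac S N).
Local Notation p := (pbar N).
Local Notation q := (qbar N).
Local Notation w := (omegabar N).
Local Notation F := (normal_component a b k N).
Local Notation mu := (borel_area S).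

(** The expansions are [defZ3 = l z31 - l ^ 2 z32] and [defE3 = -1 + l e31 - l ^ 2 e32]; [cP] and
    [cQ] below collect the resulting coefficients of [defP] and [defQ]. *)
Let z31 g := dZ k g + b g * q g + a g * p g.
Let z32 g := (a g * dZ b g - b g * dZ a g) * 2^-1.
Let e31 g := dE k g + b g * (w g * p g) - a g * (w g * q g).
Let e32 g := (a g * dE b g - b g * dE a g) * 2^-1.

Let cP (i : nat) g : R := match i with
  | 0 => p g
  | 1 => -1 * dZ b g - p g * e31 g - z31 g * (w g * q g)
  | 2 => dZ b g * e31 g + p g * e32 g - z31 g * dE b g + z32 g * (w g * q g)
  | 3 => z32 g * dE b g - dZ b g * e32 g
  | _ => 0 end.

Let cQ (i : nat) g : R := match i with
  | 0 => q g
  | 1 => z31 g * (w g * p g) + dZ a g - q g * e31 g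
  | 2 => z31 g * dE a g - z32 g * (w g * p g) - dZ a g * e31 g + q g * e32 g
  | 3 => dZ a g * e32 g - z32 g * dE a g
  | _ => 0 end.

Let defP_cubic l g : defP S N a b k l g = cubic cP l g.
Proof.
rewrite /defP /defE3 /defZ3 /deform_theta /cubic /cP /z31 /z32 /e31 /e32.
move: (a g) (b g) (dZ a g) (dZ b g) (dZ k g) (dE a g) (dE b g) (dE k g) (p g) (q g) (w g) => *.
by field.
Qed.

Let defQ_cubic l g : defQ S N a b k l g = cubic cQ l g.
Proof.
rewrite /defQ /defE3 /defZ3 /deform_theta /cubic /cQ /z31 /z32 /e31 /e32.
move: (a g) (b g) (dZ a g) (dZ b g) (dZ k g) (dE a g) (dE b g) (dE k g) (p g) (q g) (w g) => *.
by field.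
Qed.

Let surfCk_cst n (x : R) : surfCk n M (fun=> x).
Proof. by move=> U phi c; have [oU _ _ _ _] := c; exact: Ck_cst. Qed.

Let coefficients_continuous i : surfCk 0 M (cP i) /\ surfCk 0 M (cQ i).
Proof.
have [za ea] := frame_functions_continuous reg Ca; have [zb eb] := frame_functions_continuous reg Cb.
have [zk ek] := frame_functions_continuous reg Ck_.
have C0 f : surfCk 2 S f -> surfCk 0 M f.
  by move=> Cf U phi c; exact: CkS (CkS (regular_Ck reg Cf c)).
have [p1 q1 w1] := unit_normal_Ck reg.
have Cp : surfCk 0 M p by move=> U phi c; exact: CkS (p1 _ _ c).
have Cq : surfCk 0 M q by move=> U phi c; exact: CkS (q1 _ _ c).
have Cw : surfCk 0 M w by move=> U phi c; exact: CkS (w1 _ _ c).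
have A := C0 a Ca; have B := C0 b Cb.
have X1 : surfCk 0 M z31 := surfCkD (surfCkD zk (surfCkM B Cq)) (surfCkM A Cp).
have X2 : surfCk 0 M z32 := surfCkM (surfCkB (surfCkM A zb) (surfCkM B za)) (surfCk_cst 0 2^-1).
have Y1 : surfCk 0 M e31 := surfCkB (surfCkD ek (surfCkM B (surfCkM Cw Cp))) (surfCkM A (surfCkM Cw Cq)).
have Y2 : surfCk 0 M e32 := surfCkM (surfCkB (surfCkM A eb) (surfCkM B ea)) (surfCk_cst 0 2^-1).
case: i => [|[|[|[|i]]]]; split; rewrite /cP /cQ.
- exact: Cp.
- exact: Cq.
- exact: surfCkB (surfCkB (surfCkM (surfCk_cst 0 (-1)) zb) (surfCkM Cp Y1)) (surfCkM X1 (surfCkM Cw Cq)).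
- exact: surfCkB (surfCkD (surfCkM X1 (surfCkM Cw Cp)) za) (surfCkM Cq Y1).
- exact: surfCkD (surfCkB (surfCkD (surfCkM zb Y1) (surfCkM Cp Y2)) (surfCkM X1 eb)) (surfCkM X2 (surfCkM Cw Cq)).
- exact: surfCkD (surfCkB (surfCkB (surfCkM X1 ea) (surfCkM X2 (surfCkM Cw Cp))) (surfCkM za Y1)) (surfCkM Cq Y2).
- exact: surfCkB (surfCkM X2 eb) (surfCkM zb Y2).
- exact: surfCkB (surfCkM za Y2) (surfCkM X2 ea).
- exact: surfCk_cst.
- exact: surfCk_cst.
Qed.

Let MS : M `<=` S. Proof. exact: regular_sub reg. Qed.

Let CM : C2_surface M. Proof. by case: reg. Qed.

Let mK : measurable K. Proof. exact: heis_compact_measurable. Qed.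

Let common_bound : exists2 B, 0 < B & forall g, K g ->
  [/\ forall i, `|cP i g| <= B, forall i, `|cQ i g| <= B & `|hdens N g| <= B].
Proof.
have bd f : surfCk 0 M f -> exists2 B, 0 < B & forall g, K g -> `|f g| <= B.
  by move=> Cf; exact: surf_compact_bounded CM Cf cK KM.
have [h0 h00 H] := bd _ (hdens_regular reg).
have [p0 p00 P0] := bd _ (coefficients_continuous 0).1; have [p1 p10 P1] := bd _ (coefficients_continuous 1).1.
have [p2 p20 P2] := bd _ (coefficients_continuous 2).1; have [p3 p30 P3] := bd _ (coefficients_continuous 3).1.
have [q0 q00 Q0] := bd _ (coefficients_continuous 0).2; have [q1 q10 Q1] := bd _ (coefficients_continuous 1).2.
have [q2 q20 Q2] := bd _ (coefficients_continuous 2).2; have [q3 q30 Q3] := bd _ (coefficients_continuous 3).2.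
exists (h0 + p0 + p1 + p2 + p3 + q0 + q1 + q2 + q3); first by rewrite !addr_gt0.
move=> g Kg; split; last by have := H g Kg; lra.
- by case=> [|[|[|[|i]]]]; [have := P0 g Kg|have := P1 g Kg|have := P2 g Kg|have := P3 g Kg|rewrite normr0]; lra.
- by case=> [|[|[|[|i]]]]; [have := Q0 g Kg|have := Q1 g Kg|have := Q2 g Kg|have := Q3 g Kg|rewrite normr0]; lra.
Qed.

Hypothesis finite_rest : (\int[mu]_(g in D `\` K) (hdens N g)%:E < +oo)%E.

Let I l := \int[mu]_(g in K) (Num.sqrt (cubic cP l g ^+ 2 + cubic cQ l g ^+ 2) * hdens N g).

Let rho2 g : R := cP 1 g ^+ 2 + cQ 1 g ^+ 2 + 2 * (cP 0 g * cP 2 g + cQ 0 g * cQ 2 g) -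
  (cP 0 g * cP 1 g + cQ 0 g * cQ 1 g) ^+ 2.

Let integral_derive : exists2 r, 0 < r & [/\ forall l, `|l| < r -> mu.-integrable K (EFin \o (fun g =>
        Num.sqrt (cubic cP l g ^+ 2 + cubic cQ l g ^+ 2) * hdens N g)),
      forall l, `|l| < r -> derivable I l 1, derivable (derive1 I) 0 1 &
      derive1 (derive1 I) 0 = \int[mu]_(g in K) (rho2 g * hdens N g)].
Proof.
have [B B0 HB] := common_bound; case: (reg) => _ _ _ _ W0.
apply: (@cubic_sqrt_derive2 R _ _ mu K cP cQ (hdens N) B) => //.
- by apply: (compact_area_finite CS cK); exact: subset_trans MS.
- by move=> i; exact: surf_continuous_measurable CM (coefficients_continuous i).1 mK KM.
- by move=> i; exact: surf_continuous_measurable CM (coefficients_continuous i).2 mK KM.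
- by move=> i g /HB[].
- by move=> i g /HB[].
- exact: surf_continuous_measurable CM (hdens_regular reg) mK KM.
- by move=> g /HB[].
- by move=> g Kg; apply: unit_hor; exact: W0 (KM Kg).
Qed.

Let rest := fine (\int[mu]_(g in D `\` K) (hdens N g)%:E).

(** Outside [K] the density does not depend on [l]. The contribution of that part is a constant, and
    its finiteness, assumed above, makes the decomposition one of real numbers. *)
Let perimeter_split : \forall l \near (0 : R), H_perimeter (deform a b k l D) = (rest + I l)%:E.
Proof.
have KS : K `<=` S := subset_trans KM MS.
have [r r0 [int _ _ _]] := integral_derive.
have [e e0 biL] := deform_bilipschitz CS cK KS Ca Cb Ck_ abk0.
have m0 : 0 < Num.min r e by rewrite lt_min r0.
apply: filterS (@near_dist R R 0 _ m0) => l; rewrite subr0 lt_min => /andP[lr le].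
have CD : C2_surface D by rewrite DE; exact: open_surface.
have DS : D `<=` S by rewrite DE; exact: subIsetl.
have mD := surface_measurable CD.
rewrite (perimeter_deform reg CS nS oW DE cK KM Ca Cb Ck_ abk0 (biL l le)).
have mf : measurable_fun D (fun g => (deform_ratio S K N a b k l g * hdens N g)%:E).
  apply: (measurable_EFinP _ _).2; apply: measurable_funM.
    exact: (ratio_measurable reg cK KM Ca Cb Ck_ l mD DS).
  exact: (surf_continuous_measurable CS (hdens_continuous nS) mD).
have EDK : D = (D `\` K) `|` K.
  rewrite eqEsubset; split=> g; last by move=> [[]//|/KD].
  by move=> Dg; have [Kg|nK] := pselect (K g); [right|left].
have H0 g : 0 <= deform_ratio S K N a b k l g * hdens N g by rewrite mulr_ge0 ?ratio_ge0 ?hdens_ge0.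
rewrite {1}EDK ge0_integral_setU//; first last.
- by apply/disj_setPS => g [[_ nK] Kg].
- by move=> g _; rewrite lee_fin.
- by rewrite -EDK.
- exact: measurableD.
have -> : (\int[mu]_(g in D `\` K) (deform_ratio S K N a b k l g * hdens N g)%:E =
    \int[mu]_(g in D `\` K) (hdens N g)%:E)%E.
  by apply: eq_integral => g; rewrite inE => -[_ nK]; rewrite /deform_ratio memNset// mul1r.
have -> : (\int[mu]_(g in K) (deform_ratio S K N a b k l g * hdens N g)%:E =
    \int[mu]_(g in K) (Num.sqrt (cubic cP l g ^+ 2 + cubic cQ l g ^+ 2) * hdens N g)%:E)%E.
  by apply: eq_integral => g; rewrite inE => Kg; rewrite /deform_ratio mem_set// defP_cubic defQ_cubic.
rewrite EFinD /rest /I /Rintegral !fineK//.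
- exact: (integrable_fin_num mK (int l lr)).
- rewrite ge0_fin_numE//; apply: integral_ge0 => g _; rewrite lee_fin; exact: hdens_ge0.
Qed.

Lemma perimeter_derive2 : twice_differentiable_perimeter a b k D /\
  second_variation a b k D = \int[mu]_(g in K) (rho2 g * hdens N g).
Proof.
have [r r0 [_ D1 D2 E2]] := integral_derive.
have nE : \forall l \near (0 : R), rest + I l = deformed_perimeter a b k D l.
  by apply: filterS perimeter_split => l; rewrite /deformed_perimeter => ->.
have dI (l : R) : `|l| < r -> is_derive l (1 : R) (fun l => rest + I l) (derive1 I l).
  move=> lr; have DI : is_derive l (1 : R) I (derive1 I l) by rewrite derive1E; apply/derivableP; exact: D1.
  by apply: (is_derive_eq (is_deriveD (is_derive_cst rest l 1) DI)); rewrite add0r.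
have nnE : \forall l \near (0 : R), \forall s \near l, rest + I s = deformed_perimeter a b k D s.
  exact: near_join nE.
have nD : \forall l \near (0 : R), is_derive l (1 : R) (deformed_perimeter a b k D) (derive1 I l).
  apply: filterS2 nnE (@near_dist R R 0 _ r0) => l h1; rewrite subr0 => h2.
  exact: (near_eq_is_derive h1 (dI l h2)).
have nD' : \forall l \near (0 : R), derive1 I l = derive1 (deformed_perimeter a b k D) l.
  by apply: filterS nD => l [_ <-]; rewrite derive1E.
split; first split.
- by apply: filterS perimeter_split => l ->.
- by apply: filterS nD => l [].
- exact: (near_eq_derivable nD' D2).
rewrite /second_variation -E2 /= derive1E -(near_eq_derive (1 : R) nD') -derive1E.
by [].
Qed.

Definition variation_density g : R := dZ F g ^+ 2 + (- 2 * dZ w g - w g ^+ 2) * F g ^+ 2.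

(** [al] and [be] are the components of the variation field along [nuH] and [Zfield]. The product
    [f2] times [pbar dqbar - qbar dpbar] and the product [f3] times the contact form are among the
    terms whose differentials make up the remainder. *)
Let al y := p y * a y + q y * b y.
Let be y := q y * a y + -1 * (p y * b y).
Let f2 y := 2 * (al y * k y) + w y * (k y * k y).
Let f3 y := w y * (F y * F y + be y * be y).
Let gx (y : heis R) : R := y.1.1.
Let gy (y : heis R) : R := y.1.2.
Let gt (y : heis R) : R := y.2.

(** A triple (c, f, g) stands for c df /\ dg, with [f] vanishing off [K]. The sum is formally the
    differential of 2 k d be - al be (q dx - p dy) - f3 theta - f2 (p dq - q dp). The contact form
    contributes three triples because theta = dt - (x dy - y dx) / 2. *)
Let exact_terms : seq (R * (heis R -> R) * (heis R -> R)) :=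
  [:: (2, k, be); (-1, fun y => al y * be y * q y, gx); (1, fun y => al y * be y * p y, gy);
      (-1, f3, gt); (2^-1, fun y => f3 y * gx y, gy); (- 2^-1, fun y => f3 y * gy y, gx);
      (-1, fun y => f2 y * p y, q); (1, fun y => f2 y * q y, p)].

Let exact_part g := foldr (fun t s => t.1.1 * jac t.1.2 t.2 g + s) 0 exact_terms.

Let C1S f : surfCk 2 S f -> surfCk 1 M f.
Proof. by move=> Cf U phi c; exact: CkS (regular_Ck reg Cf c). Qed.

(** Minimality enters through the jets of [pbar] and [qbar]: no derivative along [Zfield], and along
    [Efield] the one fixed by the normal relation. All other jets are built from these, and the
    polynomial identity concludes. *)
Lemma rho2E g : M g -> rho2 g = variation_density g + exact_part g.
Proof.
case: (reg) => _ _ _ _ W0 Mg; have Wg := W0 _ Mg.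
have [Cp Cq Cw] := unit_normal_Ck reg; have [zp zq] := minimal_normal reg Mg (minimal Mg).
have [m [_ _ /(_ zp zq)[ep [eq mE]]]] := normal_structure reg Mg.
have jp : jet S M N p g (p g) 0 (- ((dZ w g + w g ^+ 2) * q g)) by rewrite -mE -ep -zp; exact: jetE.
have jq : jet S M N q g (q g) 0 ((dZ w g + w g ^+ 2) * p g) by rewrite -mE -eq -zq; exact: jetE.
have jw := jetE S N g Cw.
have ja := jetE S N g (C1S Ca); have jb := jetE S N g (C1S Cb).
have jk := jetE S N g (C1S Ck_).
have [jx jy jt] := jet_coord reg Mg; have jc x := jet_cst reg x Mg.
have jal := jetD reg Mg (jetM reg Mg jp ja) (jetM reg Mg jq jb).
have jbe := jetD reg Mg (jetM reg Mg jq ja) (jetM reg Mg (jc (-1)) (jetM reg Mg jp jb)).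
have jF := jetD reg Mg jal (jetM reg Mg jw jk).
have jf2 := jetD reg Mg (jetM reg Mg (jc 2) (jetM reg Mg jal jk)) (jetM reg Mg jw (jetM reg Mg jk jk)).
have jf3 := jetM reg Mg jw (jetD reg Mg (jetM reg Mg jF jF) (jetM reg Mg jbe jbe)).
have jab := jetM reg Mg jal jbe.
have EF : dZ F g = _ := let: And4 _ _ x _ := jF in x.
rewrite /variation_density EF /exact_part /exact_terms /=.
rewrite (jac_jet jk jbe) (jac_jet (jetM reg Mg jab jq) jx) (jac_jet (jetM reg Mg jab jp) jy).
rewrite (jac_jet jf3 jt) (jac_jet (jetM reg Mg jf3 jx) jy) (jac_jet (jetM reg Mg jf3 jy) jx).
rewrite (jac_jet (jetM reg Mg jf2 jp) jq) (jac_jet (jetM reg Mg jf2 jq) jp).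
have H := @second_variation_algebra R (p g) (q g) (w g) (a g) (b g) (k g) (dZ a g) (dZ b g) (dZ k g) (dE a g) (dE b g)
  (dE k g) (dZ w g) (dE w g) g.1.1 g.1.2 (unit_hor Wg).
rewrite /= in H; rewrite /rho2 /cP /cQ /z31 /z32 /e31 /e32 /normal_component /be /al /f2 /f3 /gx /gy /gt.
move: H; move: (a g) (b g) (k g) (dZ a g) (dZ b g) (dZ k g) (dE a g) (dE b g)
  (dE k g) (dZ w g) (dE w g) g.1.1 g.1.2 (p g) (q g) (w g).
move=> x1 x2 x3 x4 x5 x6 x7 x8 x9 x10 x11 x12 x13 x14 x15 x16 H.
have tr (A B C E : R) : C = E -> A = C -> B = E -> A = B by move=> CE -> ->.
by apply: (tr _ _ _ _ H); field.
Qed.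

Let F_Ck : surfCk 1 M F.
Proof.
have [Cp Cq Cw] := unit_normal_Ck reg.
exact: surfCkD (surfCkD (surfCkM Cp (C1S Ca)) (surfCkM Cq (C1S Cb))) (surfCkM Cw (C1S Ck_)).
Qed.

Lemma variation_density_continuous :
  surfCk 0 M (fun g => dZ F g ^+ 2) /\ surfCk 0 M (fun g => (- 2 * dZ w g - w g ^+ 2) * F g ^+ 2).
Proof.
have [zF _] := dZE_Ck reg F_Ck; have [_ _ Cw] := unit_normal_Ck reg; have [zw _] := dZE_Ck reg Cw.
have C0F : surfCk 0 M F by move=> U phi c; exact: CkS (F_Ck c).
have C0w : surfCk 0 M w by move=> U phi c; exact: CkS (Cw _ _ c).
have H1 : surfCk 0 M (fun g => dZ F g * dZ F g) by apply: surfCkM.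
have H2 : surfCk 0 M (fun g => F g * F g) by apply: surfCkM.
have H3 : surfCk 0 M (fun g => w g * w g) by apply: surfCkM.
split; first exact: H1.
exact: surfCkM (surfCkB (surfCkM (surfCk_cst 0 (- 2)) zw) H3) H2.
Qed.

Let regular_integrable f : surfCk 0 M f -> mu.-integrable K (EFin \o (fun g => f g * hdens N g)).
Proof.
move=> Cf; apply: (surf_integrable CS CM MS) => //.
exact: surfCkM Cf (hdens_regular reg).
Qed.

Let good (t : R * (heis R -> R) * (heis R -> R)) :=
  [/\ surfCk 1 M t.1.2, forall g, ~ K g -> t.1.2 g = 0 & surfCk 1 M t.2].

Let exact_sum (l : seq (R * (heis R -> R) * (heis R -> R))) :
  foldr (fun t P => good t /\ P) True l ->
  let s g := foldr (fun t s => t.1.1 * jac t.1.2 t.2 g + s) 0 l in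
  surfCk 0 M s /\ \int[mu]_(g in K) (s g * hdens N g) = 0.
Proof.
elim: l => [_|t l IH [[C1 f0 C2] /IH[Cs Is]]] /=.
  split; first exact: surfCk_cst.
  rewrite /Rintegral (_ : (\int[mu]_(g in K) _)%E = 0%E)//.
  by rewrite -[RHS](integral0 mu K); apply: eq_integral => g _; rewrite mul0r.
have Cj := jac_continuous reg C1 C2; have Ctj := surfCkM (surfCk_cst 0 t.1.1) Cj.
split; first exact: surfCkD Ctj Cs.
have E : \int[mu]_(g in K) (jac t.1.2 t.2 g * hdens N g) = 0.
  by rewrite /Rintegral (exactness reg CS nS cK KM C1 f0 C2).
transitivity (\int[mu]_(g in K) (t.1.1 * (jac t.1.2 t.2 g * hdens N g) +
    foldr (fun t s => t.1.1 * jac t.1.2 t.2 g + s) 0 l * hdens N g)).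
  by apply: eq_Rintegral => g _; rewrite mulrDl mulrA.
have i1 : mu.-integrable K (EFin \o (fun g => t.1.1 * (jac t.1.2 t.2 g * hdens N g))).
  by have := regular_integrable Ctj; congr (mu.-integrable K _); apply/funext => g; rewrite /= mulrA.
rewrite (RintegralD mK i1 (regular_integrable Cs)) Is addr0.
by rewrite (RintegralZl _ mK (jac_integrable reg CS cK KM C1 C2)) E mulr0.
Qed.

Lemma second_variation_region : twice_differentiable_perimeter a b k D /\
  second_variation a b k D = \int[mu]_(g in K) (variation_density g * hdens N g).
Proof.
have [H1 ->] := perimeter_derive2; split=> //.
have [Cp Cq Cw] := unit_normal_Ck reg.
have Ca1 := C1S Ca; have Cb1 := C1S Cb; have Ck1 := C1S Ck_.
have Cgx : surfCk 1 M gx by move=> U phi c; have [oU C2 _ _ _] := c; have [H _ _] := Ck_coord oU (CkS C2).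
have Cgy : surfCk 1 M gy by move=> U phi c; have [oU C2 _ _ _] := c; have [_ H _] := Ck_coord oU (CkS C2).
have Cgt : surfCk 1 M gt by move=> U phi c; have [oU C2 _ _ _] := c; have [_ _ H] := Ck_coord oU (CkS C2).
have Cal : surfCk 1 M al := surfCkD (surfCkM Cp Ca1) (surfCkM Cq Cb1).
have Cbe : surfCk 1 M be := surfCkD (surfCkM Cq Ca1) (surfCkM (surfCk_cst 1 (-1)) (surfCkM Cp Cb1)).
have Cf2 : surfCk 1 M f2 := surfCkD (surfCkM (surfCk_cst 1 2) (surfCkM Cal Ck1)) (surfCkM Cw (surfCkM Ck1 Ck1)).
have Cf3 : surfCk 1 M f3 := surfCkM Cw (surfCkD (surfCkM F_Ck F_Ck) (surfCkM Cbe Cbe)).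
have al0 g : ~ K g -> al g = 0 by move=> /abk0[E1 E2 _]; rewrite /al E1 E2 !mulr0 addr0.
have f20 g : ~ K g -> f2 g = 0.
  by move=> nK; have [_ _ E3] := abk0 nK; rewrite /f2 al0// E3 !mulr0 addr0.
have f30 g : ~ K g -> f3 g = 0.
  by move=> /abk0[E1 E2 E3]; rewrite /f3 /normal_component /be E1 E2 E3 !mulr0 !addr0 !mulr0 addr0 mulr0.
have k0 g : ~ K g -> k g = 0 by move=> /abk0[].
have G : foldr (fun t P => good t /\ P) True exact_terms.
  split; first exact: And3 Ck1 k0 Cbe.
  split; first by apply: And3 (surfCkM (surfCkM Cal Cbe) Cq) _ Cgx => g nK /=; rewrite al0// !mul0r.
  split; first by apply: And3 (surfCkM (surfCkM Cal Cbe) Cp) _ Cgy => g nK /=; rewrite al0// !mul0r.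
  split; first exact: And3 Cf3 f30 Cgt.
  split; first by apply: And3 (surfCkM Cf3 Cgx) _ Cgy => g nK /=; rewrite f30// mul0r.
  split; first by apply: And3 (surfCkM Cf3 Cgy) _ Cgx => g nK /=; rewrite f30// mul0r.
  split; first by apply: And3 (surfCkM Cf2 Cp) _ Cq => g nK /=; rewrite f20// mul0r.
  split; first by apply: And3 (surfCkM Cf2 Cq) _ Cp => g nK /=; rewrite f20// mul0r.
  by [].
have [Cs Is] := exact_sum G; have [V1 V2] := variation_density_continuous.
have Cv := surfCkD V1 V2.
transitivity (\int[mu]_(g in K) (variation_density g * hdens N g + exact_part g * hdens N g)).
  by apply: eq_Rintegral => g; rewrite inE => /KM Mg; rewrite rho2E// mulrDl.
rewrite (RintegralD mK (regular_integrable Cv) (regular_integrable Cs)).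
by rewrite [X in _ + X]Is addr0.
Qed.

End region.

(** * The formula on the whole surface and the stability criterion *)

Section stability.
Context {R : realType}.
Implicit Types (S M D K : set (heis R)) (N : heis R -> heis R) (f : heis R -> R) (g : heis R).

(** The set where [W] is nonzero is relatively open because [W ^ 2] is a polynomial in the
    continuous field [N]. *)
Lemma regular_charset S N : oriented_C2_surface S N -> exists W : set (heis R),
  [/\ open W, S `\` charset N S = S `&` W & regular_part S (S `\` charset N S) N].
Proof.
move=> [CS cN nN]; pose M := S `\` charset N S; pose h g := pN N g ^+ 2 + qN N g ^+ 2.
have ME g : M g <-> S g /\ h g != 0.
  split=> [[Sg nW]|[Sg h0]]; split=> //.
    apply/eqP => h0; apply: nW; split=> //.
    by rewrite /Wnorm [X in Num.sqrt X](_ : _ = 0) ?sqrtr0.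
  move=> [_ W0]; move/eqP: h0; apply; apply/eqP; rewrite eq_le.
  by rewrite -[h g <= 0]sqrtr_eq0 -/(Wnorm N g) W0 eqxx addr_ge0 ?sqr_ge0.
have ch g V : S g -> nbhs (h g) V -> \forall y \near g, S y -> V (h y).
  move=> Sg nV; have /subspace_continuousP/(_ g Sg) cg := cN.
  pose H (v : heis R) : R := v.1.1 * v.1.1 + v.1.2 * v.1.2.
  have hE y : h y = H (N y) by rewrite /h pNE qNE !expr2.
  have cH : {for N g, continuous H}.
    have cx := @coord_x_continuous R (N g); have cy := @coord_y_continuous R (N g).
    exact: cvgD (cvgM cx cx) (cvgM cy cy).
  have nV' : nbhs (H (N g)) V by rewrite -hE.
  have nE : \forall y \near g, S y -> V (H (N y)) by exact: (cg _ (cH _ nV')).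
  by apply: filterS nE => y HV Sy; rewrite hE; exact: (HV Sy).
pose W := interior [set y | S y -> h y != 0].
have oW : open W by exact: open_interior.
have MW : M = S `&` W.
  rewrite eqEsubset; split=> g.
    move=> /ME[Sg h0]; split=> //; have nV : nbhs (h g) [set x : R | x != 0].
      by apply: open_nbhs_nbhs; split=> //; exact: open_neq.
    exact: ch Sg nV.
  by move=> [Sg /interior_subset H]; apply/ME; split=> //; exact: H.
exists W; split=> //; split.
- by move=> U phi; rewrite -/M MW => c; exact: chart_ambient c oW.
- by rewrite -/M MW; exact: open_surface.
- by apply: (continuous_subspaceW _ cN) => g [].
- move=> g [Sg _]; have [n0 nn] := nN g Sg; split=> // v [U [phi [u [x [c Uu ug Dx]]]]].
  apply: nn; exists U, phi, u, x; split=> //.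
  by move: c; rewrite -/M MW => c; exact: chart_ambient c oW.
- by move=> g [Sg nW]; apply/eqP => W0; apply: nW.
Qed.

Lemma relatively_compact_neighborhood S K : C2_surface S -> compact K -> K `<=` S ->
  exists Q K' : set (heis R), [/\ open Q, K `<=` Q, compact K', K' `<=` S & S `&` Q `<=` K'].
Proof.
move=> CS cK KS.
pose P A := exists Q K' : set (heis R), [/\ open Q, A `<=` Q, compact K', K' `<=` S & S `&` Q `<=` K'].
apply: (@compact_ind _ _ P cK).
- by exists set0, set0; split; [exact: open0| |exact: compact0|exact: sub0set|rewrite setI0].
- move=> A B [Q1 [K1 [q1 A1 c1 s1 h1]]] [Q2 [K2 [q2 A2 c2 s2 h2]]].
  exists (Q1 `|` Q2), (K1 `|` K2); split.
  + exact: openU.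
  + exact: setUSS.
  + exact: compactU.
  + by rewrite subUset.
  + by rewrite setIUr; exact: setUSS.
- by move=> A B AB [Q [K' [qQ BQ c s h]]]; exists Q, K'; split=> //; exact: subset_trans BQ.
- move=> x /KS Sx; have [U [phi [c [u Uu ux]]]] := CS x Sx; have [oU _ _ _ _] := c.
  have [r r0 rU] := nbhs_box (open_nbhs_nbhs (conj oU Uu)).
  have := chart_image_near c Uu (box_nbhs u r0); rewrite ux => nO.
  exists (interior [set g | S g -> (phi @` (U `&` box u r)) g]); first exact: nbhs_interior.
  exists (interior [set g | S g -> (phi @` (U `&` box u r)) g]), (phi @` box u r); split=> //.
  + exact: open_interior.
  + exact: (chart_compact_image c (@box_compact R u r) rU).
  + by move=> _ [v /rU Uv <-]; exact: chart_sub c Uv.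
  + by move=> g [Sg /interior_subset /(_ Sg)[v [_ bv] <-]]; exists v.
Qed.

(** The three components may have different compact supports. The closed support of the field lies
    in their union, hence inside [M], and it is taken as the common compact set because it is the
    one that a counted region must contain. *)
Lemma support_facts S M (W : set (heis R)) a b k : M = S `&` W -> open W ->
  C2c M a -> C2c M b -> C2c M k ->
  let K := field_support a b k S in
  [/\ compact K, K `<=` M, forall g, ~ K g -> [/\ a g = 0, b g = 0 & k g = 0] &
    [/\ surfCk 2 S a, surfCk 2 S b & surfCk 2 S k]].
Proof.
move=> MW oW [Ca [Ka [cKa KaM a0]]] [Cb [Kb [cKb KbM b0]]] [Ck [Kk [cKk KkM k0]]] K.
have MS : M `<=` S by rewrite MW; exact: subIsetl.
pose K1 := Ka `|` Kb `|` Kk.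
have cK1 : compact K1 by apply: compactU => //; exact: compactU.
have clK1 : closed K1 by apply: compact_closed => //; exact: norm_hausdorff.
have XK1 g : ~ K1 g -> [/\ a g = 0, b g = 0 & k g = 0].
  by move=> nK; split; [apply: a0|apply: b0|apply: k0] => H; apply: nK; [left; left|left; right|right].
have KK1 : K `<=` K1.
  rewrite [X in _ `<=` X](closure_id _).1//; apply: closure_subset => g [_ X0]; apply: contrapT => /XK1[E1 E2 E3].
  by move/eqP: X0; apply; rewrite variation_fieldE E1 E2 E3 !mul0r !mulr0 !addr0.
split.
- by apply: (subclosed_compact _ cK1 KK1); exact: closed_closure.
- by move=> g /KK1[[/KaM|/KbM]|/KkM].
- move=> g nK; have [Sg|nS] := pselect (S g); last first.
    by apply: XK1 => -[[/KaM|/KbM]|/KkM] /MS.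
  have X0 : variation_field a b k g = 0.
    by apply/eqP; apply: contra_notT nK => X0; apply: subset_closure.
  move: X0; rewrite variation_fieldE => -[E1 E2]; rewrite E1 E2 !mul0r !mulr0 !addr0 => E3.
  by split.
- split.
  + exact: surfCk_extend MW oW cKa KaM a0 Ca.
  + exact: surfCk_extend MW oW cKb KbM b0 Cb.
  + exact: surfCk_extend MW oW cKk KkM k0 Ck.
Qed.

(** Only the product with the density has to vanish off [K]: at characteristic points the integrand
    [f] may consist of default values, but the density is zero there. *)
Lemma integral_sigmaH_support S M K N (f h : heis R -> R) : regular_part S M N -> C2_surface S ->
  normal_field S N -> compact K -> K `<=` M -> surfCk 0 M h -> (forall g, K g -> f g = h g) ->
  (forall g, S g -> ~ K g -> f g * hdens N g = 0) ->
  integral_sigmaH N S f = (\int[borel_area S]_(g in K) (h g * hdens N g))%:E.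
Proof.
move=> reg CS nS cK KM Ch fh f0; have mK := heis_compact_measurable cK.
have CM : C2_surface M by case: reg.
have MS : M `<=` S := regular_sub reg.
have Chh : surfCk 0 M (fun g => h g * hdens N g) := surfCkM Ch (hdens_regular reg).
have ih := surf_integrable CS CM MS Chh cK KM.
have mh : measurable_fun K (fun g => (h g * hdens N g)%:E).
  by apply: (measurable_EFinP _ _).2; exact: surf_continuous_measurable CM Chh mK KM.
have E1 := integral_surface_measure S mK mh.
have E2 : (\int[surface_measure S]_(g in S) (f g * hdens N g)%:E =
    \int[surface_measure S]_(g in K) (f g * hdens N g)%:E)%E.
  apply: integral_support => g; first by move=> Sg nK; rewrite f0.
  by move=> /KM /MS.
have E3 : (\int[surface_measure S]_(g in K) (f g * hdens N g)%:E =
    \int[surface_measure S]_(g in K) (h g * hdens N g)%:E)%E.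
  by apply: eq_integral => g; rewrite inE => /fh ->.
apply: (etrans E2); apply: (etrans E3); apply: (etrans E1); rewrite /Rintegral fineK//.
exact: (integrable_fin_num mK ih).
Qed.

Section formulas.
Variables (S W : set (heis R)) (N : heis R -> heis R) (a b k : heis R -> R).
Local Notation M := (S `\` charset N S).
Hypotheses (oS : oriented_C2_surface S N) (oW : open W) (MW : M = S `&` W).
Hypotheses (reg : regular_part S M N) (minS : H_minimal S N).
Hypotheses (Ca : C2c M a) (Cb : C2c M b) (Ck_ : C2c M k).

Local Notation K := (field_support a b k S).
Local Notation F := (normal_component a b k N).

Let CS : C2_surface S. Proof. by case: oS. Qed.
Let nS : normal_field S N. Proof. by case: oS. Qed.

Let dZF g := dZ S N F g ^+ 2.
Let pot g := (- 2 * dZ S N (omegabar N) g - omegabar N g ^+ 2) * F g ^+ 2.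

Let densities : surfCk 0 M dZF /\ surfCk 0 M pot.
Proof.
have [cK KM abk0 [Ca2 Cb2 Ck2]] := support_facts MW oW Ca Cb Ck_.
exact: (variation_density_continuous reg Ca2 Cb2 Ck2).
Qed.

Let off_support g : S g -> ~ K g -> [/\ F g = 0, dZ S N F g ^+ 2 * hdens N g = 0 & M g -> dZ S N F g = 0].
Proof.
have [cK KM abk0 _] := support_facts MW oW Ca Cb Ck_.
move=> Sg nK; have F0 y : ~ K y -> F y = 0.
  by move=> /abk0[E1 E2 E3]; rewrite /normal_component E1 E2 E3 !mulr0 !addr0.
have HM : M g -> dZ S N F g = 0.
  move=> Mg; have nF : \forall y \near g, M y -> F y = 0.
    have : nbhs g (~` K) by apply: open_nbhs_nbhs; split=> //; exact: compact_openC.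
    by apply: filterS => y /F0.
  by have [] := dZE_zero reg Mg nF.
split=> //; first exact: F0.
have [Mg|nM] := pselect (M g); first by rewrite HM// expr0n mul0r.
(* At a characteristic point nothing is known about the derivative, but the density vanishes. *)
have W0 : Wnorm N g = 0 by apply: contrapT => W0; apply: nM; split=> // -[].
by rewrite /hdens W0 mul0r mulr0.
Qed.

Lemma integral_gradient : integral_sigmaH N S (fun g => normsq g (gradHS N S F g)) =
  (\int[borel_area S]_(g in K) (dZF g * hdens N g))%:E.
Proof.
have [cK KM abk0 _] := support_facts MW oW Ca Cb Ck_; case: (reg) => _ _ _ _ W0.
have gE g : normsq g (gradHS N S F g) = dZ S N F g ^+ 2 * (pbar N g ^+ 2 + qbar N g ^+ 2).
  rewrite normsqE /gradHS thetaZ; have [Z1 Z2 Z3] := Zfield_frame N g.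
  rewrite Z3 mulr0 -[(tder S F g (Zfield N g) *: Zfield N g).1.1]/(dZ S N F g * (Zfield N g).1.1).
  rewrite -[(tder S F g (Zfield N g) *: Zfield N g).1.2]/(dZ S N F g * (Zfield N g).1.2) Z1 Z2.
  by move: (dZ S N F g) => x; ring.
apply: (integral_sigmaH_support reg CS nS cK KM densities.1).
- by move=> g /KM /W0 Wg; rewrite gE unit_hor// mulr1.
- move=> g Sg nK; have [_ Z _] := off_support Sg nK.
  by rewrite gE mulrAC Z mul0r.
Qed.

Lemma integral_potential : integral_sigmaH N S
    (fun g => (omegabar N g ^+ 2 - 2 * calA N S g) * F g ^+ 2) =
  (- \int[borel_area S]_(g in K) (pot g * hdens N g))%:E.
Proof.
have [cK KM abk0 _] := support_facts MW oW Ca Cb Ck_.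
have C1 : surfCk 0 M (fun=> -1 : R) by move=> U phi c; have [oU _ _ _ _] := c; exact: Ck_cst.
have Cn : surfCk 0 M (fun g => -1 * pot g) := surfCkM C1 densities.2.
have mK := heis_compact_measurable cK.
have CM : C2_surface M by case: reg.
have ip := surf_integrable CS CM (regular_sub reg) (surfCkM densities.2 (hdens_regular reg)) cK KM.
rewrite (integral_sigmaH_support reg CS nS cK KM Cn).
- have Z := RintegralZl (-1) mK ip; congr EFin; apply: (etrans _ (etrans Z (mulN1r _))).
  by apply: eq_Rintegral => g _; rewrite /= mulrA.
- by move=> g _; rewrite /pot /calA -/(dZ S N (omegabar N) g); move: (dZ S N _ g) => x; ring.
- by move=> g Sg nK; have [-> _ _] := off_support Sg nK; rewrite expr0n mulr0 mul0r.
Qed.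

Lemma integral_second_variation : integral_sigmaH N S (fun g => normsq g (gradHS N S F g) +
    (2 * calA N S g - omegabar N g ^+ 2) * F g ^+ 2) =
  (\int[borel_area S]_(g in K) (variation_density S N a b k g * hdens N g))%:E.
Proof.
have [cK KM abk0 _] := support_facts MW oW Ca Cb Ck_; case: (reg) => _ _ _ _ W0.
have gE g : normsq g (gradHS N S F g) = dZ S N F g ^+ 2 * (pbar N g ^+ 2 + qbar N g ^+ 2).
  rewrite normsqE /gradHS thetaZ; have [Z1 Z2 Z3] := Zfield_frame N g.
  rewrite Z3 mulr0 -[(tder S F g (Zfield N g) *: Zfield N g).1.1]/(dZ S N F g * (Zfield N g).1.1).
  rewrite -[(tder S F g (Zfield N g) *: Zfield N g).1.2]/(dZ S N F g * (Zfield N g).1.2) Z1 Z2.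
  by move: (dZ S N F g) => x; ring.
apply: (integral_sigmaH_support reg CS nS cK KM (surfCkD densities.1 densities.2)).
- move=> g /KM /W0 Wg; rewrite gE unit_hor// mulr1 /dZF /pot /calA -/(dZ S N (omegabar N) g).
  by move: (dZ S N (omegabar N) g) => x; ring.
- move=> g Sg nK; have [F0 Z _] := off_support Sg nK.
  by rewrite F0 expr0n mulr0 addr0 gE mulrAC Z mul0r.
Qed.

Lemma density_split : \int[borel_area S]_(g in K) (variation_density S N a b k g * hdens N g) =
  \int[borel_area S]_(g in K) (dZF g * hdens N g) + \int[borel_area S]_(g in K) (pot g * hdens N g).
Proof.
have [cK KM abk0 _] := support_facts MW oW Ca Cb Ck_; have mK := heis_compact_measurable cK.
have CM : C2_surface M by case: reg.
have H h (Ch : surfCk 0 M h) := surf_integrable CS CM (regular_sub reg) (surfCkM Ch (hdens_regular reg)) cK KM.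
rewrite -(RintegralD mK (H _ densities.1) (H _ densities.2)).
by apply: eq_Rintegral => g _; rewrite -mulrDl.
Qed.

(** The perimeter outside the support must be finite. For [D = S] this follows from the finiteness
    at parameter 0; in the other case [D] lies in a compact subset of [S]. *)
Lemma counted_variation D : counted_region a b k S D -> twice_differentiable_perimeter a b k D /\
  second_variation a b k D = \int[borel_area S]_(g in K) (variation_density S N a b k g * hdens N g).
Proof.
have [cK KM abk0 [Ca2 Cb2 Ck2]] := support_facts MW oW Ca Cb Ck_; have MS := regular_sub reg.
have mK := heis_compact_measurable cK; have mS := surface_measurable CS.
have minM g : M g -> H_curvature S N g = 0 by case: minS => + _; apply.
have mh A : measurable A -> A `<=` S -> measurable_fun A (fun g => (hdens N g)%:E).
  move=> mA AS; apply: (measurable_EFinP _ _).2.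
  exact: surf_continuous_measurable CS (hdens_continuous nS) mA AS.
have h0 A g : A g -> (0 <= (hdens N g)%:E)%E by rewrite lee_fin hdens_ge0.
case=> [[fin ->]|[_ [[Q oQ ->] [K' [cK' K'S DK']] KD]]].
- have KS := subset_trans KM MS; have ST : S = S `&` setT by rewrite setIT.
  apply: (second_variation_region reg CS nS (@openT _) ST cK KM KS Ca2 Cb2 Ck2 abk0 minM).
  (* At parameter 0 the map is the identity, so the perimeter formula applies without any smallness
     condition. *)
  have biL g h : S g -> S h -> `|g - h| <= 2 * `|deform_map a b k 0 g - deform_map a b k 0 h|.
    by move=> _ _; rewrite /deform_map !scale0r !addr0 ler_peMl// ler1n.
  have := nbhs_singleton fin; rewrite (perimeter_deform reg CS nS (@openT _) ST cK KM Ca2 Cb2 Ck2 abk0 biL).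
  apply: le_lt_trans; rewrite (@eq_integral _ _ _ _ _
      (fun g => (deform_ratio S K N a b k 0 g * hdens N g)%:E)); last first.
    by move=> g; rewrite inE => -[_ nK]; rewrite /deform_ratio memNset// mul1r.
  apply: ge0_subset_integral.
  + exact: measurableD.
  + exact: mS.
  + apply: (measurable_EFinP _ _).2; apply: measurable_funM.
      exact: (ratio_measurable reg cK KM Ca2 Cb2 Ck2 0 mS (@subset_refl _ S)).
    exact: (surf_continuous_measurable CS (hdens_continuous nS) mS).
  + by move=> g _; rewrite lee_fin mulr_ge0 ?ratio_ge0 ?hdens_ge0.
  + exact: subDsetl.
- apply: (second_variation_region reg CS nS oQ erefl cK KM KD Ca2 Cb2 Ck2 abk0 minM).
  have ih := surf_integrable CS CS (@subset_refl _ S) (hdens_continuous nS) cK' K'S.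
  have mK' := heis_compact_measurable cK'.
  apply: (@le_lt_trans _ _ (\int[borel_area S]_(g in K') (hdens N g)%:E)%E).
    apply: ge0_subset_integral => //.
    + by apply: measurableD => //; apply: measurableI => //; exact: open_measurable3.
    + exact: mh.
    + exact: h0.
    + by move=> g [/DK'].
  exact: (integrable_lty mK' ih).
Qed.

(** Stability is a statement about all counted regions; to draw the integral inequality from it, one
    such region must exist. *)
Lemma counted_region_exists : exists D, counted_region a b k S D.
Proof.
have [cK KM _ _] := support_facts MW oW Ca Cb Ck_; have KS := subset_trans KM (regular_sub reg).
have [fin|nfin] := pselect (\forall l \near (0 : R), (H_perimeter (deform a b k l S) < +oo)%E).
  by exists S; left.
have [Q [K' [oQ KQ cK' K'S QK']]] := relatively_compact_neighborhood CS cK KS.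
exists (S `&` Q); right; split=> //; split; [by exists Q|by exists K'|].
by move=> g Kg; split; [exact: KS|exact: KQ].
Qed.

End formulas.

End stability.

Unset Implicit Arguments.

Theorem theorem15p2 (R : realType) (S : set (heis R)) (N : heis R -> heis R) :
  oriented_C2_surface S N ->
  H_minimal S N ->
  (forall a b k : heis R -> R,
     C2c (S `\` charset N S) a -> C2c (S `\` charset N S) b ->
     C2c (S `\` charset N S) k ->
     forall D : set (heis R), counted_region a b k S D ->
       let F := normal_component a b k N in
       twice_differentiable_perimeter a b k D /\
       (second_variation a b k D)%:E =
         integral_sigmaH N S (fun g =>
           normsq g (gradHS N S F g) +
           (2 * calA N S g - omegabar N g ^+ 2) * F g ^+ 2)) /\
  (charset N S = set0 ->
     (stable S N <->
      forall a b k : heis R -> R,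
        C2c S a -> C2c S b -> C2c S k ->
        let F := normal_component a b k N in
        (integral_sigmaH N S (fun g =>
           ((omegabar N g ^+ 2 - 2 * calA N S g) * F g ^+ 2)%R)
         <= integral_sigmaH N S (fun g => normsq g (gradHS N S F g)))%E)).
Proof.
move=> oS minS; have [W [oW MW reg]] := regular_charset oS.
split=> [a b k Ca Cb Ck D cD F|ch0].
  have [H1 H2] := counted_variation oS oW MW reg minS Ca Cb Ck cD.
  by split=> //; rewrite H2 (integral_second_variation oS oW MW reg Ca Cb Ck).
have CE f : C2c S f -> C2c (S `\` charset N S) f by rewrite ch0 setD0.
split=> [[_ st] a b k Ca0 Cb0 Ck0|ineq].
  have Ca := CE _ Ca0; have Cb := CE _ Cb0; have Ck := CE _ Ck0.
  have [D cD] := counted_region_exists oS oW MW reg Ca Cb Ck.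
  have [_ V] := counted_variation oS oW MW reg minS Ca Cb Ck cD.
  rewrite /= (integral_gradient oS oW MW reg Ca Cb Ck) (integral_potential oS oW MW reg Ca Cb Ck) lee_fin.
  have := st a b k Ca0 Cb0 Ck0 D cD.
  by rewrite V (density_split oS oW MW reg Ca Cb Ck) -lerBlDr sub0r.
split=> // a b k Ca0 Cb0 Ck0 D cD; have Ca := CE _ Ca0; have Cb := CE _ Cb0; have Ck := CE _ Ck0.
have [_ V] := counted_variation oS oW MW reg minS Ca Cb Ck cD.
have := ineq a b k Ca0 Cb0 Ck0.
rewrite V (density_split oS oW MW reg Ca Cb Ck) -lerBlDr sub0r /=.
by rewrite (integral_gradient oS oW MW reg Ca Cb Ck) (integral_potential oS oW MW reg Ca Cb Ck) lee_fin.
Qed.
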